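(* Let $n\ge2$, $\alpha\in(\frac{n-1}{n},1]$, $C_\alpha\ge0$, $\delta>0$, and let $N\ge1$ be an integer. There exist constants $v_0=v_0(n,\alpha,C_\alpha,\delta,N)>0$ and $C_3=C_3(n,\alpha,C_\alpha,\delta,N)\ge1$ such that the following holds. Let $\Omega\subset\mathbb{R}^n$ be a bounded domain, $a:\Omega\to(0,+\infty)$ a Borel function, and let $G:\mathcal{F}_w(\Omega)\to\mathbb{R}$ satisfy $|G(\mathbf{W})-G(\mathbf{W}')|\le C_\alpha\,\mathrm{dist}(\mathbf{W},\mathbf{W}')^\alpha$ for $\mathbf{W},\mathbf{W}'\in\mathcal{F}_w(\Omega)$. Let $\Omega'\subset\Omega$ be open with $\delta\le a(x)\le1$ for $x\in\Omega'$, and let $\mathbf{W}\in\mathcal{F}_w(\Omega)$ be a minimizer of $J_w=F_w+G$ in $\mathcal{F}_w(\Omega)$, with associated open sets $W_i^\sharp$ as defined in the context. If $1\le i\le N$ and $Z\subset W_i^\sharp$ is a set of finite perimeter such that $Z\subset\subset\Omega'$ and $|Z|\le v_0$, then $$|Z|\le C_3\,\mathrm{Per}(Z;W_i^\sharp)^{\frac{n}{n-1}}.$$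
   Context: Throughout, $|A|$ is Lebesgue measure on $\mathbb{R}^n$, and $B(x,r)$ is the open ball. A Borel set $W\subset\Omega$ has (locally) finite perimeter in $\Omega$ if the distributional gradient $\nabla\mathbf{1}_W$ of its characteristic function is a (locally) finite vector-valued measure on $\Omega$; its total variation measure is denoted $\mu_W=|D\mathbf{1}_W|$, and for open $U\subset\Omega$, $\mathrm{Per}(W;U)=\mu_W(U)$. The (De Giorgi) reduced boundary of $W$ in $\Omega$ is denoted $\partial^*W\subset\Omega$. $Z\subset\subset\Omega'$ means that the closure of $Z$ in $\mathbb{R}^n$ is a compact subset of $\Omega'$. $\mathcal{F}_w=\mathcal{F}_w(\Omega)$ is the set of $N$-tuples $\mathbf{W}=(W_1,\dots,W_N)$ of Borel subsets of $\Omega$ of locally finite perimeter in $\Omega$ such that $\sum_{i=1}^N\mathbf{1}_{W_i}=\mathbf{1}_\Omega$ almost everywhere; two $N$-tuples are identified if their components agree up to Lebesgue-null sets. Some $W_i$ may be empty. $\mathrm{dist}(\mathbf{W},\mathbf{W}')=\sum_{i=1}^N|W_i\triangle W_i'|$, where $A\triangle B=(A\setminus B)\cup(B\setminus A)$. $F_w(\mathbf{W})=\sum_{i=1}^N\int_\Omega a(x)\,d\mu_{W_i}(x)\in[0,+\infty]$, and $J_w(\mathbf{W})=F_w(\mathbf{W})+G(\mathbf{W})$. A minimizer of $J_w$ in $\mathcal{F}_w(\Omega)$ is a $\mathbf{W}\in\mathcal{F}_w(\Omega)$ with $J_w(\mathbf{W})\le J_w(\mathbf{W}')$ for all $\mathbf{W}'\in\mathcal{F}_w(\Omega)$.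 Given $\mathbf{W}\in\mathcal{F}_w$, set $\partial=\Omega\cap\overline{\bigcup_i\partial^*W_i}$, and define the open sets $$W_i^\sharp=\{x\in\Omega\setminus\partial:\ |B(x,r)\setminus W_i|=0\text{ for some }r>0\}.$$ *)

(* Defs.v *)
From HB Require Import structures.
From mathcomp Require Import all_boot all_order all_algebra.
From mathcomp Require Import lra.
From mathcomp Require Import all_classical all_reals all_analysis measurable_realfun.

Set Implicit Arguments.
Unset Strict Implicit.
Unset Printing Implicit Defensive.

Import Order.TTheory GRing.Theory Num.Theory.
Import numFieldNormedType.Exports.

Local Open Scope classical_set_scope.
Local Open Scope ring_scope.

Section borel.
Context {R : realType} {n : nat}.

HB.instance Definition _ := @isMeasurable.Build (sigma_display (@open 'rV[R]_n))
  'rV[R]_n <<s (@open 'rV[R]_n) >> (@sigma_algebra0 _ setT (@open 'rV[R]_n))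
  (@sigma_algebraC _ (@open 'rV[R]_n))
  (@sigma_algebra_bigcup _ setT (@open 'rV[R]_n)).

Lemma open_measurable_rV (U : set 'rV[R]_n) : open U -> measurable U.
Proof. exact: sub_sigma_algebra. Qed.

End borel.

Section cons_rV.
Context {R : realType} {m : nat}.

Definition cons_rV (p : measurableTypeR R * 'rV[R]_m) : 'rV[R]_m.+1 :=
  row_mx (const_mx p.1 : 'rV_1) p.2.

Definition uncons_rV (v : 'rV[R]_m.+1) : measurableTypeR R * 'rV[R]_m :=
  (v 0 0, rsubmx (v : 'rV_(1 + m))).

Lemma cons_rVK : cancel cons_rV uncons_rV.
Proof.
move=> [t v]; rewrite /uncons_rV /cons_rV row_mxKr; congr pair.
rewrite [RHS](_ : t = row_mx (const_mx t : 'rV_1) v 0 (lshift m 0)).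
  by congr (fun_of_matrix _ _ _); exact/val_inj.
by rewrite row_mxEl mxE.
Qed.

Lemma measurable_uncons_rV : measurable_fun setT uncons_rV.
Proof.
apply/measurable_fun_pairP; split => /=.
  apply: (measurability _ (RGenOpens.measurableE R)) => _ [_ [a [b ->]] <-].
  rewrite setTI; apply: open_measurable_rV.
  apply: open_comp; last exact: interval_open.
  by move=> ? _; exact: coord_continuous.
apply: (measurability (@open 'rV[R]_m)) => // _ [U oU <-].
rewrite setTI; apply: open_measurable_rV.
apply: open_comp oU => v _ A /= [P nP PA].
have nv j : \forall w \near nbhs v, P 0 j ((w : 'rV_(1 + m)) 0 (rshift 1 j)).
  apply: (@coord_continuous R 1 m.+1 0 (rshift 1 j) v).
  by have := nP 0 j; rewrite mxE.
apply: (@filterS _ _ (nbhs_filter v) _ _ _ (filter_forall (nbhs_filter v) nv)).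
by move=> w Pw; apply: PA => i j; rewrite mxE (ord1 i).
Qed.

Lemma measurable_cons_ball (c : 'rV[R]_m.+1) (r : R) :
  measurable (cons_rV @^-1` ball c r).
Proof.
have [r0|r0] := ltP 0 r; last first.
  rewrite (_ : _ @^-1` _ = set0)//; apply/seteqP; split => // p [].
  by rewrite ltNge r0.
rewrite (_ : _ @^-1` _ =
    (ball (c 0 0 : R) r) `*` (ball (rsubmx (c : 'rV_(1 + m))) r)).
  apply: measurableX; first exact: measurable_ball.
  by apply: open_measurable_rV; exact: ball_open.
apply/seteqP; split => [p [_ Bp]|p [Bp1 [_ Bp2]]].
  split; first by have := Bp 0 0; rewrite -{2}(cons_rVK p).
  split => // i j; have := Bp i (rshift 1 j).
  by rewrite -{2}(cons_rVK p) [in X in _ -> X]mxE [X in _ -> ball _ _ X]mxE.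
split => // i j; rewrite (ord1 i).
case: (split_ordP (j : 'I_(1 + m))) => k ->.
  move: Bp1; rewrite /cons_rV (row_mxEl (const_mx _ : 'rV_1)) mxE (ord1 k).
  by rewrite (_ : lshift m 0 = 0)//; exact/val_inj.
by rewrite /cons_rV (row_mxEr (const_mx p.1 : 'rV_1)); have := Bp2 0 k; rewrite mxE.
Qed.

Lemma measurable_cons_rV : measurable_fun setT cons_rV.
Proof.
apply: (measurability (@open 'rV[R]_m.+1)) => // _ [U oU <-].
rewrite setTI.
pose B (q : 'rV[rat]_m.+1 * rat) : set 'rV[R]_m.+1 :=
  ball (map_mx ratr q.1 : 'rV[R]_m.+1) (ratr q.2).
pose I := [set q | B q `<=` U].
have -> : cons_rV @^-1` U = \bigcup_(q in I) (cons_rV @^-1` B q).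
  rewrite eqEsubset; split => [p Up|p [q Iq] /Iq //].
  have /nbhs_ballP[e /= e0 eU] := open_nbhs_nbhs (conj oU Up).
  have [r] : exists r, ratr r \in `]0, (e / 2)[ by apply: rat_in_itvoo; rewrite divr_gt0.
  rewrite in_itv/= => /andP[r0 re].
  have /choice[q qP] : forall j, exists q : rat, `|ratr q - cons_rV p 0 j| < ratr r.
    move=> j; have [q] : exists q, ratr q \in `](cons_rV p 0 j - ratr r), (cons_rV p 0 j + ratr r)[.
      by apply: rat_in_itvoo; rewrite ltrBlDr -addrA ltrDl addr_gt0.
    by rewrite in_itv/= -ltr_distl; exists q.
  have qB : B (\row_j q j, r) (cons_rV p).
    split => //= i j; rewrite (ord1 i) [X in ball X]mxE [X in ratr X]mxE; exact: qP.
  exists (\row_j q j, r) => //= v [_ Bv]; apply: eU; split => // i j.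
  case: qB => _ /(_ i j) /ball_sym h.
  by have := ball_triangle h (Bv i j); apply: le_ball; lra.
rewrite bigcup_mkcond; apply: countable_bigcupT_measurable; first exact: countableP.
move=> q; case: ifP => // _.
exact: measurable_cons_ball.
Qed.

End cons_rV.

Section lebesgue.
Context {R : realType}.
Local Open Scope ereal_scope.

(* Lebesgue measure on the Borel sets of R^n, as an iterated product: the
   measure of A is the integral of the measures of its slices. *)
Fixpoint lebesgue_rV (n : nat) : set 'rV[R]_n -> \bar R :=
  if n is m.+1 then fun A =>
    \int[lebesgue_measure]_t lebesgue_rV [set v | A (cons_rV (t, v))]
  else dirac (0%R : 'rV[R]_0).

Arguments lebesgue_rV {n}.

Lemma lebesgue_rV_ex n : exists mu : {sigma_finite_measure set 'rV[R]_n -> \bar R},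
  lebesgue_rV = mu.
Proof.
elim: n => [|m [mu IH]].
  by exists (dirac (0%R : 'rV[R]_0) : probability _ _).
pose M := measure_function_pushforward__canonical__measure_function_Measure
  (lebesgue_measure \x mu) (@measurable_cons_rV R m).
have ME : lebesgue_rV (n:=m.+1) = M.
  apply/funext => A /=; rewrite IH /pushforward /product_measure1.
  apply: eq_integral => t _ /=; congr (mu _).
  by apply/seteqP; split => v /=; rewrite /xsection/= inE.
have sf : sigma_finite setT M.
  have /sigma_finiteP[F [FT ndF Foo]] := sigma_finiteT (@lebesgue_measure R).
  have /sigma_finiteP[G [GT ndG Goo]] := sigma_finiteT mu.
  exists (fun k => uncons_rV @^-1` (F k `*` G k)).
    apply/esym/seteqP; split => // v _.
    have [i _ Fi] : (\bigcup_k F k) (uncons_rV v).1 by rewrite -FT.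
    have [j _ Gj] : (\bigcup_k G k) (uncons_rV v).2 by rewrite -GT.
    exists (maxn i j) => //; split.
      by move: Fi; apply: subsetPset; exact/ndF/leq_maxl.
    by move: Gj; apply: subsetPset; exact/ndG/leq_maxr.
  move=> k; have [mF Fk] := Foo k; have [mG Gk] := Goo k; split.
    rewrite -[X in measurable X]setTI; apply: measurable_uncons_rV => //.
    exact: measurableX.
  rewrite /= /pushforward -comp_preimage (_ : _ \o _ = id).
    by rewrite preimage_id product_measure1E// lte_mul_pinfty// ge0_fin_numE.
  by apply/funext => p /=; rewrite cons_rVK.
pose sm := Measure_isSigmaFinite.Build _ _ _ M sf.
pose N : {measure set 'rV[R]_m.+1 -> \bar R} := M.
by exists (HB.pack_for (SigmaFiniteMeasure.type 'rV[R]_m.+1 R) (Measure.sort N) sm).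
Qed.

Let lebesgue_rV0 n : lebesgue_rV (set0 : set 'rV[R]_n) = 0.
Proof. by have [mu ->] := lebesgue_rV_ex n; rewrite measure0. Qed.

Let lebesgue_rV_ge0 n (A : set 'rV[R]_n) : 0 <= lebesgue_rV A.
Proof. by have [mu ->] := lebesgue_rV_ex n. Qed.

Let lebesgue_rV_sigma_additive n :
  semi_sigma_additive (lebesgue_rV : set 'rV[R]_n -> \bar R).
Proof.
by have [mu ->] := lebesgue_rV_ex n; exact: measure_semi_sigma_additive.
Qed.

HB.instance Definition _ n := isMeasure.Build _ _ _
  (lebesgue_rV : set 'rV[R]_n -> \bar R)
  (lebesgue_rV0 n) (@lebesgue_rV_ge0 n) (@lebesgue_rV_sigma_additive n).

Let lebesgue_rV_sigma_finite n :
  sigma_finite setT (lebesgue_rV : set 'rV[R]_n -> \bar R).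
Proof. by have [mu ->] := lebesgue_rV_ex n; exact: sigma_finiteT. Qed.

HB.instance Definition _ n := Measure_isSigmaFinite.Build _ _ _
  (lebesgue_rV : set 'rV[R]_n -> \bar R) (@lebesgue_rV_sigma_finite n).

End lebesgue.

Arguments lebesgue_rV {R n}.

(* The library topologizes 'rV[R]_n by the sup norm; balls and lengths of
   vectors below are Euclidean. *)
Section euclidean.
Context {R : realType} {n : nat}.
Implicit Types (x y : 'rV[R]_n) (U Z : set 'rV[R]_n).

Definition enorm x : R := Num.sqrt (\sum_(i < n) x 0 i ^+ 2).

Definition eball x (r : R) : set 'rV[R]_n := [set y | enorm (y - x) < r].

Definition compactly_contained Z U := compact (closure Z) /\ closure Z `<=` U.

Definition partial (i : 'I_n) (f : 'rV[R]_n -> R) : 'rV[R]_n -> R :=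
  fun x => 'D_(delta_mx 0 i) f x.

(* C^oo: every iterated partial derivative exists and is continuous. *)
Definition smooth (f : 'rV[R]_n -> R) :=
  forall s : seq 'I_n, let g := foldr partial f s in
    continuous g /\ forall i x, derivable g x (delta_mx 0 i).

Definition test_function U (f : 'rV[R]_n -> R) :=
  smooth f /\ compactly_contained [set x | f x != 0] U.

End euclidean.

(* Locally finite R^n-valued measures on an open set U: set functions [nu] whose
   values matter only on the Borel sets compactly contained in U, on which they
   are countably additive. *)
Section vector_measure.
Context {R : realType} {n : nat}.
Implicit Types (U A E : set 'rV[R]_n) (nu : set 'rV[R]_n -> 'rV[R]_n).

Definition interior_borel U A := measurable A /\ compactly_contained A U.

Definition vector_measure U nu :=
  forall A : (set 'rV[R]_n)^nat, (forall k, measurable (A k)) ->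
    trivIset setT A -> compactly_contained (\bigcup_k A k) U ->
    (fun m => \sum_(k < m) nu (A k)) @ \oo --> nu (\bigcup_k A k).

Local Open Scope ereal_scope.

Definition total_variation U nu E : \bar R :=
  ereal_sup [set s | exists (m : nat) (A : (set 'rV[R]_n)^nat),
    [/\ forall k, interior_borel U (A k), trivIset setT A,
        forall k, A k `<=` E &
        s = \sum_(k < m) (enorm (nu (A k)))%:E]].

(* Jordan decomposition of the i-th component of [nu]. *)
Definition pos_variation U nu (i : 'I_n) E : \bar R :=
  ereal_sup [set (nu A 0%R i)%:E | A in [set A | interior_borel U A /\ A `<=` E]].

Definition neg_variation U nu (i : 'I_n) E : \bar R :=
  ereal_sup
    [set (- nu A 0%R i)%:E | A in [set A | interior_borel U A /\ A `<=` E]].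

Definition vintegral U nu (i : 'I_n) (f : 'rV[R]_n -> R) : \bar R :=
  \int[pos_variation U nu i]_(x in U) (f x)%:E
  - \int[neg_variation U nu i]_(x in U) (f x)%:E.

End vector_measure.

Section perimeter.
Context {R : realType} {n : nat}.
Implicit Types (U V W : set 'rV[R]_n) (nu : set 'rV[R]_n -> 'rV[R]_n).
Local Open Scope ereal_scope.

(* The distributional gradient on U of the indicator of W is [nu]. *)
Definition is_gradient U W nu := vector_measure U nu /\
  forall f, test_function U f -> forall i,
    \int[lebesgue_rV]_(x in U) (\1_W x * partial i f x)%:E
    = - vintegral U nu i f.

Definition locally_finite_perimeter U W := exists nu, is_gradient U W nu.

(* [is_gradient U W] determines its argument on the Borel sets compactly
   contained in U, hence determines everything below. *)
Definition gradient U W : set 'rV[R]_n -> 'rV[R]_n :=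
  xget (fun=> 0%R) (is_gradient U W).

Definition perimeter_measure U W : set 'rV[R]_n -> \bar R :=
  total_variation U (gradient U W).

Definition finite_perimeter U W :=
  locally_finite_perimeter U W /\ perimeter_measure U W U < +oo.

Definition reduced_boundary U W : set 'rV[R]_n :=
  [set x | [/\ U x,
     forall r : R, (0 < r)%R -> 0 < perimeter_measure U W (eball x r) &
     exists2 v : 'rV[R]_n, enorm v = 1%R &
       ((fine (perimeter_measure U W (eball x r)))^-1
         *: gradient U W (eball x r))%R @[r --> 0^'+] --> v]].

End perimeter.

Section partitions.
Context {R : realType} {n N : nat}.
Implicit Types (Omega : set 'rV[R]_n) (W : 'I_N -> set 'rV[R]_n).
Local Open Scope ereal_scope.

Definition weak_partition Omega W :=
  (forall i, [/\ measurable (W i), W i `<=` Omega &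
                 locally_finite_perimeter Omega (W i)]) /\
  {ae lebesgue_rV, forall x, (\sum_(i < N) \1_(W i) x)%R = \1_Omega x :> R}.

Definition partition_dist W W' : \bar R :=
  \sum_(i < N) lebesgue_rV ((W i `\` W' i) `|` (W' i `\` W i)).

Definition weighted_perimeter Omega (a : 'rV[R]_n -> R) W : \bar R :=
  \sum_(i < N) \int[perimeter_measure Omega (W i)]_(x in Omega) (a x)%:E.

(* Tuples agreeing up to null sets are not quotiented: a functional [G] with
   |G W - G W'| <= C (partition_dist W W')^alpha, alpha > 0, cannot
   distinguish them, and the other definitions are insensitive to null sets. *)
Definition energy Omega a (G : ('I_N -> set 'rV[R]_n) -> R) W : \bar R :=
  weighted_perimeter Omega a W + (G W)%:E.

Definition minimizer Omega a G W := weak_partition Omega W /\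
  forall W', weak_partition Omega W' ->
    energy Omega a G W <= energy Omega a G W'.

Definition interface Omega W : set 'rV[R]_n :=
  Omega `&` closure (\bigcup_(i in [set: 'I_N]) reduced_boundary Omega (W i)).

Definition sharp Omega W (i : 'I_N) : set 'rV[R]_n :=
  [set x | (Omega `\` interface Omega W) x /\
     exists2 r : R, (0 < r)%R & lebesgue_rV (eball x r `\` W i) = 0].

End partitions.

(* Main.v *)
(* If Z is moved from the phase W_i to W_j, minimality bounds the integral of
   a (|z| + |w_j| - |z + w_j|) by that of a (|z| + |f| - |z + f|), up to
   C (2|Z|)^alpha, where z, f, w_k are the densities of the gradients of Z,
   W_i \ Z, W_k.  As f and the w_j, j <> i, add up to -z, summing over j controls
   the perimeter of Z.  The right-hand side is at most 2|z|, and it vanishes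
   outside W_i^sharp: at almost every point where z and f are both nonzero, all
   w_k vanish (at most two of three disjoint sets have nonzero densities), and
   by a lower density estimate for the interfaces such points carry no gradient
   of Z.  So Per(Z) is at most a multiple of Per(Z; W_i^sharp) + |Z|^alpha, and as
   alpha > (n-1)/n the isoperimetric inequality absorbs |Z|^alpha for small |Z|. *)
From HB Require Import structures.
Require Import Defs.
From mathcomp Require Import all_boot all_order all_algebra.
From mathcomp Require Import ring lra zify.
From mathcomp Require Import all_classical all_reals all_analysis measurable_realfun.

Set Implicit Arguments.
Unset Strict Implicit.
Unset Printing Implicit Defensive.

Import Order.TTheory GRing.Theory Num.Theory.
Import numFieldNormedType.Exports.

Local Open Scope classical_set_scope.
Local Open Scope ring_scope.

(** * Smooth functions and cutoffs *)

(** The theory of finite perimeter is built here from one device: on a compact subset of the open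
    set, all gradients in play have densities with respect to one common finite measure. Pointwise
    statements about these densities replace the structure of the reduced boundary. The claim on
    three disjoint sets comes from translations: the increments of the indicators of two disjoint
    sets never have the same sign, hence neither do the components of their densities in any
    direction, and three nonzero vectors cannot pairwise have this property. Translations also give
    the Poincare and isoperimetric inequalities, by integrating over [h] the volume of the points
    [x] of [A] with [x + h] in [B]. The lower density estimate needs competitors modified inside a
    cube, hence the gradient of a set cut by a cube. Neither a coarea formula nor a trace theorem is
    used: the trace is a pushforward, to the faces, of densities inside the cube, and a radius with
    small trace comes from a slope argument for a monotone volume function. Cubes replace balls
    because their volume and their cutoffs factor over the coordinates. *)

Section Ck.
Context {R : realType} {n : nat}.
Implicit Types (f g : 'rV[R]_n -> R).

Definition C1 f := continuous f /\ forall i x, derivable f x (delta_mx 0 i).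

(** [smooth] quantifies over lists of partial derivatives, a form without an induction for products
    and quotients. Recursion on the order provides one, and [smoothP] passes between the two. *)
Fixpoint Ck k f : Prop :=
  C1 f /\ if k is k'.+1 then forall i, Ck k' (partial i f) else True.

Lemma Ck_C1 k f : Ck k f -> C1 f.
Proof. by case: k => [|k] []. Qed.

Lemma Ck_partial k f i : Ck k.+1 f -> Ck k (partial i f).
Proof. by case=> _ /(_ i). Qed.

Lemma CkS k f : Ck k.+1 f -> Ck k f.
Proof.
elim: k f => [|k IH] f [H1 H2]; first by split.
by split => [|i]; [exact: H1|apply: IH; exact: H2].
Qed.

Lemma smooth_partial f i : smooth f -> smooth (partial i f).
Proof. by move=> sf s; have := sf (rcons s i); rewrite foldr_rcons. Qed.

Lemma smoothP f : smooth f <-> forall k, Ck k f.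
Proof.
split=> [sf k|Cf s].
  elim: k f sf => [|k IH] f sf; have fC1 : C1 f by exact: (sf [::]).
    by split.
  by split => [|i]; [exact: fC1|apply: IH; exact: smooth_partial].
(* [foldr] applies the last index of [s] to [f] first, so the list is consumed from its right
   end. *)
elim/last_ind: s f Cf => [|s i IH] f Cf; first exact: Ck_C1 (Cf 0%N).
by rewrite foldr_rcons; apply: IH => k; apply: Ck_partial.
Qed.

Lemma smooth_continuous f : smooth f -> continuous f.
Proof. by move=> /(_ [::])[]. Qed.

Lemma smooth_derivable f i x : smooth f -> derivable f x (delta_mx 0 i).
Proof. by move=> /(_ [::])[_]; exact. Qed.

Lemma partialD f g i x : derivable f x (delta_mx 0 i) ->
  derivable g x (delta_mx 0 i) ->
  partial i (f \+ g) x = partial i f x + partial i g x.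
Proof. by move=> df dg; rewrite /partial [LHS](deriveD df dg). Qed.

Lemma partialM f g i x : derivable f x (delta_mx 0 i) ->
  derivable g x (delta_mx 0 i) ->
  partial i (f \* g) x = f x * partial i g x + partial i f x * g x.
Proof.
move=> df dg; rewrite /partial [LHS](deriveM df dg); congr (_ + _).
by rewrite [LHS]/(_ * _) mulrC.
Qed.

Lemma partial_cst (c : R) i : partial i (cst c : 'rV[R]_n -> R) = cst 0.
Proof. by apply/funext => x; rewrite /partial derive_cst. Qed.

Lemma Ck_cst k (c : R) : Ck k (cst c : 'rV[R]_n -> R).
Proof.
have H d : C1 (cst d : 'rV[R]_n -> R).
  by split=> [|i x]; [exact: cst_continuous|exact: derivable_cst].
elim: k c => [|k IH] c; split=> // i.
by rewrite partial_cst; exact: IH.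
Qed.

Lemma C1D f g : C1 f -> C1 g -> C1 (f \+ g).
Proof.
move=> [cf df] [cg dg]; split.
  by move=> x; apply: continuousD; [exact: cf|exact: cg].
by move=> i x; apply: derivableD; [exact: df|exact: dg].
Qed.

Lemma C1M f g : C1 f -> C1 g -> C1 (f \* g).
Proof.
move=> [cf df] [cg dg]; split.
  by move=> x; apply: continuousM; [exact: cf|exact: cg].
by move=> i x; apply: derivableM; [exact: df|exact: dg].
Qed.

Lemma C1V f : (forall x, f x != 0) -> C1 f -> C1 (fun x => (f x)^-1).
Proof.
move=> f0 [cf df]; split.
  by move=> x; apply: continuousV; [exact: f0|exact: cf].
by move=> i x; apply: derivableV; [exact: f0|exact: df].
Qed.

Lemma CkD k f g : Ck k f -> Ck k g -> Ck k (f \+ g).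
Proof.
elim: k f g => [|k IH] f g [H1 H2] [H3 H4]; split; try exact: C1D; first exact: I.
move=> i; rewrite (_ : partial i (f \+ g) = partial i f \+ partial i g).
  by apply: IH; [exact: H2|exact: H4].
by apply/funext => x; apply: partialD; [exact: H1.2|exact: H3.2].
Qed.

Lemma CkM k f g : Ck k f -> Ck k g -> Ck k (f \* g).
Proof.
elim: k f g => [|k IH] f g Cf Cg; have [H1 H2] := Cf; have [H3 H4] := Cg;
  split; try exact: C1M; first exact: I.
move=> i; rewrite (_ : partial i (f \* g) = (f \* partial i g) \+ (partial i f \* g)).
  by apply: CkD; apply: IH; [exact: CkS|exact: H4|exact: H2|exact: CkS].
by apply/funext => x; apply: partialM; [exact: H1.2|exact: H3.2].
Qed.

Lemma CkV k f : (forall x, f x != 0) -> Ck k f -> Ck k (fun x => (f x)^-1).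
Proof.
move=> f0; elim: k => [|k IH] Cf; have [H1 H2] := Cf; split; try exact: C1V; first exact: I.
move=> i; rewrite (_ : partial i _ =
  (cst (-1) \* ((fun x => (f x)^-1) \* (fun x => (f x)^-1))) \* partial i f).
  have {}IH := IH (CkS Cf).
  apply: (CkM _ (H2 i)); apply: (CkM (Ck_cst k (-1)) _); exact: CkM.
apply/funext => x; rewrite {1}/partial deriveV; [|exact: f0|exact: H1.2].
by rewrite [LHS]/(_ * _) /=; congr (_ * _); rewrite -exprVn expr2 mulN1r.
Qed.

Lemma smooth_cst (c : R) : smooth (cst c : 'rV[R]_n -> R).
Proof. by apply/smoothP => k; exact: Ck_cst. Qed.

Lemma smoothD f g : smooth f -> smooth g -> smooth (f \+ g).
Proof. by move=> /smoothP sf /smoothP sg; apply/smoothP => k; exact: CkD. Qed.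

Lemma smoothM f g : smooth f -> smooth g -> smooth (f \* g).
Proof. by move=> /smoothP sf /smoothP sg; apply/smoothP => k; exact: CkM. Qed.

Lemma smoothZ (c : R) f : smooth f -> smooth (fun x => c * f x).
Proof. by move=> sf; apply: (smoothM _ sf); exact: smooth_cst. Qed.

Lemma smoothB f g : smooth f -> smooth g -> smooth (fun x => f x - g x).
Proof.
move=> sf sg; rewrite (_ : (fun x => _) = f \+ (fun x => -1 * g x)).
  by apply: smoothD; [exact: sf|exact: smoothZ].
by apply/funext => x /=; rewrite mulN1r.
Qed.

Lemma smooth_partialM f g i : smooth f -> smooth g ->
  partial i (f \* g) = (f \* partial i g) \+ (partial i f \* g).
Proof.
by move=> sf sg; apply/funext => x; apply: partialM; exact: smooth_derivable.
Qed.

Lemma partialZ (c : R) f i : smooth f ->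
  partial i (fun x => c * f x) = (fun x => c * partial i f x).
Proof.
move=> sf; rewrite (_ : (fun x => c * f x) = cst c \* f)//.
rewrite smooth_partialM//; last exact: smooth_cst.
by apply/funext => x; rewrite partial_cst /= mul0r addr0.
Qed.

Lemma smooth_partialD f g i : smooth f -> smooth g ->
  partial i (f \+ g) = partial i f \+ partial i g.
Proof.
by move=> sf sg; apply/funext => x; apply: partialD; exact: smooth_derivable.
Qed.

Lemma smooth_partialB f g i : smooth f -> smooth g ->
  partial i (fun x => f x - g x) = (fun x => partial i f x - partial i g x).
Proof.
move=> sf sg; have sg' := smoothZ (-1) sg.
rewrite (_ : (fun x => f x - g x) = f \+ (fun x => -1 * g x)); last first.
  by apply/funext => x /=; rewrite mulN1r.
rewrite smooth_partialD// partialZ//.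
by apply/funext => x /=; rewrite mulN1r.
Qed.

Lemma smooth_prod (I : Type) (s : seq I) (F : I -> 'rV[R]_n -> R) :
  (forall i, smooth (F i)) -> smooth (fun x => \prod_(i <- s) F i x).
Proof.
move=> sF; elim: s => [|i s IH].
  rewrite (_ : (fun _ => _) = cst 1); first exact: smooth_cst.
  by apply/funext => x; rewrite big_nil.
rewrite (_ : (fun _ => _) = F i \* (fun x => \prod_(i <- s) F i x)).
  by apply: smoothM; [exact: sF|exact: IH].
by apply/funext => x; rewrite big_cons.
Qed.

Lemma near_eq_partial f g i x : (\near x, f x = g x) -> partial i f x = partial i g x.
Proof. exact: near_eq_derive. Qed.

(** Each term of the product rule differentiates one factor, and the remaining factors lie between 0
    and 1. *)
Lemma partial_prod_le (I : Type) (s : seq I) (F : I -> 'rV[R]_n -> R) i x :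
  (forall j, smooth (F j)) -> (forall j, 0 <= F j x <= 1) ->
  `|partial i (fun x => \prod_(j <- s) F j x) x| <=
    \sum_(j <- s) `|partial i (F j) x|.
Proof.
move=> sF F01.
have P01 t : 0 <= \prod_(j <- t) F j x <= 1.
  elim: t => [|j t IH]; first by rewrite big_nil ler01 lexx.
  rewrite big_cons; case/andP: IH => h1 h2; case/andP: (F01 j) => h3 h4.
  by rewrite mulr_ge0//= mulr_ile1.
elim: s => [|j s IH].
  under eq_fun do rewrite big_nil.
  by rewrite partial_cst/= normr0 big_nil.
under eq_fun do rewrite big_cons.
rewrite big_cons [X in partial i X](_ : _ = F j \* (fun x => \prod_(j <- s) F j x))//.
rewrite partialM; [|exact: smooth_derivable|].
- rewrite addrC; apply: (le_trans (ler_normD _ _)); apply: lerD.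
    rewrite normrM ler_piMr// ger0_norm; first by case/andP: (P01 s).
    by case/andP: (P01 s).
  apply: le_trans IH; rewrite normrM ler_piMl// ger0_norm.
    by case/andP: (F01 j).
  by case/andP: (F01 j).
- by apply: smooth_derivable; exact: smooth_prod.
Qed.

End Ck.

Section coordinate.
Context {R : realType} {n : nat}.

Lemma is_derive_coord (g : R -> R) (i j : 'I_n) (x : 'rV[R]_n) dg :
  is_derive (x 0 i) 1 g dg ->
  is_derive x (delta_mx 0 j) (fun x : 'rV[R]_n => g (x 0 i)) ((i == j)%:R * dg).
Proof.
move=> dgE; have [<-|ij] := eqVneq i j; rewrite ?mul1r ?mul0r.
  have E : (fun h : R => h^-1 *: (((fun x : 'rV[R]_n => g (x 0 i)) \o shift x)
      (h *: (delta_mx 0 i : 'rV[R]_n)) - g (x 0 i))) =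
      (fun h : R => h^-1 *: ((g \o shift (x 0 i)) (h *: (1:R)) - g (x 0 i))).
    by apply/funext => h /=; rewrite !mxE !eqxx.
  case: dgE => dv <-; split; first by rewrite /derivable E.
  by rewrite /derive E.
have E : (fun h : R => h^-1 *: (((fun x : 'rV[R]_n => g (x 0 i)) \o shift x)
      (h *: (delta_mx 0 j : 'rV[R]_n)) - g (x 0 i))) = cst 0.
  apply/funext => h /=; rewrite !mxE eqxx (negbTE ij)/= mulr0 add0r subrr.
  by rewrite scaler0.
split; first by rewrite /derivable E; exact: is_cvg_cst.
by rewrite /derive E; apply/cvg_lim => //; exact: cvg_cst.
Qed.

End coordinate.

(** * The flat function exp(-1/x) and a smooth step *)

Section expinv.
Context {R : realType}.

(** For [P = 1] this is exp(-1/x) extended by 0. The polynomial in 1/x makes the family closed under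
    differentiation ([is_derive_expinv]), so that smoothness of all orders follows by one
    induction. *)
Definition expinv (P : {poly R}) (x : R) : R :=
  if 0 < x then P.[x^-1] * expR (- x^-1) else 0.

Lemma poly_expR_bounded (P : {poly R}) :
  exists2 C, 0 < C & forall y : R, 0 <= y -> `|P.[y]| * expR (- y) <= C.
Proof.
have mono k : exists2 C, 0 < C & forall y : R, 0 <= y -> y ^+ k * expR (- y) <= C.
  exists (k`!%:R + 1).
    by rewrite ltr_wpDl// ler0n.
  move=> y y0; rewrite expRN ler_pdivrMr ?expR_gt0//.
  case: k => [|k].
    by rewrite expr0 fact0; have := expR_ge1Dx y; nra.
  have := expR_ge1Dxn k y0; have f0 : (0 : R) < (k.+1)`!%:R by rewrite ltr0n fact_gt0.
  move=> h; have h2 := expR_gt0 y.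
  have [h3 h4] : 0 <= (k.+1)`!%:R * expR y /\ y ^+ k.+1 <= (k.+1)`!%:R * expR y.
    split; first by rewrite mulr_ge0// ltW.
    by rewrite -ler_pdivrMl// mulrC; lra.
  by rewrite mulrDl mul1r; lra.
elim/poly_ind: P => [|P c [C C0 IH]].
  by exists 1 => // y _; rewrite horner0 normr0 mul0r.
suff [D D0 PX] : exists2 D, 0 < D & forall y : R, 0 <= y -> `|(P * 'X).[y]| * expR (- y) <= D.
  exists (D + `|c|); first by rewrite ltr_pwDl.
  move=> y y0; rewrite hornerD hornerC.
  apply: (@le_trans _ _ ((`|(P * 'X).[y]| + `|c|) * expR (- y))).
    by rewrite ler_wpM2r ?expR_ge0// ler_normD.
  rewrite mulrDl lerD ?PX// ler_piMr// -expR0 ler_expR; lra.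
clear IH C C0 c.
suff [D D0 PX] : exists2 D, 0 < D & forall y : R, 0 <= y ->
    (\sum_(i < size (P * 'X)) `|(P * 'X)`_i| * y ^+ i) * expR (- y) <= D.
  exists D => // y y0; apply: le_trans (PX y y0).
  rewrite ler_wpM2r ?expR_ge0// horner_coef.
  apply: (le_trans (ler_norm_sum _ _ _)); apply: ler_sum => i _.
  by rewrite normrM normrX (ger0_norm y0).
move: (P * 'X) => Q; move: (polyseq Q) => s; move: (size s) => m; elim: m => [|m [D D0 IH]].
  by exists 1 => // y y0; rewrite big_ord0 mul0r.
have [C C0 HC] := mono m.
exists (D + `|s`_m| * C); first by rewrite ltr_pwDl// mulr_ge0// ltW.
move=> y y0; rewrite big_ord_recr/= mulrDl lerD ?IH// -mulrA.
by rewrite ler_wpM2l// HC.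
Qed.

Lemma is_derive_expinv P (x : R) :
  is_derive x 1 (expinv P) (expinv ('X^2 * (P - P^`())) x).
Proof.
have [x0|x0|->] := ltgtP x 0.
- rewrite {2}/expinv ltNge (ltW x0)/=.
  apply: (@near_eq_is_derive R R R (cst 0)).
  near=> y; rewrite /expinv ltNge (_ : y <= 0)//.
  by apply: ltW; near: y; exact: lt_nbhsl.
- rewrite {2}/expinv x0.
  apply: (@near_eq_is_derive _ _ _ ((horner P \o GRing.inv) * (expR \o (fun y => - y^-1)))).
    near=> y; rewrite /expinv (_ : 0 < y)//; near: y; exact: lt_nbhsr.
  have xn0 : x != 0 by rewrite gt_eqF.
  have dV : is_derive x 1 (GRing.inv : R -> R) (- x ^- 2).
    have := @is_deriveV _ id x 1 1 xn0 (is_derive_id _ _).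
    by rewrite [_ *: _]mulr1.
  have dP : is_derive (x^-1) 1 (horner P) (P^`()).[x^-1].
    exact: is_derive_poly.
  have d1 := is_derive1_comp dP dV.
  have d2 := is_derive1_comp (is_derive_expR _) (is_deriveN dV).
  have [X Y] := is_deriveM d1 d2; apply: DeriveDef; first exact: X.
  rewrite [LHS]Y.
  rewrite /= !hornerE/= -!exprVn -![_ *: _]/(_ * _) opprK; ring.
- rewrite {2}/expinv ltxx.
  (* At 0 the difference quotient is, for [h > 0], the product of [h] and
     [(1/h)^2 P(1/h) exp(-1/h)]; the second factor is bounded by [C]. *)
  have [C C0 PC] := poly_expR_bounded ('X^2 * P).
  have cv : h^-1 *: ((expinv P \o shift 0) (h *: (1 : R)) - expinv P 0) @[h --> 0^'] --> (0 : R).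
    apply/cvgrPdist_le => e e0; near=> h.
    rewrite sub0r normrN /= addr0 {2}/expinv ltxx subr0 [h *: 1]mulr1 /expinv.
    case: ifPn => h0; last by rewrite scaler0 normr0 ltW.
    rewrite [_ *: _]/(_ * _) normrM normrM (ger0_norm (expR_ge0 _)).
    have := PC h^-1; rewrite invr_ge0 ltW// => /(_ isT).
    rewrite hornerM hornerXn normrM normrX normfV (gtr0_norm h0) -mulrA => {}PC.
    have hC : h <= e / C.
      rewrite -(gtr0_norm h0); near: h; apply: dnbhs0_le; exact: divr_gt0.
    rewrite ler_pdivlMr// in hC.
    set t := `|_| * _ in PC *.
    have -> : h^-1 * t = h * (h^-1 ^+ 2 * t) by field; rewrite gt_eqF.
    by apply: le_trans hC; rewrite ler_wpM2l// ltW.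
  by apply: DeriveDef; [exact: cvgP cv|exact: cvg_lim cv].
Unshelve. all: by end_near.
Qed.

End expinv.

Section expinv2.
Context {R : realType}.
Local Notation E := (@expinv R 1).

Lemma expinv1E (x : R) : 0 < x -> E x = expR (- x^-1).
Proof. by move=> x0; rewrite /expinv x0 hornerC mul1r. Qed.

Lemma expinv_le0 P (x : R) : x <= 0 -> expinv P x = 0.
Proof. by move=> x0; rewrite /expinv ltNge x0. Qed.

Lemma expinv1_ge0 (x : R) : 0 <= E x.
Proof. by rewrite /expinv; case: ifPn => // _; rewrite hornerC mul1r expR_ge0. Qed.

Lemma expinv1_gt0 (x : R) : 0 < x -> 0 < E x.
Proof. by move=> x0; rewrite expinv1E// expR_gt0. Qed.

Lemma expinv_bounded P : exists2 C, 0 < C & forall x : R, `|expinv P x| <= C.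
Proof.
have [C C0 PC] := poly_expR_bounded P; exists C => // x.
rewrite /expinv; case: ifPn => x0; last by rewrite normr0 ltW.
by rewrite normrM (ger0_norm (expR_ge0 _)) PC// invr_ge0 ltW.
Qed.

(** One of [x] and [1 - x] is at least 1/2, where exp(-1/x) is at least exp(-2). This keeps the
    denominator of [step] away from 0 and bounds the derivative of [step] on the whole line. *)
Lemma expinv_sum_gt0 (x : R) : expR (- 2) <= E x + E (1 - x).
Proof.
wlog x2 : x / 2^-1 <= x.
  move=> H; have [x2|x2] := leP 2^-1 x; first exact: H.
  have x3 : 2^-1 <= 1 - x by lra.
  have -> : E x + E (1 - x) = E (1 - x) + E (1 - (1 - x)).
    by rewrite addrC; congr (_ + E _); ring.
  exact: H.
have x0 : 0 < x by lra.
rewrite -[leLHS]addr0; apply: lerD; last exact: expinv1_ge0.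
by rewrite expinv1E// ler_expR lerN2 -[leRHS]invrK lef_pV2// posrE invr_gt0.
Qed.

Definition step (x : R) : R := E x / (E x + E (1 - x)).

Lemma step_den_gt0 (x : R) : 0 < E x + E (1 - x).
Proof. by apply: lt_le_trans (expinv_sum_gt0 x); exact: expR_gt0. Qed.

Lemma step_le0 (x : R) : x <= 0 -> step x = 0.
Proof. by move=> x0; rewrite /step expinv_le0// mul0r. Qed.

Lemma step_ge1 (x : R) : 1 <= x -> step x = 1.
Proof.
move=> x1; rewrite /step (@expinv_le0 _ (1 - x)) ?subr_le0// addr0 divff//.
by rewrite gt_eqF// expinv1_gt0//; lra.
Qed.

Lemma step_ge0_le1 (x : R) : 0 <= step x <= 1.
Proof.
rewrite /step divr_ge0 ?expinv1_ge0//=; last by rewrite ltW ?step_den_gt0.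
by rewrite ler_pdivrMr ?step_den_gt0// mul1r lerDl expinv1_ge0.
Qed.

Lemma is_derive_step : exists dstep : R -> R, exists2 C : R, 0 < C &
  forall x : R, [/\ is_derive x 1 step (dstep x), `|dstep x| <= C,
    x <= 0 -> dstep x = 0 & 1 <= x -> dstep x = 0].
Proof.
pose P : {poly R} := 'X^2 * (1 - 1^`()).
pose dE := expinv P.
exists (fun x => (dE x * (E x + E (1 - x)) - E x * (dE x - dE (1 - x))) / (E x + E (1 - x)) ^+ 2).
have [C C0 dEC] := expinv_bounded P.
have [D D0 ED] := expinv_bounded (1 : {poly R}).
exists ((C * (D + D) + D * (C + C)) / expR (- 2) ^+ 2) => [|x].
  by rewrite divr_gt0// ?exprn_gt0 ?expR_gt0// addr_gt0// mulr_gt0// addr_gt0.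
have d0 := step_den_gt0 x.
have dEx (y : R) : is_derive y 1 E (dE y) by exact: is_derive_expinv.
have d1x : is_derive x 1 (fun y : R => 1 - y) (-1).
  have := is_deriveB (is_derive_cst (1 : R) x 1) (is_derive_id x 1).
  by rewrite sub0r.
have dE1 : is_derive x 1 (E \o (fun y : R => 1 - y)) (- dE (1 - x)).
    by rewrite -mulrN1; exact: (is_derive1_comp (f := E) (g := fun y : R => 1 - y) (dEx (1 - x)) d1x).
split.
- have dD := is_deriveD (dEx x) dE1.
  have sumE : (E + (E \o (fun y : R => 1 - y))) x = E x + E (1 - x) by [].
  have dn : (E + (E \o (fun y : R => 1 - y))) x != 0.
    by rewrite sumE gt_eqF.
  have dV := @is_deriveV _ _ x _ 1 dn dD.
  have [X Y] := is_deriveM (dEx x) dV; apply: DeriveDef; first exact: X.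
  rewrite [LHS]Y.
  rewrite -![_ *: _]/(_ * _) sumE /=.
  by field; rewrite gt_eqF.
- have h1 : 0 < expR (- 2) ^+ 2 :> R by rewrite exprn_gt0// expR_gt0.
  rewrite normrM normfV (ger0_norm (sqr_ge0 _)).
  apply: ler_pM => //.
  + by rewrite invr_ge0 sqr_ge0.
  + apply: (le_trans (ler_normB _ _)); rewrite !normrM.
    by apply: lerD; apply: ler_pM => //; [apply: (le_trans (ler_normD _ _))
      |apply: (le_trans (ler_normB _ _))]; apply: lerD.
  + rewrite lef_pV2 ?posrE// ?exprn_gt0// lerXn2r ?nnegrE ?expR_ge0//.
      exact: ltW.
    exact: expinv_sum_gt0.
- by move=> x0; rewrite /dE !(expinv_le0 _ x0) !mul0r subrr mul0r.
- move=> x1; have x1' : 1 - x <= 0 by rewrite subr_le0.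
  by rewrite /dE !(expinv_le0 _ x1') !addr0 subr0 (mulrC (E x)) subrr mul0r.
Qed.

End expinv2.

Section smooth_coord.
Context {R : realType} {n : nat}.

Lemma Ck_expinv k (P : {poly R}) (i : 'I_n) (a b : R) :
  Ck k (fun x : 'rV[R]_n => expinv P ((x 0 i - a) * b)).
Proof.
have daff (t : R) : is_derive t 1 (fun t => (t - a) * b) b.
  have -> : (fun t => (t - a) * b) = (id - cst a) * cst b by [].
  have h1 := is_deriveB (is_derive_id t 1) (is_derive_cst a t 1).
  have [X Y] := is_deriveM h1 (is_derive_cst b t 1).
  apply: DeriveDef; first exact: X.
  rewrite [LHS]Y.
  by rewrite -![_ *: _]/(_ * _) /= subr0 mulr1 mulr0 add0r.
have dg Q (t : R) : is_derive t 1 (fun t => expinv Q ((t - a) * b))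
    (expinv ('X^2 * (Q - Q^`())) ((t - a) * b) * b).
  exact: (is_derive1_comp (is_derive_expinv Q _) (daff t)).
have dx Q j (x : 'rV[R]_n) := is_derive_coord j (dg Q (x 0 i)).
have C1e Q : C1 (fun x : 'rV[R]_n => expinv Q ((x 0 i - a) * b)).
  split=> [x|j x]; last by case: (dx Q j x).
  have /differentiable_continuous : differentiable (fun t => expinv Q ((t - a) * b)) (x 0 i : R).
    by apply/derivable1_diffP; case: (dg Q (x 0 i)).
  move=> h; apply: (@continuous_comp _ _ _ (fun x : 'rV[R]_n => x 0 i) (fun t => expinv Q ((t - a) * b))).
    exact: coord_continuous.
  exact: h.
elim: k P => [|k IH] P; split; try exact: C1e; first exact: I.
move=> j; rewrite (_ : partial j _ = cst ((i == j)%:R * b) \*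
   (fun x : 'rV[R]_n => expinv ('X^2 * (P - P^`())) ((x 0 i - a) * b))).
  exact: CkM (Ck_cst _ _) (IH _).
by apply/funext => x /=; rewrite /partial; case: (dx P j x) => _ ->; ring.
Qed.

Lemma smooth_step (i : 'I_n) (a b : R) : b != 0 ->
  smooth (fun x : 'rV[R]_n => step ((x 0 i - a) * b)).
Proof.
move=> b0; apply/smoothP => k.
(* The second argument in [step] is again affine of the same shape: [1 - (x - a) b] equals
   [(x - (a + 1/b)) (- b)]. *)
have h1 := Ck_expinv k 1 i a b; have h2 := Ck_expinv k 1 i (a + b^-1) (- b).
rewrite (_ : (fun _ => _) = (fun x : 'rV[R]_n => expinv 1 ((x 0 i - a) * b)) \*
  (fun x : 'rV[R]_n => (expinv 1 ((x 0 i - a) * b) + expinv 1 ((x 0 i - (a + b^-1)) * - b))^-1)).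
  apply: (CkM h1); apply: CkV; last exact: CkD h1 h2.
  move=> x; rewrite gt_eqF// (_ : _ * - b = 1 - (x 0 i - a) * b) ?step_den_gt0//.
  by field.
apply/funext => x /=; rewrite /step; congr (_ / (_ + expinv _ _)).
by field.
Qed.

(** One constant serves all scales: the derivative of [step] is bounded on the line and the affine
    change of variable contributes the factor [|b|]. *)
Lemma partial_step : exists2 C : R, 0 < C & forall (i j : 'I_n) (a b : R) (x : 'rV[R]_n),
  let f := fun x : 'rV[R]_n => step ((x 0 i - a) * b) in
  [/\ `|partial j f x| <= C * `|b|,
     i != j -> partial j f x = 0,
     (x 0 i - a) * b <= 0 -> partial j f x = 0 &
     1 <= (x 0 i - a) * b -> partial j f x = 0].
Proof.
have [ds [C C0 H]] := @is_derive_step R.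
exists C => // i j a b x f.
have daff (t : R) : is_derive t 1 (fun t => (t - a) * b) b.
  have -> : (fun t => (t - a) * b) = (id - cst a) * cst b by [].
  have h1 := is_deriveB (is_derive_id t 1) (is_derive_cst a t 1).
  have [X Y] := is_deriveM h1 (is_derive_cst b t 1).
  apply: DeriveDef; first exact: X.
  rewrite [LHS]Y.
  by rewrite -![_ *: _]/(_ * _) /= subr0 mulr1 mulr0 add0r.
have [h1 h2 h3 h4] := H ((x 0 i - a) * b).
have := is_derive_coord j (is_derive1_comp (f := step) (g := fun t => (t - a) * b) h1 (daff (x 0 i))).
move=> [_]; rewrite -/(partial j _) => E.
have -> : partial j f x = (i == j)%:R * (ds ((x 0 i - a) * b) * b) by exact: E.
split.
- rewrite !normrM; case: eqP => _; rewrite ?normr1 ?normr0 ?mul1r ?mul0r.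
    by rewrite ler_wpM2r.
  by rewrite mulr_ge0// ltW.
- by move=> /negbTE ->; rewrite mul0r.
- by move=> /h3 ->; rewrite !(mul0r, mulr0).
- by move=> /h4 ->; rewrite !(mul0r, mulr0).
Qed.

End smooth_coord.

(** * Cubes, compact sets and cutoff functions *)

Section cubes.
Context {R : realType} {n : nat}.
Implicit Types (c x y : 'rV[R]_n) (r : R) (U K : set 'rV[R]_n).

Definition cube c r : set 'rV[R]_n := [set y | forall i, `|y 0 i - c 0 i| <= r].
Definition ocube c r : set 'rV[R]_n := [set y | forall i, `|y 0 i - c 0 i| < r].

Lemma ball_ocube c r : 0 < r -> ball c r = ocube c r.
Proof.
move=> r0; apply/seteqP; split=> [y [_ H] i|y H].
  by have := H 0 i; rewrite /ball/= distrC.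
split => // i j; rewrite (ord1 i); have := H j; rewrite distrC; exact.
Qed.

Lemma ocube_open c r : open (ocube c r).
Proof.
have [r0|r0] := ltP 0 r; first by rewrite -ball_ocube//; exact: ball_open.
(* In dimension 0 the open cube is the whole space whatever [r] is; in positive dimension it is
   empty for [r <= 0]. *)
have [[i0 _]|n0] := pselect (exists i : 'I_n, True); last first.
  rewrite (_ : ocube c r = setT); first exact: openT.
  by apply/seteqP; split => // y _ i; case: n0; exists i.
rewrite (_ : ocube c r = set0); first exact: open0.
apply/seteqP; split => // y /(_ i0).
by rewrite ltNge (le_trans r0).
Qed.

Lemma cube_compact c r : compact (cube c r).
Proof.
rewrite (_ : cube c r = [set v : 'rV[R]_n | forall i, `[c 0 i - r, c 0 i + r]%classic (v ord0 i)]).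
  apply: (@rV_compact R n (fun i => `[c 0 i - r, c 0 i + r]%classic)) => i; exact: segment_compact.
apply/seteqP; split => y H i; have := H i; rewrite /= in_itv/= ler_distl//.
Qed.

Lemma compact_closed_rV K : compact K -> closed K.
Proof. by apply: compact_closed; exact: norm_hausdorff. Qed.

Lemma cube_closed c r : closed (cube c r).
Proof. by apply: compact_closed_rV; exact: cube_compact. Qed.

Lemma ocube_sub c r : ocube c r `<=` cube c r.
Proof. by move=> y H i; exact: ltW. Qed.

Lemma sub_cube c r s : r <= s -> cube c r `<=` cube c s.
Proof. by move=> rs y H i; exact: le_trans (H i) rs. Qed.

Lemma cube_sub_ocube c r s : r < s -> cube c r `<=` ocube c s.
Proof. by move=> rs y H i; exact: le_lt_trans (H i) rs. Qed.

Lemma cube_trans c x r s : cube c r x -> cube x s `<=` cube c (r + s).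
Proof. by move=> cx y xy i; have := cx i; have := xy i; rewrite !ler_norml; lra. Qed.

Lemma cube_center c r : 0 <= r -> cube c r c.
Proof. by move=> r0 i; rewrite subrr normr0. Qed.

Lemma ocube_center c r : 0 < r -> ocube c r c.
Proof. by move=> r0 i; rewrite subrr normr0. Qed.

Lemma cube_sym c r x : cube c r x -> cube x r c.
Proof. by move=> h i; rewrite distrC. Qed.

Lemma nbhs_cube c (A : set 'rV[R]_n) : nbhs c A -> exists2 r, 0 < r & cube c r `<=` A.
Proof.
move=> /nbhs_ballP[e /= e0 H]; exists (e / 2); first by rewrite divr_gt0.
apply: (subset_trans _ H); rewrite ball_ocube//; apply: cube_sub_ocube.
by rewrite ltr_pdivrMr// ltr_pMr// ltr1n.
Qed.

Lemma open_cube U c : open U -> U c -> exists2 r, 0 < r & cube c r `<=` U.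
Proof. by move=> oU Uc; apply: nbhs_cube; exact: open_nbhs_nbhs. Qed.

Lemma finite_cube_cover K r : compact K -> 0 < r ->
  exists2 s : seq 'rV[R]_n, (forall c, c \in s -> K c) &
    K `<=` [set x | exists2 c, c \in s & ocube c r x].
Proof.
move=> cK r0; move: cK; rewrite compact_cover => /(_ _ K (ocube^~ r)).
case=> [c _|x Kx|D DK KD].
- exact: ocube_open.
- by exists x => //; exact: ocube_center.
exists (finmap.enum_fset D) => [c cD|x Kx]; first by have := DK c cD; rewrite inE.
by have [c cD xc] := KD x Kx; exists c.
Qed.

(** A Lebesgue number: each point is covered by a cube of half the admissible radius, and the other
    half remains available around every point of that cube. *)
Lemma lebesgue_number K U : compact K -> open U -> K `<=` U ->
  exists2 r, 0 < r & forall x, K x -> cube x r `<=` U.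
Proof.
move=> cK oU KU.
have /choice[rr rP] : forall x, exists r, 0 < r /\ (K x -> cube x (r + r) `<=` U).
  move=> x; have [Kx|nKx] := pselect (K x); last by exists 1.
  have [r r0 rU] := open_cube oU (KU _ Kx); exists (r / 2); split.
    by rewrite divr_gt0.
  by rewrite -splitr.
move: cK; rewrite compact_cover => /(_ _ K (fun x => ocube x (rr x))).
case=> [c _|x Kx|D DK KD].
- exact: ocube_open.
- by exists x => //; apply: ocube_center; case: (rP x).
have [e e0 eP] : exists2 e, 0 < e & forall x, x \in finmap.enum_fset D -> e <= rr x.
  elim: (finmap.enum_fset D) => [|x s [e e0 IH]]; first by exists 1.
  exists (Num.min e (rr x)).
    by rewrite lt_min e0; case: (rP x).
  move=> y; rewrite inE => /orP[/eqP ->|ys]; first by rewrite ge_min lexx orbT.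
  by rewrite ge_min IH.
exists e => // x Kx; have [c cD xc] := KD x Kx.
have [_ H] := rP c; apply: subset_trans (H _); last first.
  by have := DK c cD; rewrite inE.
apply: subset_trans (cube_trans (ocube_sub xc)).
exact/sub_cube/eP.
Qed.

Lemma test_functionI U K f : smooth f -> compact K -> K `<=` U ->
  (forall x, ~ K x -> f x = 0) -> test_function U f.
Proof.
move=> sf cK KU f0.
have HK : closure [set x | f x != 0] `<=` K.
  rewrite [X in _ `<=` X](closure_id K).1; last exact: compact_closed_rV.
  apply: closure_subset => x /= fx; apply: contrapT => /f0 fx0.
  by rewrite fx0 eqxx in fx.
split => //; split; last exact: subset_trans HK KU.
by apply: subclosed_compact HK => //; exact: closed_closure.
Qed.

Lemma test_functionE U f : test_function U f ->
  exists K, [/\ compact K, K `<=` U & forall x, ~ K x -> f x = 0].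
Proof.
move=> [sf [cK KU]]; exists (closure [set x | f x != 0]); split => // x nx.
by apply: contrapT => /eqP fx; apply: nx; exact: subset_closure.
Qed.

Lemma partial_out K f i x : closed K -> (forall x, ~ K x -> f x = 0) ->
  ~ K x -> partial i f x = 0.
Proof.
move=> cK f0 nKx.
rewrite (@near_eq_partial _ _ f (cst 0)) ?partial_cst//.
have : nbhs x (~` K) by apply: open_nbhs_nbhs; split => //; exact: closed_openC.
by apply: filterS => y; exact: f0.
Qed.

(** A product of [2n] steps, one per face. The derivative in direction [j] vanishes as soon as the
    [j]-th coordinate lies within [r] of the centre, even at points outside the inner cube, since
    only the factors of the two faces orthogonal to [e_j] depend on that coordinate. Therefore a
    derivative in direction [j] sees only these two faces, which [face_corr] exploits. *)
Lemma cube_bump : exists2 C : R, 0 < C & forall c (r r' : R), r < r' ->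
  exists psi : 'rV[R]_n -> R,
  [/\ smooth psi, forall x, 0 <= psi x <= 1,
      (forall x, cube c r x -> psi x = 1) /\
        (forall j x, `|x 0 j - c 0 j| <= r -> partial j psi x = 0),
      forall x, ~ ocube c r' x -> psi x = 0 &
      forall j x, `|partial j psi x| <= C / (r' - r)].
Proof.
have [C C0 HC] := @partial_step R n.
(* One copy of [C] per face; the added 1 keeps the constant positive in dimension 0. *)
exists (C * (#|{: 'I_n * bool}|%:R + 1)); first by rewrite mulr_gt0// ltr_wpDl.
move=> c r r' rr'; pose b := (r' - r)^-1.
have b0 : 0 < b by rewrite invr_gt0 subr_gt0.
(* The boolean selects one of two opposite faces of the outer cube. Each factor grows from 0 on that
   face to 1 at depth [r' - r]. *)
pose cc (p : 'I_n * bool) : R := if p.2 then c 0 p.1 - r' else c 0 p.1 + r'.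
pose bb (p : 'I_n * bool) : R := if p.2 then b else - b.
pose fac (p : 'I_n * bool) (x : 'rV[R]_n) := step ((x 0 p.1 - cc p) * bb p).
have bb0 p : bb p != 0 by rewrite /bb; case: p.2; rewrite ?oppr_eq0 gt_eqF.
have bbE p : `|bb p| = b by rewrite /bb; case: p.2; rewrite ?normrN gtr0_norm.
have sfac p : smooth (fac p) by exact: smooth_step.
have fac01 p x : 0 <= fac p x <= 1 by exact: step_ge0_le1.
have facin p x : `|x 0 p.1 - c 0 p.1| <= r -> 1 <= (x 0 p.1 - cc p) * bb p.
  rewrite /cc /bb ler_norml => /andP[h1 h2].
  case: p.2; rewrite ?mulrN -?mulNr -/(_ / _) ler_pdivlMr ?subr_gt0//; lra.
have P01 s x : 0 <= \prod_(p <- s) fac p x <= 1.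
  elim: s => [|p s IH]; first by rewrite big_nil ler01 lexx.
  rewrite big_cons; case/andP: IH => h1 h2; case/andP: (fac01 p x) => h3 h4.
  by rewrite mulr_ge0//= mulr_ile1.
exists (fun x => \prod_p fac p x); split.
- exact: smooth_prod.
- by move=> x; exact: P01.
- split.
    by move=> x cx; rewrite big1// => p _; apply: step_ge1; apply: facin; exact: cx.
  move=> j x xj; apply/eqP; rewrite -normr_le0.
  apply: (le_trans (@partial_prod_le _ _ _ _ fac j x _ _)) => //.
  rewrite big1// => p _; have [_ H1 _ H] := HC p.1 j (cc p) (bb p) x.
  have [pj|pj] := eqVneq p.1 j; last by rewrite [partial j _ x]H1 ?normr0.
  by rewrite [partial j _ x]H ?normr0//; apply: facin; rewrite pj.
- move=> x /existsNP[i /negP]; rewrite -leNgt => xi.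
  have [p ip] : exists p, fac p x = 0.
    have [h|h] := leP r' (x 0 i - c 0 i).
      exists (i, false); rewrite /fac /cc /bb/=; apply: step_le0.
      by rewrite nmulr_lle0 ?oppr_lt0//; lra.
    exists (i, true); rewrite /fac /cc /bb/=; apply: step_le0.
    by rewrite pmulr_lle0//; move: xi; rewrite ler_normr; lra.
  by rewrite (bigD1 p)//= ip mul0r.
- move=> j x; apply: (le_trans (@partial_prod_le _ _ _ _ fac j x _ _)) => //.
  apply: (@le_trans _ _ (\sum_(p : 'I_n * bool) C * b)).
    apply: ler_sum => p _; have [H _ _ _] := HC p.1 j (cc p) (bb p) x.
    by rewrite -(bbE p); exact: H.
  rewrite sumr_const -[leLHS]mulr_natr -/b.
  have Cb : 0 <= C * b by rewrite mulr_ge0// ltW.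
  by rewrite [leRHS]mulrAC ler_wpM2l// lerDl.
Qed.

(** The function is [1 - \prod (1 - psi_c)]. Its derivatives are bounded by the sum of those of the
    single bumps, so the mass of its gradient is controlled by the number of cubes. *)
Lemma cubes_cutoff : exists2 C : R, 0 < C & forall (s : seq 'rV[R]_n) (r r' : R), r < r' ->
  exists phi : 'rV[R]_n -> R,
  [/\ smooth phi, forall x, 0 <= phi x <= 1,
      forall x c, c \in s -> cube c r x -> phi x = 1,
      forall x, (forall c, c \in s -> ~ ocube c r' x) -> phi x = 0 &
      forall j x, `|partial j phi x| <= \sum_(c <- s) C / (r' - r) * \1_(cube c r') x].
Proof.
have [C C0 HC] := cube_bump.
exists C => // s r r' rr'.
have /choice[psi psiP] := fun c => HC c r r' rr'.
pose G x := \prod_(c <- s) (1 - psi c x).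
have s1 c : smooth (fun x => 1 - psi c x).
  by apply: smoothB; [exact: smooth_cst|case: (psiP c)].
have psi01 c x : 0 <= 1 - psi c x <= 1.
  by have [_ /(_ x) h _ _ _] := psiP c; lra.
have P01 t x : 0 <= \prod_(p <- t) (1 - psi p x) <= 1.
  elim: t => [|p t IH]; first by rewrite big_nil ler01 lexx.
  rewrite big_cons; case/andP: IH => h1 h2; case/andP: (psi01 p x) => h3 h4.
  by rewrite mulr_ge0//= mulr_ile1.
have sG : smooth G by exact: smooth_prod.
have partial1B f j x : smooth f ->
    partial j (fun x => 1 - f x) x = - partial j f x.
  move=> sf; rewrite (smooth_partialB _ (smooth_cst 1) sf).
  by rewrite partial_cst/= sub0r.
exists (fun x => 1 - G x); split.
- by apply: smoothB; [exact: smooth_cst|exact: sG].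
- by move=> x; have := P01 s x; rewrite -/(G x); lra.
- move=> x c cs cx; rewrite /G (big_rem c)//=.
  by have [_ _ [/(_ x cx) -> _] _ _] := psiP c; rewrite subrr mul0r subr0.
- move=> x H; rewrite /G big1_seq ?subrr// => c /= cs.
  have [_ _ _ p0 _] := psiP c; rewrite (p0 x) ?subr0//.
  exact: (H c cs).
- move=> j x; rewrite partial1B// normrN.
  apply: (le_trans (@partial_prod_le _ _ _ _ (fun c x => 1 - psi c x) j x s1 _)) => //.
  apply: ler_sum => c _; rewrite partial1B ?normrN; last by case: (psiP c).
  have [sp _ _ p0 pC] := psiP c.
  have [xc|nxc] := pselect (cube c r' x).
    by rewrite indicE mem_set// mulr1.
  rewrite (partial_out _ (@cube_closed c r') _ nxc) ?normr0.
    by rewrite mulr_ge0// divr_ge0// ?ltW// subr_gt0.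
  by move=> y ny; apply: p0 => /ocube_sub.
Qed.

Lemma cutoff K U : compact K -> open U -> K `<=` U ->
  exists phi : 'rV[R]_n -> R,
  [/\ test_function U phi, forall x, 0 <= phi x <= 1 &
      exists V, [/\ open V, K `<=` V & forall x, V x -> phi x = 1]].
Proof.
move=> cK oU KU.
have [r r0 rU] := lebesgue_number cK oU KU.
have r20 : 0 < r / 2 by rewrite divr_gt0.
have [s sK Ks] := finite_cube_cover cK r20.
have [C _ /(_ s (r / 2) r)[|phi [sphi phi01 phi1 phi0 _]]] := cubes_cutoff.
  by rewrite ltr_pdivrMr// ltr_pMr// ltr1n.
exists phi; split => //.
- pose L := \bigcup_(c in [set` s]) cube c r.
  apply: (@test_functionI U L) => //.
  + rewrite /L; elim: (s) => [|c t IH]; first by rewrite set_nil bigcup_set0; exact: compact0.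
    rewrite (_ : \bigcup_(_ in _) _ = cube c r `|` \bigcup_(c in [set` t]) cube c r).
      by apply: compactU => //; exact: cube_compact.
    apply/seteqP; split=> [x [d /=]|x [cx|[d /= dt dx]]].
    - by rewrite inE => /orP[/eqP ->|dt] dx; [left|right; exists d].
    - by exists c => //=; rewrite inE eqxx.
    - by exists d => //=; rewrite inE dt orbT.
  + by move=> x [c /= cs]; apply: rU; exact: sK.
  + by move=> x nLx; apply: phi0 => c cs /ocube_sub cx; apply: nLx; exists c.
- exists (\bigcup_(c in [set` s]) ocube c (r / 2)); split.
  + by apply: bigcup_open => c _; exact: ocube_open.
  + by move=> x /Ks[c cs cx]; exists c.
  + by move=> x [c /= cs /ocube_sub]; exact: phi1.
Qed.

End cubes.

(** * Lebesgue measure on R^n *)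

Section measurable_rV.
Context {R : realType} {n : nat}.

Lemma open_rat_cubes (U : set 'rV[R]_n) : open U ->
  U = \bigcup_(q in [set q : 'rV[rat]_n * rat | ocube (map_mx ratr q.1) (ratr q.2) `<=` U])
    ocube (map_mx ratr q.1) (ratr q.2).
Proof.
move=> oU; apply/seteqP; split => [p Up|p [q Iq] /Iq //].
have [e e0 eU] := open_cube oU Up.
have [r] : exists r, ratr r \in `]0, (e / 2)[ by apply: rat_in_itvoo; rewrite divr_gt0.
rewrite in_itv/= => /andP[r0 re].
have /choice[q qP] : forall j, exists q : rat, `|ratr q - p 0 j| < ratr r.
  move=> j; have [q] : exists q, ratr q \in `](p 0 j - ratr r), (p 0 j + ratr r)[.
    by apply: rat_in_itvoo; rewrite ltrBlDr -addrA ltrDl addr_gt0.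
  by rewrite in_itv/= -ltr_distl; exists q.
exists (\row_j q j, r) => /=; last by move=> i; rewrite !mxE distrC.
move=> y yc; apply: eU => i; have := yc i; have := qP i; rewrite !mxE.
rewrite !ltr_norml ler_norml; lra.
Qed.

Lemma measurable_cube (c : 'rV[R]_n) r : measurable (cube c r).
Proof.
rewrite -[cube c r]setCK; apply: measurableC; apply: open_measurable_rV.
by apply: closed_openC; exact: cube_closed.
Qed.

Lemma measurable_ocube (c : 'rV[R]_n) r : measurable (ocube c r).
Proof. by apply: open_measurable_rV; exact: ocube_open. Qed.

Lemma closed_measurable_rV (K : set 'rV[R]_n) : closed K -> measurable K.
Proof.
move=> cK; rewrite -[K]setCK; apply: measurableC; apply: open_measurable_rV.
exact: closed_openC.
Qed.

Lemma compact_measurable_rV (K : set 'rV[R]_n) : compact K -> measurable K.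
Proof. by move=> cK; apply: closed_measurable_rV; exact: compact_closed_rV. Qed.

Lemma continuous_measurable_rV (f : 'rV[R]_n -> R) : continuous f -> measurable_fun setT f.
Proof.
move=> cf; apply: (measurability _ (RGenOpens.measurableE R)) => _ [_ [a [b ->]] <-].
rewrite setTI; apply: open_measurable_rV.
by apply: open_comp; [move=> ? _; exact: cf|exact: interval_open].
Qed.

Lemma measurable_coord (i : 'I_n) : measurable_fun setT (fun x : 'rV[R]_n => x 0 i).
Proof. by apply: continuous_measurable_rV => x; exact: coord_continuous. Qed.

Lemma measurable_fun_rV d (T : measurableType d) (f : T -> 'rV[R]_n) :
  (forall i, measurable_fun setT (fun x => f x 0 i)) -> measurable_fun setT f.
Proof.
move=> mf; apply: (measurability (@open 'rV[R]_n)) => // _ [U oU <-].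
rewrite setTI (open_rat_cubes oU) preimage_bigcup bigcup_mkcond.
apply: countable_bigcupT_measurable; first exact: countableP.
move=> q; case: ifP => // _.
rewrite (_ : _ @^-1` _ = \bigcap_(i in [set: 'I_n])
    ((fun x => f x 0 i) @^-1` ball (map_mx ratr q.1 0 i : R) (ratr q.2))).
  apply: fin_bigcap_measurable; first exact: finite_finset.
  move=> i _; rewrite -[X in measurable X]setTI.
  by apply: mf => //; exact: measurable_ball.
apply/seteqP; split=> [x H i _|x H i].
  by rewrite /= /ball/= distrC; exact: H.
by have := H i I; rewrite /= /ball/= distrC.
Qed.

Lemma measurable_translation (h : 'rV[R]_n) : measurable_fun setT (fun x : 'rV[R]_n => x + h).
Proof.
apply: measurable_fun_rV => i.
rewrite (_ : (fun _ => _) = (fun x : 'rV[R]_n => x 0 i) \+ cst (h 0 i)); last first.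
  by apply/funext => x; rewrite mxE.
by apply: measurable_funD => //; exact: measurable_coord.
Qed.

Lemma measurable_preimage_translation (h : 'rV[R]_n) A :
  measurable A -> measurable [set x | A (x + h)].
Proof.
by move=> mA; rewrite -[X in measurable X]setTI; exact: measurable_translation.
Qed.

End measurable_rV.

Lemma coord_norm_le {R : realType} {n} (x : 'rV[R]_n) i : `|x 0 i| <= `|x|.
Proof. by rewrite [leRHS]mx_normrE; exact: (le_bigmax _ (fun ij => `|x ij.1 ij.2|) (0, i)). Qed.

Lemma cons_rV0 {R : realType} {m} (t : R) (v : 'rV[R]_m) : cons_rV (t, v) 0 0 = t.
Proof. exact: (congr1 fst (cons_rVK (t, v))). Qed.

Lemma cons_rVr {R : realType} {m} (t : R) (v : 'rV[R]_m) i :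
  cons_rV (t, v) 0 (rshift 1 i) = v 0 i.
Proof. by rewrite /cons_rV (row_mxEr (const_mx t : 'rV_1)). Qed.

Lemma cons_rVP {m} (i : 'I_m.+1) : i = 0 \/ exists j : 'I_m, i = rshift 1 j.
Proof.
case: (split_ordP (i : 'I_(1 + m))) => k ->; [left|right; by exists k].
by rewrite (ord1 k); exact/val_inj.
Qed.

Lemma cons_rV_translation {R : realType} {m} (t : R) (v : 'rV[R]_m) (h : 'rV[R]_m.+1) :
  cons_rV (t, v) + h = cons_rV (t + h 0 0, v + rsubmx (h : 'rV_(1 + m))).
Proof.
apply/rowP => i; rewrite [LHS]mxE; case: (cons_rVP i) => [->|[j ->]].
  by rewrite !cons_rV0.
by rewrite !cons_rVr !mxE.
Qed.

Section lebesgue_rV_theory.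
Context {R : realType}.
Local Open Scope ereal_scope.

Lemma lebesgue_measure_translation (h : R) (A : set (measurableTypeR R)) :
  measurable A -> lebesgue_measure [set t | A (t + h)%R] = lebesgue_measure A.
Proof.
have mh : measurable_fun setT (fun t : measurableTypeR R => (t + h)%R : measurableTypeR R).
  by apply: (@measurable_funD _ _ R setT id (cst h)).
pose mu : {measure set (measurableTypeR R) -> \bar R} :=
  measure_function_pushforward__canonical__measure_function_Measure lebesgue_measure mh.
move=> mA; have := @lebesgue_measure_unique R mu _ _ mA.
rewrite /mu/= /pushforward => -> // X [[a b] _ <-].
rewrite (_ : _ @^-1` _ = `](a - h)%R, (b - h)%R]%classic); last first.
  by apply/seteqP; split => x /=; rewrite !in_itv/= ltrBlDr lerBrDr.
rewrite /= !lebesgue_measure_itv/= !lte_fin ltrD2r; case: ifPn => // _.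
by rewrite -!EFinB; congr EFin; ring.
Qed.

Lemma measurable_slice n (A : set 'rV[R]_n.+1) : measurable A ->
  measurable (cons_rV @^-1` A : set (measurableTypeR R * 'rV[R]_n)).
Proof.
by move=> mA; rewrite -[X in measurable X]setTI; exact: measurable_cons_rV.
Qed.

Lemma slice_xsection n (A : set 'rV[R]_n.+1) t :
  [set v | A (cons_rV (t, v))] = xsection (cons_rV @^-1` A) t.
Proof. by apply/seteqP; split => v /=; rewrite /xsection/= inE. Qed.

Lemma measurable_slice_measure n (A : set 'rV[R]_n.+1) : measurable A ->
  measurable_fun setT (fun t : measurableTypeR R =>
    lebesgue_rV [set v | A (cons_rV (t, v))]).
Proof.
move=> mA; under eq_fun do rewrite slice_xsection.
exact: (@measurable_fun_xsection _ _ _ _ _ lebesgue_rV _ (measurable_slice mA)).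
Qed.

Lemma lebesgue_rV_translation n (h : 'rV[R]_n) (A : set 'rV[R]_n) :
  measurable A -> lebesgue_rV [set x | A (x + h)%R] = lebesgue_rV A.
Proof.
elim: n h A => [|m IH] h A mA.
  congr lebesgue_rV; apply/seteqP; split => x /=;
    by rewrite (_ : (x + h)%R = x)//; apply/matrixP => i [].
have mh : measurable_fun setT (fun t : measurableTypeR R => (t + h 0 0)%R : measurableTypeR R).
  by apply: (@measurable_funD _ _ R setT id (cst (h 0%R 0%R))).
rewrite /lebesgue_rV -/lebesgue_rV.
pose G (t : measurableTypeR R) := lebesgue_rV [set v | A (cons_rV (t, v))].
transitivity (\int[lebesgue_measure]_t (G (t + h 0 0)%R)).
  apply: eq_integral => t _; rewrite /G -(IH (rsubmx (h : 'rV_(1 + m))) [set v | A (cons_rV ((t + h 0 0)%R, v))]); last first.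
    by rewrite slice_xsection; apply: measurable_xsection; exact: measurable_slice.
  congr lebesgue_rV; apply/seteqP; split => v /=; by rewrite cons_rV_translation.
have mG : measurable_fun setT G by exact: measurable_slice_measure.
have <- := @ge0_integral_pushforward _ _ _ _ R _ mh lebesgue_measure setT G measurableT mG (fun _ _ => measure_ge0 _ _).
apply: eq_measure_integral => X mX _ /=.
by rewrite /pushforward; exact: lebesgue_measure_translation.
Qed.

Lemma lebesgue_rV_cube n (c : 'rV[R]_n) (r : R) : (0 <= r)%R ->
  lebesgue_rV (cube c r) = ((2 * r) ^+ n)%:E.
Proof.
move=> r0; elim: n c => [|m IH] c.
  by rewrite /lebesgue_rV diracE expr0 mem_set// => -[].
rewrite /lebesgue_rV -/lebesgue_rV.
pose I : set (measurableTypeR R) := `[(c 0 0 - r)%R, (c 0 0 + r)%R]%classic.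
transitivity (\int[lebesgue_measure]_t (((2 * r) ^+ m)%:E * (\1_I t)%:E)).
  apply: eq_integral => t _; rewrite indicE.
  have [tI|tI] := boolP (t \in I); rewrite ?mule1 ?mule0.
    rewrite -(IH (rsubmx (c : 'rV_(1 + m)))); congr lebesgue_rV.
    move: tI; rewrite inE /I/= in_itv/= -ler_distl => tc.
    apply/seteqP; split => v /= H i.
      by have := H (rshift 1 i); rewrite cons_rVr mxE.
    case: (cons_rVP i) => [->|[k ->]]; first by rewrite cons_rV0.
    by rewrite cons_rVr; have := H k; rewrite mxE.
  rewrite (_ : mkset _ = set0) ?measure0//; apply/seteqP; split => // v /= /(_ (@ord0 m)).
  rewrite cons_rV0 => h.
  by move: tI; rewrite notin_setE; apply; rewrite /I/= in_itv/= -ler_distl.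
have mI : measurable I by exact: measurable_itv.
have r2 : 0%R <= ((2 * r) ^+ m)%:E by rewrite lee_fin exprn_ge0// mulr_ge0.
rewrite ge0_integralZl//; first last.
  by apply/measurable_EFinP; exact: measurable_indic.
have -> : \int[lebesgue_measure]_x (\1_I x)%:E = lebesgue_measure I.
  by rewrite integral_indic// setIT.
rewrite lebesgue_measure_itv/= lte_fin.
case: ifPn => h; first by rewrite -EFinB -EFinM; congr EFin; rewrite exprS; ring.
have -> : r = 0%R by apply/eqP; rewrite eq_le r0 andbT; lra.
by rewrite mule0 mulr0 exprS mul0r.
Qed.

Lemma lebesgue_rV_bounded n (A : set 'rV[R]_n) c r : measurable A ->
  A `<=` cube c r -> lebesgue_rV A < +oo.
Proof.
move=> mA Ac; have := lebesgue_rV_cube c (normr_ge0 r).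
have : cube c r `<=` cube c `|r| by apply: sub_cube; exact: ler_norm.
move=> cc E; apply: (@le_lt_trans _ _ (lebesgue_rV (cube c `|r|))); last by rewrite E ltry.
by apply: le_measure; rewrite ?inE//; [exact: measurable_cube|exact: subset_trans cc].
Qed.

Lemma lebesgue_rV_compact n (K : set 'rV[R]_n) : compact K -> lebesgue_rV K < +oo.
Proof.
move=> cK; have [M [_ HM]] := compact_bounded cK.
apply: (@lebesgue_rV_bounded _ _ 0%R (M + 1)%R); first exact: compact_measurable_rV.
move=> x Kx i; rewrite mxE subr0; apply: le_trans (HM (M + 1)%R _ x Kx).
  exact: coord_norm_le.
by rewrite ltrDl.
Qed.

(* The correlation identity behind the isoperimetric and Poincare inequalities. *)
Lemma measurable_correlation_graph n (A B : set 'rV[R]_n) : measurable A -> measurable B ->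
  measurable [set p : 'rV[R]_n * 'rV[R]_n | A p.2 /\ B (p.2 + p.1)%R].
Proof.
move=> mA mB; set E := [set p | _].
rewrite (_ : E = (snd @^-1` A) `&` ((fun p => (p.2 + p.1)%R) @^-1` B)); last by [].
apply: measurableI.
  by rewrite -[X in measurable X]setTI; exact: measurable_snd.
rewrite -[X in measurable X]setTI.
have : measurable_fun setT (fun p : 'rV[R]_n * 'rV[R]_n => (p.2 + p.1)%R).
  apply: measurable_fun_rV => i; under eq_fun do rewrite mxE.
  apply: measurable_funD.
    by apply: (measurableT_comp (measurable_coord i)); exact: measurable_snd.
  by apply: (measurableT_comp (measurable_coord i)); exact: measurable_fst.
exact.
Qed.

Lemma measurable_correlation n (A B : set 'rV[R]_n) : measurable A -> measurable B ->
  measurable_fun setT (fun h : 'rV[R]_n => lebesgue_rV (A `&` [set x | B (x + h)%R])).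
Proof.
move=> mA mB.
have := @measurable_fun_xsection _ _ _ _ R lebesgue_rV _ (measurable_correlation_graph mA mB).
congr (measurable_fun _ _); apply/funext => h /=; congr lebesgue_rV.
by apply/seteqP; split => x /=; rewrite /xsection/= inE.
Qed.

(** Tonelli on the set of pairs [(h, x)]: for fixed [x] the admissible [h] form a translate of
    [B]. *)
Lemma lebesgue_rV_correlation n (A B : set 'rV[R]_n) : measurable A -> measurable B ->
  \int[lebesgue_rV]_h lebesgue_rV (A `&` [set x | B (x + h)%R]) =
  lebesgue_rV A * lebesgue_rV B.
Proof.
move=> mA mB.
pose E : set ('rV[R]_n * 'rV[R]_n) := [set p | A p.2 /\ B (p.2 + p.1)%R].
have mE : measurable E by exact: measurable_correlation_graph.
transitivity (\int[lebesgue_rV]_h \int[lebesgue_rV]_x (\1_E (h, x))%:E).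
  apply: eq_integral => h _.
  rewrite (_ : (fun x => (\1_E (h, x))%:E) =
     fun x => (\1_(A `&` [set x | B (x + h)%R]) x)%:E).
    rewrite integral_indic ?setIT//.
    by apply: measurableI => //; exact: measurable_preimage_translation.
  by apply/funext => x; rewrite !indicE; congr (_%:E); congr (nat_of_bool _)%:R; apply/idP/idP; rewrite !inE.
rewrite (@fubini_tonelli _ _ _ _ _ lebesgue_rV lebesgue_rV (fun p => (\1_E p)%:E)); first last.
- by move=> p; rewrite lee_fin.
- by apply/measurable_EFinP; exact: measurable_indic.
transitivity (\int[lebesgue_rV]_x ((\1_A x)%:E * lebesgue_rV B)).
  apply: eq_integral => x _.
  transitivity (\int[lebesgue_rV]_h ((\1_A x)%:E * (\1_[set h | B (h + x)%R] h)%:E)).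
    apply: eq_integral => h _; rewrite -EFinM; congr EFin; rewrite !indicE -natrM mulnb.
    by congr (nat_of_bool _)%:R; apply/idP/andP; rewrite !inE /E/= addrC.
  rewrite ge0_integralZl//; last first.
    apply/measurable_EFinP; apply: measurable_indic; exact: measurable_preimage_translation.
  rewrite integral_indic ?setIT//; last exact: measurable_preimage_translation.
  by congr (_ * _); exact: lebesgue_rV_translation.
rewrite ge0_integralZr//; last first.
  by apply/measurable_EFinP; exact: measurable_indic.
by rewrite integral_indic ?setIT.
Qed.

End lebesgue_rV_theory.

(** * Finite measures and measures with a density *)

Section finite_copy.
Context d (T : measurableType d) (R : realType) (mu : {measure set T -> \bar R}).
Local Open Scope ereal_scope.

Lemma fin_num_measure_lty : mu setT < +oo -> fin_num_fun mu.
Proof.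
move=> h A mA; rewrite ge0_fin_numE//; apply: le_lt_trans h.
by apply: le_measure; rewrite ?inE.
Qed.

(** An alias of [mu] that carries the proof of finiteness, so that the structure of finite measure
    can be attached to it. *)
Definition finite_copy (h : mu setT < +oo) : set T -> \bar R := mu.

Hypothesis h : mu setT < +oo.

HB.instance Definition _ := Measure.copy (finite_copy h) mu.

HB.instance Definition _ :=
  Measure_isFinite.Build _ _ _ (finite_copy h) (fin_num_measure_lty h).

Lemma ex_finite_measure : exists la : {finite_measure set T -> \bar R},
  la = mu :> (set T -> \bar R).
Proof. by exists (finite_copy h). Qed.

End finite_copy.

Section finite_measures.
Context d (T : measurableType d) (R : realType).
Implicit Types (la : {finite_measure set T -> \bar R}).
Local Open Scope ereal_scope.

Lemma finite_measure_lty la A : measurable A -> la A < +oo.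
Proof. by move=> mA; rewrite -ge0_fin_numE// fin_num_measure. Qed.

Lemma ex_measure_add la la' : exists la2 : {finite_measure set T -> \bar R},
  forall A, la2 A = la A + la' A.
Proof.
have [|m mE] := @ex_finite_measure _ _ _ (measure_add la la').
  apply: (@le_lt_trans _ _ (la setT + la' setT)).
    by rewrite le_eqVlt; apply/orP; left; apply/eqP; exact: measure_addE.
  by rewrite lte_add_pinfty// finite_measure_lty.
by exists m => A; rewrite mE; exact: measure_addE.
Qed.

Lemma ex_measure_restr (mu : {measure set T -> \bar R}) D : measurable D -> mu D < +oo ->
  exists la2 : {finite_measure set T -> \bar R}, forall A, la2 A = mu (A `&` D).
Proof.
move=> mD fD; have [|m mE] := @ex_finite_measure _ _ _ (mrestr mu mD).
  by rewrite /= /mrestr setTI.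
by exists m => A; rewrite mE.
Qed.

Lemma bounded_integrable (mu : {measure set T -> \bar R}) (A : set T) (f : T -> R) (M : R) :
  measurable A -> mu A < +oo -> measurable_fun A f ->
  (forall x, A x -> (`|f x| <= M)%R) -> mu.-integrable A (EFin \o f).
Proof.
move=> mA fA mf fM; apply: measurable_bounded_integrable => //.
exists M; split; first exact: num_real.
by move=> N MN x Ax; apply: (le_trans (fM _ Ax)); exact: ltW.
Qed.

Lemma bounded_mul_integrable (mu : {measure set T -> \bar R}) (A : set T) (f g : T -> R) (M : R) :
  measurable A -> measurable_fun A f ->
  (forall x, A x -> (`|f x| <= M)%R) -> mu.-integrable A (EFin \o g) ->
  mu.-integrable A (EFin \o (f \* g)%R).
Proof.
move=> mA mf fM ig.
have mg : measurable_fun A g by apply/measurable_EFinP; exact: measurable_int ig.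
apply: (@le_integrable _ _ _ mu A mA _ (EFin \o (cst M \* g)%R)).
- by apply/measurable_EFinP; exact: measurable_funM.
- move=> x Ax; rewrite /= lee_fin !normrM ler_wpM2r//.
  by apply: (le_trans (fM _ Ax)); exact: ler_norm.
- rewrite (_ : EFin \o _ = (fun x => M%:E * (EFin \o g) x)); first exact: integrableZl.
  by apply/funext => x /=; rewrite EFinM.
Qed.

(** The measure is the charge induced by [h]. The integration formula holds because its
    Radon-Nikodym derivative and [h] have the same integral on every measurable set, hence agree
    almost everywhere. *)
Lemma ex_density_measure la (h : T -> R) : la.-integrable setT (EFin \o h) ->
  (forall x, (0 <= h x)%R) ->
  exists P : {finite_measure set T -> \bar R},
   (forall A, measurable A -> P A = \int[la]_(x in A) (h x)%:E) /\
   (forall A (f : T -> R) M, measurable A -> measurable_fun A f ->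
     (forall x, A x -> (`|f x| <= M)%R) ->
     (\int[P]_(x in A) f x = \int[la]_(x in A) (f x * h x))%R).
Proof.
move=> ih h0.
have ge0 A : 0 <= induced_charge ih A.
  by apply: integral_ge0 => x _; rewrite lee_fin.
pose P0 : {measure set T -> \bar R} := measure_of_charge _ ge0.
have [|P PE] := @ex_finite_measure _ _ _ P0.
  by rewrite -ge0_fin_numE//; exact: fin_num_measure.
have PA A : measurable A -> P A = \int[la]_(x in A) (h x)%:E by move=> mA; rewrite PE.
exists P; split => // A f M mA mf fM.
have dom : P `<< la.
  apply/null_content_dominatesP => B mB B0; rewrite PA//.
  apply: null_set_integral => //; apply: measurable_funTS; exact: measurable_int ih.
have if_ : P.-integrable A (EFin \o f).
  by apply: (bounded_integrable mA _ mf fM); exact: finite_measure_lty.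
rewrite /Rintegral -(Radon_Nikodym_change_of_variables dom mA if_); congr fine.
apply: ae_eq_integral => //.
- apply: emeasurable_funM; first exact/measurable_EFinP.
  by apply: measurable_funTS; apply: measurable_int; exact: Radon_Nikodym_integrable.
- apply/measurable_EFinP/measurable_funM => //.
  by apply: measurable_funTS; apply/measurable_EFinP; exact: measurable_int ih.
under [X in ae_eq _ _ _ X]eq_fun do rewrite EFinM.
apply: ae_eqe_mul2l; apply: integral_ae_eq => //.
- by apply: (integrableS measurableT) => //; exact: Radon_Nikodym_integrable.
- by apply: measurable_funTS; exact: measurable_int ih.
- by move=> E EA mE; rewrite -Radon_Nikodym_integral// -PA.
Qed.

End finite_measures.

(** * Regularity of finite Borel measures *)

Section regularity.
Context {R : realType} {n : nat}.
Local Open Scope ereal_scope.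
Local Notation rV := 'rV[R]_n.

Lemma finite_measure_continuity (la : {finite_measure set rV -> \bar R}) (F : (set rV)^nat) (e : R) :
  (forall k, measurable (F k)) -> nonincreasing_seq F -> \bigcap_k F k = set0 ->
  (0 < e)%R -> exists k, la (F k) < e%:E.
Proof.
move=> mF dF F0 e0.
have := @nonincreasing_cvg_mu _ _ _ la F (finite_measure_lty _ (mF 0%N)) mF.
rewrite F0 measure0 => /(_ measurable0 dF) cv.
have h : \forall k \near \oo, la (F k) < e%:E.
  apply: (cv [set x | x < e%:E]); apply: open_nbhs_nbhs; split; first exact: open_ereal_lt_ereal.
  by rewrite /= lte_fin.
by have [k _ /(_ k (leqnn _))] := h; exists k.
Qed.

(** The measurable sets with this approximation property form a sigma-algebra, and it contains the
    open sets. *)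
Lemma finite_measure_regular (la : {finite_measure set rV -> \bar R}) (A : set rV) :
  measurable A -> forall e : R, (0 < e)%R -> exists C V : set rV,
    [/\ closed C, open V, C `<=` A, A `<=` V & la (V `\` C) < e%:E].
Proof.
pose G := [set A : set rV | measurable A /\ forall e : R, (0 < e)%R -> exists C V : set rV,
    [/\ closed C, open V, C `<=` A, A `<=` V & la (V `\` C) < e%:E]].
suff : <<s @open rV >> `<=` G by move=> H /H[].
clear A.
apply: smallest_sub; last first.
  move=> U oU; split; first exact: open_measurable_rV.
  move=> e e0.
  (* An open set is exhausted by the closed sets of points at sup-distance at least [1/(k+1)] from
     its complement. *)
  pose C k : set rV := ~` \bigcup_(y in ~` U) ocube y k.+1%:R^-1.
  have cC k : closed (C k).
    by apply: open_closedC; apply: bigcup_open => y _; exact: ocube_open.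
  have CU k : C k `<=` U.
    move=> x Cx; apply: contrapT => nUx; apply: Cx; exists x => //.
    by apply: ocube_center; rewrite invr_gt0.
  have [k kP] : exists k, la (U `\` C k) < e%:E.
    apply: finite_measure_continuity => //.
    - move=> k; apply: measurableD; first exact: open_measurable_rV.
      exact: closed_measurable_rV.
    - apply/nonincreasing_seqP => k; apply/subsetPset => x [Ux nCx]; split => // Cx.
      apply: nCx => -[y Uy yx]; apply: Cx; exists y => // i.
      by apply: (lt_le_trans (yx i)); rewrite lef_pV2 ?posrE// ler_nat.
    - apply/seteqP; split => // x H; have [Ux _] := H 0%N I.
      have [r r0 rU] := open_cube oU Ux.
      have [k kr] : exists k, (k.+1%:R^-1 < r)%R.
        have := near_infty_natSinv_lt (PosNum r0) => -[k _ /(_ k (leqnn _))].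
        by exists k.
      have [_ []] := H k I => -[y nUy yx]; apply: nUy; apply: rU => i.
      by rewrite distrC; apply/ltW/(lt_trans (yx i)).
  by exists (C k), U; split.
split.
- split=> [|e e0]; first exact: measurable0.
  exists set0, set0; split; [exact: closed0|exact: open0|by []|by []|]; by rewrite setD0 measure0 lte_fin.
- move=> A [mA GA]; split; first exact: measurableD.
  move=> e e0; have [C [V [cC oO CA AO h]]] := GA e e0.
  exists (~` V), (~` C); split.
  + exact: open_closedC.
  + exact: closed_openC.
  + by move=> x nO; split => // /AO.
  + by move=> x [_ nA] /CA.
  + by rewrite (_ : ~` C `\` ~` V = V `\` C)//; rewrite !setDE setCK setIC.
- move=> A GA.
  have mA k : measurable (A k) by case: (GA k).
  split; first exact: bigcup_measurable.
  move=> e e0.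
  (* These errors add up to [e / 2]. The other half pays for replacing the countable union of the
     [C k] by a finite one, which is closed. *)
  have /choice[C /choice[V CO]] : forall k, exists C V : set rV,
      [/\ closed C, open V, C `<=` A k, A k `<=` V & la (V `\` C) < (e / 2 / (2 ^ k.+1)%:R)%:E].
    by move=> k; case: (GA k) => _; apply; rewrite !divr_gt0// ltr0n expn_gt0.
  pose D m := \bigcup_(k < m) C k.
  have cD m : closed (D m).
    by apply: closed_bigcup => [|k _]; [exact: finite_II|case: (CO k)].
  pose U := \bigcup_k V k.
  have oU : open U by apply: bigcup_open => k _; case: (CO k).
  pose E := \bigcup_k (V k `\` C k).
  have mOC k : measurable (V k `\` C k).
    case: (CO k) => h1 h2 _ _ _.
    by apply: measurableD; [exact: open_measurable_rV|exact: closed_measurable_rV].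
  have mE : measurable E by exact: bigcup_measurable.
  have laE : la E <= (e / 2)%:E.
    apply: (le_trans (@generalized_Boole_inequality _ _ _ la _ mOC mE)).
    apply: (@le_trans _ _ (\sum_(0 <= k <oo) (e / 2 / (2 ^ k.+1)%:R)%:E)).
      by apply: lee_nneseries => // k _; case: (CO k) => _ _ _ _ /ltW.
    have := @epsilon_trick0 R (e / 2) xpredT; apply.
    by rewrite divr_ge0// ltW.
  have [m mP] : exists m, la ((\bigcup_k C k) `\` D m) < (e / 2)%:E.
    apply: finite_measure_continuity.
    - move=> m; apply: measurableD; last exact: closed_measurable_rV.
      by apply: bigcup_measurable => k _; apply: closed_measurable_rV; case: (CO k).
    - apply/nonincreasing_seqP => k; apply/subsetPset => x [h1 h2]; split => // -[j /= jk Cj].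
      by apply: h2; exists j => //=; exact: ltnW.
    - apply/seteqP; split => // x H; have [[k _ Ck] _] := H 0%N I.
      by have [_ nD] := H k.+1 I; case: nD; exists k => /=.
    - by rewrite divr_gt0.
  exists (D m), U; split => //.
  + by move=> x [k _ Ck]; exists k => //; case: (CO k) => _ _ + _ _; exact.
  + by move=> x [k _ Ak]; exists k => //; case: (CO k) => _ _ _ + _; exact.
  + rewrite (splitr e) EFinD; apply: (@le_lt_trans _ _ (la (E `|` ((\bigcup_k C k) `\` D m)))).
      have mCD : measurable ((\bigcup_k C k) `\` D m).
        apply: measurableD; last exact: closed_measurable_rV.
        by apply: bigcup_measurable => k _; apply: closed_measurable_rV; case: (CO k).
      apply: le_measure; rewrite ?inE.
      * by apply: measurableD; [exact: open_measurable_rV|exact: closed_measurable_rV].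
      * exact: measurableU.
      move=> x [[k _ Ok] nD].
      have [Ck|nCk] := pselect (C k x); last by left; exists k.
      by right; split => //; exists k.
    have mCD : measurable ((\bigcup_k C k) `\` D m).
      apply: measurableD; last exact: closed_measurable_rV.
      by apply: bigcup_measurable => k _; apply: closed_measurable_rV; case: (CO k).
    apply: (le_lt_trans (measureU2 _ mE mCD)).
    by apply: lee_ltD => //; rewrite fin_num_measure.
Qed.

Lemma finite_measure_squeeze (la : {finite_measure set rV -> \bar R}) (A K U : set rV) (e : R) :
  measurable A -> A `<=` K -> compact K -> open U -> A `<=` U -> (0 < e)%R ->
  exists C V : set rV,
    [/\ compact C, open V, C `<=` A, A `<=` V /\ V `<=` U & la (V `\` C) < e%:E].
Proof.
move=> mA AK cK oU AU e0; have [C [V [cC oO CA AO h]]] := finite_measure_regular la mA e0.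
exists C, (V `&` U); split => //.
- by apply: subclosed_compact cK _ => //; exact: subset_trans AK.
- exact: openI.
- by split; [move=> x Ax; split; [exact: AO|exact: AU]|move=> x []].
- apply: le_lt_trans h; apply: le_measure; rewrite ?inE.
  + apply: measurableD; last exact: closed_measurable_rV.
    by apply: measurableI; exact: open_measurable_rV.
  + by apply: measurableD; [exact: open_measurable_rV|exact: closed_measurable_rV].
  + by move=> x [[]].
Qed.

End regularity.

(** * Vector measures and their densities *)

Section enorm.
Context {R : realType} {n : nat}.
Implicit Types x y : 'rV[R]_n.

Lemma enorm_ge0 x : 0 <= enorm x.
Proof. exact: sqrtr_ge0. Qed.

Lemma sqr_enorm x : enorm x ^+ 2 = \sum_i x 0 i ^+ 2.
Proof. by rewrite /enorm sqr_sqrtr// sumr_ge0// => i _; exact: sqr_ge0. Qed.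

Lemma enorm0 : enorm (0 : 'rV[R]_n) = 0.
Proof. by rewrite /enorm big1 ?sqrtr0// => i _; rewrite mxE expr0n. Qed.

Lemma enorm_eq0 x : enorm x = 0 -> x = 0.
Proof.
move=> x0; have := sqr_enorm x; rewrite x0 expr0n/= => /esym/eqP.
rewrite psumr_eq0; last by move=> i _; exact: sqr_ge0.
move=> /allP h; apply/rowP => i; rewrite mxE; apply/eqP.
by have := h i (mem_index_enum _); rewrite sqrf_eq0.
Qed.

Lemma coord_le_enorm x i : `|x 0 i| <= enorm x.
Proof.
rewrite -(@ler_pXn2r _ 2)// ?nnegrE ?enorm_ge0// sqr_enorm (bigD1 i)//=.
by rewrite real_normK ?num_real// lerDl sumr_ge0// => j _; exact: sqr_ge0.
Qed.

Lemma enormZ (a : R) x : enorm (a *: x) = `|a| * enorm x.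
Proof.
rewrite /enorm; under eq_bigr do rewrite mxE exprMn.
by rewrite -mulr_sumr sqrtrM ?sqr_ge0// sqrtr_sqr.
Qed.

Lemma enormN x : enorm (- x) = enorm x.
Proof. by rewrite -scaleN1r enormZ normrN1 mul1r. Qed.

Lemma cauchy_schwarz x y : \sum_i x 0 i * y 0 i <= enorm x * enorm y.
Proof.
have [x0|x0] := eqVneq (enorm x) 0.
  by rewrite x0 mul0r big1// => i _; rewrite (enorm_eq0 x0) mxE mul0r.
have [y0|y0] := eqVneq (enorm y) 0.
  by rewrite y0 mulr0 big1// => i _; rewrite (enorm_eq0 y0) mxE mulr0.
have a0 : 0 < enorm x by rewrite lt_neqAle eq_sym x0 enorm_ge0.
have b0 : 0 < enorm y by rewrite lt_neqAle eq_sym y0 enorm_ge0.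
set a := enorm x in a0 *; set b := enorm y in b0 *.
(* Young's inequality with weights [b / a] and [a / b], for which the summed right-hand side is
   exactly [a * b]. *)
have h i : x 0 i * y 0 i <= (b / a / 2) * x 0 i ^+ 2 + (a / b / 2) * y 0 i ^+ 2.
  rewrite -subr_ge0 (_ : _ - _ = (b * x 0 i - a * y 0 i) ^+ 2 / (2 * (a * b))).
    by rewrite divr_ge0 ?sqr_ge0// mulr_ge0// mulr_ge0// ltW.
  by field; rewrite !gt_eqF.
apply: (le_trans (ler_sum _ (fun i _ => h i))).
rewrite big_split/= -!mulr_sumr -!sqr_enorm -/a -/b le_eqVlt; apply/orP; left.
by apply/eqP; field; rewrite !gt_eqF.
Qed.

Lemma ler_enormD x y : enorm (x + y) <= enorm x + enorm y.
Proof.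
rewrite -(@ler_pXn2r _ 2)// ?nnegrE ?addr_ge0 ?enorm_ge0//.
rewrite sqr_enorm sqrrD !sqr_enorm -mulr_natl.
have -> : \sum_i (x + y) 0 i ^+ 2 =
    \sum_i x 0 i ^+ 2 + 2 * (\sum_i x 0 i * y 0 i) + \sum_i y 0 i ^+ 2.
  rewrite mulr_sumr -!big_split/=; apply: eq_bigr => i _.
  by rewrite mxE sqrrD -mulr_natl.
by rewrite lerD2r lerD2l ler_wpM2l// cauchy_schwarz.
Qed.

Lemma ler_enormB x y : enorm (x - y) <= enorm x + enorm y.
Proof. by rewrite -(enormN y) ler_enormD. Qed.

Lemma enorm_le_sum x : enorm x <= \sum_i `|x 0 i|.
Proof.
rewrite -(@ler_pXn2r _ 2)// ?nnegrE ?sumr_ge0 ?enorm_ge0// sqr_enorm.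
elim: (index_enum _) => [|i s IH]; first by rewrite !big_nil expr0n.
rewrite !big_cons sqrrD -(real_normK (num_real (x 0 i))).
have h : 0 <= \sum_(j <- s) `|x 0 j| by rewrite sumr_ge0.
have := mulr_ge0 (normr_ge0 (x 0 i)) h; lra.
Qed.

Lemma ler_enorm_sum (I : Type) (s : seq I) (F : I -> 'rV[R]_n) :
  enorm (\sum_(i <- s) F i) <= \sum_(i <- s) enorm (F i).
Proof.
elim: s => [|i s IH]; first by rewrite !big_nil enorm0.
by rewrite !big_cons; apply: (le_trans (ler_enormD _ _)); rewrite lerD2l.
Qed.

End enorm.

Section compactly_contained.
Context {R : realType} {n : nat}.
Implicit Types (U A B K : set 'rV[R]_n).

Lemma sub_compactly_contained A K U : compact K -> A `<=` K -> K `<=` U ->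
  compactly_contained A U.
Proof.
move=> cK AK KU.
have HK : closure A `<=` K.
  by rewrite [X in _ `<=` X](closure_id K).1; [exact: closure_subset|exact: compact_closed_rV].
split; last exact: subset_trans HK KU.
by apply: subclosed_compact HK => //; exact: closed_closure.
Qed.

Lemma compactly_containedE A U : compactly_contained A U ->
  exists K, [/\ compact K, A `<=` K & K `<=` U].
Proof. by move=> [cA AU]; exists (closure A); split => //; exact: subset_closure. Qed.

Lemma compactly_containedS A B U : compactly_contained B U -> A `<=` B ->
  compactly_contained A U.
Proof.
move=> /compactly_containedE[K [cK BK KU]] AB.
by apply: (sub_compactly_contained cK) => //; exact: subset_trans BK.
Qed.

Lemma interior_borelI U A B : interior_borel U A -> measurable B ->
  interior_borel U (A `&` B).
Proof.
move=> [mA cA] mB; split; first exact: measurableI.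
by apply: compactly_containedS cA _ => x [].
Qed.

Lemma interior_borel0 U : interior_borel U set0.
Proof.
split; first exact: measurable0.
by apply: (@sub_compactly_contained set0 set0 U); first exact: compact0.
Qed.

Lemma interior_borel_sub U A K : compact K -> K `<=` U -> measurable A -> A `<=` K ->
  interior_borel U A.
Proof. by move=> cK KU mA AK; split => //; exact: sub_compactly_contained KU. Qed.

End compactly_contained.

Section vector_measure_theory.
Context {R : realType} {n : nat}.
Variables (U : set 'rV[R]_n) (nu : set 'rV[R]_n -> 'rV[R]_n).
Hypothesis nuU : vector_measure U nu.

Lemma vm_cvg (A : (set 'rV[R]_n)^nat) (i : 'I_n) : (forall k, measurable (A k)) ->
  trivIset setT A -> compactly_contained (\bigcup_k A k) U ->
  (fun m => \sum_(k < m) nu (A k) 0 i) @ \oo --> nu (\bigcup_k A k) 0 i.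
Proof.
move=> mA tA cA; have h := nuU mA tA cA.
rewrite (_ : (fun m => _) = (fun M : 'rV[R]_n => M 0 i) \o (fun m => \sum_(k < m) nu (A k))).
  by apply: (cvg_comp _ _ h); exact: coord_continuous.
by apply/funext => m /=; rewrite summxE.
Qed.

Lemma vm0 : nu set0 = 0.
Proof.
apply/rowP => i; rewrite mxE.
have := @vm_cvg (fun=> set0) i (fun=> measurable0).
rewrite bigcup0// => /(_ _ (interior_borel0 U).2) h.
have {}h : (fun m => \sum_(k < m) nu set0 0 i) @ \oo --> nu set0 0 i.
  by apply: h; apply/trivIsetP => *; rewrite set0I.
have h2 : (fun m => \sum_(k < m.+1) nu set0 0 i) @ \oo --> nu set0 0 i.
  by move: h; rewrite -(@cvg_shiftS _ (fun m => \sum_(k < m) nu set0 0 i)).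
have h3 : (fun m => \sum_(k < m.+1) nu set0 0 i) @ \oo --> nu set0 0 i + nu set0 0 i.
  under eq_fun do rewrite big_ord_recr/=.
  by apply: cvgD => //; exact: cvg_cst.
have := @cvg_unique _ (@norm_hausdorff _ _) _ _ _ _ h2 h3.
move=> /(_ _)/eqP; rewrite -[X in X == _]addr0 (inj_eq (addrI _)) => h4.
by apply/esym/eqP; exact: h4.
Qed.

Section charge.
Variables (K : set 'rV[R]_n) (cK : compact K) (KU : K `<=` U) (i : 'I_n).
Local Open Scope ereal_scope.

(** [nu] is countably additive only on Borel sets compactly contained in [U]; cutting it off to [K]
    turns each component into a finite charge on all Borel sets. The two proofs are arguments so
    that the charge structure can be attached to the term. *)
Definition vm_comp (_ : compact K) (_ : K `<=` U) (A : set 'rV[R]_n) : \bar R :=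
  (nu (A `&` K) 0%R i)%:E.

Local Notation kappa := (vm_comp cK KU).

Let kappa0 : kappa set0 = 0.
Proof. by rewrite /vm_comp set0I vm0 mxE. Qed.

Let kappa_fin : fin_num_fun kappa.
Proof. by []. Qed.

Let kappa_sigma : semi_sigma_additive kappa.
Proof.
move=> F mF tF mUF; rewrite /vm_comp setI_bigcupl.
have h := @vm_cvg (fun k => F k `&` K) i.
under eq_fun do rewrite sumEFin big_mkord.
apply: cvg_EFin; first by near=> x.
have mK : measurable K by exact: compact_measurable_rV.
apply: h => //.
- by move=> k; exact: measurableI.
- by apply: trivIset_setIr.
- by apply: (sub_compactly_contained cK) => // x [k _ []].
Unshelve. all: by end_near.
Qed.

HB.instance Definition _ := isCharge.Build _ _ _ kappa kappa0 kappa_fin kappa_sigma.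

Lemma vm_charge : exists c : {charge set 'rV[R]_n -> \bar R},
  forall A, c A = (nu (A `&` K) 0%R i)%:E.
Proof. by exists kappa. Qed.

End charge.

Lemma vm_norm_le (A : (set 'rV[R]_n)^nat) : (forall k, measurable (A k)) ->
  trivIset setT A -> compactly_contained (\bigcup_k A k) U ->
  ((enorm (nu (\bigcup_k A k)))%:E <= \sum_(0 <= k <oo) (enorm (nu (A k)))%:E)%E.
Proof.
move=> mA tA cA; apply/lee_addgt0Pr => e e0.
(* Error allowed per coordinate: [n] of them stay below [e], and [n.+1] avoids a division by 0. *)
pose d := e / n.+1%:R.
have d0 : 0 < d by rewrite divr_gt0.
have h : \forall m \near \oo, forall i, `|nu (\bigcup_k A k) 0 i - \sum_(k < m) nu (A k) 0 i| <= d.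
  apply: filter_forall => i; have := @vm_cvg A i mA tA cA.
  by move/cvgrPdist_le => /(_ d d0).
have [m _ /(_ m (leqnn _)) mP] := h.
apply: (@le_trans _ _ ((\sum_(k < m) enorm (nu (A k)))%:E + e%:E)%E).
  rewrite -EFinD lee_fin -(subrK (\sum_(k < m) nu (A k)) (nu _)).
  rewrite addrC; apply: (le_trans (ler_enormD _ _)).
  rewrite lerD ?ler_enorm_sum//; apply: (le_trans (enorm_le_sum _)).
  apply: (@le_trans _ _ (\sum_(i < n) d)).
    by apply: ler_sum => i _; have := mP i; rewrite !mxE summxE.
  rewrite sumr_const card_ord -mulr_natr /d mulrAC ler_pdivrMr//.
  by rewrite ler_wpM2l ?ler_nat// ltW.
rewrite leeD2r// -sumEFin -(big_mkord xpredT (fun k => (enorm (nu (A k)))%:E)).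
by apply: nneseries_lim_ge => k _ _; rewrite lee_fin enorm_ge0.
Qed.

Local Open Scope ereal_scope.

Local Notation tv := (Defs.total_variation U nu).

Let tv_empty E : exists (m : nat) (A : (set 'rV[R]_n)^nat),
    [/\ forall k, interior_borel U (A k), trivIset setT A,
        forall k, A k `<=` E &
        0 = \sum_(k < m) (enorm (nu (A k)))%:E].
Proof.
exists 0%N, (fun=> set0); split.
- by move=> k; exact: interior_borel0.
- by apply/trivIsetP => *; rewrite set0I.
- by move=> _ x.
- by rewrite big_ord0.
Qed.

Let tv_ge0 E : 0 <= tv E.
Proof. by apply: ereal_sup_ubound; exact: tv_empty. Qed.

Let tv0 : tv set0 = 0.
Proof.
apply/eqP; rewrite eq_le tv_ge0 andbT.
apply: ge_ereal_sup => _ [m [A [_ _ A0 ->]]].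
rewrite big1// => k _.
have -> : A k = set0 by apply/seteqP; split => // x /A0.
by rewrite vm0 enorm0.
Qed.

Lemma total_variationS E F : E `<=` F -> tv E <= tv F.
Proof.
move=> EF; apply: ereal_sup_le => _ [m [A [iA tA AE ->]]].
by exists m, A; split => // k; exact: subset_trans (AE k) EF.
Qed.

Let tv_super E F : E `&` F = set0 -> tv E + tv F <= tv (E `|` F).
Proof.
move=> EF0.
have h m1 (A1 : (set 'rV[R]_n)^nat) m2 (A2 : (set 'rV[R]_n)^nat) : (forall k, interior_borel U (A1 k)) -> trivIset setT A1 ->
    (forall k, A1 k `<=` E) -> (forall k, interior_borel U (A2 k)) -> trivIset setT A2 ->
    (forall k, A2 k `<=` F) ->
    \sum_(k < m1) (enorm (nu (A1 k)))%:E + \sum_(k < m2) (enorm (nu (A2 k)))%:E <= tv (E `|` F).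
  move=> iA1 tA1 A1E iA2 tA2 A2F.
  (* Superadditivity: a family inside [E] and a family inside [F] are concatenated. *)
  pose A k := if (k < m1)%N then A1 k else A2 (k - m1)%N.
  apply: ereal_sup_ubound; exists (m1 + m2)%N, A; split.
  - by move=> k; rewrite /A; case: ifP.
  - apply/trivIsetP => i j _ _ ij; rewrite /A.
    case: ifPn => im; case: ifPn => jm.
    + by move/trivIsetP : tA1; exact.
    + apply/seteqP; split => // x [/A1E Ex /A2F Fx].
      by rewrite -EF0.
    + apply/seteqP; split => // x [/A2F Fx /A1E Ex].
      by rewrite -EF0.
    + move/trivIsetP : tA2; apply => //.
      by apply: contra ij => /eqP ij; apply/eqP; lia.
  - by move=> k; rewrite /A; case: ifP => _ x; [move/A1E; left|move/A2F; right].
  - rewrite big_split_ord/=; congr (_ + _); apply: eq_bigr => i _; rewrite /A /=.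
      by rewrite ltn_ord.
    by rewrite ltnNge leq_addr/= addKn.
have [->|Xoo] := eqVneq (tv (E `|` F)) +oo; first exact: leey.
have Xfin : tv (E `|` F) \is a fin_num by rewrite ge0_fin_numE// ltey.
have Efin : tv E \is a fin_num.
  rewrite ge0_fin_numE//; apply: (@le_lt_trans _ _ (tv (E `|` F))); last by rewrite ltey.
  exact: total_variationS.
rewrite -leeBrDl//; apply: ge_ereal_sup => _ [m2 [A2 [iA2 tA2 A2F ->]]].
rewrite leeBrDl// addeC -leeBrDl; last by rewrite sumEFin.
apply: ge_ereal_sup => _ [m1 [A1 [iA1 tA1 A1E ->]]].
by rewrite leeBrDl ?sumEFin// -!sumEFin addeC; exact: h.
Qed.

(** Each piece of a competing family is cut by the sets [F j]; by [vm_norm_le] this refinement does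
    not decrease the sum of the norms. *)
Let tv_sub (F : (set 'rV[R]_n)^nat) : (forall k, measurable (F k)) -> trivIset setT F ->
  tv (\bigcup_k F k) <= \sum_(0 <= k <oo) tv (F k).
Proof.
move=> mF tF; apply: ge_ereal_sup => _ [m [A [iA tA AF ->]]].
apply: (@le_trans _ _ (\sum_(k < m) \sum_(0 <= j <oo) (enorm (nu (A k `&` F j)))%:E)).
  apply: lee_sum => k _.
  have E : \bigcup_j (A k `&` F j) = A k by rewrite -setI_bigcupr; apply/setIidPl; exact: AF.
  have := @vm_norm_le (fun j => A k `&` F j); rewrite E; apply.
  - by move=> j; case: (interior_borelI (iA k) (mF j)).
  - exact: trivIset_setIl.
  - by case: (iA k).
rewrite -nneseries_sum; last by move=> i j _; rewrite lee_fin enorm_ge0.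
apply: lee_nneseries => j _; first by rewrite sume_ge0// => k _; rewrite lee_fin enorm_ge0.
apply: ereal_sup_ubound; exists m, (fun k => A k `&` F j); split => //.
- by move=> k; exact: interior_borelI.
- exact: trivIset_setIr.
Qed.

Let tv_sigma : semi_sigma_additive tv.
Proof.
move=> F mF tF mUF.
have -> : tv (\bigcup_k F k) = \sum_(0 <= k <oo) tv (F k).
  apply/eqP; rewrite eq_le tv_sub//=.
  apply: lime_le; first by apply: is_cvg_nneseries => *.
  apply: nearW => m.
  apply: (@le_trans _ _ (tv (\bigcup_(k < m) F k))); last first.
    by apply: total_variationS => x [k _ Fk]; exists k.
  elim: m => [|m IH]; first by rewrite big_geq// bigcup_mkord big_ord0 tv0.
  rewrite big_nat_recr//= bigcup_mkord big_ord_recr/= -bigcup_mkord.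
  apply: (le_trans (leeD2r _ IH)); apply: tv_super.
  apply/seteqP; split => // x [[i /= im Fi] Fm].
  have E : i = m by apply: tF => //; exists x.
  by move: im; rewrite E ltnn.
by apply: is_cvg_nneseries => *.
Qed.

HB.instance Definition _ := isMeasure.Build _ _ _ tv tv0 tv_ge0 tv_sigma.

(** The measure structure depends on the proof that [nu] is a vector measure, so it is exported as
    an equality with some measure, ready for rewriting. *)
Lemma ex_total_variation : exists mu : {measure set 'rV[R]_n -> \bar R}, tv = mu.
Proof. by exists tv. Qed.

End vector_measure_theory.

(** * Densities with respect to a common finite measure *)

Section densities.
Context {R : realType} {n : nat}.
Local Notation rV := 'rV[R]_n.
Implicit Types (la : {finite_measure set rV -> \bar R}) (K U : set rV) (g : rV -> R).

(** The density represents [kappa] on the Borel subsets of [K] only, as gradients carry no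
    information elsewhere. With the same [la] for several gradients, their densities can be compared
    pointwise. *)
Definition has_density la K g (kappa : set rV -> R) :=
  la.-integrable setT (EFin \o g) /\
  forall A, measurable A -> A `<=` K -> kappa A = \int[la]_(x in A) g x.

Lemma common_dominating (J : finType) (c : J -> {charge set rV -> \bar R}) :
  exists la, forall j, c j `<< la.
Proof.
suff [la laP] : exists la, forall j, j \in enum J -> c j `<< la.
  by exists la => j; apply: laP; rewrite mem_enum.
elim: (enum J) => [|j s [la IH]].
  have [|la _] := @ex_finite_measure _ _ R (@mzero _ rV R); first exact: ltry.
  by exists la.
have [P [N PN]] := Hahn_decomposition (c j).
have [la1 la1E] := ex_measure_add (jordan_pos PN) (jordan_neg PN).
have [la2 la2E] := ex_measure_add la la1.
exists la2 => i; rewrite inE => /orP[/eqP ->|/IH ci]; apply/null_content_dominatesP => A mA.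
  move=> h; have /eqP := etrans (esym (la2E A)) h; rewrite padde_eq0// => /andP[_ /eqP A0].
  apply/eqP; rewrite -abse_eq0 eq_le abse_ge0 andbT -A0 la1E.
  exact: (abse_charge_variation PN mA).
move=> h; have /eqP := etrans (esym (la2E A)) h; rewrite padde_eq0// => /andP[/eqP A0 _].
by move/null_content_dominatesP : ci => /(_ A mA A0).
Qed.

(* Radon-Nikodym with respect to the sum of the variations of all the components. *)
Lemma vm_density (J : finType) U K (nu : J -> set rV -> rV) :
  (forall j, vector_measure U (nu j)) -> compact K -> K `<=` U ->
  exists la (g : J -> 'I_n -> rV -> R),
    forall j i, has_density la K (g j i) (fun A => nu j A 0 i).
Proof.
move=> nuU cK KU.
have /choice[c cP] : forall p : J * 'I_n, exists c : {charge set rV -> \bar R},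
    forall A, c A = (nu p.1 (A `&` K) 0 p.2)%:E.
  by move=> p; exact: vm_charge.
have [la laP] := common_dominating c.
exists la, (fun j i x => fine ((Radon_Nikodym (c (j, i)) la x))) => j i.
have h := laP (j, i).
have E : EFin \o (fun x => fine ((Radon_Nikodym (c (j, i)) la x))) = Radon_Nikodym (c (j, i)) la.
  by apply/funext => x /=; rewrite fineK// Radon_Nikodym_fin_num.
split; first by rewrite E; exact: Radon_Nikodym_integrable.
move=> A mA AK.
have := Radon_Nikodym_integral h mA; rewrite cP (setIidl AK)/= /Rintegral => H.
rewrite -[LHS]/(fine (nu j A 0 i)%:E) H; congr fine.
by apply: eq_integral => x _; rewrite /= fineK// Radon_Nikodym_fin_num.
Qed.

Definition vnorm (g : 'I_n -> rV -> R) (x : rV) : R := enorm (\row_i g i x).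

Lemma measurable_vnorm (g : 'I_n -> rV -> R) :
  (forall i, measurable_fun setT (g i)) -> measurable_fun setT (vnorm g).
Proof.
move=> mg; rewrite /vnorm /enorm.
have -> : (fun x => Num.sqrt (\sum_i (\row_i0 g i0 x) 0 i ^+ 2)) =
    Num.sqrt \o (fun x => \sum_(i <- index_enum 'I_n) g i x ^+ 2).
  by apply/funext => x /=; congr Num.sqrt; apply: eq_bigr => i _; rewrite mxE.
apply: measurableT_comp.
  by apply: continuous_measurable_fun; exact: sqrt_continuous.
by apply: measurable_sum => i; exact: measurable_funX.
Qed.

Lemma integrable_vnorm la (g : 'I_n -> rV -> R) :
  (forall i, la.-integrable setT (EFin \o g i)) -> la.-integrable setT (EFin \o vnorm g).
Proof.
move=> ig; apply: (@le_integrable _ _ _ la setT measurableT _ (fun x => (\sum_i `|g i x|)%:E)).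
- apply/measurable_EFinP; apply: measurable_vnorm => i.
  by apply/measurable_EFinP; exact: measurable_int (ig i).
- move=> x _; rewrite /= lee_fin ger0_norm ?enorm_ge0// ger0_norm ?sumr_ge0//.
  apply: (le_trans (enorm_le_sum _)); rewrite le_eqVlt; apply/orP; left; apply/eqP.
  by apply: eq_bigr => i _; rewrite mxE.
- under eq_fun do rewrite -sumEFin.
  apply: integrable_sum => // i _; exact: integrable_norm (ig i).
Qed.

Lemma Rintegral_sum d (T : measurableType d) (mu : {measure set T -> \bar R}) (I : Type)
    (s : seq I) (F : I -> T -> R) (D : set T) :
  measurable D -> (forall i, mu.-integrable D (EFin \o F i)) ->
  \int[mu]_(x in D) (\sum_(i <- s) F i x) = \sum_(i <- s) \int[mu]_(x in D) F i x.
Proof.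
move=> mD iF.
have iS t : mu.-integrable D (EFin \o (fun x => \sum_(i <- t) F i x)).
  rewrite (_ : EFin \o _ = (fun x => \sum_(i <- t) (EFin \o F i) x)%E).
    by apply: integrable_sum => // i _; exact: iF.
  by apply/funext => x /=; rewrite sumEFin.
elim: s => [|i s IH].
  rewrite big_nil; under eq_Rintegral do rewrite big_nil.
  by rewrite Rintegral_cst// mul0r.
under eq_Rintegral do rewrite big_cons.
by rewrite RintegralD// IH big_cons.
Qed.

End densities.
Import HBNNSimple.

Section variation_densities.
Context {R : realType} {n : nat}.
Local Notation rV := 'rV[R]_n.
Implicit Types (la : {finite_measure set rV -> \bar R}) (K U : set rV) (g : rV -> R).

Lemma integrable_sub la A g : measurable A -> la.-integrable setT (EFin \o g) ->
  la.-integrable A (EFin \o g).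
Proof. by move=> mA; exact: integrableS. Qed.

Lemma EFin_Rintegral (mu : {measure set rV -> \bar R}) A g : measurable A ->
  mu.-integrable A (EFin \o g) ->
  (\int[mu]_(x in A) g x)%:E = (\int[mu]_(x in A) (g x)%:E)%E.
Proof. by move=> mA ig; rewrite /Rintegral fineK//; exact: integrable_fin_num. Qed.

(** Applies to arbitrary set functions, as needed for [pos_variation] and [neg_variation]: the
    integral is a supremum over simple functions below [f], whose nonzero level sets all lie in
    [K]. *)
Lemma integral_measure_congr (m1 m2 : set rV -> \bar R) (D K : set rV) (f : rV -> \bar R) :
  (forall A, measurable A -> A `<=` K -> m1 A = m2 A) ->
  (forall x, ~ K x -> f x = 0%E) ->
  (\int[m1]_(x in D) f x = \int[m2]_(x in D) f x)%E.
Proof.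
have H (p1 p2 : set rV -> \bar R) (h : rV -> \bar R) :
    (forall A, measurable A -> A `<=` K -> p1 A = p2 A) ->
    (forall x, ~ K x -> h x = 0%E) ->
    [set sintegral p1 k | k in [set k : {nnsfun rV >-> R} | forall x, ((k x)%:E <= h x)%E]] `<=`
    [set sintegral p2 k | k in [set k : {nnsfun rV >-> R} | forall x, ((k x)%:E <= h x)%E]].
  move=> p12 h0 _ [k /= kh <-]; exists k => //; apply: eq_fsbigr => r _.
  have [->|r0] := eqVneq r 0; first by rewrite !mul0e.
  congr (_ * _)%E; apply/esym/p12; first exact: measurable_funPTI.
  move=> x /= kxr; apply: contrapT => nKx; have := kh x.
  rewrite h0// lee_fin kxr => r_le0; move/eqP : r0; apply.
  by apply/eqP; rewrite eq_le r_le0 -kxr fun_ge0.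
move=> m12 f0; rewrite /integral.
have p0 x : ~ K x -> ((f \_ D)^\+ x = 0)%E.
  by move=> /f0 fx; rewrite unlock /patch; case: ifP => _; rewrite ?fx maxxx.
have n0 x : ~ K x -> ((f \_ D)^\- x = 0)%E.
  by move=> /f0 fx; rewrite unlock /patch; case: ifP => _; rewrite ?fx oppe0 maxxx.
congr (ereal_sup _ - ereal_sup _)%E; rewrite eqEsubset; split; apply: H => // A mA AK;
  by rewrite m12.
Qed.

(** The supremum is attained on the part of [E] where [g] is nonnegative. Applied to [g] and to
    [- g], it identifies both parts of the Jordan decomposition. *)
Lemma sup_variation_density U K la g (kappa : set rV -> R) E :
  compact K -> K `<=` U -> has_density la K g kappa -> measurable E -> E `<=` K ->
  ereal_sup [set (kappa A)%:E | A in [set A | interior_borel U A /\ A `<=` E]] =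
  (\int[la]_(x in E) (Num.max (g x) 0)%:E)%E.
Proof.
move=> cK KU [ig gE] mE EK.
have mg : measurable_fun setT g by apply/measurable_EFinP; exact: measurable_int ig.
have mm : measurable_fun setT (fun x => Num.max (g x) 0) by apply: measurable_maxr.
have m0 x : (0 <= (Num.max (g x) 0)%:E)%E by rewrite lee_fin le_max lexx orbT.
apply/eqP; rewrite eq_le; apply/andP; split.
  apply: ge_ereal_sup => _ [A [[mA _] AE] <-].
  have AK := subset_trans AE EK.
  rewrite gE// EFin_Rintegral//; last exact: integrable_sub.
  apply: (@le_trans _ _ (\int[la]_(x in A) (Num.max (g x) 0)%:E)%E).
    apply: le_integral => //; first exact: integrable_sub.
      apply: (@le_integrable _ _ _ la A mA _ (EFin \o g)); last exact: integrable_sub.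
        by apply/measurable_EFinP; exact: measurable_funTS.
      move=> x _; rewrite /= lee_fin ger0_norm ?le_max ?lexx ?orbT//.
      by rewrite ge_max ler_norm normr_ge0.
    by move=> x _; rewrite lee_fin le_max lexx.
  apply: ge0_subset_integral => //.
  by apply/measurable_EFinP; exact: measurable_funTS.
pose A := E `&` [set x | 0 <= g x].
have mA : measurable A.
  apply: measurableI => //; rewrite -[X in measurable X]setTI.
  rewrite (_ : [set x | 0 <= g x] = g @^-1` `[0, +oo[%classic); last first.
    by apply/seteqP; split => x /=; rewrite in_itv/= andbT.
  by apply: mg => //; exact: measurable_itv.
apply: ereal_sup_ubound; exists A.
  split; last by move=> x [].
  apply: (interior_borel_sub cK KU mA); by move=> x [/EK].
rewrite gE//; last by move=> x [/EK].
rewrite EFin_Rintegral//; last exact: integrable_sub.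
rewrite integral_mkcondr; apply: eq_integral => x _; rewrite /patch.
case: ifPn; rewrite ?inE ?notin_setE /= => gx; congr (_%:E).
  by apply/esym/max_idPl.
by apply/esym/max_idPr; apply: ltW; rewrite ltNge; exact/negP.
Qed.

Lemma has_densityN la K g kappa : has_density la K g kappa ->
  has_density la K (fun x => - g x) (fun A => - kappa A).
Proof.
move=> [ig gE]; split.
  rewrite (_ : EFin \o _ = (-%E \o (EFin \o g))); first exact: integrableN.
  by apply/funext => x.
move=> A mA AK; rewrite gE// -mulN1r -RintegralZl//; last exact: integrable_sub.
by apply: eq_Rintegral => x _; rewrite mulN1r.
Qed.

Lemma vintegral_density U K la g (nu : set rV -> rV) (i : 'I_n) (f : rV -> R) (M : R) :
  compact K -> K `<=` U -> has_density la K g (fun A => nu A 0 i) ->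
  measurable_fun setT f -> (forall x, `|f x| <= M) -> (forall x, ~ K x -> f x = 0) ->
  vintegral U nu i f = (\int[la]_(x in K) (f x * g x))%:E.
Proof.
move=> cK KU dg mf fM f0.
have mK := compact_measurable_rV cK.
have main (g' : rV -> R) kappa : has_density la K g' kappa ->
  (\int[fun E => ereal_sup [set (kappa A)%:E | A in [set A | interior_borel U A /\ A `<=` E]]]_(x in U)
     (f x)%:E)%E = (\int[la]_(x in K) (f x * Num.max (g' x) 0))%:E.
  move=> dg'; have [ig _] := dg'.
  have mg : measurable_fun setT g' by apply/measurable_EFinP; exact: measurable_int ig.
  have ih : la.-integrable setT (EFin \o (fun x => Num.max (g' x) 0)).
    apply: (@le_integrable _ _ _ la setT measurableT _ (EFin \o g')) => //.
      by apply/measurable_EFinP; exact: measurable_maxr.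
    move=> x _; rewrite /= lee_fin ger0_norm ?le_max ?lexx ?orbT//.
    by rewrite ge_max ler_norm normr_ge0.
  have h0 x : 0 <= Num.max (g' x) 0 by rewrite le_max lexx orbT.
  have [P [PE Pf]] := ex_density_measure ih h0.
  rewrite (@integral_measure_congr _ P U K); first last.
  - by move=> x /f0 ->.
  - by move=> A mA AK; rewrite (sup_variation_density cK KU dg' mA AK) PE.
  rewrite integral_mkcond (_ : _ \_ U = (EFin \o f) \_ K); last first.
    apply/funext => x; rewrite /patch/=.
    have [xK|xK] := boolP (x \in K).
      by rewrite mem_set//; apply: KU; rewrite inE in xK.
    by rewrite f0; [case: ifP|rewrite notin_setE in xK].
  rewrite -integral_mkcond -EFin_Rintegral//; last first.
    apply: (bounded_integrable mK _ _ (fun x _ => fM x)).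
      exact: finite_measure_lty.
    exact: measurable_funTS.
  by rewrite (Pf _ _ M)//; exact: measurable_funTS.
rewrite /vintegral (main g)// (main (fun x => - g x)); last exact: has_densityN.
have [ig _] := dg.
have mg : measurable_fun setT g by apply/measurable_EFinP; exact: measurable_int ig.
have imax (g' : rV -> R) : la.-integrable setT (EFin \o g') -> la.-integrable K (EFin \o (fun x => f x * Num.max (g' x) 0)).
  move=> ig'.
  apply: (bounded_mul_integrable mK (measurable_funTS mf) (fun x _ => fM x)).
  apply: (@le_integrable _ _ _ la K mK _ (EFin \o g')) => //; last exact: integrable_sub.
    apply/measurable_EFinP/measurable_maxr => //.
    by apply: measurable_funTS; apply/measurable_EFinP; exact: measurable_int ig'.
  move=> x _; rewrite /= lee_fin ger0_norm ?le_max ?lexx ?orbT//.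
  by rewrite ge_max ler_norm normr_ge0.
rewrite -EFinB -RintegralB//; last 2 first.
- exact: imax.
- by apply: imax; case: (has_densityN dg).
congr EFin; apply: eq_Rintegral => x _; rewrite -mulrBr; congr (_ * _).
case: (leP (g x) 0) => gx.
  by rewrite max_l ?oppr_ge0// opprK add0r.
by rewrite max_r ?oppr_le0 ?ltW// subr0.
Qed.

Lemma norm_Rintegral_le la A (g : 'I_n -> rV -> R) : measurable A ->
  (forall i, la.-integrable setT (EFin \o g i)) ->
  enorm (\row_i \int[la]_(x in A) g i x) <= \int[la]_(x in A) vnorm g x.
Proof.
move=> mA ig; set v := \row_i _.
have [v0|v0] := eqVneq (enorm v) 0.
  by rewrite v0; apply: Rintegral_ge0 => x _; exact: enorm_ge0.
have N0 : 0 < enorm v by rewrite lt_neqAle eq_sym v0 enorm_ge0.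
(* With [v] the integral of [g]: [|v|^2] is the integral of [v . g], which is at most [|v|] times
   that of [|g|]. *)
rewrite -(ler_pM2l N0) -expr2 sqr_enorm -RintegralZl//; last first.
  by apply: integrable_sub => //; exact: integrable_vnorm.
have -> : \sum_i v 0 i ^+ 2 = \int[la]_(x in A) (\sum_(i <- index_enum 'I_n) v 0 i * g i x).
  rewrite Rintegral_sum//.
    apply: eq_bigr => i _; rewrite RintegralZl//; last exact: integrable_sub.
    by rewrite expr2 {2}/v mxE.
  move=> i; rewrite (_ : EFin \o _ = (fun x => (v 0 i)%:E * (EFin \o g i) x)%E).
    by apply: integrableZl => //; exact: integrable_sub.
  by apply/funext => x /=; rewrite EFinM.
apply: le_Rintegral => //.
- rewrite (_ : EFin \o _ = (fun x => \sum_(i <- index_enum 'I_n) (v 0 i)%:E * (EFin \o g i) x)%E).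
    apply: integrable_sum => // i _; apply: integrableZl => //; exact: integrable_sub.
  by apply/funext => x /=; rewrite -sumEFin; apply: eq_bigr => i _; rewrite EFinM.
- rewrite (_ : EFin \o _ = (fun x => (enorm v)%:E * (EFin \o vnorm g) x)%E).
    apply: integrableZl => //; apply: integrable_sub => //; exact: integrable_vnorm.
  by apply/funext => x /=; rewrite EFinM.
- move=> x _; have := cauchy_schwarz v (\row_i g i x); rewrite -/(vnorm g x).
  by under eq_bigr do rewrite [(\row_i0 _) 0 _]mxE.
Qed.

(** Countably many normalized directions almost attain the norm of every vector. If the rational
    vector is 0 the pairing is 0, which is enough because [x] itself is then short. *)
Lemma rat_direction (x : rV) (e : R) : 0 < e -> exists q : 'rV[rat]_n,
  let v := map_mx ratr q in
  enorm x - e <= \sum_i ((enorm v)^-1 *: v) 0 i * x 0 i.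
Proof.
move=> e0; pose d := e / 2 / n.+1%:R.
have d0 : 0 < d by rewrite !divr_gt0.
have /choice[q qP] : forall j, exists q : rat, `|ratr q - x 0 j| < d.
  move=> j; have [q] : exists q, ratr q \in `](x 0 j - d), (x 0 j + d)[.
    by apply: rat_in_itvoo; rewrite ltrBlDr -addrA ltrDl addr_gt0.
  by rewrite in_itv/= -ltr_distl; exists q.
exists (\row_j q j); set v := map_mx _ _ => /=.
have xv : enorm (x - v) <= e / 2.
  apply: (le_trans (enorm_le_sum _)); apply: (@le_trans _ _ (\sum_(i < n) d)).
    by apply: ler_sum => i _; rewrite !mxE distrC ltW.
  rewrite sumr_const card_ord -[leLHS]mulr_natr /d mulrAC ler_pdivrMr//.
  by rewrite ler_wpM2l ?ler_nat// divr_ge0// ltW.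
have xv2 : enorm x <= enorm v + e / 2.
  rewrite -(subrK v x) addrC; apply: (le_trans (ler_enormD _ _)).
  by rewrite lerD2l.
have [v0|v0] := eqVneq (enorm v) 0.
  rewrite v0 invr0 scale0r big1; first by move: xv2; rewrite v0; lra.
  by move=> i _; rewrite mxE mul0r.
have N0 : 0 < enorm v by rewrite lt_neqAle eq_sym v0 enorm_ge0.
have -> : \sum_i ((enorm v)^-1 *: v) 0 i * x 0 i =
    enorm v - (enorm v)^-1 * \sum_i v 0 i * (v - x) 0 i.
  rewrite -[X in X - _](@mulKf _ (enorm v))// -expr2 sqr_enorm -mulrBr.
  rewrite -sumrB mulr_sumr; apply: eq_bigr => i _; rewrite !mxE; ring.
have : (enorm v)^-1 * \sum_i v 0 i * (v - x) 0 i <= e / 2.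
  rewrite ler_pdivrMl//; apply: (le_trans (cauchy_schwarz _ _)).
  by rewrite ler_wpM2l ?enorm_ge0// -enormN opprB.
lra.
Qed.

(** The upper bound is the triangle inequality for integrals. For the lower bound, [E] is split into
    countably many pieces, on each of which a single direction of norm at most 1 realizes [|g|] up
    to [d]; on such a piece the norm of [nu] almost equals the integral of [|g|]. *)
Lemma total_variation_density U K la (g : 'I_n -> rV -> R) nu E :
  vector_measure U nu -> compact K -> K `<=` U ->
  (forall i, has_density la K (g i) (fun A => nu A 0 i)) ->
  measurable E -> E `<=` K ->
  Defs.total_variation U nu E = (\int[la]_(x in E) (vnorm g x)%:E)%E.
Proof.
move=> nuU cK KU dg mE EK.
have ig i : la.-integrable setT (EFin \o g i) by case: (dg i).
have mg i : measurable_fun setT (g i) by apply/measurable_EFinP; exact: measurable_int (ig i).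
have iv := integrable_vnorm ig.
have mv := measurable_vnorm mg.
have v0 x : (0 <= (vnorm g x)%:E)%E by rewrite lee_fin enorm_ge0.
have nuE A : measurable A -> A `<=` K -> nu A = \row_i \int[la]_(x in A) g i x.
  by move=> mA AK; apply/rowP => i; rewrite mxE; case: (dg i) => _; exact.
have tvle A : measurable A -> A `<=` K ->
    ((enorm (nu A))%:E <= \int[la]_(x in A) (vnorm g x)%:E)%E.
  move=> mA AK; rewrite nuE// -EFin_Rintegral//; last exact: integrable_sub.
  by rewrite lee_fin norm_Rintegral_le.
apply/eqP; rewrite eq_le; apply/andP; split.
  apply: ge_ereal_sup => _ [m [A [iA tA AE ->]]].
  have mA k : measurable (A k) by case: (iA k).
  have AK k := subset_trans (AE k) EK.
  apply: (@le_trans _ _ (\sum_(k < m) \int[la]_(x in A k) (vnorm g x)%:E)%E).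
    by apply: lee_sum => k _; exact: tvle.
  rewrite -(big_mkord xpredT (fun k => (\int[la]_(x in A k) (vnorm g x)%:E)%E)).
  apply: (@le_trans _ _ (\sum_(0 <= k <oo) \int[la]_(x in A k) (vnorm g x)%:E)%E).
    by apply: nneseries_lim_ge => k _ _; exact: integral_ge0.
  rewrite -ge0_integral_bigcup//; last by apply/measurable_EFinP; exact: measurable_funTS.
  apply: ge0_subset_integral => //.
  - exact: bigcup_measurable.
  - by apply/measurable_EFinP; exact: measurable_funTS.
  - by move=> x [k _ /AE].
have [mu muE] := ex_total_variation nuU.
apply/lee_addgt0Pr => e e0.
(* The pointwise error [d] integrates over [E] to at most [e]; the added 1 covers a null [E]. *)
pose d := e / (fine (la E) + 1).
have l0 : 0 < fine (la E) + 1 by rewrite ltr_wpDl// fine_ge0.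
have d0 : 0 < d by rewrite divr_gt0.
pose v (j : nat) : rV := if unpickle j is Some q then
  (enorm (map_mx ratr (q : 'rV[rat]_n) : rV))^-1 *: map_mx ratr q else 0.
have v1 j : enorm (v j) <= 1.
  rewrite /v; case: unpickle => [q|]; last by rewrite enorm0.
  rewrite enormZ ger0_norm ?invr_ge0 ?enorm_ge0//.
  have [->|h] := eqVneq (enorm (map_mx ratr q : rV)) 0; first by rewrite mulr0.
  by rewrite mulVf.
pose F j := E `&` [set x | vnorm g x - d <= \sum_(i <- index_enum 'I_n) v j 0 i * g i x].
have ms j : measurable_fun setT (fun x => \sum_(i <- index_enum 'I_n) v j 0 i * g i x).
  by apply: measurable_sum => i; apply: measurable_funM.
have mF j : measurable (F j).
  apply: measurableI => //; rewrite -[X in measurable X]setTI.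
  rewrite (_ : [set x | _ <= _] = (fun x => \sum_(i <- index_enum 'I_n) v j 0 i * g i x - (vnorm g x - d)) @^-1` `[0, +oo[%classic).
    by apply: (measurable_funB (ms j) (measurable_funB mv _)) => //; exact: measurable_itv.
  by apply/seteqP; split => x /=; rewrite in_itv/= andbT subr_ge0.
have FE : \bigcup_j F j = E.
  apply/seteqP; split => [x [j _ []]//|x Ex].
  have [q qP] := rat_direction (\row_i g i x) d0.
  exists (pickle q) => //; split => //=; apply: (le_trans qP).
  rewrite /v pickleK le_eqVlt; apply/orP; left; apply/eqP.
  by apply: eq_bigr => i _; rewrite !mxE.
have mD := seqDU_measurable mF.
have DF j : seqDU F j `<=` F j by exact: subset_seqDU.
have DE j : seqDU F j `<=` E by move=> x /DF[].
have tD : trivIset setT (seqDU F) by exact: trivIset_seqDU.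
have EE : E = \bigcup_j seqDU F j by rewrite -seqDU_bigcup_eq FE.
have key j : (\int[la]_(x in seqDU F j) (vnorm g x)%:E <=
    mu (seqDU F j) + d%:E * la (seqDU F j))%E.
  have DK := subset_trans (DE j) EK.
  apply: (@le_trans _ _ ((enorm (nu (seqDU F j)))%:E + d%:E * la (seqDU F j))%E).
    rewrite -EFin_Rintegral//; last exact: integrable_sub.
    rewrite -[la _]fineK ?fin_num_measure// -EFinM -EFinD lee_fin.
    have i1 : la.-integrable (seqDU F j) (EFin \o (fun x => \sum_(i <- index_enum 'I_n) v j 0 i * g i x)).
      rewrite (_ : EFin \o _ = (fun x => \sum_(i <- index_enum 'I_n) (v j 0 i)%:E * (EFin \o g i) x)%E).
        apply: integrable_sum => // i _; apply: integrableZl => //; exact: integrable_sub.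
      by apply/funext => x /=; rewrite -sumEFin; apply: eq_bigr => i _; rewrite EFinM.
    have i2 : la.-integrable (seqDU F j) (EFin \o cst d).
      by apply: (@bounded_integrable _ _ _ la _ _ d) => //; [exact: finite_measure_lty|move=> x _; rewrite gtr0_norm].
    apply: (@le_trans _ _ (\int[la]_(x in seqDU F j) ((\sum_(i <- index_enum 'I_n) v j 0 i * g i x) + d))).
      apply: le_Rintegral => //; first exact: integrable_sub.
        have -> : EFin \o (fun x => \sum_(i <- index_enum 'I_n) v j 0 i * g i x + d) =
            ((EFin \o (fun x => (\sum_(i <- index_enum 'I_n) v j 0 i * g i x)%R)) \+ (EFin \o cst d))%E by [].
        exact: integrableD.
      by move=> x /DF[_ /=]; rewrite lerBlDr.
    rewrite RintegralD// Rintegral_cst// lerD2r Rintegral_sum//; last first.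
      move=> i; rewrite (_ : EFin \o _ = (fun x => (v j 0 i)%:E * (EFin \o g i) x)%E).
        by apply: integrableZl => //; exact: integrable_sub.
      by apply/funext => x /=; rewrite EFinM.
    apply: (@le_trans _ _ (\sum_i v j 0 i * nu (seqDU F j) 0 i)).
      rewrite le_eqVlt; apply/orP; left; apply/eqP; apply: eq_bigr => i _.
      rewrite RintegralZl//; last exact: integrable_sub.
      by case: (dg i) => _ ->.
    apply: (le_trans (cauchy_schwarz _ _)).
    by rewrite ler_piMl ?enorm_ge0.
  rewrite leeD2r// -muE; apply: ereal_sup_ubound.
  exists 1%N, (bigcup2 (seqDU F j) set0); split.
  - move=> [|[|k]] /=; rewrite /bigcup2/=; try exact: interior_borel0.
    exact: (interior_borel_sub cK KU).
  - by rewrite -trivIset_bigcup2 setI0.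
  - by move=> [|[|k]] /=.
  - by rewrite big_ord1.
rewrite muE {1}EE ge0_integral_bigcup//; last first.
  by rewrite -EE; apply/measurable_EFinP; exact: measurable_funTS.
apply: (@le_trans _ _ (\sum_(0 <= j <oo) (mu (seqDU F j) + d%:E * la (seqDU F j)))%E).
  by apply: lee_nneseries => // j *; apply: integral_ge0.
rewrite nneseriesD//; last first.
  by move=> j _ _; apply: mule_ge0 => //; rewrite lee_fin ltW.
rewrite nneseriesZl//.
have sE (m : {measure set rV -> \bar R}) : (\sum_(0 <= j <oo) m (seqDU F j) = m E)%E.
  by rewrite -measure_semi_bigcup// -EE.
have lE : (\sum_(0 <= j <oo) la (seqDU F j) = la E)%E by exact: sE.
rewrite sE lE leeD2l// -[la E]fineK ?fin_num_measure// -EFinM lee_fin.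
rewrite /d mulrAC ler_pdivrMr//; rewrite ler_wpM2l ?ltW//; lra.
Qed.

End variation_densities.

(** * Distributional gradients *)

Section fgradient.
Context {R : realType} {n : nat}.
Local Notation rV := 'rV[R]_n.
Implicit Types (la : {finite_measure set rV -> \bar R}) (K U : set rV) (u f g : rV -> R)
  (nu : set rV -> rV).

Lemma compact_support_bounded K f : continuous f -> compact K ->
  (forall x, ~ K x -> f x = 0) -> exists2 M, 0 < M & forall x, `|f x| <= M.
Proof.
move=> cf cK f0.
have /compact_bounded[M [_ MP]] : compact (f @` K).
  by apply: continuous_compact => //; apply: continuous_subspaceT.
exists (`|M| + 1) => [|x]; first by rewrite ltr_wpDl.
have [Kx|nKx] := pselect (K x); last by rewrite f0// normr0 addr_ge0.
apply: MP; last by exists x.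
by rewrite (le_lt_trans (ler_norm M))// ltrDl.
Qed.

Lemma smooth_measurable f : smooth f -> measurable_fun setT f.
Proof. by move=> sf; apply: continuous_measurable_rV; exact: smooth_continuous. Qed.

Definition bounded_measurable u := measurable_fun setT u /\ exists M, forall x, `|u x| <= M.

Lemma bounded_measurable_indic (A : set rV) : measurable A -> bounded_measurable \1_A.
Proof.
move=> mA; split; first exact: measurable_indic.
exists 1 => x; rewrite indicE; case: (_ \in _); by rewrite ?normr1 ?normr0.
Qed.

Lemma bounded_measurableD u v : bounded_measurable u -> bounded_measurable v ->
  bounded_measurable (fun x => u x + v x).
Proof.
move=> [mu [M uM]] [mv [N vN]]; split; first exact: measurable_funD.
by exists (M + N) => x; apply: (le_trans (ler_normD _ _)); rewrite lerD.
Qed.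

Lemma bounded_measurableM u v : bounded_measurable u -> bounded_measurable v ->
  bounded_measurable (fun x => u x * v x).
Proof.
move=> [mu [M uM]] [mv [N vN]]; split; first exact: measurable_funM.
by exists (M * N) => x; rewrite normrM ler_pM.
Qed.

Lemma bounded_measurableZ (c : R) u : bounded_measurable u ->
  bounded_measurable (fun x => c * u x).
Proof.
move=> bu; apply: bounded_measurableM bu; split => //.
by exists `|c|.
Qed.

Lemma smooth_bounded_measurable K f : smooth f -> compact K ->
  (forall x, ~ K x -> f x = 0) -> bounded_measurable f.
Proof.
move=> sf cK f0; split; first exact: smooth_measurable.
by have [M _ fM] := compact_support_bounded (smooth_continuous sf) cK f0; exists M.
Qed.

Lemma bounded_measurable_integrable (mu : {measure set rV -> \bar R}) K u :
  measurable K -> (mu K < +oo)%E -> bounded_measurable u ->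
  mu.-integrable K (EFin \o u).
Proof.
move=> mK Koo [mu' [M uM]]; apply: (bounded_integrable (M := M)) => //.
exact: measurable_funTS.
Qed.

Lemma Rintegral_support (mu : {measure set rV -> \bar R}) (K D E : set rV) u :
  K `<=` D -> K `<=` E -> (forall x, ~ K x -> u x = 0) ->
  \int[mu]_(x in D) u x = \int[mu]_(x in E) u x.
Proof.
move=> KD KE u0; rewrite Rintegral_mkcond [RHS]Rintegral_mkcond.
apply: eq_Rintegral => x _; rewrite /patch.
have [Kx|/u0 ->] := pselect (K x); last by rewrite !if_same.
by rewrite !mem_set//; [exact: KE|exact: KD].
Qed.

Lemma integral_support K U u : compact K -> K `<=` U -> bounded_measurable u ->
  (forall x, ~ K x -> u x = 0) ->
  (\int[lebesgue_rV]_(x in U) (u x)%:E = (\int[lebesgue_rV]_(x in K) u x)%:E)%E.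
Proof.
move=> cK KU bu u0.
have mK := compact_measurable_rV cK.
rewrite EFin_Rintegral//; last first.
  by apply: bounded_measurable_integrable => //; exact: lebesgue_rV_compact.
rewrite integral_mkcond [RHS]integral_mkcond; apply: eq_integral => x _; rewrite /patch.
have [Kx|/u0 ->] := pselect (K x); last by rewrite !if_same.
by rewrite !mem_set//; exact: KU.
Qed.

(* [is_gradient U W] is convertible to [fgradient U \1_W]. *)
Definition fgradient U u nu := vector_measure U nu /\
  forall f, test_function U f -> forall i,
    (\int[lebesgue_rV]_(x in U) (u x * partial i f x)%:E = - vintegral U nu i f)%E.

(** The defining identity in real integrals over one compact set on which the gradient has a
    density; [pairing_fgradient] goes back. *)
Lemma fgradient_pairing U u nu K la g (i : 'I_n) f : bounded_measurable u ->
  fgradient U u nu -> compact K -> K `<=` U ->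
  has_density la K g (fun A => nu A 0 i) ->
  smooth f -> (forall x, ~ K x -> f x = 0) ->
  \int[lebesgue_rV]_(x in K) (u x * partial i f x) = - \int[la]_(x in K) (f x * g x).
Proof.
move=> bu [_ gu] cK KU dg sf f0.
have tf : test_function U f := test_functionI sf cK KU f0.
have pf0 x : ~ K x -> partial i f x = 0.
  by apply: partial_out => //; exact: compact_closed_rV.
have [M _ fM] := compact_support_bounded (smooth_continuous sf) cK f0.
have := gu f tf i.
rewrite (vintegral_density cK KU dg (smooth_measurable sf) fM f0).
rewrite (integral_support cK KU) -?EFinN; first by move=> [].
  apply: bounded_measurableM => //; apply: smooth_bounded_measurable cK pf0.
  exact: smooth_partial.
by move=> x /pf0 ->; rewrite mulr0.
Qed.

Lemma pairing_fgradient U u nu : bounded_measurable u -> vector_measure U nu ->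
  (forall K la (g : 'I_n -> rV -> R) (i : 'I_n) f, compact K -> K `<=` U ->
    (forall i, has_density la K (g i) (fun A => nu A 0 i)) ->
    smooth f -> (forall x, ~ K x -> f x = 0) ->
    \int[lebesgue_rV]_(x in K) (u x * partial i f x) = - \int[la]_(x in K) (f x * g i x)) ->
  fgradient U u nu.
Proof.
move=> bu nuU H; split => // f tf i.
have [K [cK KU f0]] := test_functionE tf.
have sf : smooth f by case: tf.
have [la [g gP]] := @vm_density R n unit U K (fun=> nu) (fun=> nuU) cK KU.
have pf0 x : ~ K x -> partial i f x = 0.
  by apply: partial_out => //; exact: compact_closed_rV.
have [M _ fM] := compact_support_bounded (smooth_continuous sf) cK f0.
rewrite (vintegral_density cK KU (gP tt i) (smooth_measurable sf) fM f0).
rewrite (integral_support cK KU) -?EFinN; first by rewrite (H K la (g tt) i f).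
  apply: bounded_measurableM => //; apply: smooth_bounded_measurable cK pf0.
  exact: smooth_partial.
by move=> x /pf0 ->; rewrite mulr0.
Qed.

Lemma vm_lin U (a b : R) nu1 nu2 : vector_measure U nu1 -> vector_measure U nu2 ->
  vector_measure U (fun A => a *: nu1 A + b *: nu2 A).
Proof.
move=> h1 h2 A mA tA cA.
rewrite (_ : (fun m => _) = (fun m => a *: (\sum_(k < m) nu1 (A k)) + b *: (\sum_(k < m) nu2 (A k)))).
  apply: cvgD; apply: cvgZr; [exact: h1|exact: h2].
by apply/funext => m; rewrite big_split/= !scaler_sumr.
Qed.

Lemma has_density_lin la K (a b : R) g1 g2 (k1 k2 : set rV -> R) :
  has_density la K g1 k1 -> has_density la K g2 k2 ->
  has_density la K (fun x => a * g1 x + b * g2 x) (fun A => a * k1 A + b * k2 A).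
Proof.
move=> [i1 e1] [i2 e2].
have iZ c g : la.-integrable setT (EFin \o g) -> la.-integrable setT (EFin \o (fun x => c * g x)).
  move=> ig; have -> : EFin \o (fun x => c * g x) = (fun x => c%:E * (EFin \o g) x)%E.
    by apply/funext => x /=; rewrite EFinM.
  exact: integrableZl.
split.
  have -> : EFin \o (fun x => a * g1 x + b * g2 x) =
    ((EFin \o (fun x => (a * g1 x)%R)) \+ (EFin \o (fun x => (b * g2 x)%R)))%E by [].
  by apply: integrableD => //; exact: iZ.
move=> A mA AK; rewrite RintegralD//; try by apply: integrable_sub => //; exact: iZ.
by rewrite !RintegralZl ?e1 ?e2//; exact: integrable_sub.
Qed.

Lemma fgradient_lin U (a b : R) u v nu1 nu2 : bounded_measurable u -> bounded_measurable v ->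
  fgradient U u nu1 -> fgradient U v nu2 ->
  fgradient U (fun x => a * u x + b * v x) (fun A => a *: nu1 A + b *: nu2 A).
Proof.
move=> bu bv gu gv.
have nuU1 : vector_measure U nu1 by case: gu.
have nuU2 : vector_measure U nu2 by case: gv.
split; first exact: vm_lin.
move=> f tf i.
have [K [cK KU f0]] := test_functionE tf.
have sf : smooth f by case: tf.
have [la [g gP]] := @vm_density R n bool U K (fun b => if b then nu1 else nu2)
  (fun b => if b as b' return vector_measure U (if b' then nu1 else nu2) then nuU1 else nuU2) cK KU.
have d1 := gP true i; have d2 := gP false i; rewrite /= in d1 d2.
have pf0 x : ~ K x -> partial i f x = 0.
  by apply: partial_out => //; exact: compact_closed_rV.
have [M _ fM] := compact_support_bounded (smooth_continuous sf) cK f0.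
have dd : has_density la K (fun x => a * g true i x + b * g false i x)
    (fun A => (a *: nu1 A + b *: nu2 A) 0 i).
  have -> : (fun A => (a *: nu1 A + b *: nu2 A) 0 i) = (fun A => a * nu1 A 0 i + b * nu2 A 0 i).
    by apply/funext => A; rewrite !mxE.
  exact: has_density_lin.
have mK := compact_measurable_rV cK.
have bf := smooth_bounded_measurable sf cK f0.
have bp : bounded_measurable (partial i f).
  by apply: smooth_bounded_measurable cK pf0; exact: smooth_partial.
rewrite (vintegral_density cK KU dd (smooth_measurable sf) fM f0).
rewrite (integral_support cK KU) -?EFinN.
- congr EFin.
  have fg j : la.-integrable K (EFin \o (fun x => f x * g j i x)).
    case: bf => mf _.
    apply: (bounded_mul_integrable mK (measurable_funTS mf) (fun x _ => fM x)).
    by apply: integrable_sub => //; case: (gP j i).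
  have up w : bounded_measurable w -> lebesgue_rV.-integrable K (EFin \o (fun x => w x * partial i f x)).
    move=> bw; apply: bounded_measurable_integrable => //; first exact: lebesgue_rV_compact.
    exact: bounded_measurableM.
  have -> : \int[lebesgue_rV]_(x in K) ((a * u x + b * v x) * partial i f x) =
      a * \int[lebesgue_rV]_(x in K) (u x * partial i f x) +
      b * \int[lebesgue_rV]_(x in K) (v x * partial i f x).
    rewrite -!RintegralZl//; try exact: up.
    rewrite -RintegralD//; last 2 first.
    + have := up _ (bounded_measurableZ a bu); apply: eq_integrable => // x _ /=.
      by rewrite mulrA.
    + have := up _ (bounded_measurableZ b bv); apply: eq_integrable => // x _ /=.
      by rewrite mulrA.
    by apply: eq_Rintegral => x _; rewrite mulrDl !mulrA.
  rewrite (fgradient_pairing bu gu cK KU d1 sf f0) (fgradient_pairing bv gv cK KU d2 sf f0).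
  rewrite !mulrN -opprD; congr (- _).
  rewrite -!RintegralZl// -RintegralD//; last 2 first.
  + have -> : EFin \o (fun x => a * (f x * g true i x)) = (fun x => a%:E * (EFin \o (fun x => f x * g true i x)%R) x)%E.
      by apply/funext => x /=; rewrite EFinM.
    by apply: integrableZl => //; exact: fg.
  + have -> : EFin \o (fun x => b * (f x * g false i x)) = (fun x => b%:E * (EFin \o (fun x => f x * g false i x)%R) x)%E.
      by apply/funext => x /=; rewrite EFinM.
    by apply: integrableZl => //; exact: fg.
  by apply: eq_Rintegral => x _; ring.
- apply: bounded_measurableM => //.
  by apply: bounded_measurableD; exact: bounded_measurableZ.
- by move=> x /pf0 ->; rewrite mulr0.
Qed.

Lemma fgradient_ae U u v nu : measurable U -> bounded_measurable u -> bounded_measurable v ->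
  {ae lebesgue_rV, forall x, U x -> u x = v x} ->
  fgradient U u nu -> fgradient U v nu.
Proof.
move=> mU [mu _] [mv _] uv [nuU gu]; split => // f tf i; rewrite -gu//.
have sf : smooth f by case: tf.
have mp : measurable_fun setT (partial i f) by apply: smooth_measurable; exact: smooth_partial.
apply: ae_eq_integral => //.
- by apply/measurable_EFinP; apply: measurable_funTS; exact: measurable_funM.
- by apply/measurable_EFinP; apply: measurable_funTS; exact: measurable_funM.
- by apply: filterS uv => x uvx Ux; rewrite uvx.
Qed.

(** The sign of [w] on [A] is approximated by a difference of two cutoffs, one for the part of [A]
    where [w >= 0] and one for the part where [w < 0]. The integral on the right runs over the whole
    space, and what [phi] picks up outside [A] is part of the error. *)
Lemma dual_approx la (w : rV -> R) (A K U : set rV) (e : R) :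
  la.-integrable setT (EFin \o w) -> measurable A -> A `<=` K -> compact K ->
  open U -> A `<=` U -> 0 < e ->
  exists phi : rV -> R, [/\ test_function U phi, forall x, `|phi x| <= 1 &
    \int[la]_(x in A) `|w x| <= \int[la]_x (phi x * w x) + e].
Proof.
move=> iw mA AK cK oU AU e0.
have mw : measurable_fun setT w by apply/measurable_EFinP; exact: measurable_int iw.
have iaw : la.-integrable setT (EFin \o (fun x => `|w x|)) by exact: integrable_norm iw.
have [P [PE _]] := ex_density_measure iaw (fun x => normr_ge0 (w x)).
pose A1 := A `&` [set x | 0 <= w x]; pose A2 := A `&` [set x | w x < 0].
have mw1 : measurable [set x | 0 <= w x].
  rewrite (_ : [set x | 0 <= w x] = w @^-1` `[0, +oo[%classic); last first.
    by apply/seteqP; split => x /=; rewrite in_itv/= andbT.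
  by rewrite -[X in measurable X]setTI; apply: mw => //; exact: measurable_itv.
have mw2 : measurable [set x | w x < 0].
  rewrite (_ : [set x | w x < 0] = ~` [set x | 0 <= w x]); first exact: measurableC.
  by apply/seteqP; split => x /=; rewrite ltNge => /negP.
have mA1 : measurable A1 by exact: measurableI.
have mA2 : measurable A2 by exact: measurableI.
(* Each of the two exceptional sets [V \ C] carries at most [e / 4] of the mass of [|w|], and there
   [|w| - phi w] can be as large as [2 |w|]. *)
have e4 : 0 < e / 4 by rewrite divr_gt0.
have sq B : measurable B -> B `<=` A -> exists (C V : set rV) (chi : rV -> R),
    [/\ C `<=` B /\ measurable C, B `<=` V /\ measurable V, test_function U chi,
      forall x, 0 <= chi x <= 1 &
      [/\ forall x, C x -> chi x = 1, forall x, ~ V x -> chi x = 0 &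
       (P (V `\` C) < (e / 4)%:E)%E]].
  move=> mB BA.
  have [C [V [cC oV CB [BV VU] h]]] := finite_measure_squeeze P mB (subset_trans BA AK) cK oU (subset_trans BA AU) e4.
  have [chi [tchi chi01 [V' [oV' CV' chi1]]]] := cutoff cC oV (subset_trans CB BV).
  exists C, V, chi; split => //.
  - by split => //; exact: compact_measurable_rV.
  - by split => //; exact: open_measurable_rV.
  - have [L [cL LV l0]] := test_functionE tchi.
    by apply: (test_functionI _ cL (subset_trans LV VU) l0); case: tchi.
  - split => //; first by move=> x /CV'; exact: chi1.
    have [L [cL LV l0]] := test_functionE tchi.
    by move=> x nV; apply: l0 => /LV.
have [C1' [V1 [c1 [[CA1 mC1] [AV1 mV1] t1 c01 [c11 c10 h1]]]]] := sq A1 mA1 (fun x => @proj1 _ _).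
have [C2' [V2 [c2 [[CA2 mC2] [AV2 mV2] t2 c02 [c21 c20 h2]]]]] := sq A2 mA2 (fun x => @proj1 _ _).
have sm1 : smooth c1 by case: t1.
have sm2 : smooth c2 by case: t2.
exists (fun x => c1 x - c2 x); split.
- have [L1 [cL1 L1U l1]] := test_functionE t1; have [L2 [cL2 L2U l2]] := test_functionE t2.
  apply: (@test_functionI _ _ U (L1 `|` L2)).
  + exact: smoothB.
  + exact: compactU.
  + by rewrite subUset.
  + by move=> x h; rewrite l1 ?l2 ?subrr// => ?; apply: h; [right|left].
- by move=> x; have := c01 x; have := c02 x; rewrite ler_norml => /andP[? ?] /andP[? ?]; lra.
pose B1 := V1 `\` C1'; pose B2 := V2 `\` C2'.
have mB1 : measurable B1 by exact: measurableD.
have mB2 : measurable B2 by exact: measurableD.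
have iB B : measurable B -> la.-integrable setT (EFin \o (fun x => \1_B x * `|w x|)).
  move=> mB; apply: (@bounded_mul_integrable _ _ _ la setT \1_B _ 1) => //.
  by move=> x _; rewrite indicE; case: (_ \in _); rewrite ?normr1 ?normr0.
have PB B : measurable B -> (P B < (e / 4)%:E)%E -> \int[la]_x (\1_B x * `|w x|) <= e / 4.
  move=> mB; rewrite PE// -EFin_Rintegral//; last exact: integrable_sub.
  rewrite lte_fin => /ltW; apply: le_trans.
  rewrite le_eqVlt; apply/orP; left; apply/eqP.
  rewrite [RHS]Rintegral_mkcond; apply: eq_Rintegral => x _.
  by rewrite /patch indicE; case: (_ \in _); rewrite ?mul1r ?mul0r.
have iphi : la.-integrable setT (EFin \o (fun x => (c1 x - c2 x) * w x)).
  apply: (@bounded_mul_integrable _ _ _ la setT (fun x => c1 x - c2 x) w 1) => //.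
    by apply: smooth_measurable; exact: smoothB.
  by move=> x _; have := c01 x; have := c02 x; rewrite ler_norml => /andP[? ?] /andP[? ?]; lra.
have i2 B : measurable B -> la.-integrable setT (EFin \o (fun x => 2 * (\1_B x * `|w x|))).
  move=> mB; have -> : EFin \o (fun x => 2 * (\1_B x * `|w x|)) = (fun x => 2%:E * (EFin \o (fun x => \1_B x * `|w x|)%R) x)%E.
    by apply/funext => x /=; rewrite EFinM.
  by apply: integrableZl => //; exact: iB.
apply: (@le_trans _ _ (\int[la]_x ((c1 x - c2 x) * w x + (2 * (\1_B1 x * `|w x|) + 2 * (\1_B2 x * `|w x|))))).
  rewrite Rintegral_mkcond; apply: le_Rintegral => //.
  - have -> : EFin \o ((fun x => `|w x|) \_ A) = (EFin \o (fun x => \1_A x * `|w x|)).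
      by apply/funext => x /=; rewrite /patch indicE; case: (_ \in _); rewrite ?mul1r ?mul0r.
    exact: iB.
  - have -> : EFin \o (fun x => (c1 x - c2 x) * w x + (2 * (\1_B1 x * `|w x|) + 2 * (\1_B2 x * `|w x|))) =
      ((EFin \o (fun x => ((c1 x - c2 x) * w x)%R)) \+ ((EFin \o (fun x => (2 * (\1_B1 x * `|w x|))%R)) \+ (EFin \o (fun x => (2 * (\1_B2 x * `|w x|))%R))))%E by [].
    by apply: integrableD => //; apply: integrableD => //; exact: i2.
  - move=> x _.
    have a0 := normr_ge0 (w x).
    have /andP[p1 p2] := c01 x; have /andP[q1 q2] := c02 x.
    have bd : - `|w x| <= (c1 x - c2 x) * w x.
      have : `|(c1 x - c2 x) * w x| <= `|w x|.
        by rewrite normrM ler_piMl// ler_norml; apply/andP; split; clear -p1 p2 q1 q2; lra.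
      by rewrite ler_norml => /andP[].
    have -> : ((fun x => `|w x|) \_ A) x = \1_A x * `|w x|.
      by rewrite /= /patch indicE; case: (_ \in _); rewrite ?mul1r ?mul0r.
    rewrite !indicE.
    have [b1|b1] := boolP (x \in B1).
      by case: (x \in A); case: (x \in B2); rewrite /= ?mul1r ?mul0r; clear -a0 bd; lra.
    have [b2|b2] := boolP (x \in B2).
      by case: (x \in A); rewrite /= ?mul1r ?mul0r; clear -a0 bd; lra.
    rewrite !mul0r !mulr0 !addr0.
    rewrite notin_setE in b1; rewrite notin_setE in b2.
    have [Ax|nAx] := boolP (x \in A); rewrite ?mul1r ?mul0r.
      rewrite inE in Ax; have [w0|w0] := leP 0 (w x).
        have C1x : C1' x by apply: contrapT => nC; apply: b1; split => //; exact: AV1.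
        have nV2 : ~ V2 x.
          move=> V2x; apply: b2; split => // /CA2[_ /=]; by rewrite ltNge w0.
        by rewrite c11// c20// subr0 mul1r ger0_norm.
      have C2x : C2' x by apply: contrapT => nC; apply: b2; split => //; exact: AV2.
      have nV1 : ~ V1 x.
        move=> V1x; apply: b1; split => // /CA1[_ /=]; by rewrite leNgt w0.
      by rewrite c21// c10// ltr0_norm// sub0r mulN1r.
    rewrite notin_setE in nAx.
    rewrite c10 ?c20 ?subrr ?mul0r// => V; [apply: b2|apply: b1]; split => //.
      by move=> /CA2[].
    by move=> /CA1[].
rewrite RintegralD//; last first.
  have -> : EFin \o (fun x => (2 * (\1_B1 x * `|w x|) + 2 * (\1_B2 x * `|w x|))) =
      ((EFin \o (fun x => (2 * (\1_B1 x * `|w x|))%R)) \+ (EFin \o (fun x => (2 * (\1_B2 x * `|w x|))%R)))%E by [].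
  by apply: integrableD => //; exact: i2.
rewrite RintegralD//; [|exact: i2|exact: i2].
rewrite !RintegralZl//; [|exact: iB|exact: iB].
by have := PB _ mB1 h1; have := PB _ mB2 h2; lra.
Qed.

Lemma ae_eq_Rintegral (mu : {measure set rV -> \bar R}) (D : set rV) u v : measurable D ->
  measurable_fun setT u -> measurable_fun setT v ->
  {ae mu, forall x, D x -> u x = v x} ->
  \int[mu]_(x in D) u x = \int[mu]_(x in D) v x.
Proof.
move=> mD mu' mv uv; congr fine; apply: ae_eq_integral => //.
- by apply/measurable_EFinP; exact: measurable_funTS.
- by apply/measurable_EFinP; exact: measurable_funTS.
- by apply: filterS uv => x uvx Dx; rewrite uvx.
Qed.

Lemma density_vanish la K (A U : set rV) g : la.-integrable setT (EFin \o g) ->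
  compact K -> measurable A -> open U -> A `<=` U -> U `<=` K ->
  (forall f, test_function U f -> \int[la]_(x in K) (f x * g x) = 0) ->
  \int[la]_(x in A) `|g x| = 0.
Proof.
move=> ig cK mA oU AU UK H.
apply/eqP; rewrite eq_le Rintegral_ge0//= andbT.
apply/ler_addgt0Pr => e e0; rewrite add0r.
have [phi [tphi _ h]] := dual_approx ig mA (subset_trans AU UK) cK oU AU e0.
apply: (le_trans h); rewrite gerDr.
have [L [cL LU l0]] := test_functionE tphi.
rewrite -(H phi tphi) le_eqVlt; apply/orP; left; apply/eqP.
apply: (@Rintegral_support _ L); first by [].
  exact: subset_trans UK.
by move=> x /l0 ->; rewrite mul0r.
Qed.

Lemma compact_nbhd K U : compact K -> open U -> K `<=` U ->
  exists V L, [/\ open V, compact L, K `<=` V, V `<=` L & L `<=` U].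
Proof.
move=> cK oU KU; have [phi [tphi _ [V [oV KV phi1]]]] := cutoff cK oU KU.
have [L [cL LU l0]] := test_functionE tphi.
exists V, L; split => // x Vx; apply: contrapT => /l0.
by rewrite phi1// => /eqP; rewrite oner_eq0.
Qed.

(** Locality and uniqueness: the gradient of [u - v] has a density that pairs to 0 with all test
    functions near the compact set, and such a density vanishes by [density_vanish]. *)
Lemma fgradient_local U V u v nu1 nu2 : open U -> open V -> V `<=` U ->
  bounded_measurable u -> bounded_measurable v ->
  {ae lebesgue_rV, forall x, V x -> u x = v x} ->
  fgradient U u nu1 -> fgradient U v nu2 ->
  forall A, interior_borel V A -> nu1 A = nu2 A.
Proof.
move=> oU oV VU bu bv uv gu gv A [mA /compactly_containedE[K [cK AK KV]]].
have [V' [L [oV' cL KV' VL LV]]] := compact_nbhd cK oV KV.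
have LU := subset_trans LV VU.
pose w x := 1 * u x + (-1) * v x.
pose nu B := 1 *: nu1 B + (-1) *: nu2 B.
have gw : fgradient U w nu by exact: fgradient_lin.
have bw : bounded_measurable w by apply: bounded_measurableD; exact: bounded_measurableZ.
have nuU : vector_measure U nu by case: gw.
have [la [g gP]] := @vm_density R n unit U L (fun=> nu) (fun=> nuU) cL LU.
have mL := compact_measurable_rV cL.
have mV := open_measurable_rV oV.
apply/eqP; rewrite -subr_eq0; apply/eqP.
have -> : nu1 A - nu2 A = nu A by rewrite /nu scale1r scaleN1r.
apply/rowP => i; rewrite [RHS]mxE.
have dg := gP tt i; rewrite /= in dg.
have ig : la.-integrable setT (EFin \o g tt i) by case: dg.
have AL : A `<=` L by apply: subset_trans VL; exact: subset_trans KV'.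
have -> : nu A 0 i = \int[la]_(x in A) g tt i x by case: dg => _; exact.
apply/eqP; rewrite -normr_le0.
rewrite -(@density_vanish la L A V' (g tt i) ig cL mA oV' (subset_trans AK KV') VL).
  by apply: le_normr_Rintegral => //; exact: integrable_sub.
move=> f tf; have [M [cM MV f0]] := test_functionE tf.
have sf : smooth f by case: tf.
have f0L x : ~ L x -> f x = 0 by move=> nL; apply: f0 => /MV /VL.
have := fgradient_pairing bw gw cL LU dg sf f0L.
have -> : \int[lebesgue_rV]_(x in L) (w x * partial i f x) = 0.
  rewrite (@ae_eq_Rintegral lebesgue_rV L _ (fun=> 0))//.
  - by rewrite Rintegral_cst// mul0r.
  - apply: measurable_funM.
      by case: bw.
    by apply: smooth_measurable; exact: smooth_partial.
  - apply: filterS uv => x uvx Lx; rewrite /w uvx; last exact: LV.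
    by rewrite mul1r mulN1r subrr mul0r.
by move=> /eqP; rewrite eq_sym oppr_eq0 => /eqP.
Qed.

Lemma total_variation_eq U (nu1 nu2 : set rV -> rV) E :
  (forall A, interior_borel U A -> A `<=` E -> nu1 A = nu2 A) ->
  Defs.total_variation U nu1 E = Defs.total_variation U nu2 E.
Proof.
move=> H; congr ereal_sup; apply/seteqP; split => s [m [A [iA tA AE ->]]].
  by exists m, A; split => //; apply: eq_bigr => k _; rewrite H.
by exists m, A; split => //; apply: eq_bigr => k _; rewrite H.
Qed.

(** [gradient] is a chosen witness; by uniqueness any other witness gives the same values on
    interior Borel sets and the same perimeter measure. *)
Lemma perimeter_measureE U W nu : open U -> measurable W -> is_gradient U W nu ->
  perimeter_measure U W = Defs.total_variation U nu /\
  (forall A, interior_borel U A -> gradient U W A = nu A).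
Proof.
move=> oU mW gW.
have gW' : is_gradient U W (gradient U W) by rewrite /gradient; case: xgetP => // /(_ nu).
have E A : interior_borel U A -> gradient U W A = nu A.
  move=> iA; apply: (@fgradient_local U U \1_W \1_W) gW' gW A iA => //.
  - exact: bounded_measurable_indic.
  - exact: bounded_measurable_indic.
  - exact: aeW.
split=> //; apply/funext => F; apply: total_variation_eq => A iA _; exact: E.
Qed.

Lemma gradient_is_gradient U W : locally_finite_perimeter U W ->
  is_gradient U W (gradient U W).
Proof. by move=> [nu h]; rewrite /gradient; case: xgetP => // /(_ nu). Qed.

End fgradient.

(** * Derivatives along lines and under the integral sign *)

Section lines.
Context {R : realType} {n : nat}.
Local Notation rV := 'rV[R]_n.
Implicit Types (f : rV -> R) (x y h : rV).

Lemma partial_translation f h i :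
  partial i (fun x => f (x + h)) = (fun x => partial i f (x + h)).
Proof.
apply/funext => x; have E : (fun t : R => t^-1 *: (((fun y => f (y + h)) \o shift x) (t *: delta_mx 0 i) - f (x + h))) =
    (fun t => t^-1 *: ((f \o shift (x + h)) (t *: delta_mx 0 i) - f (x + h))).
  by apply/funext => t /=; rewrite addrA.
by rewrite /partial /derive E.
Qed.

Lemma derivable_translation f h x v : derivable f (x + h) v ->
  derivable (fun x => f (x + h)) x v.
Proof.
rewrite /derivable => H; set F := (X in cvg (X @ _)).
rewrite (_ : F = (fun t => t^-1 *: (f (t *: v + (x + h)) - f (x + h))))//.
by apply/funext => t; rewrite /F/= addrA.
Qed.

Lemma smooth_translation f h : smooth f -> smooth (fun x => f (x + h)).
Proof.
move=> sf s /=.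
have -> : foldr partial (fun x => f (x + h)) s = (fun x => foldr partial f s (x + h)).
  by elim: s => [//|i s IH] /=; rewrite IH partial_translation.
have [cf df] := sf s; split.
  move=> x; apply: (continuous_comp (f := fun x => x + h)); last exact: cf.
  exact: (cvgD cvg_id (cvg_cst _)).
by move=> i x; apply: derivable_translation; exact: df.
Qed.

Lemma is_derive_axis f i y (c t : R) : smooth f ->
  is_derive t 1 (fun t : R => f (y + (t * c) *: delta_mx 0 i))
    (c * partial i f (y + (t * c) *: delta_mx 0 i)).
Proof.
move=> sf; pose p (t : R) := f (y + t *: delta_mx 0 i).
have H (s : R) : is_derive s 1 p (partial i f (y + s *: delta_mx 0 i)).
  have E : (fun k => k^-1 *: ((p \o shift s) (k *: 1) - p s)) =
     (fun k => k^-1 *: ((f \o shift (y + s *: delta_mx 0 i)) (k *: delta_mx 0 i) - f (y + s *: delta_mx 0 i))).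
    by apply/funext => k /=; rewrite /p scaler1 scalerDl addrCA.
  apply: DeriveDef; first by rewrite /derivable E; exact: (smooth_derivable (f := f)).
  by rewrite /derive E.
rewrite [c * _]mulrC; apply: (is_derive1_comp (f := p) (g := fun t => t * c)).
have [X Y] := is_deriveM (f := id) (g := cst c) (is_derive_id t 1) (is_derive_cst c t 1).
apply: DeriveDef; first exact: X.
by rewrite [LHS]Y /= scaler0 add0r scaler1.
Qed.

(** The coordinates are moved one at a time, with the mean value theorem for each move. The cube
    that contains [y] is smaller than the cube of radius [d] by the moves still to come, so that all
    intermediate points stay where the partial derivatives are controlled. *)
Lemma partial_telescope f x (e d : R) (s : seq 'I_n) h y : smooth f ->
  (forall i z, cube x d z -> `|partial i f z - partial i f x| <= e) ->
  cube x (d - \sum_(i <- s) `|h 0 i|) y ->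
  `|f (y + \sum_(i <- s) h 0 i *: delta_mx 0 i) - f y - \sum_(i <- s) h 0 i * partial i f x|
    <= e * \sum_(i <- s) `|h 0 i|.
Proof.
move=> sf H; elim: s y => [|i s IH] y.
  by rewrite !big_nil addr0 subrr !subr0 normr0 mulr0.
rewrite !big_cons => cy.
set z := y + h 0 i *: delta_mx 0 i.
have cz t : 0 <= t <= 1 -> cube x (d - \sum_(i <- s) `|h 0 i|) (y + (t * h 0 i) *: delta_mx 0 i).
  move=> /andP[t0 t1] j; rewrite !mxE eqxx /=.
  have := cy j; have [->|ij] := eqVneq j i; last by rewrite mulr0 addr0; have := normr_ge0 (h 0 i); lra.
  rewrite mulr1 => h1; rewrite addrAC; apply: (le_trans (ler_normD _ _)).
  have : `|t * h 0 i| <= `|h 0 i| by rewrite normrM (ger0_norm t0) ler_piMl.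
  lra.
have h0 : 0 <= \sum_(i <- s) `|h 0 i| by rewrite sumr_ge0.
have {}IH := IH z; have {}IH := IH _.
have [t t01 E] : exists2 t : R, 0 <= t <= 1 & f z - f y = h 0 i * partial i f (y + (t * h 0 i) *: delta_mx 0 i).
  have [|t|t] := @MVT_segment R (fun t : R => f (y + (t * h 0 i) *: delta_mx 0 i))
    (fun t => h 0 i * partial i f (y + (t * h 0 i) *: delta_mx 0 i)) 0 1 ler01.
  - by move=> t _; exact: is_derive_axis.
  - apply: continuous_subspaceT => s'; apply/differentiable_continuous/derivable1_diffP.
    by have [] := is_derive_axis i y (h 0 i) s' sf.
  - rewrite in_itv/= => t01 E; exists t => //.
    by move: E; rewrite mul1r mul0r scale0r addr0 subr0 mulr1.
have e1 : `|f z - f y - h 0 i * partial i f x| <= e * `|h 0 i|.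
  rewrite E -mulrBr normrM mulrC ler_wpM2r//; apply: H.
  by apply: sub_cube (cz _ t01); lra.
have := IH; rewrite (_ : cube _ _ _ = True); last first.
  by apply/propext; split => // _; have := cz 1; rewrite mul1r; apply; rewrite ler01 lexx.
move=> /(_ I) e2.
rewrite addrA -/z mulrDr.
apply: le_trans (lerD e1 e2); apply: le_trans (ler_normD _ _).
by rewrite le_eqVlt; apply/orP; left; apply/eqP; congr `|_|; ring.
Qed.

Lemma sum_delta h : \sum_i h 0 i *: delta_mx 0 i = h :> rV.
Proof. by rewrite [RHS]row_sum_delta. Qed.

Lemma is_derive_line f x h (s : R) : smooth f ->
  is_derive s 1 (fun s : R => f (x + s *: h)) (\sum_i h 0 i * partial i f (x + s *: h)).
Proof.
move=> sf; set y : rV := x + s *: h; set D := \sum_i _.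
have C (i : 'I_n) : {for y, continuous (partial i f)}.
  by have := smooth_continuous (smooth_partial i sf); apply.
have key : (fun t : R => t^-1 *: (f (y + t *: h) - f y)) @ 0^' --> D.
  apply/cvgrPdist_le => e e0.
  pose S := \sum_i `|h 0 i| + 1.
  have S0 : 0 < S by rewrite ltr_wpDl// sumr_ge0.
  have [d d0 dP] : exists2 d : R, 0 < d & forall i z, cube y d z -> `|partial i f z - partial i f y| <= e / S.
    have : \near y, forall i, `|partial i f y - partial i f (y : rV)| <= e / S.
      by near=> z => i; rewrite subrr normr0 divr_ge0 ?ltW.
    have : \forall z \near y, forall i, `|partial i f z - partial i f y| <= e / S.
      apply: (filter_forall (nbhs_filter y)) => i.
      have := C i.
      move/cvgrPdist_le => /(_ (e / S) (divr_gt0 e0 S0)).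
      by apply: filterS => z; rewrite distrC.
    move=> /nbhs_cube[d d0 dP] _; exists d => // i z /dP; exact.
  near=> t.
  have t0 : t != 0 by near: t; exact: nbhs_dnbhs_neq.
  have td : `|t| * S <= d.
    rewrite -ler_pdivlMr//; near: t; apply: nbhs_dnbhs.
    have /cvgr0_norm_le : (id : R -> R) @ 0 --> 0 by exact: cvg_id.
    by apply; rewrite divr_gt0.
  have := @partial_telescope f y (e / S) d (index_enum 'I_n) (t *: h) y sf dP.
  have E1 : \sum_i `|(t *: h) 0 i| = `|t| * \sum_i `|h 0 i|.
    by rewrite mulr_sumr; apply: eq_bigr => i _; rewrite mxE normrM.
  rewrite E1 sum_delta.
  have E2 : \sum_i (t *: h) 0 i * partial i f y = t * D.
    by rewrite mulr_sumr; apply: eq_bigr => i _; rewrite mxE mulrA.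
  rewrite E2 => /(_ _) K.
  have {}K : `|f (y + t *: h) - f y - t * D| <= e / S * (`|t| * \sum_i `|h 0 i|).
    apply: K; apply: cube_center; move: td; rewrite /S mulrDr mulr1.
    by have := normr_ge0 t; lra.
  have t1 : 0 < `|t| by rewrite normr_gt0.
  have -> : D - t^-1 *: (f (y + t *: h) - f y) = - (t^-1 * (f (y + t *: h) - f y - t * D)).
    by rewrite mulrBr mulKf// opprB.
  rewrite normrN normrM normfV ler_pdivrMl//; apply: (le_trans K).
  rewrite mulrCA ler_wpM2l// mulrAC ler_pdivrMr// ler_wpM2l ?ltW//.
  by rewrite /S ltrDl.
have E : (fun k => k^-1 *: (((fun s : R => f (x + s *: h)) \o shift s) (k *: 1) - f (x + s *: h))) =
    (fun t : R => t^-1 *: (f (y + t *: h) - f y)).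
  by apply/funext => k /=; rewrite scaler1 scalerDl addrCA addrC /y.
apply: DeriveDef; first by rewrite /derivable E; apply/cvg_ex; exists D.
by rewrite /derive E; apply: cvg_lim.
Unshelve. all: by end_near.
Qed.

End lines.

Section translations.
Context {R : realType} {n : nat}.
Local Notation rV := 'rV[R]_n.
Local Notation leb := (@lebesgue_rV R n).
Implicit Types (la : {finite_measure set rV -> \bar R}) (K L U : set rV) (u f phi : rV -> R)
  (nu : set rV -> rV) (h : rV).

Lemma Rintegral_translation f h : leb.-integrable setT (EFin \o f) ->
  \int[leb]_x f (x + h) = \int[leb]_x f x.
Proof.
move=> ifn; congr fine.
have mt := @measurable_translation R n h.
have mf : measurable_fun setT f by apply/measurable_EFinP; exact: measurable_int ifn.
have E A : measurable A -> A `<=` [set: rV] -> pushforward leb (fun x => x + h) A = leb A.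
  by move=> mA _; exact: lebesgue_rV_translation.
have := @integral_pushforward _ _ _ _ R _ mt leb setT (EFin \o f).
rewrite preimage_setT => <- //; last 2 first.
- by apply/measurable_EFinP.
- apply/integrableP; split; first by apply/measurable_EFinP; exact: measurableT_comp.
  have /integrableP[_] := ifn; apply: le_lt_trans.
  have ma : measurable_fun setT (abse \o (EFin \o f)).
    by apply: measurableT_comp => //; apply/measurable_EFinP.
  have := @ge0_integral_pushforward _ _ _ _ R _ mt leb setT (abse \o (EFin \o f)) measurableT ma (fun x _ => abse_ge0 _).
  rewrite preimage_setT => <-.
  by rewrite le_eqVlt; apply/orP; left; apply/eqP; exact: eq_measure_integral.
exact: eq_measure_integral.
Qed.

Lemma compact_support_integrable K u f : bounded_measurable u -> bounded_measurable f ->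
  compact K -> (forall x, ~ K x -> f x = 0) ->
  leb.-integrable setT (EFin \o (fun x => u x * f x)).
Proof.
move=> bu bf cK f0; have mK := compact_measurable_rV cK.
have := @bounded_measurable_integrable _ _ leb K _ mK (lebesgue_rV_compact cK) (bounded_measurableM bu bf).
move/(integrable_mkcond _ mK).
apply: eq_integrable => // x _; rewrite /patch.
by case: ifPn => //; rewrite notin_setE => /f0 /= ->; rewrite mulr0.
Qed.

Lemma is_derive_shift_integral K u f h (s : R) : bounded_measurable u -> compact K ->
  smooth f -> (exists M, forall i x, `|partial i f x| <= M) -> bounded_measurable f ->
  is_derive s 1 (fun s : R => \int[leb]_(x in K) (u x * f (x + s *: h)))
    (\int[leb]_(x in K) (u x * \sum_i h 0 i * partial i f (x + s *: h))).
Proof.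
move=> bu cK sf [M fM] bf; have mK := compact_measurable_rV cK.
have Koo := lebesgue_rV_compact cK.
have [mu [N uN]] := bu.
pose F (s : R) x := u x * f (x + s *: h).
have dF (t : R) x : is_derive t 1 (F ^~ x) (u x * \sum_i h 0 i * partial i f (x + t *: h)).
  have [X Y] := is_deriveM (is_derive_cst (u x) t 1) (is_derive_line x h t sf).
  apply: DeriveDef; first exact: X.
  by rewrite [LHS]Y /= scaler0 addr0.
have d1 (t : R) x : partial1of2 F t x = u x * \sum_i h 0 i * partial i f (x + t *: h).
  by rewrite partial1of2E; have [_] := dF t x.
pose G (x : rV) := `|N| * \sum_i `|h 0 i| * `|M|.
have Is : (`]s - 1, s + 1[%classic : set R) s.
  by rewrite /= in_itv/= ltrBlDr !ltrDl ltr01.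
have iF (t : R) : (`]s - 1, s + 1[%classic : set R) t -> leb.-integrable K (EFin \o F t).
  move=> _; apply: bounded_measurable_integrable => //; apply: bounded_measurableM => //.
  have [mf [Mf fMf]] := bf; split; last by exists Mf.
  apply: (measurableT_comp mf); exact: measurable_translation.
have derF (t : R) x : (`]s - 1, s + 1[%classic : set R) t -> K x -> derivable (F ^~ x) t 1.
  by move=> _ _; have [] := dF t x.
have G0 x : 0 <= G x by rewrite mulr_ge0// sumr_ge0// => i _; rewrite mulr_ge0.
have iG : leb.-integrable K (EFin \o G).
  by apply: (@bounded_integrable _ _ _ leb K G (G 0)) => //; [exact: measurable_cst|move=> x _; rewrite ger0_norm].
have Gub (t : R) x : (`]s - 1, s + 1[%classic : set R) t -> K x -> `|partial1of2 F t x| <= G x.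
  move=> _ _; rewrite d1 normrM ler_pM//; first exact: le_trans (uN x) (ler_norm _).
  apply: (le_trans (ler_norm_sum _ _ _)); apply: ler_sum => i _.
  by rewrite normrM ler_wpM2l//; exact: le_trans (fM i _) (ler_norm _).
have D := derivable_under_integral mK Is iF derF G0 iG Gub.
have V := differentiation_under_integral mK Is iF derF G0 iG Gub.
apply: DeriveDef; first exact: D.
rewrite -derive1E V; apply: eq_Rintegral => x _; exact: d1.
Qed.

Lemma smooth_partial_bounded K f : smooth f -> compact K -> (forall x, ~ K x -> f x = 0) ->
  exists M, forall i x, `|partial i f x| <= M.
Proof.
move=> sf cK f0.
have /choice[M MP] : forall i, exists M, forall x, `|partial i f x| <= M.
  move=> i; have pf0 x : ~ K x -> partial i f x = 0.
    by apply: partial_out => //; exact: compact_closed_rV.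
  have [M _ MP] := compact_support_bounded (smooth_continuous (smooth_partial i sf)) cK pf0.
  by exists M.
exists (\sum_i `|M i|) => i x; apply: (le_trans (MP i x)); apply: (le_trans (ler_norm _)).
by rewrite (bigD1 i)//= lerDl sumr_ge0.
Qed.

Lemma bounded_subset_cube K : compact K -> exists2 r : R, 0 < r & K `<=` cube 0 r.
Proof.
move=> cK; have /(_ 1 ltr01)[s _ sP] := finite_cube_cover cK.
pose r := \sum_(c <- s) \sum_i `|c 0 i| + 1.
have r0 : 0 < r by rewrite ltr_wpDl// sumr_ge0// => *; rewrite sumr_ge0.
exists r => // x /sP[c cs cx] i; rewrite mxE subr0.
have h1 : `|c 0 i| <= \sum_(c <- s) \sum_i `|c 0 i|.
  rewrite (big_rem c)//= -[leLHS]addr0 lerD//.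
    by rewrite (bigD1 i)//= lerDl sumr_ge0.
  by rewrite sumr_ge0// => *; rewrite sumr_ge0.
have := cx i; rewrite -{2}(subrK (c 0 i) (x 0 i)) => h2.
by apply: (le_trans (ler_normD _ _)); rewrite /r; lra.
Qed.

(** Over a cube larger than the support by a margin of 1, the integral of [f (x + t e_i)] is
    constant for [|t| < 1]; its derivative at 0 is the integral of the partial derivative. *)
Lemma integral_partial K f i : smooth f -> compact K -> (forall x, ~ K x -> f x = 0) ->
  \int[leb]_(x in K) partial i f x = 0.
Proof.
move=> sf cK f0; have [r r0 Kr] := bounded_subset_cube cK.
pose L : set rV := cube 0 (r + 1).
have cL : compact L by exact: cube_compact.
have KL : K `<=` L by apply: subset_trans Kr _; apply: sub_cube; lra.
have bf := smooth_bounded_measurable sf cK f0.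
have b1 : @bounded_measurable R n (cst 1) by split => //; exists 1 => x /=; rewrite normr1.
have [X Y] := is_derive_shift_integral (delta_mx 0 i) 0 b1 cL sf (smooth_partial_bounded sf cK f0) bf.
have pf0 x : ~ K x -> partial i f x = 0.
  by apply: partial_out => //; exact: compact_closed_rV.
have -> : \int[leb]_(x in K) partial i f x = \int[leb]_(x in L) partial i f x.
  exact: (@Rintegral_support _ _ _ K).
move: Y; under [in RHS]eq_Rintegral => x _.
  rewrite scale0r addr0 mul1r (bigD1 i)//= big1 ?addr0; last first.
    by move=> j ji; rewrite mxE (negbTE ji) andbF mul0r.
  rewrite mxE !eqxx mul1r; over.
move=> <-.
have E (t : R) : `|t| < 1 -> \int[leb]_(x in L) (cst 1 x * f (x + t *: delta_mx 0 i)) = \int[leb]_x f x.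
  move=> t1; rewrite -(@Rintegral_translation f (t *: delta_mx 0 i)); last first.
    have := @compact_support_integrable K (cst 1) f b1 bf cK f0.
    by apply: eq_integrable => // x _ /=; rewrite mul1r.
  rewrite Rintegral_mkcond; apply: eq_Rintegral => x _; rewrite /patch.
  case: ifPn; first by rewrite mul1r.
  rewrite notin_setE => nL; rewrite f0// => /Kr h; apply: nL => j.
  have := h j; rewrite !mxE eqxx /= !subr0 => h1.
  rewrite -(addrK (t * (j == i)%:R) (x 0 j)); apply: (le_trans (ler_normB _ _)).
  rewrite lerD// normrM; case: (j == i); rewrite /= ?normr1 ?normr0 ?mulr1 ?mulr0//.
  exact: ltW.
rewrite (@near_eq_derive _ _ _ _ (cst (\int[leb]_x f x))) ?derive_cst//.
apply/nbhs_ballP; exists 1 => //= t; rewrite /ball/= sub0r normrN => t1.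
by rewrite E.
Qed.

Lemma fgradient_cst U (c : R) : fgradient U (cst c) (fun=> 0).
Proof.
have b1 : @bounded_measurable R n (cst c) by split => //; exists `|c|.
have vm : vector_measure U (fun=> 0).
  move=> A _ _ _; under eq_fun do rewrite big1//; exact: cvg_cst.
apply: pairing_fgradient => // K la g i f cK KU dg sf f0.
have -> : \int[leb]_(x in K) (cst c x * partial i f x) = c * \int[leb]_(x in K) partial i f x.
  rewrite -RintegralZl//; first exact: compact_measurable_rV.
  apply: bounded_measurable_integrable => //; first exact: compact_measurable_rV.
    exact: lebesgue_rV_compact.
  apply: (smooth_bounded_measurable (smooth_partial i sf) cK).
  by move=> x; apply: partial_out => //; exact: compact_closed_rV.
rewrite integral_partial// mulr0; apply/esym/eqP; rewrite oppr_eq0; apply/eqP.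
have mK := compact_measurable_rV cK.
have d0 : has_density la K (fun=> 0) (fun A : set rV => (0 : rV) 0 i).
  split; first exact: integrable0.
  by move=> A mA _; rewrite Rintegral_cst// mul0r mxE.
have [M _ fM] := compact_support_bounded (smooth_continuous sf) cK f0.
have := vintegral_density cK KU (dg i) (smooth_measurable sf) fM f0.
rewrite (vintegral_density cK KU d0 (smooth_measurable sf) fM f0) => -[<-].
by under eq_Rintegral do rewrite mulr0; rewrite Rintegral_cst// mul0r.
Qed.

End translations.

(** * Poincare and isoperimetric inequalities *)

Section translation_estimate.
Context {R : realType} {n : nat}.
Local Notation rV := 'rV[R]_n.
Local Notation leb := (@lebesgue_rV R n).
Implicit Types (la : {finite_measure set rV -> \bar R}) (A B K L U V : set rV) (u f phi : rV -> R)
  (nu : set rV -> rV) (h : rV).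

Definition dirc (h : rV) (g : 'I_n -> rV -> R) (x : rV) : R := \sum_i h 0 i * g i x.

Lemma integrable_dirc la h (g : 'I_n -> rV -> R) :
  (forall i, la.-integrable setT (EFin \o g i)) -> la.-integrable setT (EFin \o dirc h g).
Proof.
move=> ig; have -> : EFin \o dirc h g = (fun x => \sum_(i <- index_enum 'I_n) (h 0 i)%:E * (EFin \o g i) x)%E.
  by apply/funext => x /=; rewrite -sumEFin; apply: eq_bigr => i _; rewrite EFinM.
by apply: integrable_sum => // i _; apply: integrableZl.
Qed.

Lemma dirc_le (h : rV) (g : 'I_n -> rV -> R) x : `|dirc h g x| <= enorm h * vnorm g x.
Proof.
have E k : dirc k g x = \sum_i k 0 i * (\row_i g i x) 0 i.
  by apply: eq_bigr => i _; rewrite mxE.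
rewrite ler_norml; apply/andP; split; last by rewrite E; exact: cauchy_schwarz.
rewrite lerNl -(enormN h); have -> : - dirc h g x = dirc (- h) g x.
  by rewrite /dirc -sumrN; apply: eq_bigr => i _; rewrite mxE mulNr.
by rewrite E; exact: cauchy_schwarz.
Qed.

Lemma Rintegral_restr (mu : {measure set rV -> \bar R}) la A K f :
  (forall A, la A = mu (A `&` K)) -> measurable A -> A `<=` K ->
  \int[la]_(x in A) f x = \int[mu]_(x in A) f x.
Proof.
move=> laE mA AK; congr fine; apply: eq_measure_integral => B mB BA.
by apply: (etrans (laE B)); congr (mu _); apply/setIidl; exact: subset_trans AK.
Qed.

Section shift.
Variables (U : set rV) (u : rV -> R) (nu : set rV -> rV) (L : set rV)
  (la : {finite_measure set rV -> \bar R}) (g : 'I_n -> rV -> R).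
Hypotheses (bu : bounded_measurable u) (gu : fgradient U u nu) (cL : compact L) (LU : L `<=` U)
  (dg : forall i, has_density la L (g i) (fun A => nu A 0 i)).

Let mL := compact_measurable_rV cL.

(** The translation is put on the smooth function, where it can be differentiated under the
    integral; the definition of the gradient then moves the derivative to [u]. The translated
    support has to stay in [L], where [nu] has a density. *)
Lemma is_derive_shift_gradient K phi h (s : R) : smooth phi -> compact K ->
  (forall x, ~ K x -> phi x = 0) -> (forall x, K x -> L (x + s *: h)) ->
  is_derive s 1 (fun s : R => \int[leb]_(x in L) (u x * phi (x - s *: h)))
    (\int[la]_(x in L) (phi (x - s *: h) * dirc h g x)).
Proof.
move=> sphi cK phi0 KL.
have [M pM] := smooth_partial_bounded sphi cK phi0.
have bphi := smooth_bounded_measurable sphi cK phi0.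
have := is_derive_shift_integral (- h) s bu cL sphi (ex_intro _ M pM) bphi.
under eq_fun => t do under eq_Rintegral => x _ do rewrite scalerN.
set psi := fun x => phi (x - s *: h).
have spsi : smooth psi by exact: smooth_translation.
have psi0 x : ~ L x -> psi x = 0.
  by move=> nL; apply: phi0 => /KL; rewrite subrK.
have ppsi i x : partial i psi x = partial i phi (x + s *: - h).
  by rewrite /psi partial_translation scalerN.
have ppsi0 i x : ~ L x -> partial i psi x = 0.
  by apply: partial_out => //; exact: compact_closed_rV.
have bpsi i : bounded_measurable (partial i psi).
  exact: (smooth_bounded_measurable (smooth_partial i spsi) cL (ppsi0 i)).
have ib i : leb.-integrable L (EFin \o (fun x => u x * partial i psi x)).
  apply: bounded_measurable_integrable => //; first exact: lebesgue_rV_compact.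
  exact: bounded_measurableM.
have -> : \int[leb]_(x in L) (u x * (\sum_i (- h) 0 i * partial i phi (x + s *: - h))) =
  \int[la]_(x in L) (phi (x - s *: h) * dirc h g x); last by [].
transitivity (\int[leb]_(x in L) (\sum_(i <- index_enum 'I_n) (- h 0 i) * (u x * partial i psi x))).
  apply: eq_Rintegral => x _; rewrite mulr_sumr; apply: eq_bigr => i _.
  by rewrite ppsi mxE mulrCA.
transitivity (\int[la]_(x in L) (\sum_(i <- index_enum 'I_n) h 0 i * (psi x * g i x))); last first.
  apply: eq_Rintegral => x _; rewrite mulr_sumr; apply: eq_bigr => i _.
  by rewrite mulrCA.
have [Mp _ psiM] := compact_support_bounded (smooth_continuous spsi) cL psi0.
have ip i : la.-integrable L (EFin \o (fun x => psi x * g i x)).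
  apply: (bounded_mul_integrable mL (measurable_funTS (smooth_measurable spsi))).
    by move=> x _; exact: (psiM x).
  by apply: integrable_sub => //; case: (dg i).
have iZ (mu : {measure set rV -> \bar R}) (c : R) (f : rV -> R) : mu.-integrable L (EFin \o f) -> mu.-integrable L (EFin \o (fun x => c * f x)).
  move=> ifn; have -> : EFin \o (fun x => c * f x) = (fun x => c%:E * (EFin \o f) x)%E.
    by apply/funext => x /=; rewrite EFinM.
  exact: integrableZl.
rewrite Rintegral_sum//; last by move=> i; exact: iZ.
rewrite Rintegral_sum//; last by move=> i; exact: iZ.
apply: eq_bigr => i _; rewrite RintegralZl// RintegralZl//.
by rewrite (fgradient_pairing bu gu cL LU (dg i) spsi psi0) mulrN mulNr opprK.
Qed.

Lemma shift_diff K phi h (s : R) : smooth phi -> compact K ->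
  (forall x, ~ K x -> phi x = 0) -> K `<=` L -> (forall x, K x -> L (x + s *: h)) ->
  \int[leb]_(x in L) (u x * phi (x - s *: h)) - \int[leb]_(x in L) (u x * phi (x - 0 *: h)) =
  \int[leb]_(x in K) (phi x * (u (x + s *: h) - u x)).
Proof.
move=> sphi cK phi0 KL KLs; have mK := compact_measurable_rV cK.
have bphi := smooth_bounded_measurable sphi cK phi0.
set psi := fun x => phi (x - s *: h).
have spsi : smooth psi by exact: smooth_translation.
have psi0 x : ~ L x -> psi x = 0.
  by move=> nL; apply: phi0 => /KLs; rewrite subrK.
have bpsi := smooth_bounded_measurable spsi cL psi0.
have -> : \int[leb]_(x in L) (u x * psi x) = \int[leb]_(x in K) (phi x * u (x + s *: h)).
  rewrite (@Rintegral_support _ _ _ L L setT)//; last by move=> x /psi0 ->; rewrite mulr0.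
  rewrite -(@Rintegral_translation _ _ _ (s *: h)); last exact: compact_support_integrable cL psi0.
  rewrite (@Rintegral_support _ _ _ K K setT)//; last by move=> x /phi0 ->; rewrite mul0r.
  by apply: eq_Rintegral => x _; rewrite /psi addrK mulrC.
have -> : \int[leb]_(x in L) (u x * phi (x - 0 *: h)) = \int[leb]_(x in K) (phi x * u x).
  rewrite (@Rintegral_support _ _ _ K L K)//; last first.
    by move=> x /phi0; rewrite scale0r subr0 => ->; rewrite mulr0.
  by apply: eq_Rintegral => x _; rewrite scale0r subr0 mulrC.
have bus : bounded_measurable (fun x => u (x + s *: h)).
  have [mu [M uM]] := bu; split; last by exists M.
  by apply: (measurableT_comp mu); exact: measurable_translation.
rewrite -RintegralB//.
- by apply: eq_Rintegral => x _; rewrite mulrBr.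
- apply: bounded_measurable_integrable => //; first exact: lebesgue_rV_compact.
  exact: bounded_measurableM.
- apply: bounded_measurable_integrable => //; first exact: lebesgue_rV_compact.
  exact: bounded_measurableM.
Qed.

Let ig i : la.-integrable setT (EFin \o g i).
Proof. by case: (dg i). Qed.

Lemma integrable_abs_dirc h : la.-integrable L (EFin \o (fun x => `|dirc h g x|)).
Proof. by apply: integrable_sub => //; apply: integrable_norm (integrable_dirc h ig). Qed.

(* Mean value theorem along s |-> \int u(x) phi(x - s h) dx, whose derivative is
   the integral of phi(x - s h) against the h-component of the gradient of u. *)
Lemma translation_le A V K h : measurable A -> A `<=` V -> open V -> V `<=` K -> compact K ->
  K `<=` L -> (forall x (s : R), K x -> -1 < s < 2 -> L (x + s *: h)) ->
  \int[leb]_(x in A) `|u (x + h) - u x| <= \int[la]_(x in L) `|dirc h g x|.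
Proof.
move=> mA AV oV VK cK KL Ks; have mK := compact_measurable_rV cK.
have [P PE] := ex_measure_restr mK (lebesgue_rV_compact cK).
have bus : bounded_measurable (fun x => u (x + h)).
  have [mu [M uM]] := bu; split; last by exists M.
  by apply: (measurableT_comp mu); exact: measurable_translation.
pose w x := u (x + h) - u x.
have bw : bounded_measurable w.
  have -> : w = (fun x => u (x + h) + (-1) * u x) by apply/funext => x; rewrite mulN1r.
  by apply: bounded_measurableD => //; exact: bounded_measurableZ.
have iw : P.-integrable setT (EFin \o w).
  by apply: bounded_measurable_integrable => //; exact: finite_measure_lty.
apply/ler_addgt0Pr => e e0.
have AK := subset_trans AV VK.
have [phi [tphi phi1 h1]] := dual_approx iw mA AK cK oV AV e0.
rewrite -(Rintegral_restr _ PE)//; apply: (le_trans h1); rewrite lerD2r.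
have sphi : smooth phi by case: tphi.
have phi0 x : ~ K x -> phi x = 0.
  by have [C [_ CV c0]] := test_functionE tphi; move=> nK; apply: c0 => /CV/VK.
have -> : \int[P]_x (phi x * w x) = \int[leb]_(x in K) (phi x * w x).
  rewrite (@Rintegral_support _ _ _ K setT K)//; last by move=> x /phi0 ->; rewrite mul0r.
  exact: Rintegral_restr PE _ _.
have := @shift_diff K phi h 1 sphi cK phi0 KL.
rewrite scale1r => <-; last by move=> x Kx; rewrite -[h]scale1r; apply: Ks => //; apply/andP; split; lra.
pose F (s : R) := \int[leb]_(x in L) (u x * phi (x - s *: h)).
have dF (s : R) : -1 < s < 2 -> is_derive s 1 F (\int[la]_(x in L) (phi (x - s *: h) * dirc h g x)).
  by move=> s12; apply: (is_derive_shift_gradient (K := K)) => // x Kx; exact: Ks.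
have [s s01||s] := @MVT_segment R F (fun s => \int[la]_(x in L) (phi (x - s *: h) * dirc h g x)) 0 1 ler01.
- by move: s01; rewrite in_itv/= => /andP[? ?]; apply: dF; apply/andP; split; lra.
- apply: derivable_within_continuous => s; rewrite in_itv/= => /andP[? ?].
  by have [|] := dF s; first by apply/andP; split; lra.
- rewrite in_itv/= => /andP[s0 s1]; rewrite /F scale1r subr0 mulr1 => ->.
have s12 : -1 < s < 2 by apply/andP; split; lra.
have ipw : la.-integrable L (EFin \o (fun x => phi (x - s *: h) * dirc h g x)).
  apply: (@bounded_mul_integrable _ _ _ la L (fun x => phi (x - s *: h)) (dirc h g) 1) => //.
  - by apply: measurable_funTS; apply: smooth_measurable; exact: smooth_translation.
  - by apply: integrable_sub => //; exact: integrable_dirc.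
apply: (le_trans (ler_norm _)); apply: (le_trans (le_normr_Rintegral mL ipw)).
apply: le_Rintegral => //.
- exact: integrable_norm ipw.
- exact: integrable_abs_dirc.
- by move=> x _; rewrite normrM ler_piMl.
Qed.

Lemma translation_norm_le A V K h : measurable A -> A `<=` V -> open V -> V `<=` K -> compact K ->
  K `<=` L -> (forall x (s : R), K x -> -1 < s < 2 -> L (x + s *: h)) ->
  \int[leb]_(x in A) `|u (x + h) - u x| <= enorm h * \int[la]_(x in L) vnorm g x.
Proof.
move=> mA AV oV VK cK KL Ks; apply: (le_trans (translation_le mA AV oV VK cK KL Ks)).
have iv : la.-integrable L (EFin \o vnorm g).
  by apply: integrable_sub => //; exact: integrable_vnorm.
rewrite -RintegralZl//; apply: le_Rintegral => //.
- exact: integrable_abs_dirc.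
- have -> : EFin \o (fun x => enorm h * vnorm g x) = (fun x => (enorm h)%:E * (EFin \o vnorm g) x)%E.
    by apply/funext => x /=; rewrite EFinM.
  exact: integrableZl.
- by move=> x _; exact: dirc_le.
Qed.

End shift.

Lemma cube_enorm_le (h : rV) (r : R) : cube 0 r h -> enorm h <= n%:R * r.
Proof.
move=> hr; apply: (le_trans (enorm_le_sum _)).
apply: (@le_trans _ _ (\sum_(i < n) r)).
  by apply: ler_sum => i _; have := hr i; rewrite mxE subr0.
by rewrite sumr_const card_ord -[leLHS]mulr_natl.
Qed.

(** The range of [s] is an open interval around the segment from 0 to 1, so that the mean value
    theorem finds two-sided derivatives at the endpoints. Since [|s| <= 2], it costs a margin of
    [2 r1]. *)
Lemma cube_shift (c x h : rV) (r r1 s : R) : cube c r x -> cube 0 r1 h -> -1 < s < 2 ->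
  cube c (r + 2 * r1) (x + s *: h).
Proof.
move=> cx ch /andP[s1 s2] i; have := cx i; have := ch i; rewrite !mxE subr0 => h1 h2.
rewrite addrAC; apply: (le_trans (ler_normD _ _)); rewrite lerD// normrM ler_pM//.
by rewrite ler_norml; apply/andP; split; lra.
Qed.

Lemma Rintegral_indic (mu : {measure set rV -> \bar R}) A B : measurable A -> measurable B ->
  \int[mu]_(x in A) \1_B x = fine (mu (B `&` A)).
Proof. by move=> mA mB; rewrite /Rintegral integral_indic. Qed.

End translation_estimate.

Section isoperimetric.
Context {R : realType} {n : nat}.
Local Notation rV := 'rV[R]_n.
Local Notation leb := (@lebesgue_rV R n).
Implicit Types (la : {finite_measure set rV -> \bar R}) (A B K L U V W Z : set rV)
  (nu : set rV -> rV) (h : rV).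

(** By [lebesgue_rV_correlation] the product of the volumes is the integral over [h] of the volume
    of the points [x] of [A] with [x + h] in [B]. Differences of points of the cube lie in
    [cube 0 (2 r)], of volume [(4 r)^n]; for such [h] the integrand is at most [|h|] times the total
    variation, and [|h| <= n (2 r)]. The radius [6 r] is [2 r] plus the margin [2 (2 r)] of
    [cube_shift]. *)
Lemma poincare U W nu (c : rV) (r : R) (p : R) : measurable W ->
  is_gradient U W nu -> 0 < r -> cube c (6 * r) `<=` U ->
  (Defs.total_variation U nu (cube c (6 * r)) <= p%:E)%E ->
  fine (leb (cube c r `\` W)) * fine (leb (cube c r `&` W)) <=
    (4 * r) ^+ n * (n%:R * (2 * r) * p).
Proof.
move=> mW gW r0 cU tvp.
have cL : compact (cube c (6 * r)) by exact: cube_compact.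
have nuU : vector_measure U nu by case: gW.
have [la [g gP]] := @vm_density R n unit U _ (fun=> nu) (fun=> nuU) cL cU.
have dg := gP tt.
have bW : bounded_measurable (\1_W : rV -> R) by exact: bounded_measurable_indic.
have gu : fgradient U \1_W nu by [].
have mQ := measurable_cube c r.
set A := cube c r `\` W; set B := cube c r `&` W.
have mA : measurable A by exact: measurableD.
have mB : measurable B by exact: measurableI.
have iv : \int[la]_(x in cube c (6 * r)) vnorm (g tt) x <= p.
  rewrite -lee_fin EFin_Rintegral//; [|exact: measurable_cube|]; last first.
    apply: integrable_sub; first exact: measurable_cube.
    by apply: integrable_vnorm => i; case: (dg i).
  by rewrite -(total_variation_density nuU cL cU dg) //; exact: measurable_cube.
have p0 : 0 <= p by apply: le_trans iv; apply: Rintegral_ge0 => x _; exact: enorm_ge0.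
have fin D : measurable D -> D `<=` cube c r -> leb D \is a fin_num.
  by move=> mD DQ; rewrite ge0_fin_numE//; exact: lebesgue_rV_bounded mD DQ.
have AQ : A `<=` cube c r by move=> x [].
have BQ : B `<=` cube c r by move=> x [].
have key (h : rV) : (leb (A `&` [set x | B (x + h)%R]) <=
    ((n%:R * (2 * r) * p)%:E * (\1_(cube (0 : rV) (2 * r)) h)%:E))%E.
  have mS : measurable (A `&` [set x | B (x + h)]).
    by apply: measurableI => //; exact: measurable_preimage_translation.
  rewrite indicE; have [h2|h2] := boolP (h \in _); last first.
    rewrite mule0 (_ : _ `&` _ = set0) ?measure0//.
    apply/seteqP; split => // x [[Qx _] [Qxh _]].
    rewrite notin_setE in h2; apply: h2 => i; have := Qx i; have := Qxh i; rewrite !mxE subr0.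
    rewrite -{2}(addrK (c 0 i - x 0 i) (h 0 i)) => a b.
    rewrite (_ : h 0 i + _ = x 0 i + h 0 i - c 0 i - (x 0 i - c 0 i) + (c 0 i - x 0 i)); last by ring.
    rewrite addrK; apply: (le_trans (ler_normB _ _)); lra.
  rewrite inE in h2; rewrite mule1 -[leLHS]fineK; last by apply: fin => // x [/AQ].
  rewrite lee_fin -[X in fine (leb X)]setIid -Rintegral_indic//.
  apply: (@le_trans _ _ (\int[leb]_(x in A `&` [set x | B (x + h)]) `|\1_W (x + h) - \1_W x|)).
    rewrite le_eqVlt; apply/orP; left; apply/eqP; apply: eq_Rintegral => x; rewrite inE => Sx.
    have [[Qx nWx] [Qxh Wxh]] := Sx.
    by rewrite !indicE mem_set// mem_set// memNset// subr0 normr1.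
  apply: le_trans (@translation_norm_le R n U \1_W nu (cube c (6 * r)) la (g tt) bW gu cL cU dg
    _ (ocube c (2 * r)) (cube c (2 * r)) h mS _ (@ocube_open _ _ _ _) (@ocube_sub _ _ _ _)
    (@cube_compact _ _ _ _) _ _) _.
  - by move=> x [/AQ Qx _]; apply: cube_sub_ocube Qx; lra.
  - by apply: sub_cube; lra.
  - move=> x s Qx s12; apply: (sub_cube _ (cube_shift Qx h2 s12)); lra.
  - by apply: ler_pM => //; [exact: enorm_ge0|apply: Rintegral_ge0 => x _; exact: enorm_ge0|exact: cube_enorm_le].
have := lebesgue_rV_correlation mA mB.
rewrite -(fineK (fin A mA AQ)) -(fineK (fin B mB BQ)) -EFinM => E.
rewrite -lee_fin -E.
apply: (@le_trans _ _ (\int[leb]_h ((n%:R * (2 * r) * p)%:E * (\1_(cube (0 : rV) (2 * r)) h)%:E))%E).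
  apply: ge0_le_integral => //.
  - exact: measurable_correlation.
  - apply/measurable_EFinP; apply: measurable_funM => //; apply: measurable_indic.
    exact: measurable_cube.
rewrite ge0_integralZl_EFin//.
- rewrite integral_indic//; last exact: measurable_cube.
  have r2 : 0 <= 2 * r by rewrite mulr_ge0// ltW.
  have lE : ((n%:R * (2 * r) * p)%:E * leb (cube (0 : rV) (2 * r) `&` setT) =
      ((4 * r) ^+ n * (n%:R * (2 * r) * p))%:E)%E.
    by rewrite setIT lebesgue_rV_cube// -EFinM mulrC; congr ((_ ^+ _ * _)%:E); ring.
  by rewrite le_eqVlt; apply/orP; left; apply/eqP; exact: lE.
- by apply/measurable_EFinP; apply: measurable_indic; exact: measurable_cube.
- by do ![apply: mulr_ge0 => //]; exact: ltW.
Qed.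

(** Here [A] and [B] are both [Z]: the volumes [|Z \cap (Z - h)|] integrate to [v^2], and each of
    them is at least [v - n rho p] for [h] in the cube of radius [rho]. Hence
    [2 v (v - n rho p) <= v^2], so [v <= 2 n rho p], and the [n]-th power of this is the claim. *)
Lemma isoperimetric Z nu (r p : R) : (1 < n)%N -> measurable Z -> is_gradient setT Z nu ->
  Z `<=` cube 0 r -> (Defs.total_variation setT nu setT <= p%:E)%E ->
  fine (leb Z) ^+ n.-1 <= 2 * (n%:R * p) ^+ n.
Proof.
move=> n1 mZ gZ Zr tvp; set v := fine (leb Z).
have v0 : 0 <= v by exact: fine_ge0.
have nuU : vector_measure setT nu by case: gZ.
have p0 : 0 <= p by rewrite -lee_fin; apply: le_trans tvp; have [mu ->] := ex_total_variation nuU.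
have vfin : leb Z \is a fin_num by rewrite ge0_fin_numE//; exact: lebesgue_rV_bounded mZ Zr.
have n0 : (0 < n)%N by exact: ltnW.
have n0R : (n%:R : R) != 0 by rewrite pnatr_eq0 -lt0n.
have [v00|v_neq0] := eqVneq v 0.
  by rewrite v00 expr0n/= -subn1 subn_eq0 leqNgt n1/= mulr_ge0// exprn_ge0// mulr_ge0.
have vgt0 : 0 < v by rewrite lt_neqAle eq_sym v_neq0.
(* Chosen such that the cube of radius [rho] has volume [2 v], twice that of [Z]. *)
pose rho := (2 * v) `^ (n%:R^-1) / 2.
have rhoE : (2 * rho) ^+ n = 2 * v.
  rewrite /rho mulrC divfK// -powR_mulrn ?powR_ge0// -powRrM mulVf// powRr1//.
  by rewrite mulr_ge0.
have rho0 : 0 < rho by rewrite divr_gt0// powR_gt0// mulr_gt0.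
suff main : v <= 2 * (n%:R * rho * p).
  have E : v ^+ n = v ^+ n.-1 * v by rewrite -exprSr prednK.
  rewrite -(ler_pM2r vgt0) -E; apply: le_trans (_ : (2 * (n%:R * rho * p)) ^+ n <= _).
    have rho00 := ltW rho0.
    have q0 : 0 <= 2 * (n%:R * rho * p) by do ![apply: mulr_ge0 => //].
    by apply: lerXn2r.
  rewrite (_ : 2 * (n%:R * rho * p) = (2 * rho) * (n%:R * p)); last by ring.
  by rewrite exprMn rhoE le_eqVlt; apply/orP; left; apply/eqP; ring.
(* If [v] is at most [n rho p] the bound is immediate; otherwise the lower bound for the integrand
   is positive, as the comparison of integrals below requires. *)
have [//|vp] := leP v (n%:R * rho * p).
  by move=> h; apply: (le_trans h); have rho00 := ltW rho0; have : 0 <= n%:R * rho * p by [do ![apply: mulr_ge0 => //]]; lra.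
pose L : set rV := cube 0 (r + 1 + 2 * rho).
have cL : compact L by exact: cube_compact.
have [la [g gP]] := @vm_density R n unit setT _ (fun=> nu) (fun=> nuU) cL (@subsetT _ _).
have dg := gP tt.
have bZ : bounded_measurable (\1_Z : rV -> R) by exact: bounded_measurable_indic.
have gu : fgradient setT \1_Z nu by [].
have mL : measurable L by exact: measurable_cube.
have iv : \int[la]_(x in L) vnorm (g tt) x <= p.
  rewrite -lee_fin EFin_Rintegral//; last first.
    by apply: integrable_sub => //; apply: integrable_vnorm => i; case: (dg i).
  rewrite -(total_variation_density nuU cL (@subsetT _ _) dg) //.
  by apply: le_trans tvp; apply: total_variationS.
have key (h : rV) : cube 0 rho h -> ((v - n%:R * rho * p)%:E <= leb (Z `&` [set x | Z (x + h)%R]))%E.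
  move=> hr; have mZh := measurable_preimage_translation h mZ.
  have mS : measurable (Z `&` [set x | Z (x + h)]) by exact: measurableI.
  have sfin : leb (Z `&` [set x | Z (x + h)]) \is a fin_num.
    rewrite ge0_fin_numE//; apply: lebesgue_rV_bounded mS _ => x [/Zr q _]; exact: q.
  have dfin : leb (Z `\` [set x | Z (x + h)]) \is a fin_num.
    rewrite ge0_fin_numE//; apply: (lebesgue_rV_bounded (measurableD mZ mZh)) => x [/Zr q _]; exact: q.
  rewrite -(fineK sfin) lee_fin lerBlDr.
  have -> : v = fine (leb (Z `&` [set x | Z (x + h)])) + fine (leb (Z `\` [set x | Z (x + h)])).
    rewrite -fineD// -measureU//; last first.
    + by rewrite setDE setIACA setICr setI0.
    + exact: measurableD.
    by rewrite setUIDK.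
  rewrite lerD2l.
  apply: le_trans (le_trans (@translation_norm_le R n setT \1_Z nu L la (g tt) bZ gu cL (@subsetT _ _) dg
    Z (ocube 0 (r + 1)) (cube 0 (r + 1)) h mZ _ (@ocube_open _ _ _ _) (@ocube_sub _ _ _ _)
    (@cube_compact _ _ _ _) _ _) _).
  - rewrite -[X in fine (leb X)](setIidr (_ : Z `\` [set x | Z (x + h)] `<=` Z)); last by move=> x [].
    rewrite setIC -Rintegral_indic//; last exact: measurableD.
    rewrite le_eqVlt; apply/orP; left; apply/eqP; apply: eq_Rintegral => x; rewrite inE => Zx.
    rewrite !indicE; rewrite (mem_set Zx); have [Zxh|nZxh] := pselect (Z (x + h)).
      by rewrite (mem_set Zxh) memNset ?subrr ?normr0// => -[_]; apply.
    by rewrite (memNset nZxh) mem_set// sub0r normrN normr1.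
  - by move=> x /Zr Qx; apply: cube_sub_ocube Qx; lra.
  - by apply: sub_cube; lra.
  - by move=> x s Qx s12; exact: cube_shift Qx hr s12.
  - by apply: ler_pM => //; [exact: enorm_ge0|apply: Rintegral_ge0 => x _; exact: enorm_ge0|exact: cube_enorm_le].
have := lebesgue_rV_correlation mZ mZ; rewrite -(fineK vfin) -/v -EFinM => E.
have : ((v - n%:R * rho * p)%:E * leb (cube (0 : rV) rho) <= (v * v)%:E)%E.
  rewrite -E -integral_cst; last exact: measurable_cube.
  apply: (@le_trans _ _ (\int[leb]_(h in cube (0 : rV) rho) leb (Z `&` [set x | Z (x + h)%R]))%E).
    apply: ge0_le_integral => //.
    + exact: measurable_cube.
    + by move=> h _; rewrite lee_fin subr_ge0 ltW.
    + by apply: measurable_funTS; exact: measurable_correlation.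
  apply: ge0_subset_integral => //; first exact: measurable_cube.
  exact: measurable_correlation.
have cE : leb (cube (0 : rV) rho) = (2 * v)%:E.
  by rewrite -rhoE; apply: lebesgue_rV_cube; exact: ltW.
rewrite cE -EFinM lee_fin => h.
have : v * (2 * (v - n%:R * rho * p)) <= v * v by apply: le_trans h; rewrite le_eqVlt; apply/orP; left; apply/eqP; ring.
rewrite ler_pM2l// => h2; lra.
Qed.

End isoperimetric.

(** * Extension by zero from an open set to the whole space *)

Section extension.
Context {R : realType} {n : nat}.
Local Notation rV := 'rV[R]_n.
Local Notation leb := (@lebesgue_rV R n).
Implicit Types (la : {finite_measure set rV -> \bar R}) (A B C K L U V : set rV) (u f phi : rV -> R)
  (nu : set rV -> rV) (h : rV).

(** The integral of the absolute value of a density is inner regular, so a nonzero value of [nu] on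
    [A] would already show on some compact subset. *)
Lemma vm_inner_zero U nu A : open U -> vector_measure U nu -> interior_borel U A ->
  (forall C, compact C -> C `<=` A -> nu C = 0) -> nu A = 0.
Proof.
move=> oU nuU [mA /compactly_containedE[K [cK AK KU]]] H.
have [la [g gP]] := @vm_density R n unit U K (fun=> nu) (fun=> nuU) cK KU.
apply/rowP => i; rewrite mxE.
have [ig gE] := gP tt i; rewrite /= in gE.
have [P [PE _]] := ex_density_measure (integrable_norm ig) (fun x => normr_ge0 (g tt i x)).
apply/eqP; rewrite -normr_le0; apply/ler_addgt0Pr => e e0; rewrite add0r.
have [C [V [cC oV CA [AV _] h]]] := finite_measure_squeeze P mA AK cK oU (subset_trans AK KU) e0.
have mC := compact_measurable_rV cC.
have mD : measurable (A `\` C) by exact: measurableD.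
have -> : nu A 0 i = nu C 0 i + \int[la]_(x in A `\` C) g tt i x.
  rewrite gE// gE//; last exact: subset_trans AK.
  rewrite -Rintegral_setU//.
  - by rewrite setDUK.
  - by rewrite setDUK//; apply: integrable_sub.
  - by rewrite disj_set2E setDIK.
rewrite H// mxE add0r.
have iD : la.-integrable (A `\` C) (EFin \o g tt i) by exact: integrable_sub.
apply: (le_trans (le_normr_Rintegral mD iD)).
rewrite -lee_fin EFin_Rintegral//; last exact: integrable_norm.
rewrite -PE//; apply: ltW; apply: le_lt_trans h; apply: le_measure; rewrite ?inE//.
  by apply: measurableD => //; exact: open_measurable_rV.
by move=> x [/AV Vx nCx].
Qed.

Lemma vmD U nu A B : vector_measure U nu -> interior_borel U A -> measurable B ->
  nu A = nu (A `&` B) + nu (A `\` B).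
Proof.
move=> nuU [mA /compactly_containedE[K [cK AK KU]]] mB.
have [la [g gP]] := @vm_density R n unit U K (fun=> nu) (fun=> nuU) cK KU.
have mI : measurable (A `&` B) by exact: measurableI.
have mD : measurable (A `\` B) by exact: measurableD.
apply/rowP => i; rewrite mxE; have [ig gE] := gP tt i; rewrite /= in gE.
rewrite !gE//; try by move=> x [/AK].
rewrite -Rintegral_setU ?setUIDK//; first exact: integrable_sub.
by rewrite disj_set2E setDE setIACA setICr setI0.
Qed.

Lemma vintegral_eq U nu1 nu2 i f : (forall A, interior_borel U A -> nu1 A = nu2 A) ->
  vintegral U nu1 i f = vintegral U nu2 i f.
Proof.
move=> H; rewrite /vintegral.
have -> : pos_variation U nu1 i = pos_variation U nu2 i.
  apply/funext => E; congr ereal_sup; apply/seteqP.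
  by split => _ [A [iA AE] <-]; exists A => //; rewrite H.
have -> // : neg_variation U nu1 i = neg_variation U nu2 i.
  apply/funext => E; congr ereal_sup; apply/seteqP.
  by split => _ [A [iA AE] <-]; exists A => //; rewrite H.
Qed.

Lemma vm_restr U nu K : vector_measure U nu -> compact K -> K `<=` U ->
  vector_measure setT (fun A => nu (A `&` K)).
Proof.
move=> nuU cK KU A mA tA _; have mK := compact_measurable_rV cK.
rewrite setI_bigcupl; apply: (nuU (fun k => A k `&` K)).
- by move=> k; exact: measurableI.
- exact: trivIset_setIr.
- by apply: (sub_compactly_contained cK) => // x [k _ []].
Qed.

(** On the open set [U \ K] the function agrees with the constant 0, so locality makes the gradient
    vanish there. *)
Lemma gradient_supported U u nu K A : open U -> bounded_measurable u -> fgradient U u nu ->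
  compact K -> (forall x, ~ K x -> u x = 0) -> interior_borel U A -> nu A = nu (A `&` K).
Proof.
move=> oU bu gu cK u0 iA; have mK := compact_measurable_rV cK.
have nuU : vector_measure U nu by case: gu.
rewrite (vmD nuU iA mK) (_ : nu (A `\` K) = 0) ?addr0//.
have iAK : interior_borel U (A `\` K) by rewrite setDE; apply: interior_borelI => //; exact: measurableC.
apply: (vm_inner_zero oU nuU iAK) => C cC CA.
have oUK : open (U `\` K) by rewrite setDE; apply: openI => //; apply: closed_openC; exact: compact_closed_rV.
have AU : A `<=` U by have [_ /compactly_containedE[L [_ AL LU]]] := iA; exact: subset_trans AL LU.
have b0 : @bounded_measurable R n (cst 0) by split => //; exists 0 => x; rewrite normr0.
have := @fgradient_local R n U (U `\` K) u (cst 0) nu (fun=> 0) oU oUK.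
move=> /(_ (fun x => @proj1 _ _) bu b0 _ gu (fgradient_cst U 0) C); apply.
- by apply: aeW => x [_ /u0].
- split; first exact: compact_measurable_rV.
  by apply: (sub_compactly_contained cC) => // x /CA[/AU].
Qed.

(** A test function on the whole space is multiplied by a cutoff [chi] that equals 1 near [K]:
    neither side of the identity changes, as [u] vanishes off [K] and [nu] is concentrated on
    [K]. *)
Lemma fgradient_extend U u nu K : open U -> bounded_measurable u -> fgradient U u nu ->
  compact K -> K `<=` U -> (forall x, ~ K x -> u x = 0) ->
  fgradient setT u (fun A => nu (A `&` K)).
Proof.
move=> oU bu gu cK KU u0.
have nuU : vector_measure U nu by case: gu.
have vmK := vm_restr nuU cK KU.
apply: pairing_fgradient => // L la g i f cL _ dg sf f0.
have [chi [tchi _ [V [oV KV chi1]]]] := cutoff cK oU KU.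
have [M [cM MU chi0]] := test_functionE tchi.
have schi : smooth chi by case: tchi.
have mK := compact_measurable_rV cK; have mM := compact_measurable_rV cM.
have [la2 [g2 g2P]] := @vm_density R n unit U M (fun=> nu) (fun=> nuU) cM MU.
have dg2 := g2P tt i; rewrite /= in dg2.
have [ig2 g2E] := dg2.
pose F := f \* chi.
have sF : smooth F by exact: smoothM.
have F0 x : ~ M x -> F x = 0 by move=> /chi0 h; rewrite /F /= h mulr0.
have KM : K `<=` M.
  by move=> x /KV Vx; apply: contrapT => /chi0; rewrite chi1// => /eqP; rewrite oner_eq0.
have pF0 x : ~ M x -> partial i F x = 0.
  by apply: partial_out => //; exact: compact_closed_rV.
have pf0 x : ~ L x -> partial i f x = 0.
  by apply: partial_out => //; exact: compact_closed_rV.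
have h1 := fgradient_pairing bu gu cM MU dg2 sF F0.
have -> : \int[leb]_(x in L) (u x * partial i f x) = \int[leb]_(x in M) (u x * partial i F x).
  transitivity (\int[leb]_x (u x * partial i f x)).
    apply: (@Rintegral_support _ _ leb L); [exact: subset_refl|exact: subsetT|].
    by move=> x /pf0 ->; rewrite mulr0.
  transitivity (\int[leb]_x (u x * partial i F x)); last first.
    apply: (@Rintegral_support _ _ leb M); [exact: subsetT|exact: subset_refl|].
    by move=> x /pF0 ->; rewrite mulr0.
  apply: eq_Rintegral => x _; have [Kx|/u0 ->] := pselect (K x); last by rewrite !mul0r.
  congr (_ * _); apply: near_eq_partial.
  have := open_nbhs_nbhs (conj oV (KV _ Kx)); apply: filterS => y Vy.
  by rewrite /F /= chi1// mulr1.
rewrite h1; congr (- _).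
have dK N : has_density la2 N (fun x => \1_K x * g2 tt i x) (fun A => nu (A `&` K) 0 i).
  split.
    apply: (@bounded_mul_integrable _ _ _ la2 setT \1_K (g2 tt i) 1) => //.
    by move=> x _; rewrite indicE; case: (_ \in _); rewrite ?normr1 ?normr0.
  move=> A mA _; rewrite g2E; last 2 first.
  - exact: measurableI.
  - by move=> x [_ /KM].
  rewrite Rintegral_mkcondr; apply: eq_Rintegral => x _.
  by rewrite /patch indicE; case: (_ \in _); rewrite ?mul1r ?mul0r.
have [Mf _ fM] := compact_support_bounded (smooth_continuous sf) cL f0.
have [MF _ FM] := compact_support_bounded (smooth_continuous sF) cM F0.
have := vintegral_density cL (@subsetT _ L) (dg i) (smooth_measurable sf) fM f0.
rewrite (vintegral_density cL (@subsetT _ L) (dK L) (smooth_measurable sf) fM f0) => -[<-].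
have := vintegral_density cM MU dg2 (smooth_measurable sF) FM F0.
rewrite (@vintegral_eq U nu (fun A => nu (A `&` K))); last first.
  by move=> A iA; exact: (gradient_supported oU bu gu cK u0 iA).
rewrite (vintegral_density cM MU (dK M) (smooth_measurable sF) FM F0) => -[<-].
rewrite (@Rintegral_support _ _ _ M M setT)//; last by move=> x /F0 ->; rewrite mul0r.
rewrite (@Rintegral_support _ _ _ L L setT)//; last by move=> x /f0 ->; rewrite mul0r.
apply: eq_Rintegral => x _; rewrite indicE.
have [Kx|nKx] := pselect (K x); last by rewrite memNset// mul0r !mulr0.
by rewrite /F /= chi1 ?mulr1//; exact: KV.
Qed.

Lemma total_variation_restr U nu K E : compact K -> K `<=` U ->
  (Defs.total_variation setT (fun A => nu (A `&` K)) E <= Defs.total_variation U nu K)%E.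
Proof.
move=> cK KU; have mK := compact_measurable_rV cK.
apply: ge_ereal_sup => _ [m [A [iA tA _ ->]]].
apply: ereal_sup_ubound; exists m, (fun k => A k `&` K); split => //.
- move=> k; apply: (interior_borel_sub cK KU); last by move=> x [].
  by apply: measurableI => //; case: (iA k).
- exact: trivIset_setIr.
Qed.

(** [isoperimetric] translates sets freely and is therefore stated on the whole space; the extension
    by zero has no more total variation than [nu] has on [K]. *)
Lemma isoperimetric_compact U Z K nu (p : R) : (1 < n)%N -> open U -> measurable Z ->
  is_gradient U Z nu -> compact K -> K `<=` U -> Z `<=` K ->
  (Defs.total_variation U nu K <= p%:E)%E ->
  fine (leb Z) ^+ n.-1 <= 2 * (n%:R * p) ^+ n.
Proof.
move=> n1 oU mZ gZ cK KU ZK tvp.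
have [r r0 Kr] := bounded_subset_cube cK.
apply: (@isoperimetric _ _ Z (fun A => nu (A `&` K)) r) => //.
- apply: (fgradient_extend oU (bounded_measurable_indic mZ) gZ cK KU).
  by move=> x nKx; rewrite indicE memNset// => /ZK.
- exact: subset_trans Kr.
- by apply: le_trans tvp; exact: total_variation_restr.
Qed.

End extension.

(** * Gradients of disjoint sets *)

Section disjoint.
Context {R : realType} {n : nat}.
Local Notation rV := 'rV[R]_n.
Local Notation leb := (@lebesgue_rV R n).
Implicit Types (la : {finite_measure set rV -> \bar R}) (A B C K L U V S : set rV) (u f phi : rV -> R)
  (nu : set rV -> rV) (h : rV).

Lemma is_derive_le (f : R -> R) (d c e : R) : is_derive (0 : R) 1 f d -> 0 < e ->
  (forall t, 0 < t < e -> f t - f 0 <= c * t) -> d <= c.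
Proof.
move=> [df dE] e0 H.
have : (fun t : R => t^-1 *: (f t - f 0)) @ 0^'+ --> d.
  have h1 : (fun t : R => t^-1 *: (f t - f 0)) @ 0^' --> d.
    move: df; rewrite /derivable => /cvgP; rewrite -dE /derive.
    by under eq_fun do rewrite /= scaler1 addr0.
  exact: cvg_dnbhs_at_right.
move=> h; rewrite -(cvg_lim _ h)//; apply: limr_le; first by apply/cvg_ex; exists d.
near=> t.
have t0 : 0 < t by near: t; exact: nbhs_right_gt.
rewrite /= -[X in X <= _]/(t^-1 * (f t - f 0)) ler_pdivrMl// mulrC; apply: H; rewrite t0/=.
by near: t; exact: nbhs_right_lt.
Unshelve. all: by end_near.
Qed.

(** The two increments cannot both be 1, nor both be -1: one of the points [x], [y] would lie in
    both sets. *)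
Lemma disjoint_indic_diff A B x y : A `&` B = set0 ->
  `|(\1_A y - \1_B y) - (\1_A x - \1_B x)| = `|\1_A y - \1_A x| + `|\1_B y - \1_B x| :> R.
Proof.
move=> AB0.
have h z : ~ (z \in A /\ z \in B) by move=> []; rewrite !inE => Az Bz; rewrite -[False]/(set0 z) -AB0.
rewrite !indicE; have := h x; have := h y.
case: (y \in A); case: (y \in B); case: (x \in A); case: (x \in B) => h1 h2 /=;
  try (by case: h1); try (by case: h2);
  rewrite ?subrr ?subr0 ?sub0r ?opprK ?normr0 ?normrN ?normr1 ?addr0 ?add0r ?normrN ?normr1//.
- by rewrite ger0_norm// addr_ge0.
- by rewrite -opprD normrN ger0_norm// addr_ge0.
Qed.

(** The identity [disjoint_indic_diff] in the limit of small translations: almost optimal test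
    functions for the two terms on the left are shifted by [t h], the increments are bounded by
    those of [\1_A - \1_B] through [translation_le], and the one-sided derivative at [t = 0] is
    compared. *)
Lemma disjoint_gradients_le U A B nuA nuB L la (gA gB : 'I_n -> rV -> R) S V K h (e : R) :
  measurable A -> measurable B -> A `&` B = set0 ->
  is_gradient U A nuA -> is_gradient U B nuB -> compact L -> L `<=` U ->
  (forall i, has_density la L (gA i) (fun E => nuA E 0 i)) ->
  (forall i, has_density la L (gB i) (fun E => nuB E 0 i)) ->
  measurable S -> S `<=` V -> open V -> V `<=` K -> compact K -> 0 < e ->
  (forall x (s : R), K x -> `|s| < e -> L (x + s *: h)) ->
  \int[la]_(x in S) `|dirc h gA x| + \int[la]_(x in S) `|dirc h gB x| <=
  \int[la]_(x in L) `|dirc h gA x - dirc h gB x|.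
Proof.
move=> mA mB AB0 gA' gB' cL LU dA dB mS SV oV VK cK e0 KL.
have mK := compact_measurable_rV cK; have mL := compact_measurable_rV cL.
have iA i : la.-integrable setT (EFin \o gA i) by case: (dA i).
have iB i : la.-integrable setT (EFin \o gB i) by case: (dB i).
have KLs : K `<=` L by move=> x Kx; have := KL x 0 Kx; rewrite scale0r addr0 normr0; exact.
have SK := subset_trans SV VK.
have bA : bounded_measurable (\1_A : rV -> R) by exact: bounded_measurable_indic.
have bB : bounded_measurable (\1_B : rV -> R) by exact: bounded_measurable_indic.
apply/ler_addgt0Pr => d d0; have d2 : 0 < d / 2 by rewrite divr_gt0.
have [p [tp p1 hp]] := dual_approx (integrable_dirc h iA) mS SK cK oV SV d2.
have [q [tq q1 hq]] := dual_approx (integrable_dirc h iB) mS SK cK oV SV d2.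
have supp (w : rV -> R) : test_function V w -> smooth w /\ forall x, ~ V x -> w x = 0.
  by move=> tw; have [C [_ CV c0]] := test_functionE tw; split; [case: tw|move=> x nV; apply: c0 => /CV].
have [sp pV] := supp p tp; have [sq qV] := supp q tq.
have p0 x : ~ K x -> p x = 0 by move=> nK; apply: pV => /VK.
have q0 x : ~ K x -> q x = 0 by move=> nK; apply: qV => /VK.
have toL (w g : rV -> R) : (forall x, ~ K x -> w x = 0) ->
    \int[la]_x (w x * g x) = \int[la]_(x in L) (w (x - 0 *: h) * g x).
  move=> w0; rewrite (@Rintegral_support _ _ _ K setT L)//; last by move=> x /w0 ->; rewrite mul0r.
  by apply: eq_Rintegral => x _; rewrite scale0r subr0.
rewrite (toL p)// in hp; rewrite (toL q)// in hq.
have KL0 x : K x -> L (x + 0 *: h) by move=> Kx; apply: KL; rewrite ?normr0.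
have D1 := @is_derive_shift_gradient R n U _ _ L la gA bA gA' cL LU dA K p h 0 sp cK p0 KL0.
have D2 := @is_derive_shift_gradient R n U _ _ L la gB bB gB' cL LU dB K q h 0 sq cK q0 KL0.
suff main : \int[la]_(x in L) (p (x - 0 *: h) * dirc h gA x) +
    \int[la]_(x in L) (q (x - 0 *: h) * dirc h gB x) <=
    \int[la]_(x in L) `|dirc h gA x - dirc h gB x|.
  by clear - hp hq main; lra.
have [X Y] := is_deriveD D1 D2; rewrite -Y.
have e2 : 0 < e / 2 by rewrite divr_gt0.
apply: (is_derive_le (DeriveDef X (erefl _)) e2) => t /andP[t0 te].
have Kt x : K x -> L (x + t *: h).
  by move=> Kx; apply: KL => //; rewrite gtr0_norm//; clear -te e0; lra.
rewrite /= opprD addrACA.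
rewrite (shift_diff bA cL sp cK p0 KLs Kt) (shift_diff bB cL sq cK q0 KLs Kt).
pose u x : R := 1 * \1_A x + (-1) * \1_B x.
have gu : fgradient U u (fun E => 1 *: nuA E + (-1) *: nuB E) by exact: fgradient_lin.
have bu : bounded_measurable u by apply: bounded_measurableD; exact: bounded_measurableZ.
have du i : has_density la L (fun x => 1 * gA i x + (-1) * gB i x) (fun E => (1 *: nuA E + (-1) *: nuB E) 0 i).
  have -> : (fun E => (1 *: nuA E + (-1) *: nuB E) 0 i) = (fun E => 1 * nuA E 0 i + (-1) * nuB E 0 i).
    by apply/funext => E; rewrite !mxE.
  exact: has_density_lin.
have mV := open_measurable_rV oV.
have T := @translation_le R n U u _ L la _ bu gu cL LU du V V K (t *: h) mV (@subset_refl _ _) oV VK cK KLs.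
have {}T : \int[leb]_(x in V) `|u (x + t *: h) - u x| <= t * \int[la]_(x in L) `|dirc h gA x - dirc h gB x|.
  apply: (le_trans (T _)).
    move=> x s Kx /andP[s1 s2]; rewrite scalerA; apply: KL => //.
    rewrite normrM (gtr0_norm t0).
    have : `|s| < 2 by rewrite ltr_norml; apply/andP; split => //; clear -s1; lra.
    move=> s3; apply: (@le_lt_trans _ _ (2 * t)); first by rewrite ler_wpM2r// ltW.
    by clear -te; lra.
  rewrite -RintegralZl//; last first.
    apply: integrable_sub => //; apply: integrable_norm.
    have -> : EFin \o (fun x => dirc h gA x - dirc h gB x) = ((EFin \o dirc h gA) \- (EFin \o dirc h gB))%E by [].
    by apply: integrableB => //; exact: integrable_dirc.
  rewrite le_eqVlt; apply/orP; left; apply/eqP; apply: eq_Rintegral => x _.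
  rewrite -[X in X * _](gtr0_norm t0) -normrM; congr `|_|.
  rewrite /dirc -sumrB mulr_sumr; apply: eq_bigr => i _; rewrite mxE; ring.
rewrite mulrC; apply: le_trans T.
have bs w : bounded_measurable w -> bounded_measurable (fun x => w (x + t *: h)).
  move=> [mw [M wM]]; split; last by exists M.
  by apply: (measurableT_comp mw); exact: measurable_translation.
have bd w : bounded_measurable w -> bounded_measurable (fun x => w (x + t *: h) - w x).
  move=> bw; have -> : (fun x => w (x + t *: h) - w x) = (fun x => w (x + t *: h) + (-1) * w x).
    by apply/funext => x; rewrite mulN1r.
  by apply: bounded_measurableD; [exact: bs|exact: bounded_measurableZ].
have bn w : bounded_measurable w -> bounded_measurable (fun x => `|w x| : R).
  move=> [mw [M wM]]; split; last by exists M => x; rewrite normr_id.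
  exact: measurableT_comp.
have Voo : (leb V < +oo)%E.
  apply: le_lt_trans (lebesgue_rV_compact cK); apply: le_measure; rewrite ?inE//.
have iV w : bounded_measurable w -> leb.-integrable V (EFin \o w).
  by move=> bw; exact: bounded_measurable_integrable.
have half (w z : rV -> R) : smooth w -> (forall x, ~ V x -> w x = 0) -> (forall x, `|w x| <= 1) ->
    bounded_measurable z -> \int[leb]_(x in K) (w x * (z (x + t *: h) - z x)) <= \int[leb]_(x in V) `|z (x + t *: h) - z x|.
  move=> sw w0 w1 bz.
  rewrite (@Rintegral_support _ _ _ V K V)//; last by move=> x /w0 ->; rewrite mul0r.
  have bw : bounded_measurable w by split; [exact: smooth_measurable|exists 1].
  apply: le_Rintegral => //.
  - by apply: iV; apply: bounded_measurableM => //; exact: bd.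
  - by apply: iV; apply: bn; exact: bd.
  - by move=> x _; apply: (le_trans (ler_norm _)); rewrite normrM ler_piMl.
apply: (le_trans (lerD (half p \1_A sp pV p1 bA) (half q \1_B sq qV q1 bB))).
rewrite -RintegralD//; last 2 first.
- by apply: iV; apply: bn; exact: bd.
- by apply: iV; apply: bn; exact: bd.
rewrite le_eqVlt; apply/orP; left; apply/eqP; apply: eq_Rintegral => x _.
by rewrite -disjoint_indic_diff// /u !mul1r !mulN1r.
Qed.

Lemma mul_gt0_norm_neq (a b : R) : `|a| + `|b| = `|a - b| -> ~ 0 < a * b.
Proof.
move=> h ab; have := congr1 (fun x => x ^+ 2) h.
rewrite real_normK ?num_real// sqrrB sqrrD !real_normK ?num_real//.
rewrite -normrM gtr0_norm// !mulr2n => h2; clear h; lra.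
Qed.

Lemma measurable_dirc h (g : 'I_n -> rV -> R) : (forall i, measurable_fun setT (g i)) ->
  measurable_fun setT (dirc h g).
Proof.
move=> mg; have -> : dirc h g = fun x => \sum_(i <- index_enum 'I_n) h 0 i * g i x by [].
by apply: measurable_sum => i; exact: measurable_funM.
Qed.

(** Localized to compact sets, [disjoint_gradients_le] says that the [h]-components satisfy
    [|a| + |b| <= |a - b|] almost everywhere, which excludes equal signs. It plays the role of the
    opposite normals of disjoint sets on a common boundary. *)
Lemma disjoint_gradients U A B nuA nuB L la (gA gB : 'I_n -> rV -> R) V h :
  measurable A -> measurable B -> A `&` B = set0 ->
  is_gradient U A nuA -> is_gradient U B nuB -> compact L -> L `<=` U ->
  (forall i, has_density la L (gA i) (fun E => nuA E 0 i)) ->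
  (forall i, has_density la L (gB i) (fun E => nuB E 0 i)) ->
  open V -> V `<=` L ->
  la (V `&` [set x | 0 < dirc h gA x * dirc h gB x]) = 0.
Proof.
move=> mA mB AB0 gA' gB' cL LU dA dB oV VL.
have mL := compact_measurable_rV cL.
have iA i : la.-integrable setT (EFin \o gA i) by case: (dA i).
have iB i : la.-integrable setT (EFin \o gB i) by case: (dB i).
have m1 : measurable_fun setT (dirc h gA).
  by apply: measurable_dirc => i; apply/measurable_EFinP; exact: measurable_int (iA i).
have m2 : measurable_fun setT (dirc h gB).
  by apply: measurable_dirc => i; apply/measurable_EFinP; exact: measurable_int (iB i).
set E := _ `&` _.
have mE : measurable E.
  apply: measurableI; first exact: open_measurable_rV.
  rewrite (_ : [set x | _] = (dirc h gA \* dirc h gB) @^-1` `]0, +oo[%classic).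
    by rewrite -[X in measurable X]setTI; apply: (measurable_funM m1 m2) => //; exact: measurable_itv.
  by apply/seteqP; split => x /=; rewrite in_itv/= andbT.
pose f1 x := `|dirc h gA x| + `|dirc h gB x|.
pose f2 x := `|dirc h gA x - dirc h gB x|.
have if1 D : measurable D -> la.-integrable D (EFin \o f1).
  move=> mD; have -> : EFin \o f1 = ((EFin \o (fun x => `|dirc h gA x|%R)) \+ (EFin \o (fun x => `|dirc h gB x|%R)))%E by [].
  by apply: integrableD => //; apply: integrable_sub => //; apply: integrable_norm; exact: integrable_dirc.
have iT2 : la.-integrable setT (EFin \o f2).
  apply: integrable_norm.
  have -> : EFin \o (fun x => dirc h gA x - dirc h gB x) = ((EFin \o dirc h gA) \- (EFin \o dirc h gB))%E by [].
  by apply: integrableB => //; exact: integrable_dirc.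
have if2 D : measurable D -> la.-integrable D (EFin \o f2).
  by move=> mD; exact: integrable_sub iT2.
have f21 x : f2 x <= f1 x by exact: ler_normB.
have key C : compact C -> C `<=` V -> \int[la]_(x in C) f1 x <= \int[la]_(x in C) f2 x.
  move=> cC CV; have mC := compact_measurable_rV cC.
  apply/ler_addgt0Pr => e e0.
  have [P [PE _]] := ex_density_measure iT2 (fun x => normr_ge0 _).
  (* The right-hand side of [disjoint_gradients_le] lives on a neighbourhood of [C]. One is taken in
     which [f2] has mass less than [e] outside [C], with two nested neighbourhoods inside it as room
     for the translations. *)
  have [C1 [V0 [cC1 oV0 C1C [CV0 V0V] Pe]]] := finite_measure_squeeze P mC (@subset_refl _ C) cC oV CV e0.
  have [V1 [K1 [oV1 cK1 CV1 V1K1 K1O]]] := compact_nbhd cC oV0 CV0.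
  have [V2 [L2 [oV2 cL2 K1V2 V2L2 L2O]]] := compact_nbhd cK1 oV0 K1O.
  have [r r0 rP] := lebesgue_number cK1 oV2 K1V2.
  have mL2 := compact_measurable_rV cL2.
  pose H := \sum_i `|h 0 i| + 1.
  have H0 : 0 < H by rewrite ltr_wpDl// sumr_ge0.
  have L2L : L2 `<=` L by apply: subset_trans VL; exact: subset_trans V0V.
  have rest (g : 'I_n -> rV -> R) nu : (forall i, has_density la L (g i) (fun E => nu E 0 i)) ->
      forall i, has_density la L2 (g i) (fun E : set rV => (nu E : rV) 0 i).
    by move=> dg i; have [ig gE] := dg i; split => // D mD DL; apply: gE => //; exact: subset_trans L2L.
  have step : \int[la]_(x in C) f1 x <= \int[la]_(x in L2) f2 x.
    have := @disjoint_gradients_le U A B nuA nuB L2 la gA gB C V1 K1 h (r / H) mA mB AB0 gA' gB' cL2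
      (subset_trans L2L LU) (rest _ _ dA) (rest _ _ dB) mC CV1 oV1 V1K1 cK1 (divr_gt0 r0 H0).
    rewrite -RintegralD//; try by (apply: integrable_sub => //; apply: integrable_norm; exact: integrable_dirc).
    apply => x s Kx; rewrite ltr_pdivlMr// => sr; apply: V2L2; apply: (rP x Kx) => i.
    rewrite !mxE [x 0 i + _]addrC addrK normrM; apply: ltW; apply: le_lt_trans sr.
    rewrite ler_wpM2l// /H (bigD1 i)//= -addrA lerDl addr_ge0// sumr_ge0//.
  apply: (le_trans step).
  have CL2 : C `<=` L2 by apply: subset_trans V2L2; apply: subset_trans K1V2; apply: subset_trans V1K1.
  rewrite -(setDUK CL2) Rintegral_setU//; last 3 first.
  - exact: measurableD.
  - by rewrite setDUK//; exact: if2.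
  - by rewrite disj_set2E setDIK.
  rewrite lerD2l -lee_fin EFin_Rintegral//; last 2 first.
  - exact: measurableD.
  - by apply: if2; exact: measurableD.
  have -> : (\int[la]_(x in L2 `\` C) (f2 x)%:E = P (L2 `\` C))%E.
    by rewrite PE//; exact: measurableD.
  apply: ltW; apply: le_lt_trans Pe; apply: le_measure; rewrite ?inE.
  - exact: measurableD.
  - by apply: measurableD; [exact: open_measurable_rV|exact: compact_measurable_rV].
  - by move=> x [/L2O Ox nC]; split => // /C1C.
apply/eqP; rewrite eq_le measure_ge0 andbT; apply/lee_addgt0Pr => e e0; rewrite add0e.
have EV : E `<=` V by move=> x [].
have [C [V0 [cC oV0 CE [EO _] h1]]] := finite_measure_squeeze la mE (subset_trans EV VL) cL oV EV e0.
have mC := compact_measurable_rV cC.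
have C0 : la C = 0.
  have := key C cC (subset_trans CE EV); rewrite -subr_le0 -RintegralB//; [|exact: if1|exact: if2].
  move=> le0; have i12 : la.-integrable C (EFin \o (fun x => f1 x - f2 x)).
    have -> : EFin \o (fun x => f1 x - f2 x) = ((EFin \o f1) \- (EFin \o f2))%E by [].
    by apply: integrableB => //; [exact: if1|exact: if2].
  have z : (\int[la]_(x in C) (f1 x - f2 x)%:E)%E = 0.
    rewrite -EFin_Rintegral//; congr EFin; apply/eqP; rewrite eq_le le0 Rintegral_ge0// => x _.
    by rewrite subr_ge0.
  have mf12 : measurable_fun C (EFin \o (fun x => f1 x - f2 x)) by exact: measurable_int i12.
  have /(ae_eq_integral_abs la mC mf12)[N [mN N0 CN]] :
      (\int[la]_(x in C) `|(EFin \o (fun x => f1 x - f2 x)%R) x| = 0)%E.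
    rewrite -[RHS]z; apply: eq_integral => x _; congr EFin.
    by rewrite ger0_norm// subr_ge0.
  apply/eqP; rewrite eq_le measure_ge0 andbT -N0; apply: le_measure; rewrite ?inE// => x Cx.
  apply: CN => /(_ Cx) /= -[] /eqP; rewrite subr_eq0 => /eqP f12.
  have [_ /=] := CE x Cx; have := f12; rewrite /f1 /f2; exact: mul_gt0_norm_neq.
apply: ltW; apply: le_lt_trans h1.
rewrite -[leLHS](_ : la (C `|` (E `\` C)) = la E)%E; last by rewrite setDUK.
apply: (le_trans (measureU2 la mC (measurableD mE mC))).
rewrite [X in (X + _)%E]C0 add0e; apply: le_measure; rewrite ?inE.
- exact: measurableD.
- by apply: measurableD => //; exact: open_measurable_rV.
- by move=> x [/EO].
Qed.

End disjoint.

(** * Pushforward of densities to vector measures *)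

Section pushforward.
Context {R : realType} {n : nat}.
Local Notation rV := 'rV[R]_n.
Implicit Types (la : {finite_measure set rV -> \bar R}) (A B K L U : set rV) (f : rV -> R)
  (nu : set rV -> rV).

Lemma cvg_rV (v : nat -> rV) (l : rV) :
  (forall i, (fun m => v m 0 i) @ \oo --> l 0 i) -> v @ \oo --> l.
Proof.
move=> H.
have E (w : rV) : w = \sum_(i <- index_enum 'I_n) w 0 i *: delta_mx 0 i by rewrite [LHS]row_sum_delta.
rewrite (E l) (_ : v = (fun m => \sum_(i <- index_enum 'I_n) v m 0 i *: delta_mx 0 i)); last first.
  by apply/funext => m; exact: E.
elim: (index_enum _) => [|i s IH].
  rewrite big_nil; under eq_fun do rewrite big_nil; exact: cvg_cst.
rewrite big_cons; under eq_fun do rewrite big_cons.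
apply: cvgD; last exact: IH.
by apply: cvgZl; exact: H.
Qed.

(** Each component has its own map, because the [i]-th component of a trace is carried by the faces
    orthogonal to [e_i], reached by projection along [e_i]. *)
Definition vm_push la (p : 'I_n -> rV -> rV) (w : 'I_n -> rV -> R) A : rV :=
  \row_i \int[la]_(x in p i @^-1` A) w i x.

Section push.
Variables (la : {finite_measure set rV -> \bar R}) (p : 'I_n -> rV -> rV) (w : 'I_n -> rV -> R).
Hypotheses (mp : forall i, measurable_fun setT (p i))
  (iw : forall i, la.-integrable setT (EFin \o w i)).

Let mpre i A : measurable A -> measurable (p i @^-1` A).
Proof. by move=> mA; rewrite -[X in measurable X]setTI; exact: mp. Qed.

Lemma vm_push_vm U : vector_measure U (vm_push la p w).
Proof.
move=> A mA tA _; apply: cvg_rV => i; rewrite mxE.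
have tp : trivIset setT (fun k => p i @^-1` A k).
  have /trivIsetP tA' := tA.
  by apply/trivIsetP => k l _ _ kl; rewrite -preimage_setI (tA' k l I I kl) preimage_set0.
have mU : measurable (\bigcup_k (p i @^-1` A k)).
  by apply: bigcup_measurable => k _; exact: mpre.
have h := @charge_semi_sigma_additive _ _ _ (induced_charge (iw i)) _ (fun k => mpre i (mA k)) tp mU.
rewrite preimage_bigcup.
have fin B : measurable B -> (\int[la]_(x in B) (w i x)%:E)%E \is a fin_num.
  by move=> mB; apply: integrable_fin_num => //; exact: integrable_sub.
have -> : (fun m => (\sum_(k < m) vm_push la p w (A k)) 0 i) =
    fine \o (fun m => \sum_(0 <= k < m) \int[la]_(x in p i @^-1` A k) (w i x)%:E)%E.
  apply/funext => m /=; rewrite summxE big_mkord.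
  under [in RHS]eq_bigr => k _ do rewrite -(fineK (fin _ (mpre i (mA k)))).
  by rewrite sumEFin; apply: eq_bigr => k _; rewrite mxE.
apply: fine_cvg; rewrite /Rintegral fineK; last first.
  exact: fin.
exact: h.
Qed.

Lemma ex_pushforward (P : {finite_measure set rV -> \bar R}) (q : rV -> rV) : measurable_fun setT q ->
  exists P' : {finite_measure set rV -> \bar R}, (forall A, P' A = P (q @^-1` A)) /\
    forall K f, measurable K -> bounded_measurable f ->
      \int[P']_(x in K) f x = \int[P]_(x in q @^-1` K) f (q x).
Proof.
move=> mq.
have mqp K : measurable K -> measurable (q @^-1` K).
  by move=> mK; rewrite -[X in measurable X]setTI; exact: mq.
pose M := measure_function_pushforward__canonical__measure_function_Measure P mq.
have MT : (M setT < +oo)%E by rewrite /= /pushforward preimage_setT; exact: finite_measure_lty.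
have [P' PE] := ex_finite_measure MT.
have {}PE A : P' A = P (q @^-1` A) by rewrite PE.
exists P'; split => // K f mK [mf [N fN]]; congr fine.
have mqK : measurable (q @^-1` K) by exact: mqp.
have E : (\int[pushforward P q]_(x in K) (EFin \o f) x = \int[P]_(x in q @^-1` K) ((EFin \o f) \o q) x)%E.
  apply: integral_pushforward => //; first by apply/measurable_EFinP.
  apply: (@bounded_integrable _ _ _ P _ (f \o q) N) => //; first exact: finite_measure_lty.
    by apply: measurable_funTS; apply: (measurableT_comp mf); apply mq.
  by move=> x _; exact: fN.
rewrite -[RHS]E; apply: eq_measure_integral => B mB _; exact: PE.
Qed.

Lemma bounded_measurable_comp f (q : rV -> rV) : measurable_fun setT q -> bounded_measurable f ->
  bounded_measurable (f \o q).
Proof. by move=> mq [mf [M fM]]; split; [exact: measurableT_comp|exists M => x; exact: fM]. Qed.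

Lemma integrable_bm_mul (mu : {measure set rV -> \bar R}) D f g : measurable D -> bounded_measurable f ->
  mu.-integrable D (EFin \o g) -> mu.-integrable D (EFin \o (fun x => f x * g x)).
Proof.
move=> mD [mf [M fM]] ig.
exact: (bounded_mul_integrable mD (measurable_funTS mf) (fun x _ => fM x)).
Qed.

(** The difficulty is cancellation: [vintegral] uses the Jordan decomposition of the pushed measure,
    which is in general not the pushforward of the one upstairs. The two pairs of positive measures
    have the same difference on subsets of [K], and that is enough for the integrals. *)
Lemma vintegral_push U K i f : compact K -> K `<=` U -> bounded_measurable f ->
  (forall x, ~ K x -> f x = 0) ->
  vintegral U (vm_push la p w) i f = (\int[la]_x (f (p i x) * w i x))%:E.
Proof.
move=> cK KU bf f0; have mK := compact_measurable_rV cK.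
have [lb [g gP]] := @vm_density R n unit U K (fun=> vm_push la p w) (fun=> @vm_push_vm U) cK KU.
have dg := gP tt i; rewrite /= in dg.
have [mf [M fM]] := bf.
rewrite (vintegral_density cK KU dg mf fM f0); congr EFin.
have [ig gE] := dg.
have part (l : {finite_measure set rV -> \bar R}) (v : rV -> R) : l.-integrable setT (EFin \o v) ->
  exists P N : {finite_measure set rV -> \bar R},
    [/\ forall A, measurable A -> (P A = \int[l]_(x in A) (Num.max (v x) 0)%:E)%E,
        forall A, measurable A -> (N A = \int[l]_(x in A) (Num.max (- v x) 0)%:E)%E,
        forall A, measurable A -> \int[l]_(x in A) v x = fine (P A) - fine (N A) &
        forall A z, measurable A -> bounded_measurable z ->
          \int[l]_(x in A) (z x * v x) = \int[P]_(x in A) z x - \int[N]_(x in A) z x].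
  move=> iv.
  have mv : measurable_fun setT v by apply/measurable_EFinP; exact: measurable_int iv.
  have imax (v' : rV -> R) : l.-integrable setT (EFin \o v') -> l.-integrable setT (EFin \o (fun x => Num.max (v' x) 0)).
    move=> iv'; apply: (@le_integrable _ _ _ l setT measurableT _ (EFin \o v')) => //.
      by apply/measurable_EFinP/measurable_maxr => //; apply/measurable_EFinP; exact: measurable_int iv'.
    move=> x _; rewrite /= lee_fin ger0_norm ?le_max ?lexx ?orbT//.
    by rewrite ge_max ler_norm normr_ge0.
  have iN : l.-integrable setT (EFin \o (fun x => - v x)).
    have -> : EFin \o (fun x => - v x) = (-%E \o (EFin \o v)) by apply/funext => x.
    exact: integrableN.
  have m0 (v' : rV -> R) x : 0 <= Num.max (v' x) 0 by rewrite le_max lexx orbT.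
  have [P [PE Pf]] := ex_density_measure (imax _ iv) (m0 v).
  have [N [NE Nf]] := ex_density_measure (imax _ iN) (m0 (fun x => - v x)).
  have vE x : v x = Num.max (v x) 0 - Num.max (- v x) 0.
    case: (leP (v x) 0) => vx; first by rewrite max_l ?oppr_ge0// opprK add0r.
    by rewrite max_r ?oppr_le0 ?ltW// subr0.
  have fE A z : measurable A -> bounded_measurable z ->
      \int[l]_(x in A) (z x * v x) = \int[P]_(x in A) z x - \int[N]_(x in A) z x.
    move=> mA bz; have [mz [Mz zM]] := bz.
    rewrite (Pf A z Mz)//; last exact: measurable_funTS.
    rewrite (Nf A z Mz)//; last exact: measurable_funTS.
    rewrite -RintegralB//; last 2 first.
    - by apply: integrable_bm_mul => //; apply: integrable_sub => //; exact: imax.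
    - by apply: integrable_bm_mul => //; apply: integrable_sub => //; exact: imax.
    by apply: eq_Rintegral => x _; rewrite -mulrBr -vE.
  exists P, N; split => // A mA.
  have b1 : @bounded_measurable R n (cst 1) by split => //; exists 1 => x; rewrite normr1.
  have := fE A (cst 1) mA b1; rewrite !Rintegral_cst// !mul1r => <-.
  by apply: eq_Rintegral => x _; rewrite mul1r.
have [P [N [PE NE PN Pf]]] := part la (w i) (iw i).
have [P1 [N1 [P1E N1E P1N1 P1f]]] := part lb (g tt i) ig.
have [P' [P'E P'f]] := ex_pushforward P (mp i).
have [N' [N'E N'f]] := ex_pushforward N (mp i).
(* Equality of the differences [P' - N'] and [P1 - N1], written with sums to stay among positive
   measures. *)
have key A : measurable A -> A `<=` K -> (measure_add P' N1 A = measure_add N' P1 A)%E.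
  move=> mA AK; rewrite !measure_addE.
  have := gE A mA AK; rewrite mxE P1N1// (PN _ (mpre i mA)) => h.
  apply: (etrans (congr1 (fun z => z + N1 A)%E (P'E A))).
  apply/esym; apply: (etrans (congr1 (fun z => z + P1 A)%E (N'E A))); apply/esym.
  have mpA := mpre i mA.
  rewrite -(fineK (fin_num_measure P _ mpA)) -(fineK (fin_num_measure N _ mpA)).
  rewrite -(fineK (fin_num_measure P1 _ mA)) -(fineK (fin_num_measure N1 _ mA)).
  rewrite -!EFinD; congr EFin; move: h.
  set a := fine _; set b := fine _; set c := fine _; set d := fine _.
  by clear; lra.
have iM (m : {finite_measure set rV -> \bar R}) : m.-integrable K (EFin \o f).
  by apply: bounded_measurable_integrable => //; exact: finite_measure_lty.
have mfK : measurable_fun K (EFin \o f) by apply/measurable_EFinP; exact: measurable_funTS.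
have fin (m : {finite_measure set rV -> \bar R}) : (\int[m]_(x in K) (f x)%:E)%E \is a fin_num.
  by apply: integrable_fin_num => //; exact: iM.
have E : \int[P']_(x in K) f x + \int[N1]_(x in K) f x = \int[N']_(x in K) f x + \int[P1]_(x in K) f x.
  rewrite /Rintegral -fineD ?fin// -[RHS]fineD ?fin//; congr fine.
  rewrite -(integral_measure_add mK (iM P') (iM N1)).
  rewrite -(integral_measure_add mK (iM N') (iM P1)).
  by apply: eq_measure_integral => A mA AK; exact: key.
rewrite P1f// -[RHS]/(\int[la]_(x in setT) ((f \o p i) x * w i x)) Pf//; last exact: bounded_measurable_comp.
have toT (m : {finite_measure set rV -> \bar R}) : \int[m]_x (f \o p i) x = \int[m]_(x in p i @^-1` K) f (p i x).
  by apply: (@Rintegral_support _ _ _ (p i @^-1` K)) => // x /f0.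
rewrite !toT -P'f// -N'f//; move: E.
set a := Rintegral _ _ _; set b := Rintegral _ _ _; set c := Rintegral _ _ _; set d := Rintegral _ _ _.
by clear; lra.
Qed.

End push.

Lemma vintegral_lin U (a b : R) nu1 nu2 K i f : vector_measure U nu1 -> vector_measure U nu2 ->
  compact K -> K `<=` U -> bounded_measurable f -> (forall x, ~ K x -> f x = 0) ->
  vintegral U (fun A => a *: nu1 A + b *: nu2 A) i f =
  (a * fine (vintegral U nu1 i f) + b * fine (vintegral U nu2 i f))%:E.
Proof.
move=> n1 n2 cK KU bf f0; have mK := compact_measurable_rV cK.
have [la [g gP]] := @vm_density R n bool U K (fun b => if b then nu1 else nu2)
  (fun b => if b as b' return vector_measure U (if b' then nu1 else nu2) then n1 else n2) cK KU.
have d1 := gP true i; have d2 := gP false i; rewrite /= in d1 d2.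
have [mf [M fM]] := bf.
have dd : has_density la K (fun x => a * g true i x + b * g false i x)
    (fun A => (a *: nu1 A + b *: nu2 A) 0 i).
  have -> : (fun A => (a *: nu1 A + b *: nu2 A) 0 i) = (fun A => a * nu1 A 0 i + b * nu2 A 0 i).
    by apply/funext => A; rewrite !mxE.
  exact: has_density_lin.
rewrite (vintegral_density cK KU dd mf fM f0) (vintegral_density cK KU d1 mf fM f0).
rewrite (vintegral_density cK KU d2 mf fM f0) /=; congr EFin.
have fg j : la.-integrable K (EFin \o (fun x => f x * g j i x)).
  by apply: integrable_bm_mul => //; apply: integrable_sub => //; case: (gP j i).
have iZ (c : R) (z : rV -> R) : la.-integrable K (EFin \o z) -> la.-integrable K (EFin \o (fun x => c * z x)).
  move=> iz; have -> : EFin \o (fun x => c * z x) = (fun x => c%:E * (EFin \o z) x)%E.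
    by apply/funext => x /=; rewrite EFinM.
  exact: integrableZl.
rewrite -!RintegralZl// -RintegralD//; [|exact: iZ|exact: iZ].
by apply: eq_Rintegral => x _; ring.
Qed.

Lemma vector_measureS U nu : vector_measure setT nu -> vector_measure U nu.
Proof.
move=> H A mA tA cA; apply: H => //.
by have [K [cK AK _]] := compactly_containedE cA; exact: (sub_compactly_contained cK).
Qed.

End pushforward.

(** * Cutting a set by a cube and the trace on its faces *)

Section projections.
Context {R : realType} {n : nat}.
Local Notation rV := 'rV[R]_n.
Implicit Types (f : rV -> R) (x : rV).

Definition cproj (i : 'I_n) (a : R) x : rV := \row_j (if j == i then a else x 0 j).

Lemma cprojE i a x : cproj i a x = x + (a - x 0 i) *: delta_mx 0 i.
Proof.
apply/rowP => j; rewrite !mxE eqxx /=; have [->|ji] := eqVneq j i.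
  by rewrite mulr1 addrC subrK.
by rewrite mulr0 addr0.
Qed.

Lemma measurable_cproj i a : measurable_fun setT (cproj i a).
Proof.
apply: measurable_fun_rV => j; under eq_fun do rewrite mxE.
case: (j == i); first exact: measurable_cst.
exact: measurable_coord.
Qed.

Lemma cproj_line i a x j (s : R) :
  cproj i a (s *: delta_mx 0 j + x) = (if j == i then 0 else s) *: delta_mx 0 j + cproj i a x.
Proof.
apply/rowP => k; rewrite !mxE eqxx /=.
have [-> | ki] := eqVneq k i; last by have [ji|//] := eqVneq j i; rewrite ji (negbTE ki) !mulr0.
have [ji|ji] := eqVneq j i; first by rewrite mul0r add0r.
by rewrite mulr0 add0r.
Qed.

Lemma cproj_partial i a f j :
  partial j (fun x => f (cproj i a x)) = (fun x => if j == i then 0 else partial j f (cproj i a x)).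
Proof.
apply/funext => x; have [ji|ji] := eqVneq j i.
  rewrite /partial /derive.
  have -> : (fun h : R => h^-1 *: (((fun x => f (cproj i a x)) \o shift x) (h *: delta_mx 0 j) - f (cproj i a x))) = cst 0.
    by apply/funext => h /=; rewrite cproj_line ji eqxx scale0r add0r subrr scaler0.
  exact: lim_cst.
rewrite /partial /derive.
have -> // : (fun h : R => h^-1 *: (((fun x => f (cproj i a x)) \o shift x) (h *: delta_mx 0 j) - f (cproj i a x))) =
  (fun h : R => h^-1 *: ((f \o shift (cproj i a x)) (h *: delta_mx 0 j) - f (cproj i a x))).
by apply/funext => h /=; rewrite cproj_line (negbTE ji).
Qed.

Lemma continuous_cproj i a : continuous (cproj i a).
Proof.
move=> x; rewrite (_ : cproj i a = (fun x => x + (a - x 0 i) *: delta_mx 0 i)); last first.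
  by apply/funext => y; exact: cprojE.
have h : (fun y : rV => (a - y 0 i) *: (delta_mx 0 i : rV)) @ x --> (a - x 0 i) *: (delta_mx 0 i : rV).
  have h1 : (fun y : rV => y 0 i) @ x --> x 0 i by exact: coord_continuous.
  have h2 : (fun t : R => a - t) @ (x 0 i) --> a - x 0 i.
    by apply: cvgB; [exact: cvg_cst|exact: cvg_id].
  have h3 : (fun y : rV => a - y 0 i) @ x --> a - x 0 i by exact: (cvg_comp _ _ h1 h2).
  exact: (@cvgZl _ _ _ _ _ (fun y : rV => a - y 0 i) (a - x 0 i) (delta_mx 0 i : rV) h3).
exact: (cvgD cvg_id h).
Qed.

Lemma smooth_cproj i a f : smooth f -> smooth (fun x => f (cproj i a x)).
Proof.
have C1p g : C1 g -> C1 (fun x => g (cproj i a x)).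
  move=> [cg dg]; split.
    by move=> x; apply: (continuous_comp (f := cproj i a)); [exact: continuous_cproj|exact: cg].
  move=> j x; rewrite /derivable.
  have [ji|ji] := eqVneq j i.
    have -> : (fun h : R => h^-1 *: (((fun x => g (cproj i a x)) \o shift x) (h *: delta_mx 0 j) - g (cproj i a x))) = cst 0.
      by apply/funext => h /=; rewrite cproj_line ji eqxx scale0r add0r subrr scaler0.
    exact: is_cvg_cst.
  have -> : (fun h : R => h^-1 *: (((fun x => g (cproj i a x)) \o shift x) (h *: delta_mx 0 j) - g (cproj i a x))) =
    (fun h : R => h^-1 *: ((g \o shift (cproj i a x)) (h *: delta_mx 0 j) - g (cproj i a x))).
    by apply/funext => h /=; rewrite cproj_line (negbTE ji).
  exact: dg.
move=> /smoothP H; apply/smoothP => k; elim: k f H => [|k IH] f H.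
  by split => //; apply: C1p; exact: Ck_C1 (H 0%N).
split; first by apply: C1p; exact: Ck_C1 (H 0%N).
move=> j; rewrite cproj_partial; case: (j == i); first exact: (Ck_cst k 0).
by apply: IH => l; apply: Ck_partial; exact: H.
Qed.

Lemma axis_lipschitz f i y (s M : R) : smooth f -> (forall x, `|partial i f x| <= M) ->
  `|f (y + s *: delta_mx 0 i) - f y| <= M * `|s|.
Proof.
move=> sf fM.
have [t _||t _] := @MVT_segment R (fun t : R => f (y + (t * s) *: delta_mx 0 i))
    (fun t => s * partial i f (y + (t * s) *: delta_mx 0 i)) 0 1 ler01.
- exact: is_derive_axis.
- apply: continuous_subspaceT => t; apply/differentiable_continuous/derivable1_diffP.
  by have [] := is_derive_axis i y s t sf.
rewrite mul1r mul0r scale0r addr0 subr0 mulr1 => ->.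
by rewrite normrM mulrC ler_wpM2r.
Qed.

End projections.

Section cut.
Context {R : realType} {n : nat}.
Local Notation rV := 'rV[R]_n.
Local Notation leb := (@lebesgue_rV R n).
Implicit Types (la : {finite_measure set rV -> \bar R}) (A B K L U W : set rV) (u f phi psi G : rV -> R)
  (nu : set rV -> rV) (c x : rV) (t r h : R).

Definition is_bump (C : R) c r r' psi := [/\ smooth psi, forall x, 0 <= psi x <= 1,
      (forall x, cube c r x -> psi x = 1) /\
        (forall j x, `|x 0 j - c 0 j| <= r -> partial j psi x = 0),
      forall x, ~ ocube c r' x -> psi x = 0 &
      forall j x, `|partial j psi x| <= C / (r' - r)].

Definition shell c t h : set rV := cube c (t + h) `\` cube c t.

Lemma measurable_shell c t h : measurable (shell c t h).
Proof. by apply: measurableD; exact: measurable_cube. Qed.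

Lemma shell_small la c t (e : R) : 0 < e ->
  exists2 h1, 0 < h1 & forall h, h <= h1 -> (la (shell c t h) < e%:E)%E.
Proof.
move=> e0; pose F k := shell c t (k.+1%:R^-1).
have [|||k kP] := @finite_measure_continuity R n la F e _ _ _ e0.
- by move=> k; exact: measurable_shell.
- move=> k l kl; apply/subsetPset => x [cx nx]; split => //.
  by apply: sub_cube cx; rewrite lerD2l lef_pV2 ?posrE// ler_nat ltnS.
- apply/seteqP; split => // x Fx.
  have [_ /existsNP[i /negP]] := Fx 0%N I; rewrite -ltNge => /ltr_add_invr[k hk].
  have [cx _] := Fx k I; by have := le_lt_trans (cx i) hk; rewrite ltxx.
- exists k.+1%:R^-1; first by rewrite invr_gt0.
  move=> h hk; apply: le_lt_trans kP; apply: le_measure; rewrite ?inE; [exact: measurable_shell..|].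
  by move=> x [cx nx]; split => //; apply: sub_cube cx; rewrite lerD2l.
Qed.

Lemma cube_margin c t U : 0 <= t -> open U -> cube c t `<=` U ->
  exists2 r, 0 < r & cube c (t + r) `<=` U.
Proof.
move=> t0 oU cU; have [r r0 rU] := lebesgue_number (@cube_compact _ _ c t) oU cU.
(* [x] is a nearest point of the cube in the sup norm: every coordinate of [y - c] is clamped to the
   interval from [- t] to [t]. *)
exists r => // y cy; pose x : rV := \row_i (c 0 i + Num.max (- t) (Num.min t (y 0 i - c 0 i))).
apply: (rU x) => i; have := cy i; rewrite !mxE ler_norml => /andP[h1 h2].
  rewrite addrAC subrr add0r ler_norml le_max lexx/= ge_max ge_min lexx/= andbT.
  by rewrite (@le_trans _ _ 0) ?oppr_le0.
rewrite ler_norml; set d := y 0 i - c 0 i in h1 h2 *.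
have -> : y 0 i - (c 0 i + Num.max (- t) (Num.min t d)) = d - Num.max (- t) (Num.min t d).
  by rewrite /d opprD addrA.
have [h3|h3] := leP t d.
  by rewrite max_r ?(le_trans _ t0) ?oppr_le0//; apply/andP; split; lra.
have [h4|h4] := leP (- t) d; first by rewrite subrr; apply/andP; split; lra.
by apply/andP; split; lra.
Qed.

Lemma smooth_bounded_on K f : smooth f -> compact K -> exists2 M, 0 < M & forall x, K x -> `|f x| <= M.
Proof.
move=> sf cK.
have /compact_bounded[M [_ MP]] : compact (f @` K).
  by apply: continuous_compact => //; apply: continuous_subspaceT; exact: smooth_continuous.
exists (`|M| + 1) => [|x Kx]; first by rewrite ltr_wpDl.
apply: MP; last by exists x.
by rewrite (le_lt_trans (ler_norm M))// ltrDl.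
Qed.

Lemma ler_dist_Rintegral (mu : {measure set rV -> \bar R}) D (f1 f2 f3 : rV -> R) : measurable D ->
  mu.-integrable D (EFin \o f1) -> mu.-integrable D (EFin \o f2) -> mu.-integrable D (EFin \o f3) ->
  (forall x, D x -> `|f1 x - f2 x| <= f3 x) ->
  `|\int[mu]_(x in D) f1 x - \int[mu]_(x in D) f2 x| <= \int[mu]_(x in D) f3 x.
Proof.
move=> mD i1 i2 i3 H.
have i12 : mu.-integrable D (EFin \o (fun x => f1 x - f2 x)).
  have -> : EFin \o (fun x => f1 x - f2 x) = ((EFin \o f1) \- (EFin \o f2))%E by [].
  exact: integrableB.
rewrite -RintegralB//; apply: (le_trans (le_normr_Rintegral mD i12)).
by apply: le_Rintegral => //; exact: integrable_norm i12.
Qed.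

(** The left-hand side is the defect of integration by parts over the closed cube. Testing with
    [psi G], for a bump [psi] of width [h], leaves two errors supported in the shell, which vanish
    as [h] tends to 0, and the boundary term with [partial i psi]. The latter has to be bounded only
    along a sequence of widths. *)
Lemma cut_limit U W nu c t r la (g : 'I_n -> rV -> R) (C : R) (i : 'I_n) G (B : R) :
  measurable W -> is_gradient U W nu -> 0 < r -> cube c (t + r) `<=` U ->
  (forall i, has_density la (cube c (t + r)) (g i) (fun A => nu A 0 i)) ->
  (forall h, 0 < h -> exists psi, is_bump C c t (t + h) psi) -> smooth G ->
  (forall h0, 0 < h0 -> exists2 h, 0 < h < h0 & forall psi, is_bump C c t (t + h) psi ->
    \int[leb]_(x in cube c (t + r)) (\1_W x * `|partial i psi x * G x|) <= B) ->
  `|\int[leb]_(x in cube c t) (\1_W x * partial i G x) + \int[la]_(x in cube c t) (G x * g i x)| <= B.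
Proof.
move=> mW gW r0 KU dg bumps sG HB.
set K := cube c (t + r) in KU dg HB; set Q := cube c t.
have cK : compact K by exact: cube_compact.
have mK : measurable K by exact: measurable_cube.
have mQ : measurable Q by exact: measurable_cube.
have QK : Q `<=` K by apply: sub_cube; rewrite lerDl ltW.
have spG := smooth_partial i sG.
have [M1 M10 HM1] := smooth_bounded_on sG cK.
have [M2 M20 HM2] := smooth_bounded_on spG cK.
pose M := M1 + M2; have M0 : 0 < M by rewrite addr_gt0.
have GM x : K x -> `|G x| <= M by move=> Kx; apply: (le_trans (HM1 x Kx)); rewrite lerDl ltW.
have pGM x : K x -> `|partial i G x| <= M by move=> Kx; apply: (le_trans (HM2 x Kx)); rewrite lerDr ltW.
have [P1 P1E] := ex_measure_restr mK (lebesgue_rV_compact cK).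
have [ig gE] := dg i.
have iag := integrable_norm ig.
have [P2 [P2E _]] := ex_density_measure iag (fun x => normr_ge0 (g i x)).
apply/ler_addgt0Pr => e e0.
(* The two shell errors are each at most [M] times the mass of the shell, for the volume and for
   [|g i|]; together they stay below [e]. *)
have e1 : 0 < e / (2 * M) by rewrite divr_gt0// mulr_gt0.
have [h1 h10 Hh1] := shell_small P1 c t e1.
have [h2 h20 Hh2] := shell_small P2 c t e1.
have h30 : 0 < Num.min r (Num.min h1 h2) by rewrite !lt_min r0 h10.
have [h /andP[h0 hlt] hB] := HB _ h30.
move: hlt; rewrite !lt_min => /andP[hr /andP[hh1 hh2]].
have [psi bpsi] := bumps h h0.
have {}hB := hB psi bpsi.
have [spsi psi01 [psi1 _] psi0 psiC] := bpsi.
have mW1 : measurable_fun setT (\1_W : rV -> R) by exact: measurable_indic.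
have indM A x : `|\1_A x : R| <= 1 by rewrite indicE; case: (_ \in _); rewrite ?normr1 ?normr0.
have psiN x : `|psi x| <= 1 by have /andP[p1 p2] := psi01 x; rewrite ger0_norm.
have mG := smooth_measurable sG; have mpG := smooth_measurable spG.
have mpsi := smooth_measurable spsi.
have mppsi := smooth_measurable (smooth_partial i spsi).
pose F := psi \* G.
have sF : smooth F by exact: smoothM.
have F0 x : ~ K x -> F x = 0.
  move=> nK; rewrite /F /= psi0 ?mul0r// => /ocube_sub ox; apply: nK; apply: sub_cube ox.
  by rewrite lerD2l ltW.
have pairing := fgradient_pairing (bounded_measurable_indic mW) gW cK KU (dg i) sF F0.
have ib (f : rV -> R) (N : R) : measurable_fun setT f -> (forall x, K x -> `|f x| <= N) -> leb.-integrable K (EFin \o f).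
  move=> mf fN; apply: (bounded_integrable mK _ _ fN); first exact: lebesgue_rV_compact.
  exact: measurable_funTS.
have iW1 : leb.-integrable K (EFin \o (fun x => \1_W x * (psi x * partial i G x))).
  apply: (ib _ M); first by apply: measurable_funM => //; exact: measurable_funM.
  move=> x Kx; rewrite !normrM; apply: (@le_trans _ _ (1 * (1 * M))); last by rewrite !mul1r.
  by apply: ler_pM => //; apply: ler_pM => //; exact: pGM.
have iW2 : leb.-integrable K (EFin \o (fun x => \1_W x * (partial i psi x * G x))).
  apply: (ib _ (1 * ((C / (t + h - t)) * M))); first by apply: measurable_funM => //; exact: measurable_funM.
  move=> x Kx; rewrite !normrM; apply: ler_pM => //; apply: ler_pM => //; exact: GM.
have E1 : \int[leb]_(x in K) (\1_W x * partial i F x) =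
    \int[leb]_(x in K) (\1_W x * (psi x * partial i G x)) +
    \int[leb]_(x in K) (\1_W x * (partial i psi x * G x)).
  rewrite -RintegralD//; apply: eq_Rintegral => x _.
  by rewrite /F (smooth_partialM i spsi sG)/= mulrDr.
have A1 : `|\int[leb]_(x in Q) (\1_W x * partial i G x) - \int[leb]_(x in K) (\1_W x * (psi x * partial i G x))| <= e / 2.
  have -> : \int[leb]_(x in Q) (\1_W x * partial i G x) = \int[leb]_(x in K) (\1_Q x * (\1_W x * partial i G x)).
    rewrite [LHS]Rintegral_mkcond [RHS]Rintegral_mkcond; apply: eq_Rintegral => x _.
    rewrite /patch [\1_Q x]indicE; have [xQ|xQ] := boolP (x \in Q); last by rewrite mul0r if_same.
    by rewrite mul1r mem_set//; apply: QK; rewrite inE in xQ.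
  apply: (@le_trans _ _ (\int[leb]_(x in K) (M * \1_(shell c t h) x))).
    apply: ler_dist_Rintegral => //.
    - apply: (ib _ M); first by apply: measurable_funM; [exact: measurable_indic|exact: measurable_funM].
      move=> x Kx; rewrite !normrM; apply: (@le_trans _ _ (1 * (1 * M))); last by rewrite !mul1r.
      by apply: ler_pM => //; apply: ler_pM => //; exact: pGM.
    - apply: (ib _ (M * 1)).
        by apply: measurable_funM => //; apply: measurable_indic; exact: measurable_shell.
      by move=> x _; rewrite normrM (gtr0_norm M0) ler_wpM2l// ltW.
    - move=> x Kx; rewrite [\1_Q x]indicE [\1_(shell c t h) x]indicE.
      have [Qx|nQx] := pselect (Q x).
        rewrite (mem_set Qx) psi1// !mul1r subrr normr0.
        by rewrite mulr_ge0// ltW.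
      rewrite (memNset nQx) mul0r sub0r normrN.
      have [cx|ncx] := pselect (cube c (t + h) x).
        rewrite mem_set; last by split.
        rewrite mulr1 !normrM; apply: (@le_trans _ _ (1 * (1 * M))); last by rewrite !mul1r.
        by apply: ler_pM => //; apply: ler_pM => //; exact: pGM.
      by rewrite psi0 ?mul0r ?mulr0 ?normr0 ?mulr_ge0// ?ltW// => /ocube_sub.
  rewrite RintegralZl//; last first.
    by apply: (ib _ 1) => //; apply: measurable_indic; exact: measurable_shell.
  rewrite Rintegral_indic//; last exact: measurable_shell.
  have := Hh1 h (ltW hh1); have -> : (P1 (shell c t h) = leb (shell c t h `&` K))%E by exact: P1E.
  have fin : leb (shell c t h `&` K) \is a fin_num.
    rewrite ge0_fin_numE//; apply: le_lt_trans (lebesgue_rV_compact cK).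
    apply: le_measure; rewrite ?inE; [|by []|by move=> x []].
    by apply: measurableI => //; exact: measurable_shell.
  rewrite -{1}(fineK fin) lte_fin ltr_pdivlMr ?mulr_gt0// => q; clear -q; nra.
have iG2 (z : rV -> R) (N : R) : measurable_fun setT z -> (forall x, K x -> `|z x| <= N) ->
    la.-integrable K (EFin \o (fun x => z x * g i x)).
  move=> mz zN; apply: (bounded_mul_integrable mK (measurable_funTS mz) zN).
  exact: integrable_sub.
have A2 : `|\int[la]_(x in Q) (G x * g i x) - \int[la]_(x in K) (F x * g i x)| <= e / 2.
  have -> : \int[la]_(x in Q) (G x * g i x) = \int[la]_(x in K) ((\1_Q x * G x) * g i x).
    rewrite [LHS]Rintegral_mkcond [RHS]Rintegral_mkcond; apply: eq_Rintegral => x _.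
    rewrite /patch [\1_Q x]indicE; have [xQ|xQ] := boolP (x \in Q); last by rewrite !mul0r if_same.
    by rewrite mul1r mem_set//; apply: QK; rewrite inE in xQ.
  apply: (@le_trans _ _ (\int[la]_(x in K) (M * (\1_(shell c t h) x * `|g i x|)))).
    have i3 : la.-integrable K (EFin \o (fun x => \1_(shell c t h) x * `|g i x|)).
      apply: (@bounded_mul_integrable _ _ _ la K _ _ 1) => //; last by apply: integrable_sub.
      by apply: measurable_funTS; apply: measurable_indic; exact: measurable_shell.
    apply: ler_dist_Rintegral => //.
    - apply: (iG2 _ (1 * M)); first by apply: measurable_funM => //; exact: measurable_indic.
      by move=> x Kx; rewrite normrM; apply: ler_pM => //; exact: GM.
    - apply: (iG2 _ (1 * M)); first exact: measurable_funM.
      by move=> x Kx; rewrite normrM; apply: ler_pM => //; exact: GM.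
    - have -> : EFin \o (fun x => M * (\1_(shell c t h) x * `|g i x|)) = (fun x => M%:E * (EFin \o (fun x => (\1_(shell c t h) x * `|g i x|)%R)) x)%E.
        by apply/funext => x /=; rewrite EFinM.
      exact: integrableZl.
    - move=> x Kx; rewrite -mulrBl normrM [\1_Q x]indicE [\1_(shell c t h) x]indicE mulrA ler_wpM2r//.
      have [Qx|nQx] := pselect (Q x).
        rewrite /F /= (mem_set Qx) psi1// !mul1r subrr normr0.
        by rewrite mulr_ge0// ltW.
      rewrite (memNset nQx) mul0r sub0r normrN.
      have [cx|ncx] := pselect (cube c (t + h) x).
        rewrite mem_set; last by split.
        rewrite mulr1 /F normrM; apply: (@le_trans _ _ (1 * M)); last by rewrite !mul1r.
        by apply: ler_pM => //; exact: GM.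
      by rewrite /F /= psi0 ?mul0r ?mulr0 ?normr0 ?mulr_ge0// ?ltW// => /ocube_sub.
  rewrite RintegralZl//; last first.
    apply: (@bounded_mul_integrable _ _ _ la K _ _ 1) => //; last by apply: integrable_sub.
    by apply: measurable_funTS; apply: measurable_indic; exact: measurable_shell.
  have := Hh2 h (ltW hh2); rewrite P2E; last exact: measurable_shell.
  rewrite -EFin_Rintegral//; [|exact: measurable_shell|by apply: integrable_sub => //; exact: measurable_shell].
  have -> : \int[la]_(x in K) (\1_(shell c t h) x * `|g i x|) = \int[la]_(x in shell c t h) `|g i x|.
    rewrite [LHS]Rintegral_mkcond [RHS]Rintegral_mkcond; apply: eq_Rintegral => x _.
    rewrite /patch indicE; have [xs|xs] := boolP (x \in shell c t h); last by rewrite mul0r if_same.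
    rewrite mul1r mem_set//; rewrite inE in xs; case: xs => cx _; apply: sub_cube cx.
    by rewrite lerD2l ltW.
  rewrite lte_fin ltr_pdivlMr ?mulr_gt0// => q; clear -q; nra.
have A3 : `|\int[leb]_(x in K) (\1_W x * (partial i psi x * G x))| <= B.
  apply: le_trans hB; apply: (le_trans (le_normr_Rintegral mK iW2)).
  rewrite le_eqVlt; apply/orP; left; apply/eqP; apply: eq_Rintegral => x _.
  by rewrite normrM indicE; case: (_ \in _); rewrite ?normr1 ?normr0.
move: A1 A2 A3 pairing; rewrite E1.
set a := Rintegral _ _ _; set a' := Rintegral _ _ _; set b := Rintegral _ _ _; set b' := Rintegral _ _ _; set d := Rintegral _ _ _.
clear => A1 A2 A3 E.
have -> : a + b = (a - a') + (b - b') - d by move: E; lra.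
apply: (le_trans (ler_normB _ _)); apply: (le_trans (lerD (ler_normD _ _) (lexx _))).
lra.
Qed.

End cut.

Section cut_gradient.
Context {R : realType} {n : nat}.
Local Notation rV := 'rV[R]_n.
Local Notation leb := (@lebesgue_rV R n).
Implicit Types (la : {finite_measure set rV -> \bar R}) (A B K L U W : set rV) (u f phi psi G : rV -> R)
  (nu : set rV -> rV) (c x : rV) (t r h : R) (b : bool).

Definition sgb b : R := if b then 1 else -1.

(* [face_cut] is 1 on the side of [b], 0 on the other side of the centre; its
   transition happens inside the cube. *)
Definition face_cut c t b (i : 'I_n) x := step ((x 0 i - c 0 i) * (sgb b / t)).
Definition face_proj c t b (i : 'I_n) : rV -> rV := cproj i (c 0 i + sgb b * t).
(** [f] minus its values on the two faces orthogonal to [e_i], carried inwards along [e_i]. The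
    difference vanishes on these faces, so integrating its [i]-th derivative over the cube produces
    no boundary term. *)
Definition face_corr c t (i : 'I_n) f x :=
  f x - face_cut c t true i x * f (face_proj c t true i x)
      - face_cut c t false i x * f (face_proj c t false i x).

Lemma norm_sgb b : `|sgb b| = 1.
Proof. by case: b; rewrite /sgb ?normrN normr1. Qed.

Lemma smooth_face_cut c t b i : 0 < t -> smooth (face_cut c t b i).
Proof.
move=> t0; apply: smooth_step; apply: mulf_neq0; last by rewrite invr_eq0 gt_eqF.
by rewrite -normr_eq0 norm_sgb oner_eq0.
Qed.

Lemma smooth_face_term c t b i f : 0 < t -> smooth f ->
  smooth (face_cut c t b i \* (fun x => f (face_proj c t b i x))).
Proof. by move=> t0 sf; apply: smoothM; [exact: smooth_face_cut|exact: smooth_cproj]. Qed.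

Lemma smooth_face_corr c t i f : 0 < t -> smooth f -> smooth (face_corr c t i f).
Proof.
move=> t0 sf; apply: smoothB; last exact: smooth_face_term.
by apply: smoothB => //; exact: smooth_face_term.
Qed.

(** After projection along [e_i] nothing depends on the [i]-th coordinate, so the derivative falls
    on the cutoff alone. *)
Lemma partial_face_term c t b i f : 0 < t -> smooth f ->
  partial i (face_cut c t b i \* (fun x => f (face_proj c t b i x))) =
  (fun x => partial i (face_cut c t b i) x * f (face_proj c t b i x)).
Proof.
move=> t0 sf; rewrite smooth_partialM; [|exact: smooth_face_cut|exact: smooth_cproj].
by rewrite cproj_partial eqxx; apply/funext => x /=; rewrite mulr0 add0r.
Qed.

Lemma partial_face_corr c t i f : 0 < t -> smooth f ->
  partial i (face_corr c t i f) = (fun x => partial i f x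
    - partial i (face_cut c t true i) x * f (face_proj c t true i x)
    - partial i (face_cut c t false i) x * f (face_proj c t false i x)).
Proof.
move=> t0 sf.
have s1 := smooth_face_term c true i t0 sf; have s2 := smooth_face_term c false i t0 sf.
have := smooth_partialB i (smoothB sf s1) s2.
by rewrite (smooth_partialB i sf s1) !partial_face_term// => <-.
Qed.

(** Beyond a face, the term of that face has cutoff 1 and the opposite one has cutoff 0. What
    remains is the change of [f] between [x] and its projection. *)
Lemma face_corr_le c t i f x (M : R) : 0 < t -> smooth f -> (forall x, `|partial i f x| <= M) ->
  t <= `|x 0 i - c 0 i| -> `|face_corr c t i f x| <= M * (`|x 0 i - c 0 i| - t).
Proof.
move=> t0 sf fM; have ti : 0 < t^-1 by rewrite invr_gt0.
rewrite /face_corr /face_cut /face_proj /sgb.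
have [xc|xc] := leP 0 (x 0 i - c 0 i).
  rewrite ger0_norm// => tx.
  rewrite step_ge1; last by rewrite mul1r ler_pdivlMr// mul1r.
  rewrite step_le0; last by rewrite mulN1r mulrN oppr_le0 mulr_ge0// ltW.
  rewrite mul1r mul0r subr0 cprojE distrC.
  have H := axis_lipschitz x (c 0 i + 1 * t - x 0 i) sf fM.
  apply: (le_trans H).
  rewrite mul1r ler0_norm; last by clear -tx; lra.
  by rewrite le_eqVlt; apply/orP; left; apply/eqP; congr (_ * _); ring.
rewrite ltr0_norm// => tx.
rewrite [step (_ * (1 / t))]step_le0; last by rewrite mul1r pmulr_lle0// ltW.
rewrite step_ge1; last by rewrite mulN1r mulrN -mulNr ler_pdivlMr// mul1r.
rewrite mul1r mul0r subr0 cprojE distrC.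
apply: (le_trans (axis_lipschitz x (c 0 i + - 1 * t - x 0 i) sf fM)).
rewrite ger0_norm; last by clear -tx; lra.
by rewrite le_eqVlt; apply/orP; left; apply/eqP; congr (_ * _); ring.
Qed.

Lemma face_proj_cube c t b i x : 0 <= t -> cube c t x -> cube c t (face_proj c t b i x).
Proof.
move=> t0 cx j; rewrite !mxE; have [->|_] := eqVneq j i; last exact: cx.
by rewrite addrAC subrr add0r normrM norm_sgb mul1r ger0_norm.
Qed.

Lemma vm_push_restr la (p : 'I_n -> rV -> rV) (w : 'I_n -> rV -> R) Q A :
  (forall i x, Q x -> Q (p i x)) ->
  vm_push la p (fun i x => \1_Q x * w i x) A = vm_push la p (fun i x => \1_Q x * w i x) (A `&` Q).
Proof.
move=> pQ; apply/rowP => i; rewrite !mxE [LHS]Rintegral_mkcond [RHS]Rintegral_mkcond.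
apply: eq_Rintegral => x _; rewrite /patch indicE.
have [Qx|nQx] := pselect (Q x); last first.
  by rewrite (memNset nQx) mul0r; case: ifP; case: ifP.
rewrite (_ : (x \in p i @^-1` (A `&` Q)) = (x \in p i @^-1` A))//.
apply/idP/idP; rewrite !inE; first by case.
by split => //; exact: pQ.
Qed.

Lemma cut_arith (a b1 b2 d e1 e2 : R) : a - b1 - b2 + (d - e1 - e2) = 0 ->
  - (e1 + e2 + (b1 + b2)) = - (a + d).
Proof. by lra. Qed.

Variables (C : R).
Hypotheses (C0 : 0 < C)
  (bumps : forall c (r r' : R), r < r' -> exists psi : rV -> R, is_bump C c r r' psi).

Section one_cut.
Variables (U W : set rV) (nu : set rV -> rV) (c : rV) (t r : R)
  (la : {finite_measure set rV -> \bar R}) (g : 'I_n -> rV -> R).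
Hypotheses (oU : open U) (mW : measurable W) (gW : is_gradient U W nu) (t0 : 0 < t) (r0 : 0 < r)
  (KU : cube c (t + r) `<=` U)
  (dg : forall i, has_density la (cube c (t + r)) (g i) (fun A => nu A 0 i)).

Local Notation K := (cube c (t + r)).
Local Notation Q := (cube c t).

Let mK : measurable K. Proof. exact: measurable_cube. Qed.
Let mQ : measurable Q. Proof. exact: measurable_cube. Qed.
Let cQ : compact Q. Proof. exact: cube_compact. Qed.
Let QK : Q `<=` K. Proof. by apply: sub_cube; rewrite lerDl ltW. Qed.
Let QU : Q `<=` U. Proof. exact: subset_trans KU. Qed.
Let ig i : la.-integrable setT (EFin \o g i). Proof. by case: (dg i). Qed.

Let bQ : bounded_measurable (\1_Q : rV -> R). Proof. exact: bounded_measurable_indic. Qed.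
Let bW : bounded_measurable (\1_W : rV -> R). Proof. exact: bounded_measurable_indic. Qed.

Let bcut b i : bounded_measurable (face_cut c t b i).
Proof.
split; first by apply: smooth_measurable; exact: smooth_face_cut.
by exists 1 => x; have /andP[? ?] := step_ge0_le1 ((x 0 i - c 0 i) * (sgb b / t)); rewrite ger0_norm.
Qed.

Let bpcut b i : bounded_measurable (fun x => \1_Q x * partial i (face_cut c t b i) x).
Proof.
have sp := smooth_partial i (smooth_face_cut c b i t0).
have [M _ HM] := smooth_bounded_on sp cQ.
split; first by apply: measurable_funM; [exact: measurable_indic|exact: smooth_measurable].
exists M => x; rewrite indicE; have [Qx|nQx] := pselect (Q x).
  by rewrite mem_set// mul1r; exact: HM.
by rewrite memNset// mul0r normr0 (le_trans _ (HM c _))//; apply: cube_center; exact: ltW.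
Qed.

Lemma ex_face_push la0 (w0 : 'I_n -> rV -> R) b : (forall i, la0.-integrable setT (EFin \o w0 i)) ->
  exists m, [/\ vector_measure U m, forall A, m A = m (A `&` Q) &
    forall phi K0 i, compact K0 -> K0 `<=` U ->
      bounded_measurable phi -> (forall x, ~ K0 x -> phi x = 0) ->
      vintegral U m i phi = (\int[la0]_(x in Q) (phi (face_proj c t b i x) * w0 i x))%:E].
Proof.
move=> iw; have mp i : measurable_fun setT (face_proj c t b i) by exact: measurable_cproj.
have iw1 i : la0.-integrable setT (EFin \o (fun x => \1_Q x * w0 i x)).
  by apply: integrable_bm_mul => //; exact: iw.
exists (vm_push la0 (face_proj c t b) (fun i x => \1_Q x * w0 i x)); split.
- exact: vm_push_vm.
- by move=> A; apply: vm_push_restr => i x; apply: face_proj_cube; exact: ltW.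
- move=> phi K0 i cK0 K0U bphi phi0.
  rewrite (vintegral_push mp iw1 i cK0 K0U bphi phi0); congr EFin.
  rewrite (@Rintegral_support _ _ la0 Q setT Q)//; last first.
    by move=> x nQ; rewrite indicE memNset// mul0r mulr0.
  apply: eq_Rintegral => x; rewrite inE => Qx.
  by rewrite indicE mem_set// mul1r.
Qed.

Lemma ex_add (m1 m2 : set rV -> rV) : vector_measure U m1 -> vector_measure U m2 ->
  (forall A, m1 A = m1 (A `&` Q)) -> (forall A, m2 A = m2 (A `&` Q)) ->
  exists m, [/\ vector_measure U m, forall A, m A = m (A `&` Q) &
    forall phi K0 i, compact K0 -> K0 `<=` U ->
      bounded_measurable phi -> (forall x, ~ K0 x -> phi x = 0) ->
      vintegral U m i phi =
      (fine (vintegral U m1 i phi) + fine (vintegral U m2 i phi))%:E].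
Proof.
move=> v1 v2 h1 h2; exists (fun A => 1 *: m1 A + 1 *: m2 A); split.
- exact: vm_lin.
- by move=> A; rewrite h1 h2.
- by move=> phi K0 i cK0 K0U bphi phi0; rewrite (vintegral_lin 1 1 i v1 v2 cK0 K0U bphi phi0) !mul1r.
Qed.

(** Integration by parts is exact for [face_corr] of [phi]. Written out, this expresses the defect
    for [phi] itself through integrals of [phi] composed with the face projections, against
    [face_cut * g] and against [\1_W * partial i face_cut]. These are pushforwards to the faces, so
    the defect is a vector measure [tau] with an explicit construction, and the cut set has gradient
    [nu] on the cube plus [tau]. *)
Lemma ex_cut_gradient : exists tau, [/\ vector_measure U tau,
   forall A, measurable A -> tau A = tau (A `&` Q),
   is_gradient U (W `&` Q) (fun A => nu (A `&` Q) + tau A) &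
   forall phi K0 i, smooth phi -> compact K0 -> K0 `<=` U -> (forall x, ~ K0 x -> phi x = 0) ->
     fine (vintegral U tau i phi) =
     - (\int[leb]_(x in Q) (\1_W x * partial i phi x) + \int[la]_(x in Q) (phi x * g i x))].
Proof.
have [lb lbE] := ex_measure_restr mQ (lebesgue_rV_compact cQ).
have [n1 /all_and3[vn1 n1Q n1E]] : exists n1 : bool -> set rV -> rV, forall b, [/\ vector_measure U (n1 b),
    forall A, n1 b A = n1 b (A `&` Q) & forall phi K0 i, compact K0 -> K0 `<=` U ->
      bounded_measurable phi -> (forall x, ~ K0 x -> phi x = 0) ->
      vintegral U (n1 b) i phi = (\int[la]_(x in Q)
        (phi (face_proj c t b i x) * (face_cut c t b i x * g i x)))%:E].
  suff /choice[n1 n1P] : forall b, exists m, [/\ vector_measure U m,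
    forall A, m A = m (A `&` Q) & forall phi K0 i, compact K0 -> K0 `<=` U ->
      bounded_measurable phi -> (forall x, ~ K0 x -> phi x = 0) ->
      vintegral U m i phi = (\int[la]_(x in Q)
        (phi (face_proj c t b i x) * (face_cut c t b i x * g i x)))%:E] by exists n1.
  move=> b; apply: ex_face_push.
  - by move=> i; apply: integrable_bm_mul => //; exact: ig.
have [n2 /all_and3[vn2 n2Q n2E]] : exists n2 : bool -> set rV -> rV, forall b, [/\ vector_measure U (n2 b),
    forall A, n2 b A = n2 b (A `&` Q) & forall phi K0 i, compact K0 -> K0 `<=` U ->
      bounded_measurable phi -> (forall x, ~ K0 x -> phi x = 0) ->
      vintegral U (n2 b) i phi = (\int[lb]_(x in Q)
        (phi (face_proj c t b i x) * (\1_W x * (\1_Q x * partial i (face_cut c t b i) x))))%:E].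
  suff /choice[n2 n2P] : forall b, exists m, [/\ vector_measure U m,
    forall A, m A = m (A `&` Q) & forall phi K0 i, compact K0 -> K0 `<=` U ->
      bounded_measurable phi -> (forall x, ~ K0 x -> phi x = 0) ->
      vintegral U m i phi = (\int[lb]_(x in Q)
        (phi (face_proj c t b i x) * (\1_W x * (\1_Q x * partial i (face_cut c t b i) x))))%:E] by exists n2.
  move=> b; apply: ex_face_push.
  - move=> i; apply: bounded_measurable_integrable => //; first exact: finite_measure_lty.
    exact: bounded_measurableM.
have [m1 [vm1 m1Q m1E]] := ex_add (vn1 true) (vn1 false) (n1Q true) (n1Q false).
have [m2 [vm2 m2Q m2E]] := ex_add (vn2 true) (vn2 false) (n2Q true) (n2Q false).
have [m3 [vm3 m3Q m3E]] := ex_add vm1 vm2 m1Q m2Q.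
(* The measure [- m3], in the form of a linear combination that [vm_lin] and [vintegral_lin]
   accept. *)
pose tau A := (-1) *: m3 A + 0 *: m3 A.
have vtau : vector_measure U tau by exact: vm_lin.
have tauQ A : tau A = tau (A `&` Q) by rewrite /tau m3Q.
have key phi K0 i : smooth phi -> compact K0 -> K0 `<=` U -> (forall x, ~ K0 x -> phi x = 0) ->
    vintegral U tau i phi =
    (- (\int[leb]_(x in Q) (\1_W x * partial i phi x) + \int[la]_(x in Q) (phi x * g i x)))%:E.
  move=> sphi cK0 K0U phi0.
  have bphi := smooth_bounded_measurable sphi cK0 phi0.
  have [M0 fM0] := smooth_partial_bounded sphi cK0 phi0.
  pose M := `|M0| + 1; have M_gt0 : 0 < M by rewrite ltr_wpDl.
  have fM x : `|partial i phi x| <= M.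
    by apply: (le_trans (fM0 i x)); apply: (le_trans (ler_norm _)); rewrite lerDl.
  pose T1 b := \int[la]_(x in Q) (face_cut c t b i x * phi (face_proj c t b i x) * g i x).
  pose T2 b := \int[leb]_(x in Q) (\1_W x * (partial i (face_cut c t b i) x * phi (face_proj c t b i x))).
  have E1 b : vintegral U (n1 b) i phi = (T1 b)%:E.
    rewrite (n1E b phi K0 i)//; congr EFin.
    by apply: eq_Rintegral => x _; rewrite mulrCA mulrA.
  have E2 b : vintegral U (n2 b) i phi = (T2 b)%:E.
    rewrite (n2E b phi K0 i)//; congr EFin.
    rewrite (Rintegral_restr _ lbE)//.
    apply: eq_Rintegral => x; rewrite inE => Qx.
    by rewrite [\1_Q x]indicE (mem_set Qx) mul1r [LHS]mulrC -mulrA.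
  rewrite (vintegral_lin (-1) 0 i vm3 vm3 cK0 K0U bphi phi0) mul0r addr0.
  rewrite (m3E phi K0 i)// (m1E phi K0 i)// (m2E phi K0 i)// !E1 !E2 /= mulN1r; congr EFin.
  have sG := smooth_face_corr c i t0 sphi.
  (* In the shell the derivative of the bump is at most [C / h] and the corrected function at most
     [M h]; the product is at most [C M], over a shell whose volume tends to 0. *)
  have G0 : `|\int[leb]_(x in Q) (\1_W x * partial i (face_corr c t i phi) x) +
      \int[la]_(x in Q) (face_corr c t i phi x * g i x)| <= 0.
    apply/ler_addgt0Pr => e e0; rewrite add0r.
    apply: (cut_limit (U := U) (nu := nu) (r := r) (C := C)) => //.
      by move=> h h0; apply: bumps; rewrite ltrDl.
    move=> h0 h00.
    have [lb2 lb2E] := ex_measure_restr mK (lebesgue_rV_compact (@cube_compact _ _ c (t + r))).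
    have [h1 h10 Hh1] := shell_small lb2 c t (divr_gt0 e0 (mulr_gt0 C0 M_gt0)).
    have hm0 : 0 < Num.min h0 (Num.min h1 r) by rewrite !lt_min h00 h10.
    pose h := Num.min h0 (Num.min h1 r) / 2.
    have hh : 0 < h by rewrite divr_gt0.
    have hlt : h < Num.min h0 (Num.min h1 r).
      by rewrite /h ltr_pdivrMr// ltr_pMr// ltr1n.
    have := hlt; rewrite !lt_min => /andP[hlt0 /andP[hlt1 hltr]].
    exists h; first by rewrite hh hlt0.
    move=> psi [spsi psi01 [psi1 ppsi1] psi0 psiC].
    have pout x : ~ cube c (t + h) x -> partial i psi x = 0.
      apply: partial_out; first exact: cube_closed.
      by move=> y ny; apply: psi0 => /ocube_sub.
    have mG := smooth_measurable sG.
    have mpp := smooth_measurable (smooth_partial i spsi).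
    have bd x : K x -> \1_W x * `|partial i psi x * face_corr c t i phi x| <= C * M * \1_(shell c t h) x.
      move=> Kx; apply: (@le_trans _ _ `|partial i psi x * face_corr c t i phi x|).
        by rewrite indicE; case: (_ \in _); rewrite ?mul1r ?mul0r.
      have CM : 0 <= C * M by rewrite mulr_ge0// ltW.
      have [ncx|cx] := pselect (~ cube c (t + h) x).
        by rewrite pout// mul0r normr0 mulr_ge0.
      have {}cx := contrapT cx.
      have [xt|tx] := leP `|x 0 i - c 0 i| t.
        by rewrite ppsi1// mul0r normr0 mulr_ge0.
      rewrite indicE mem_set ?mulr1; last first.
        by split => // /(_ i); rewrite leNgt tx.
      rewrite normrM; apply: (@le_trans _ _ (C / h * (M * h))); last first.
        by rewrite le_eqVlt; apply/orP; left; apply/eqP; field; rewrite gt_eqF.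
      apply: ler_pM => //; first by have := psiC i x; rewrite addrAC subrr add0r.
      apply: (le_trans (face_corr_le t0 sphi fM (ltW tx))).
      by rewrite ler_wpM2l ?(ltW M_gt0)// lerBlDl; exact: cx.
    have ishell : leb.-integrable K (EFin \o (fun x => \1_(shell c t h) x : R)).
      apply: bounded_measurable_integrable => //; first exact: lebesgue_rV_compact (@cube_compact _ _ _ _).
      by apply: bounded_measurable_indic; exact: measurable_shell.
    apply: (@le_trans _ _ (\int[leb]_(x in K) (C * M * \1_(shell c t h) x))).
      apply: le_Rintegral => //.
      - have [M1 M10 HM1] := smooth_bounded_on sG (@cube_compact _ _ c (t + r)).
        have [M2 M20 HM2] := smooth_bounded_on (smooth_partial i spsi) (@cube_compact _ _ c (t + r)).
        apply: (@bounded_integrable _ _ _ leb K _ (1 * (M2 * M1))) => //.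
        + exact: lebesgue_rV_compact (@cube_compact _ _ _ _).
        + apply: measurable_funTS; apply: measurable_funM; first exact: measurable_indic.
          by apply: measurableT_comp => //; exact: measurable_funM.
        + move=> x Kx; rewrite normrM normr_id normrM; apply: ler_pM => //.
            by rewrite indicE; case: (_ \in _); rewrite ?normr1 ?normr0.
          by apply: ler_pM => //; [exact: HM2|exact: HM1].
      - have -> : EFin \o (fun x => C * M * \1_(shell c t h) x) = (fun x => (C * M)%:E * (EFin \o (fun x => \1_(shell c t h) x : R)) x)%E.
          by apply/funext => x /=; rewrite EFinM.
        exact: integrableZl.
    rewrite RintegralZl// Rintegral_indic//; last exact: measurable_shell.
    have := Hh1 h (ltW hlt1).
    have -> : (lb2 (shell c t h) = leb (shell c t h `&` K))%E by exact: lb2E.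
    have fin : leb (shell c t h `&` K) \is a fin_num.
      rewrite ge0_fin_numE//; apply: le_lt_trans (lebesgue_rV_compact (@cube_compact _ _ c (t + r))).
      apply: le_measure; rewrite ?inE; [|by []|by move=> x []].
      by apply: measurableI => //; exact: measurable_shell.
    rewrite -{1}(fineK fin) lte_fin ltr_pdivlMr ?mulr_gt0// => q.
    by rewrite mulrC ltW.
  have X0 : \int[leb]_(x in Q) (\1_W x * partial i (face_corr c t i phi) x) +
      \int[la]_(x in Q) (face_corr c t i phi x * g i x) = 0.
    by apply/eqP; rewrite -normr_le0.
  have bnd f : smooth f -> bounded_measurable (fun x => \1_Q x * f x).
    move=> sf; have [N _ HN] := smooth_bounded_on sf cQ.
    split; first by apply: measurable_funM; [exact: measurable_indic|exact: smooth_measurable].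
    exists N => x; rewrite indicE; have [Qx|nQx] := pselect (Q x).
      by rewrite mem_set// mul1r; exact: HN.
    by rewrite memNset// mul0r normr0 (le_trans _ (HN c _))//; apply: cube_center; exact: ltW.
  have iQ1 f : smooth f -> leb.-integrable Q (EFin \o (fun x => \1_W x * f x)).
    move=> sf; have [N _ HN] := smooth_bounded_on sf cQ.
    apply: (@bounded_integrable _ _ _ leb Q _ (1 * N)) => //; first exact: lebesgue_rV_compact.
      apply: measurable_funTS; apply: measurable_funM; first exact: measurable_indic.
      exact: smooth_measurable.
    move=> x Qx; rewrite normrM; apply: ler_pM => //; last exact: HN.
    by rewrite indicE; case: (_ \in _); rewrite ?normr1 ?normr0.
  have iQ2 f : smooth f -> la.-integrable Q (EFin \o (fun x => f x * g i x)).
    move=> sf; have [N _ HN] := smooth_bounded_on sf cQ.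
    apply: (@bounded_mul_integrable _ _ _ la Q f (g i) N) => //.
    - by apply: measurable_funTS; exact: smooth_measurable.
    - exact: integrable_sub.
  have st b := smooth_face_term c b i t0 sphi.
  have spt b : smooth (fun x => partial i (face_cut c t b i) x * phi (face_proj c t b i x)).
    apply: (smoothM (f := partial i (face_cut c t b i)) (g := fun x => phi (face_proj c t b i x))).
      by apply: smooth_partial; exact: smooth_face_cut.
    exact: smooth_cproj.
  have spphi := smooth_partial i sphi.
  have X1 : \int[leb]_(x in Q) (\1_W x * partial i (face_corr c t i phi) x) =
      \int[leb]_(x in Q) (\1_W x * partial i phi x) - T2 true - T2 false.
    rewrite /T2 -RintegralB//; [|exact: (iQ1 _ spphi)|exact: (iQ1 _ (spt true))].
    rewrite -RintegralB//; last 2 first.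
    - have := iQ1 _ (smoothB spphi (spt true)); apply: eq_integrable => // x _ /=.
      by rewrite mulrBr.
    - exact: (iQ1 _ (spt false)).
    by apply: eq_Rintegral => x _; rewrite partial_face_corr// !mulrBr.
  have X2 : \int[la]_(x in Q) (face_corr c t i phi x * g i x) =
      \int[la]_(x in Q) (phi x * g i x) - T1 true - T1 false.
    rewrite /T1 -RintegralB//; [|exact: iQ2|exact: (iQ2 _ (st true))].
    rewrite -RintegralB//; last 2 first.
    - have := iQ2 _ (smoothB sphi (st true)); apply: eq_integrable => // x _ /=.
      by rewrite mulrBl.
    - exact: (iQ2 _ (st false)).
    by apply: eq_Rintegral => x _; rewrite /face_corr !mulrBl.
  by apply: cut_arith; rewrite -X0 X1 X2.
exists tau; split => //.
- have vnQ : vector_measure U (fun A => nu (A `&` Q)).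
    by apply: vector_measureS; apply: vm_restr cQ QU; case: gW.
  suff H : fgradient U \1_(W `&` Q) (fun A => 1 *: nu (A `&` Q) + 1 *: tau A).
    have -> // : (fun A => nu (A `&` Q) + tau A) = (fun A => 1 *: nu (A `&` Q) + 1 *: tau A).
    by apply/funext => A; rewrite !scale1r.
  split; first exact: vm_lin.
  move=> f tf i.
  have [K0 [cK0 K0U f0]] := test_functionE tf.
  have sf : smooth f by case: tf.
  have bf := smooth_bounded_measurable sf cK0 f0.
  have pf0 x : ~ K0 x -> partial i f x = 0.
    by apply: partial_out => //; exact: compact_closed_rV.
  have bp := smooth_bounded_measurable (smooth_partial i sf) cK0 pf0.
  rewrite (vintegral_lin 1 1 i vnQ vtau cK0 K0U bf f0) (key f K0)//=.
  have -> : vintegral U (fun A => nu (A `&` Q)) i f = (\int[la]_(x in Q) (f x * g i x))%:E.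
    rewrite (@vintegral_eq _ _ _ _ (vm_push la (fun=> id) (fun i x => \1_Q x * g i x))); last first.
      move=> A [mA _]; apply/rowP => j; rewrite mxE; case: (dg j) => _ ->; last 2 first.
      - exact: measurableI.
      - by move=> x [_ /QK].
      rewrite Rintegral_mkcondr; apply: eq_Rintegral => x _.
      by rewrite /patch indicE; case: (_ \in _); rewrite ?mul1r ?mul0r.
    rewrite (vintegral_push _ _ _ cK0 K0U bf f0)//; last first.
      by move=> j; apply: integrable_bm_mul => //; exact: ig.
    congr EFin; rewrite (@Rintegral_support _ _ _ Q setT Q)//; last first.
      by move=> x nQ; rewrite indicE memNset// mul0r mulr0.
    by apply: eq_Rintegral => x; rewrite inE => Qx; rewrite indicE mem_set// mul1r.
  rewrite (integral_support cK0 K0U); last 2 first.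
  + by apply: bounded_measurableM => //; apply: bounded_measurable_indic; exact: measurableI.
  + by move=> x /pf0 ->; rewrite mulr0.
  congr EFin; rewrite /= !mul1r opprD opprK addrCA addNr addr0.
  transitivity (\int[leb]_x (\1_(W `&` Q) x * partial i f x)).
    apply: (@Rintegral_support _ _ leb K0); [exact: subset_refl|exact: subsetT|].
    by move=> x /pf0 ->; rewrite mulr0.
  transitivity (\int[leb]_(x in Q) (\1_(W `&` Q) x * partial i f x)).
    apply: (@Rintegral_support _ _ leb Q); [exact: subsetT|exact: subset_refl|].
    by move=> x nQ; rewrite indicE memNset ?mul0r// => -[].
  apply: eq_Rintegral => x; rewrite inE => Qx; congr (_ * _).
  by rewrite indicI /= [\1_Q x]indicE mem_set// mulr1.
- by move=> phi K0 i sphi cK0 K0U phi0; rewrite (key phi K0).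
Qed.

End one_cut.

End cut_gradient.

Section cut_estimate.
Context {R : realType} {n : nat}.
Local Notation rV := 'rV[R]_n.
Local Notation leb := (@lebesgue_rV R n).
Implicit Types (A B K L U W : set rV) (nu tau : set rV -> rV) (c x : rV) (t r h q : R).

Lemma vnorm_le_sum (g : 'I_n -> rV -> R) x : vnorm g x <= \sum_i `|g i x|.
Proof.
apply: (le_trans (enorm_le_sum _)); rewrite le_eqVlt; apply/orP; left; apply/eqP.
by apply: eq_bigr => i _; rewrite mxE.
Qed.

(* Q is the closed cube; tau is the trace of W on the faces of Q. *)
Lemma cut_gradient : exists2 C : R, 0 < C & forall U W nu c t q, open U -> measurable W ->
  is_gradient U W nu -> 0 < t -> cube c t `<=` U -> 0 <= q ->
  (forall h0, 0 < h0 -> exists2 h, 0 < h < h0 & (leb (W `&` shell c t h) <= (q * h)%:E)%E) ->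
  exists tau, [/\ vector_measure U tau,
    forall A, measurable A -> tau A = tau (A `&` cube c t),
    is_gradient U (W `&` cube c t) (fun A => nu (A `&` cube c t) + tau A) &
    (Defs.total_variation U tau U <= (C * q)%:E)%E].
Proof.
have [C C0 bumps] := @cube_bump R n.
have bumps' (c : rV) (r r' : R) : r < r' -> exists psi : rV -> R, is_bump C c r r' psi by exact: bumps.
(* Each of the [n] components of the trace has mass at most [C q]; the added 1 keeps the constant
   positive. *)
exists (C * (n%:R + 1)); first by rewrite mulr_gt0// ltr_wpDl.
move=> U W nu c t q oU mW gW t0 QU q0 Hq.
have [r r0 KU] := cube_margin (ltW t0) oU QU.
have nuU : vector_measure U nu by case: gW.
have cK : compact (cube c (t + r)) by exact: cube_compact.
have [la [g gP]] := @vm_density R n unit U _ (fun=> nu) (fun=> nuU) cK KU.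
have dg := gP tt; rewrite /= in dg.
have [tau [vtau tauQ gtau tauE]] := ex_cut_gradient C0 bumps' mW gW t0 r0 KU dg.
exists tau; split => //.
set Q := cube c t in QU tauQ gtau tauE *.
have cQ : compact Q by exact: cube_compact.
have mQ : measurable Q by exact: measurable_cube.
have QK : Q `<=` cube c (t + r) by apply: sub_cube; rewrite lerDl ltW.
have mK : measurable (cube c (t + r)) by exact: measurable_cube.
(* Now the test function does not vanish on the faces: [C / h] for the derivative of the bump times
   [q h] for the volume of [W] in the shell gives [C q], whatever [h] is. *)
have bound phi i : smooth phi -> (forall x, `|phi x| <= 1) ->
    `|\int[leb]_(x in Q) (\1_W x * partial i phi x) + \int[la]_(x in Q) (phi x * g tt i x)| <= C * q.
  move=> sphi phi1.
  apply: (cut_limit (U := U) (nu := nu) (r := r) (C := C)) => //.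
    by move=> h h0; apply: bumps; rewrite ltrDl.
  move=> h0 h00.
  have hm : 0 < Num.min h0 r by rewrite lt_min h00.
  have [h /andP[hh hlt] hW] := Hq _ hm.
  move: hlt; rewrite lt_min => /andP[hlt0 hltr].
  exists h; first by rewrite hh.
  move=> psi [spsi psi01 [psi1 ppsi1] psi0 psiC].
  have pout x : ~ cube c (t + h) x -> partial i psi x = 0.
    apply: partial_out; first exact: cube_closed.
    by move=> y ny; apply: psi0 => /ocube_sub.
  have Ch : 0 <= C / h by rewrite divr_ge0// ltW.
  have bd x : \1_W x * `|partial i psi x * phi x| <= C / h * \1_(W `&` shell c t h) x.
    rewrite indicE; have [Wx|nWx] := pselect (W x); last first.
      by rewrite (memNset nWx) mul0r mulr_ge0.
    rewrite (mem_set Wx) mul1r.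
    have [ncx|cx] := pselect (~ cube c (t + h) x).
      by rewrite pout// mul0r normr0 mulr_ge0.
    have {}cx := contrapT cx.
    have [xt|tx] := leP `|x 0 i - c 0 i| t.
      by rewrite ppsi1// mul0r normr0 mulr_ge0.
    rewrite indicE mem_set ?mulr1; last first.
      by split => //; split => // /(_ i); rewrite leNgt tx.
    rewrite normrM -[leRHS]mulr1; apply: ler_pM => //.
    by have := psiC i x; rewrite addrAC subrr add0r.
  have mS : measurable (W `&` shell c t h) by apply: measurableI => //; exact: measurable_shell.
  have iS : leb.-integrable (cube c (t + r)) (EFin \o (fun x => \1_(W `&` shell c t h) x : R)).
    apply: bounded_measurable_integrable => //; first exact: lebesgue_rV_compact.
    exact: bounded_measurable_indic.
  apply: (@le_trans _ _ (\int[leb]_(x in cube c (t + r)) (C / h * \1_(W `&` shell c t h) x))).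
    apply: le_Rintegral => //.
    - have [M2 M20 HM2] := smooth_bounded_on (smooth_partial i spsi) cK.
      apply: (@bounded_integrable _ _ _ leb (cube c (t + r)) _ (1 * (M2 * 1))) => //.
      + exact: lebesgue_rV_compact.
      + apply: measurable_funTS; apply: measurable_funM; first exact: measurable_indic.
        have mabs (z : rV -> R) : measurable_fun setT z -> measurable_fun setT (fun x => `|z x|).
          by move=> mz; exact: measurableT_comp.
        apply: mabs.
        apply: measurable_funM; last exact: smooth_measurable sphi.
        exact: smooth_measurable (smooth_partial i spsi).
      + move=> x Kx; rewrite normrM normr_id normrM; apply: ler_pM => //.
          by rewrite indicE; case: (_ \in _); rewrite ?normr1 ?normr0.
        by apply: ler_pM => //; exact: HM2.
    - have -> : EFin \o (fun x => C / h * \1_(W `&` shell c t h) x) = (fun x => (C / h)%:E * (EFin \o (fun x => \1_(W `&` shell c t h) x : R)) x)%E.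
        by apply/funext => x /=; rewrite EFinM.
      exact: integrableZl.
  rewrite RintegralZl// Rintegral_indic//.
  have -> : W `&` shell c t h `&` cube c (t + r) = W `&` shell c t h.
    apply/setIidPl => x [_ [cx _]]; apply: sub_cube cx.
    by rewrite lerD2l ltW.
  have fin : leb (W `&` shell c t h) \is a fin_num.
    by rewrite ge0_fin_numE//; apply: le_lt_trans hW _; exact: ltry.
  have hW' : fine (leb (W `&` shell c t h)) <= q * h by rewrite -lee_fin fineK.
  apply: (le_trans (ler_wpM2l Ch hW')).
  by rewrite le_eqVlt; apply/orP; left; apply/eqP; field; rewrite gt_eqF.
have -> : Defs.total_variation U tau U = Defs.total_variation U tau Q.
  apply/eqP; rewrite eq_le; apply/andP; split; last exact: total_variationS.
  apply: ge_ereal_sup => _ [m [A [iA tA AU ->]]].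
  apply: ereal_sup_ubound; exists m, (fun k => A k `&` Q); split.
  - by move=> k; exact: interior_borelI.
  - exact: trivIset_setIr.
  - by move=> k x [].
  - by apply: eq_bigr => k _; rewrite tauQ//; case: (iA k).
have [V [L [oV cL QV VL LU]]] := compact_nbhd cQ oU QU.
have [lb [s sP]] := @vm_density R n unit U L (fun=> tau) (fun=> vtau) cL LU.
have ds := sP tt; rewrite /= in ds.
have is_ i : lb.-integrable setT (EFin \o s tt i) by case: (ds i).
have QL := subset_trans QV VL.
rewrite (total_variation_density vtau cL LU ds mQ QL).
rewrite -EFin_Rintegral//; last by apply: integrable_sub => //; exact: integrable_vnorm.
rewrite lee_fin; apply: (@le_trans _ _ (\int[lb]_(x in Q) \sum_(i <- index_enum 'I_n) `|s tt i x|)).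
  apply: le_Rintegral => //.
  - by apply: integrable_sub => //; exact: integrable_vnorm.
  - have -> : EFin \o (fun x => \sum_(i <- index_enum 'I_n) `|s tt i x|) = (fun x => \sum_(i <- index_enum 'I_n) (EFin \o (fun x => `|s tt i x|)%R) x)%E.
      by apply/funext => x /=; rewrite sumEFin.
    by apply: integrable_sum => // i _; apply: integrable_sub => //; exact: integrable_norm (is_ i).
  - by move=> x _; exact: vnorm_le_sum.
rewrite Rintegral_sum//; last by move=> i; apply: integrable_sub => //; exact: integrable_norm (is_ i).
apply: (@le_trans _ _ (\sum_(i < n) C * q)).
  apply: ler_sum => i _; apply/ler_addgt0Pr => e e0.
  have [phi [tphi phi1 h]] := dual_approx (is_ i) mQ QL cL oV QV e0.
  apply: (le_trans h); rewrite lerD2r.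
  have sphi : smooth phi by case: tphi.
  have [K0 [cK0 K0V phi0]] := test_functionE tphi.
  have phi0L x : ~ L x -> phi x = 0 by move=> nL; apply: phi0 => /K0V/VL.
  have := tauE phi L i sphi cL LU phi0L.
  rewrite (vintegral_density cL LU (ds i) (smooth_measurable sphi) phi1 phi0L)/= => E.
  have -> : \int[lb]_x (phi x * s tt i x) = \int[lb]_(x in L) (phi x * s tt i x).
    by apply: (@Rintegral_support _ _ lb L) => // x /phi0L ->; rewrite mul0r.
  by rewrite E; apply: (le_trans (ler_norm _)); rewrite normrN; exact: bound.
rewrite sumr_const card_ord -[leLHS]mulr_natr mulrAC ler_wpM2r// ler_wpM2l ?(ltW C0)//.
by rewrite lerDl.
Qed.

(** If a monotone function has mean slope below [q] on an interval, then at some point its lower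
    right slope is at most [q]. Applied to a volume as a function of the radius, it yields a cube on
    whose faces the trace is small. *)
Lemma slow_growth (M : R -> R) (s r q : R) : s < r ->
  (forall t u, s <= t -> t <= u -> u <= r -> M t <= M u) -> M r - M s < q * (r - s) ->
  exists t, [/\ s <= t, t < r & forall h0, 0 < h0 -> exists2 h, 0 < h < h0 & M (t + h) - M t <= q * h].
Proof.
move=> sr mono lt; apply: contrapT => H.
have q0 : 0 < q.
  rewrite -(pmulr_lgt0 _ (_ : 0 < r - s)) ?subr_gt0//; apply: le_lt_trans lt.
  by rewrite subr_ge0 mono// ltW.
have {}H t : s <= t -> t < r -> exists2 h0, 0 < h0 & forall h, 0 < h < h0 -> q * h < M (t + h) - M t.
  move=> st tr; apply: contrapT => H2; apply: H; exists t; split => // h0 h00.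
  apply: contrapT => H3; apply: H2; exists h0 => // h hh; rewrite ltNge; apply/negP => le.
  by apply: H3; exists h.
(* The points up to which [M] has gained at least rate [q]. If the claim fails, the set extends
   beyond its supremum, unless that supremum is [r], where the mean slope contradicts it. *)
pose S := [set t | s <= t <= r /\ q * (t - s) <= M t - M s].
have Ss : S s by split; [rewrite lexx ltW|rewrite !subrr mulr0].
have hS : has_sup S by split; [exists s|exists r => t [/andP[]]].
pose T := sup S.
have sT : s <= T by apply: ub_le_sup => //; case: hS.
have Tr : T <= r by apply: ge_sup; [exists s|move=> t [/andP[]]].
have ST : q * (T - s) <= M T - M s.
  apply/ler_addgt0Pr => e e0.
  have eq0 : 0 < e / q by rewrite divr_gt0.
  have [t [/andP[st tr] St] tT] := sup_adherent eq0 hS.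
  have tT' : t <= T by apply: ub_le_sup; [case: hS|split => //; rewrite st].
  have M1 := mono t T st tT' Tr.
  have : q * (T - t) <= e.
    rewrite mulrC -ler_pdivlMr//; move: tT; rewrite -/T; clear; lra.
  move: St M1; clear; nra.
have [Tr'|rT] := ltP T r; last first.
  have E : T = r by apply/eqP; rewrite eq_le Tr.
  by move: ST; rewrite E leNgt lt.
have [h0 h00 Hh] := H T sT Tr'.
pose h := Num.min h0 (r - T) / 2.
have m0 : 0 < Num.min h0 (r - T) by rewrite lt_min h00 subr_gt0.
have hh : 0 < h by rewrite divr_gt0.
have hm : h < Num.min h0 (r - T) by rewrite /h ltr_pdivrMr// ltr_pMr// ltr1n.
move: hm; rewrite lt_min => /andP[h1 h2].
have := Hh h; rewrite hh h1 => /(_ isT) h3.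
have : S (T + h).
  split; first by apply/andP; split; move: sT h2 hh; clear; lra.
  by move: ST h3; clear; nra.
move=> SS; have := ub_le_sup hS.2 SS; rewrite -/T -subr_ge0 opprD addrA subrr add0r oppr_ge0.
by rewrite leNgt hh.
Qed.

End cut_estimate.

(** * Comparison with competitors *)

Section perimeter_measures.
Context {R : realType} {n : nat}.
Local Notation rV := 'rV[R]_n.
Local Notation leb := (@lebesgue_rV R n).
Implicit Types (la : {finite_measure set rV -> \bar R}) (A B E K L U W : set rV) (nu tau : set rV -> rV)
  (a : rV -> R).

Lemma ex_perimeter_measure U W : locally_finite_perimeter U W ->
  exists mu : {measure set rV -> \bar R}, perimeter_measure U W = mu.
Proof.
by move=> /gradient_is_gradient[vm _]; have [mu E] := ex_total_variation vm; exists mu.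
Qed.

Lemma weighted_density U K la (g : 'I_n -> rV -> R) nu a A :
  vector_measure U nu -> compact K -> K `<=` U ->
  (forall i, has_density la K (g i) (fun A => nu A 0 i)) ->
  measurable A -> A `<=` K -> measurable_fun A a -> (forall x, A x -> 0 <= a x <= 1) ->
  (\int[Defs.total_variation U nu]_(x in A) (a x)%:E)%E = (\int[la]_(x in A) (a x * vnorm g x))%:E.
Proof.
move=> vm cK KU dg mA AK ma a01.
have [mu muE] := ex_total_variation vm; rewrite muE.
have iv : la.-integrable setT (EFin \o vnorm g) by apply: integrable_vnorm => i; case: (dg i).
have [P [PE Pf]] := ex_density_measure iv (fun x => enorm_ge0 _).
have a1 x : A x -> `|a x| <= 1 by move=> /a01/andP[? ?]; rewrite ger0_norm.
transitivity (\int[P]_(x in A) (a x)%:E)%E.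
  apply: eq_measure_integral => B mB BA; rewrite -muE.
  apply: (etrans _ (esym (PE B mB))).
  by apply: (total_variation_density vm cK KU dg mB); exact: subset_trans AK.
rewrite -EFin_Rintegral//; first by rewrite (Pf A a 1).
by apply: (bounded_integrable mA _ ma a1); exact: finite_measure_lty.
Qed.

Lemma indic_1E (U : set rV) x : U x -> \1_U x = 1 :> R.
Proof. by move=> Ux; rewrite indicE mem_set. Qed.

Lemma is_gradient_self U : measurable U -> is_gradient U U (fun=> 0).
Proof.
move=> mU; have b1 : @bounded_measurable R n (cst 1) by split => //; exists 1 => x; rewrite normr1.
apply: (fgradient_ae mU b1 (bounded_measurable_indic mU) _ (fgradient_cst U 1)).
by apply: aeW => x Ux; rewrite indic_1E.
Qed.

Lemma is_gradient_set0 U : measurable U -> is_gradient U set0 (fun=> 0).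
Proof.
move=> mU; have b1 : @bounded_measurable R n (cst 0) by split => //; exists 0 => x; rewrite normr0.
apply: (fgradient_ae mU b1 (bounded_measurable_indic measurable0) _ (fgradient_cst U 0)).
by apply: aeW => x Ux; rewrite indic0.
Qed.

Lemma total_variation_zero U (nu : set rV -> rV) E :
  (forall A, interior_borel U A -> A `<=` E -> nu A = 0) -> Defs.total_variation U nu E = 0%E.
Proof.
move=> H; apply/eqP; rewrite eq_le; apply/andP; split.
  apply: ge_ereal_sup => _ [m [A [iA _ AE ->]]].
  by rewrite big1// => k _; rewrite H// enorm0.
apply: ereal_sup_ubound; exists 0%N, (fun=> set0); split.
- by move=> k; exact: interior_borel0.
- by apply/trivIsetP => *; rewrite set0I.
- by move=> _ x.
- by rewrite big_ord0.
Qed.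

Lemma total_variation_off U nu nu' K E :
  (forall A, interior_borel U A -> A `&` K = set0 -> nu A = nu' A) -> E `&` K = set0 ->
  Defs.total_variation U nu E = Defs.total_variation U nu' E.
Proof.
move=> H EK; apply: total_variation_eq => A iA AE; apply: H => //.
by apply/seteqP; split => // x [/AE Ex Kx]; rewrite -EK.
Qed.

End perimeter_measures.

Section comparison.
Context {R : realType} {n N : nat}.
Local Notation rV := 'rV[R]_n.
Local Notation leb := (@lebesgue_rV R n).
Implicit Types (Omega K A : set rV) (W V : 'I_N -> set rV) (a : rV -> R).
Local Open Scope ereal_scope.

(** Compare with the tuple that gives all of [Omega] to one phase: its gradients in [Omega] vanish.
    Finiteness is what later allows the common part of two energies to be cancelled. *)
Lemma weighted_perimeter_lty Omega a G W : (0 < N)%N -> open Omega ->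
  minimizer Omega a G W -> weighted_perimeter Omega a W < +oo.
Proof.
move=> N0 oO [wW minW]; have mO := open_measurable_rV oO.
pose V (i : 'I_N) := if (i : nat) == 0%N then Omega else set0.
have gV i : is_gradient Omega (V i) (fun=> 0%R).
  by rewrite /V; case: eqP => _; [exact: is_gradient_self|exact: is_gradient_set0].
have wV : weak_partition Omega V.
  split.
    move=> i; split; last by exists (fun=> 0%R).
    - by rewrite /V; case: eqP.
    - by rewrite /V; case: eqP => // _ x.
  apply: aeW => x; rewrite (bigD1 (Ordinal N0))//= big1 ?addr0//.
  move=> i /eqP i0; rewrite /V ifF ?indic0//.
  by apply/eqP => i00; apply: i0; apply/val_inj.
have pV0 i : perimeter_measure Omega (V i) = @mzero _ rV R.
  have mV : measurable (V i) by rewrite /V; case: eqP.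
  rewrite (perimeter_measureE oO mV (gV i)).1; apply/funext => E.
  by rewrite total_variation_zero.
have := minW V wV; rewrite /energy.
have -> : weighted_perimeter Omega a V = 0.
  by rewrite /weighted_perimeter big1// => i _; rewrite pV0 integral_measure_zero.
rewrite add0e => h; have : weighted_perimeter Omega a W + (G W)%:E < +oo.
  by apply: le_lt_trans h _; exact: ltry.
by case: (weighted_perimeter Omega a W) => //= r _; exact: ltry.
Qed.

(** Away from [K] the perimeter measures of the two tuples coincide, and that common part of the
    energy is finite, hence cancels. *)
Lemma minimizer_compare Omega a (G : ('I_N -> set rV) -> R) (Ca al D : R) W V K :
  (0 < N)%N -> open Omega -> measurable_fun Omega a -> (forall x, Omega x -> (0 < a x)%R) ->
  (forall V V', weak_partition Omega V -> weak_partition Omega V' ->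
      (`|G V - G V'|%:E <= Ca%:E * partition_dist V V' `^ al)) ->
  (0 <= al)%R -> (0 <= Ca)%R -> minimizer Omega a G W -> weak_partition Omega V ->
  compact K -> K `<=` Omega ->
  (forall k A, interior_borel Omega A -> A `&` K = set0 ->
    gradient Omega (W k) A = gradient Omega (V k) A) ->
  partition_dist V W <= D%:E ->
  \sum_k \int[perimeter_measure Omega (W k)]_(x in K) (a x)%:E <=
  \sum_k \int[perimeter_measure Omega (V k)]_(x in K) (a x)%:E + (Ca * D `^ al)%:E.
Proof.
move=> N0 oO ma a0 hG al0 Ca0 minW wV cK KO agree distD.
have mO := open_measurable_rV oO; have mK := compact_measurable_rV cK.
have wlt := weighted_perimeter_lty N0 oO minW.
have [wW minE] := minW.
have /choice[mu muE] k : exists mu : {measure set rV -> \bar R}, perimeter_measure Omega (W k) = mu.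
  by apply: ex_perimeter_measure; have [/(_ k)[]] := wW.
have /choice[mv mvE] k : exists mu : {measure set rV -> \bar R}, perimeter_measure Omega (V k) = mu.
  by apply: ex_perimeter_measure; have [/(_ k)[]] := wV.
pose O1 := Omega `\` K.
have mO1 : measurable O1 by exact: measurableD.
have mu_off k E : measurable E -> E `<=` O1 -> mu k E = mv k E.
  move=> mE EO1; rewrite -muE -mvE; apply: (total_variation_off (K := K)); first exact: agree.
  by apply/seteqP; split => // x [/EO1[_ nK]].
have split_int (m : {measure set rV -> \bar R}) : \int[m]_(x in Omega) (a x)%:E =
    \int[m]_(x in K) (a x)%:E + \int[m]_(x in O1) (a x)%:E.
  rewrite -[in LHS](setDUK KO) ge0_integral_setU//.
  - by rewrite setDUK//; apply/measurable_EFinP.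
  - by move=> x; rewrite setDUK// => /a0/ltW; rewrite lee_fin.
  - by rewrite disj_set2E setDIK.
have K0 (m : {measure set rV -> \bar R}) : 0 <= \int[m]_(x in K) (a x)%:E.
  by apply: integral_ge0 => x /KO/a0/ltW; rewrite lee_fin.
have O0 (m : {measure set rV -> \bar R}) : 0 <= \int[m]_(x in O1) (a x)%:E.
  by apply: integral_ge0 => x [/a0/ltW + _]; rewrite lee_fin.
pose X := \sum_k \int[mu k]_(x in O1) (a x)%:E.
rewrite [leLHS](eq_bigr (fun k => \int[mu k]_(x in K) (a x)%:E)); last by move=> k _; rewrite muE.
rewrite [X in _ <= X + _](eq_bigr (fun k => \int[mv k]_(x in K) (a x)%:E)); last by move=> k _; rewrite mvE.
pose p := \sum_k \int[mu k]_(x in K) (a x)%:E.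
pose q := \sum_k \int[mv k]_(x in K) (a x)%:E.
have X0 : 0 <= X by apply: sume_ge0.
have p0 : 0 <= p by apply: sume_ge0.
have q0 : 0 <= q by apply: sume_ge0.
have EW : weighted_perimeter Omega a W = p + X.
  rewrite /weighted_perimeter /p /X -big_split/=; apply: eq_bigr => k _.
  by rewrite muE split_int.
have EV : weighted_perimeter Omega a V = q + X.
  rewrite /weighted_perimeter /q /X -big_split/=; apply: eq_bigr => k _.
  rewrite mvE split_int; congr (_ + _); apply: eq_measure_integral => A mA AO1.
  by rewrite mu_off.
rewrite -/p -/q; move: (p) (q) p0 q0 EW EV => {}p {}q p0 q0 EW EV.
have Xfin : X \is a fin_num.
  rewrite ge0_fin_numE//; apply: le_lt_trans wlt; rewrite EW; exact: leeDr.
have pfin : p \is a fin_num.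
  rewrite ge0_fin_numE//; apply: le_lt_trans wlt; rewrite EW; exact: leeDl.
have hGV : (`|G V - G W| <= Ca * D `^ al)%R.
  rewrite -lee_fin; apply: (le_trans (hG V W wV wW)).
  have d0 : 0 <= partition_dist V W by apply: sume_ge0.
  rewrite EFinM -poweR_EFin; apply: lee_wpmul2l; first by rewrite lee_fin.
  apply: gt0_ler_poweR => //; rewrite in_itv/= leey andbT//.
  exact: le_trans distD.
have := minE V wV; rewrite /energy EW EV.
have [qoo _|qoo] := eqVneq q +oo; first by rewrite qoo addye ?leey.
have qfin : q \is a fin_num by rewrite ge0_fin_numE// ltey.
rewrite -(fineK pfin) -(fineK qfin) -(fineK Xfin) -!EFinD !lee_fin => h.
move: hGV; rewrite ler_norml => /andP[_ h2].
by move: h h2; set u := (Ca * _)%R; clear; lra.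
Qed.

End comparison.

(** * Absorption of the volume term *)

Section absorption.
Context {R : realType}.
Implicit Types (q v al : R).

(** Since [al > (n - 1) / n], the exponent [be = al n - (n - 1)] is positive, and
    [(v^al)^n = v^(n-1) v^be] is a small multiple of the left-hand side when [v] is small. *)
Lemma absorb (n : nat) (A' al : R) : (1 < n)%N -> 0 <= A' -> (n%:R - 1) / n%:R < al ->
  exists2 v0, 0 < v0 & forall v q (A : R), 0 <= v <= v0 -> 0 <= q -> 0 <= A ->
    v ^+ n.-1 <= 2 * (n%:R * (A * q + A' * v `^ al)) ^+ n ->
    v ^+ n.-1 <= (8 * n%:R * A * q) ^+ n.
Proof.
move=> n1 A'0 hal.
have n0 : (0 < n)%N by exact: ltnW.
have nR : 0 < n%:R :> R by rewrite ltr0n.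
pose be := al * n%:R - n.-1%:R.
have be0 : 0 < be.
  by rewrite subr_gt0; move: hal; rewrite ltr_pdivrMr// -subn1 natrB.
(* With [v^be <= c] the volume term is at most half of the left-hand side: the 4 accounts for this
   half and for the factor 2 of the hypothesis, and [2 (n A')] for the split of the [n]-th power of
   a sum. The added 1 covers [A' = 0]. *)
pose c := (4 * (2 * (n%:R * A')) ^+ n + 1)^-1.
have B0 : 0 <= (2 * (n%:R * A')) ^+ n by rewrite exprn_ge0// mulr_ge0// mulr_ge0// ltW.
have c0 : 0 < c by rewrite invr_gt0 ltr_wpDl// mulr_ge0.
exists (c `^ be^-1); first exact: powR_gt0.
move=> v q A /andP[v0 vc] q0 A0 H.
have [->|vn0] := eqVneq v 0.
  rewrite expr0n -subn1 subn_eq0 leqNgt n1/= exprn_ge0//.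
  by rewrite !mulr_ge0.
have vgt0 : 0 < v by rewrite lt_neqAle eq_sym vn0.
have vbe : v `^ be <= c.
  rewrite -[leRHS]powRr1; last exact: ltW.
  rewrite -(mulVf (lt0r_neq0 be0)) powRrM; apply: ge0_ler_powR => //; rewrite ?nnegrE ?powR_ge0//.
  exact: ltW.
have E1 : (v `^ al) ^+ n = v ^+ n.-1 * v `^ be.
  rewrite -powR_mulrn ?powR_ge0// -powRrM -powR_mulrn// -powRD; last by rewrite vn0 implybT.
  by congr (_ `^ _); rewrite /be addrC subrK.
have two (x y : R) : 0 <= x -> 0 <= y -> (x + y) ^+ n <= 2 ^+ n * (x ^+ n + y ^+ n).
  move=> x0 y0; wlog xy : x y x0 y0 / x <= y.
    by move=> W; have [|/ltW] := leP x y; [exact: W|rewrite addrC [X in _ <= _ * X]addrC; exact: W].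
  apply: (@le_trans _ _ ((2 * y) ^+ n)).
    by apply: lerXn2r; rewrite ?nnegrE ?addr_ge0 ?mulr_ge0//; lra.
  by rewrite exprMn ler_wpM2l ?exprn_ge0// lerDr exprn_ge0.
set X := 2 * (n%:R * (A * q)).
set Y := 2 * (n%:R * A').
have h1 : v ^+ n.-1 <= 2 * (X ^+ n + Y ^+ n * (v ^+ n.-1 * v `^ be)).
  apply: (le_trans H); rewrite ler_wpM2l// -E1.
  have p1 : 0 <= n%:R * (A * q) by rewrite mulr_ge0 ?mulr_ge0// ltW.
  have p2 : 0 <= n%:R * (A' * v `^ al) by rewrite mulr_ge0 ?mulr_ge0 ?powR_ge0// ltW.
  rewrite mulrDr; apply: (le_trans (two _ _ p1 p2)).
  by rewrite mulrDr /X /Y !exprMn !mulrA.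
have h2 : Y ^+ n * (v ^+ n.-1 * v `^ be) <= v ^+ n.-1 / 4.
  rewrite mulrCA ler_wpM2l ?exprn_ge0//.
  apply: (@le_trans _ _ (Y ^+ n * c)); first by rewrite ler_wpM2l.
  rewrite /c -/Y ler_pdivrMr ?ltr_wpDl ?mulr_ge0//; move: B0; rewrite -/Y; clear; lra.
have h3 : v ^+ n.-1 <= 4 * X ^+ n by move: h1 h2; set a := v ^+ _; set b := X ^+ _; set d := _ * (_ * _); clear; lra.
apply: (le_trans h3).
have -> : 8 * n%:R * A * q = 4 * X by rewrite /X; ring.
rewrite [leRHS]exprMn ler_wpM2r ?exprn_ge0//.
  by rewrite !mulr_ge0// ltW.
by rewrite -[leLHS]expr1 ler_weXn2l// ler1n.
Qed.

End absorption.

(** * Quasi-minimizers and the competitor that fills a cube *)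

Section quasi_minimizers.
Context {R : realType} {n N : nat}.
Local Notation rV := 'rV[R]_n.
Local Notation leb := (@lebesgue_rV R n).
Implicit Types (A B E K L U Omega Theta : set rV) (nu tau : set rV -> rV) (a : rV -> R)
  (W V : 'I_N -> set rV) (Ca al delta D q t r : R) (c x : rV).

Lemma total_variation_le U nu nu1 nu2 E :
  (forall A, interior_borel U A -> A `<=` E -> enorm (nu A) <= enorm (nu1 A) + enorm (nu2 A)) ->
  (Defs.total_variation U nu E <= Defs.total_variation U nu1 E + Defs.total_variation U nu2 E)%E.
Proof.
move=> H; apply: ge_ereal_sup => _ [m [A [iA tA AE ->]]].
apply: (@le_trans _ _ (\sum_(k < m) (enorm (nu1 (A k)))%:E + \sum_(k < m) (enorm (nu2 (A k)))%:E)%E).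
  by rewrite -big_split/=; apply: lee_sum => k _; rewrite -EFinD lee_fin; exact: H.
by apply: leeD; apply: ereal_sup_ubound; exists m, A; split.
Qed.

Lemma weak_partition_disjoint Omega W k l : weak_partition Omega W -> k != l ->
  leb (W k `&` W l) = 0.
Proof.
move=> [wW ae1] kl.
have mI : measurable (W k `&` W l) by apply: measurableI; [case: (wW k)|case: (wW l)].
apply: (negligibleP _ mI).1; apply: negligibleS ae1 => x [Wk Wl] /= H.
have : \1_Omega x <= 1 :> R by rewrite indicE; case: (_ \in _).
rewrite -H (bigD1 k)//= (bigD1 l)/=; last by rewrite eq_sym.
rewrite !indic_1E//; have := @sumr_ge0 R _ (index_enum 'I_N) (fun i => (i != k) && (i != l))
   (fun i => \1_(W i) x).
have i0 (i : 'I_N) : (i != k) && (i != l) -> 0 <= (\1_(W i) x : R) by move=> _; rewrite indicE ler0n.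
by move=> /(_ i0); set s := \sum_(_ <- _ | _) _; lra.
Qed.

Lemma weak_partition_measure Omega W K : weak_partition Omega W -> compact K ->
  K `<=` Omega -> \sum_k fine (leb (K `&` W k)) = fine (leb K).
Proof.
move=> [wW ae1] cK KO; have mK := compact_measurable_rV cK.
have Koo := lebesgue_rV_compact cK.
have mW k : measurable (W k) by case: (wW k).
rewrite (eq_bigr (fun k => \int[leb]_(x in K) \1_(W k) x)); last first.
  by move=> k _; rewrite Rintegral_indic// setIC.
rewrite -Rintegral_sum//; last first.
  by move=> k; apply: (bounded_measurable_integrable mK Koo); exact: bounded_measurable_indic.
rewrite (_ : fine (leb K) = \int[leb]_(x in K) \1_K x); last by rewrite Rintegral_indic// setIid.
apply: ae_eq_Rintegral => //.
- by apply: measurable_sum => k; exact: measurable_indic.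
- apply: filterS ae1 => x H Kx; rewrite H !indic_1E//; exact: KO.
Qed.

(* The functional G enters the argument only through [qm_compare]. *)
Record quasi_minimizer Ca al delta Omega Theta a W : Prop := QuasiMinimizer {
  qm_open : open Omega;
  qm_open' : open Theta;
  qm_sub : Theta `<=` Omega;
  qm_measurable : measurable_fun Omega a;
  qm_weight : forall x, Theta x -> delta <= a x <= 1;
  qm_partition : weak_partition Omega W;
  qm_compare : forall V K D, weak_partition Omega V -> compact K -> K `<=` Theta ->
    (forall k A, interior_borel Omega A -> A `&` K = set0 ->
      gradient Omega (W k) A = gradient Omega (V k) A) ->
    (partition_dist V W <= D%:E)%E ->
    (\sum_k \int[perimeter_measure Omega (W k)]_(x in K) (a x)%:E <=
     \sum_k \int[perimeter_measure Omega (V k)]_(x in K) (a x)%:E + (Ca * D `^ al)%:E)%E }.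

(** On [K] the weight is at most 1 on the side of the competitor and at least [delta] on the side of
    [W]. The factor [N] counts the phases of the competitor, while all phases of [W] but one are
    dropped. *)
Lemma qm_perimeter Ca al delta Omega Theta a W V K D (P : R) : 0 < delta ->
  quasi_minimizer Ca al delta Omega Theta a W -> weak_partition Omega V -> compact K ->
  K `<=` Theta ->
  (forall k A, interior_borel Omega A -> A `&` K = set0 ->
    gradient Omega (W k) A = gradient Omega (V k) A) ->
  (partition_dist V W <= D%:E)%E ->
  (forall k, (perimeter_measure Omega (V k) K <= P%:E)%E) ->
  forall k, (perimeter_measure Omega (W k) K <= (N%:R / delta * P + Ca * D `^ al / delta)%:E)%E.
Proof.
move=> d0 qm wV cK KO' agree dist PV k.
have KO := subset_trans KO' (qm_sub qm).
have mK := compact_measurable_rV cK.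
have ma : measurable_fun K (EFin \o a).
  by apply/measurable_EFinP; apply: measurable_funS (qm_measurable qm) => //; exact: open_measurable_rV (qm_open qm).
have aw x : K x -> delta <= a x <= 1 by move=> /KO'; exact: qm_weight qm x.
have exW l : exists mu : {measure set rV -> \bar R}, perimeter_measure Omega (W l) = mu.
  by apply: ex_perimeter_measure; have [/(_ l)[]] := qm_partition qm.
have exV l : exists mu : {measure set rV -> \bar R}, perimeter_measure Omega (V l) = mu.
  by apply: ex_perimeter_measure; have [/(_ l)[]] := wV.
have a0 x : K x -> (0 <= (a x)%:E)%E.
  by move=> /aw/andP[h _]; rewrite lee_fin; apply: le_trans h; exact: ltW.
have up l : (\int[perimeter_measure Omega (V l)]_(x in K) (a x)%:E <= P%:E)%E.
  have [mu E] := exV l; rewrite E; apply: le_trans (PV l); rewrite E.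
  rewrite -[leRHS]mul1e -integral_cst//; apply: ge0_le_integral => //.
  by move=> x /aw/andP[_]; rewrite lee_fin.
have low l : (delta%:E * perimeter_measure Omega (W l) K <= \int[perimeter_measure Omega (W l)]_(x in K) (a x)%:E)%E.
  have [mu E] := exW l; rewrite E -integral_cst//; apply: ge0_le_integral => //.
  - by move=> x _; rewrite lee_fin ltW.
  - by move=> x /aw/andP[+ _]; rewrite lee_fin.
have h := qm_compare qm wV cK KO' agree dist.
have h1 : (delta%:E * perimeter_measure Omega (W k) K <= (N%:R * P + Ca * D `^ al)%:E)%E.
  apply: (le_trans (low k)).
  apply: (@le_trans _ _ (\sum_l \int[perimeter_measure Omega (W l)]_(x in K) (a x)%:E)%E).
    rewrite (bigD1 k)//= leeDl//; apply: sume_ge0 => l _; have [mu ->] := exW l.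
    exact: integral_ge0.
  apply: (le_trans h); rewrite EFinD; apply: leeD => //.
  apply: (@le_trans _ _ (\sum_(l < N) P%:E)%E); first exact: lee_sum.
  by rewrite sumEFin lee_fin sumr_const card_ord mulr_natl.
have -> : N%:R / delta * P + Ca * D `^ al / delta = delta^-1 * (N%:R * P + Ca * D `^ al).
  by field; rewrite gt_eqF.
have -> : perimeter_measure Omega (W k) K = (delta^-1%:E * (delta%:E * perimeter_measure Omega (W k) K))%E.
  by rewrite muleA -EFinM mulVf ?mul1e// gt_eqF.
by rewrite EFinM lee_pmul2l// lte_fin invr_gt0.
Qed.

(* The competitor gives the whole cube Q to the phase k0, at the cost of the
   traces of the phases on the faces of Q; its energy bounds the perimeters
   inside Q, and then the isoperimetric inequality applies to Q \ W_k0. *)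
Lemma cut_competitor : (1 < n)%N -> exists2 C : R, 0 < C &
  forall Ca al delta Omega Theta a W k0 c t q, 0 < delta ->
  quasi_minimizer Ca al delta Omega Theta a W -> 0 < t -> cube c t `<=` Theta -> 0 <= q ->
  0 <= al ->
  (forall h0, 0 < h0 -> exists2 h, 0 < h < h0 &
    (leb ((Omega `\` W k0) `&` shell c t h) <= (q * h)%:E)%E) ->
  forall v, v = fine (leb (cube c t `\` W k0)) ->
  v ^+ n.-1 <= 2 * (n%:R * ((N%:R / delta + 1) * C * q + Ca * N%:R `^ al / delta * v `^ al)) ^+ n.
Proof.
move=> n1; have [C C0 cut] := @cut_gradient R n; exists C => //.
move=> Ca al delta Omega Theta a W k0 c t q d0 qm t0 QO' q0 al0 slope v vdef.
have oO := qm_open qm; have mO := open_measurable_rV oO.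
have QO := subset_trans QO' (qm_sub qm).
have [wW ae1] := qm_partition qm.
have mW k : measurable (W k) by case: (wW k).
have gW k : is_gradient Omega (W k) (gradient Omega (W k)).
  by apply: gradient_is_gradient; case: (wW k).
pose Q := cube c t; have mQ : measurable Q by exact: measurable_cube.
have cQ : compact Q by exact: cube_compact.
(* [V k] arises from [W k] by adding, for [k0], or removing, for the others, the part of [B k] in
   the cube, and [s k] is the sign. Up to null sets every [B k] is contained in the complement of
   [W k0], so the slope hypothesis for that complement covers all of them. *)
pose B k := if k == k0 then Omega `\` W k0 else W k.
pose s k : R := if k == k0 then 1 else -1.
have mB k : measurable (B k) by rewrite /B; case: eqP => _ //; exact: measurableD.
have gB k : is_gradient Omega (B k) (fun A => - s k *: gradient Omega (W k) A).
  rewrite /B /s; case: eqP => [->|_].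
    have := fgradient_lin 1 (-1) (bounded_measurable_indic mO) (bounded_measurable_indic (mW k0))
      (is_gradient_self mO) (gW k0).
    rewrite (_ : (fun A => 1 *: 0 + _) = fun A => - 1 *: gradient Omega (W k0) A); last first.
      by apply/funext => A; rewrite scaler0 add0r.
    move=> h; apply: (fgradient_ae mO _ _ _ h).
    - by apply: bounded_measurableD; apply: bounded_measurableZ; exact: bounded_measurable_indic.
    - by apply: bounded_measurable_indic; exact: measurableD.
    - apply: aeW => x Ox; rewrite !indicE in_setD; rewrite (mem_set Ox).
      by case: (x \in W k0) => /=; lra.
  rewrite (_ : (fun A => _) = gradient Omega (W k))//.
  by apply/funext => A; rewrite opprK scale1r.
have slopeB k h0 : 0 < h0 -> exists2 h, 0 < h < h0 & (leb (B k `&` shell c t h) <= (q * h)%:E)%E.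
  move=> /slope[h h0h le]; exists h => //; apply: le_trans le; rewrite /B.
  case: eqP => [_|/eqP kk]; first exact: lexx.
  have ms := measurable_shell c t h.
  have mR : measurable ((Omega `\` W k0) `&` shell c t h).
    by apply: measurableI => //; exact: measurableD.
  have mI : measurable (W k `&` W k0) by exact: measurableI.
  have -> : leb ((Omega `\` W k0) `&` shell c t h) = (leb ((Omega `\` W k0) `&` shell c t h) + leb (W k `&` W k0))%E.
    by rewrite (weak_partition_disjoint (qm_partition qm) kk) adde0.
  apply: (le_trans _ (measureU2 _ mR mI)); apply: le_measure; rewrite ?inE.
  - exact: measurableI.
  - exact: measurableU.
  - move=> x [Wx sx]; have [Wk0|nW] := pselect (W k0 x); first by right.
    by left; split => //; split => //; case: (wW k) => _ WO _; exact: WO.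
have /choice[tau tauP] k := cut Omega (B k) _ c t q oO (mB k) (gB k) t0 QO q0 (slopeB k).
pose V k := if k == k0 then W k `|` Q else W k `\` Q.
have mV k : measurable (V k).
  by rewrite /V; case: eqP => _; [exact: measurableU|exact: measurableD].
pose nB k A := - s k *: gradient Omega (W k) (A `&` Q) + tau k A.
have gBQ k : is_gradient Omega (B k `&` Q) (nB k) by case: (tauP k).
pose nV k A := 1 *: gradient Omega (W k) A + s k *: nB k A.
have gV k : is_gradient Omega (V k) (nV k).
  have mBQ : measurable (B k `&` Q) by exact: measurableI.
  have h := fgradient_lin 1 (s k) (bounded_measurable_indic (mW k)) (bounded_measurable_indic mBQ)
      (gW k) (gBQ k).
  apply: (fgradient_ae mO _ _ _ h).
  - by apply: bounded_measurableD; apply: bounded_measurableZ; exact: bounded_measurable_indic.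
  - exact: bounded_measurable_indic.
  - apply: aeW => x Ox; rewrite /V /B /s; case: eqP => [->|_].
      rewrite !indicE in_setU in_setI in_setD (mem_set Ox).
      by case: (x \in W k0); case: (x \in Q) => /=; lra.
    rewrite !indicE in_setI in_setD.
    by case: (x \in W k); case: (x \in Q) => /=; lra.
have wV : weak_partition Omega V.
  split.
    move=> k; split => //; last by exists (nV k).
    have [_ WO _] := wW k.
    by rewrite /V; case: eqP => _ x; [case=> [/WO|/QO]|case=> /WO].
  apply: filterS ae1 => x H; have [Qx|nQ] := pselect (Q x).
    rewrite (bigD1 k0)//= big1 ?addr0.
      by rewrite /V eqxx !indic_1E//; [exact: QO|right].
    by move=> k kk; rewrite /V (negbTE kk) indicE memNset// => -[].
  rewrite -H; apply: eq_bigr => k _; rewrite /V; case: eqP => _.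
    by rewrite !indicE in_setU (memNset nQ) orbF.
  by rewrite !indicE in_setD (memNset nQ) andbT.
have nVE k A : interior_borel Omega A -> gradient Omega (V k) A = nV k A.
  exact: (perimeter_measureE oO (mV k) (gV k)).2.
have agree k A : interior_borel Omega A -> A `&` Q = set0 ->
    gradient Omega (W k) A = gradient Omega (V k) A.
  move=> iA AQ; rewrite nVE// /nV /nB scale1r.
  have [tv tQ _ _] := tauP k; rewrite tQ; last by case: iA.
  by rewrite AQ (vm0 tv) (vm0 (gW k).1) scaler0 addr0 scaler0 addr0.
have s2 k : s k * s k = 1 by rewrite /s; case: eqP => _; lra.
(* Inside the cube the gradient of [W k] cancels against that of the exchanged part, and only the
   trace remains. *)
have nVQ k A : A `<=` Q -> enorm (nV k A) = enorm (tau k A).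
  move=> AQ; rewrite /nV /nB (setIidl AQ) scale1r scalerDr scalerA mulrN s2 scaleN1r addrA subrr add0r.
  by rewrite enormZ /s; case: eqP => _; rewrite ?normrN normr1 mul1r.
have pV k : (perimeter_measure Omega (V k) Q <= (C * q)%:E)%E.
  rewrite (perimeter_measureE oO (mV k) (gV k)).1.
  have [_ _ _ tvle] := tauP k; apply: le_trans tvle.
  apply: (@le_trans _ _ (Defs.total_variation Omega (tau k) Q + Defs.total_variation Omega (fun=> 0%R) Q)%E).
    by apply: total_variation_le => A iA AQ; rewrite nVQ// enorm0 addr0.
  rewrite (@total_variation_zero R n Omega (fun=> 0) Q)// adde0; exact: total_variationS.
have voo : (leb (Q `\` W k0) < +oo)%E.
  by apply: (@lebesgue_rV_bounded _ _ _ c t); [exact: measurableD|exact: subDsetl].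
have vE : leb (Q `\` W k0) = v%:E.
  by rewrite vdef fineK// ge0_fin_numE.
have v0 : 0 <= v by rewrite vdef fine_ge0.
(* Each of the [N] phases changes by at most the part of the cube outside [W k0]. *)
have dist : (partition_dist V W <= (N%:R * v)%:E)%E.
  apply: (@le_trans _ _ (\sum_(k < N) v%:E)%E); last first.
    by rewrite sumEFin lee_fin sumr_const card_ord mulr_natl.
  apply: lee_sum => k _; rewrite -vE; rewrite /V; case: eqP => [->|/eqP kk].
    rewrite (_ : _ `|` _ = Q `\` W k0); first exact: lexx.
    by apply/seteqP; split => x /=; have := EM (Q x); have := EM (W k0 x); tauto.
  rewrite (_ : _ `|` _ = W k `&` Q); last first.
    by apply/seteqP; split => x /=; have := EM (Q x); have := EM (W k x); tauto.
  have mR : measurable (Q `\` W k0) by exact: measurableD.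
  have mI : measurable (W k `&` W k0) by exact: measurableI.
  have -> : leb (Q `\` W k0) = (leb (Q `\` W k0) + leb (W k `&` W k0))%E.
    by rewrite (weak_partition_disjoint (qm_partition qm) kk) adde0.
  apply: (le_trans _ (measureU2 _ mR mI)); apply: le_measure; rewrite ?inE.
  - exact: measurableI.
  - exact: measurableU.
  - by move=> x [Wx Qx]; have [Wk0|nW] := pselect (W k0 x); [right|left].
have pW := qm_perimeter d0 qm wV cQ QO' agree dist pV k0.
have isoZ : is_gradient Omega (Q `\` W k0) (nB k0).
  have := gBQ k0; rewrite /B eqxx (_ : _ `&` _ = Q `\` W k0)//.
  apply/seteqP; split => x /=; first by tauto.
  by move=> [Qx nW]; split => //; split => //; exact: QO.
have mZ : measurable (Q `\` W k0) by exact: measurableD.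
rewrite vdef; apply: (isoperimetric_compact n1 oO mZ isoZ cQ QO (@subDsetl _ _ _)); rewrite -vdef.
apply: (@le_trans _ _ (Defs.total_variation Omega (gradient Omega (W k0)) Q + Defs.total_variation Omega (tau k0) Q)%E).
  apply: total_variation_le => A iA AQ; rewrite /nB (setIidl AQ).
  apply: (le_trans (ler_enormD _ _)); rewrite lerD2r enormZ normrN /s eqxx normr1 mul1r//.
have [_ _ _ tvle] := tauP k0.
have tvQ : (Defs.total_variation Omega (tau k0) Q <= (C * q)%:E)%E.
  by apply: le_trans tvle; exact: total_variationS.
apply: (le_trans (leeD pW tvQ)); rewrite -EFinD lee_fin powRM//.
by rewrite le_eqVlt; apply/orP; left; apply/eqP; ring.
Qed.

End quasi_minimizers.

(** * Lower density of the interfaces *)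

Section de_giorgi.
Context {R : realType}.

(* M decays like M(rho) 2^(-nk) along the radii rho/2 + rho/2^(k+1). *)
Lemma de_giorgi_iteration (n : nat) (M : R -> R) (D rho : R) : (1 < n)%N -> 0 < rho -> 0 < D ->
  (forall r, 0 <= M r) -> (forall s r, s <= r -> M s <= M r) ->
  (forall s r, rho / 2 <= s -> s < r -> r <= rho ->
    M s ^+ n.-1 <= (D * M r / (r - s)) ^+ n) ->
  M rho <= (2 ^+ n ^+ n.-1)^-1 * (rho / (4 * D)) ^+ n -> M (rho / 2) = 0.
Proof.
move=> n1 rho0 D0 M0 mono step small.
have n0 : (0 < n)%N by exact: ltnW.
have n1' : (0 < n.-1)%N by rewrite -subn1 subn_gt0.
pose s k : R := rho / 2 + rho / 2 * (2 ^- k).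
have s_ge k : rho / 2 <= s k.
  by rewrite lerDl mulr_ge0 ?invr_ge0 ?exprn_ge0// divr_ge0// ltW.
have s_le k : s k <= rho.
  rewrite /s [leRHS](_ : _ = rho / 2 + rho / 2 * 1); last by field.
  rewrite lerD2l; apply: ler_wpM2l; first by rewrite divr_ge0// ltW.
  by rewrite invf_le1 ?exprn_gt0// exprn_ege1// ler1n.
have sS k : s k - s k.+1 = rho / 4 * 2 ^- k.
  by rewrite /s exprS; field; rewrite expf_neq0.
(* The decay rate that balances the shrinking gaps: consecutive radii differ by [rho / 4 * 2 ^- k],
   whose [n]-th power costs [(2 ^+ k) ^+ n], the inverse of [lam ^+ k]. *)
pose lam : R := 2 ^- n.
have lam0 : 0 < lam by rewrite invr_gt0 exprn_gt0.
have lam_lt1 : lam < 1.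
  by rewrite /lam invf_lt1 ?exprn_gt0// exprn_egt1 ?ltr1n// -lt0n.
have claim k : M (s k) <= M rho * lam ^+ k.
  elim: k => [|k IH].
    by rewrite expr0 mulr1 (_ : s 0%N = rho)// /s expr0; field.
  have st : M (s k.+1) ^+ n.-1 <= (D * (M rho * lam ^+ k) / (rho / 4 * 2 ^- k)) ^+ n.
    have ds : 0 < s k - s k.+1 by rewrite sS mulr_gt0 ?divr_gt0 ?invr_gt0 ?exprn_gt0.
    apply: (le_trans (step _ _ (s_ge k.+1) _ (s_le k))); first by rewrite -subr_gt0.
    rewrite sS; apply: lerXn2r.
    - by rewrite nnegrE; apply: mulr_ge0; [exact: mulr_ge0 (ltW D0) _|rewrite -sS invr_ge0 ltW].
    - rewrite nnegrE; apply: mulr_ge0; last by rewrite -sS invr_ge0 ltW.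
      by apply: mulr_ge0; [exact: ltW|apply: mulr_ge0 => //; rewrite exprn_ge0// ltW].
    - by apply: ler_wpM2r; [rewrite -sS invr_ge0 ltW|apply: ler_wpM2l => //; exact: ltW].
  rewrite -(@ler_pXn2r _ n.-1)// ?nnegrE//; last first.
    by apply: mulr_ge0 => //; rewrite exprn_ge0// ltW.
  apply: (le_trans st).
  have E : (D * (M rho * lam ^+ k) / (rho / 4 * 2 ^- k)) ^+ n =
      (4 * D / rho) ^+ n * (2 ^+ k * lam ^+ k) ^+ n * M rho * M rho ^+ n.-1.
    have u0 : 2 ^+ k != 0 :> R by rewrite expf_neq0.
    move: (2 ^+ k) u0 (lam ^+ k) => u u0 w.
    rewrite -[RHS]mulrA -exprS prednK// -!exprMn; congr (_ ^+ _); field.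
    by rewrite u0 gt_eqF.
  rewrite E [leRHS]exprMn [leRHS]mulrC; apply: ler_wpM2r; first by rewrite exprn_ge0.
  have E2 : (2 ^+ k * lam ^+ k) ^+ n = lam ^+ k * (lam ^+ k.+1) ^+ n.-1 * 2 ^+ n ^+ n.-1 * (2 ^+ k) ^+ n.
    have -> : 2 ^+ n ^+ n.-1 = (lam^-1) ^+ n.-1 by rewrite /lam invrK.
    have h : (lam ^-1) ^+ n.-1 * (lam ^+ k.+1) ^+ n.-1 = (lam ^+ k) ^+ n.-1.
      by rewrite -exprMn exprS mulKf// gt_eqF.
    have h2 : (lam ^+ k) ^+ n = lam ^+ k * (lam ^+ k) ^+ n.-1 by rewrite -exprS prednK.
    by rewrite exprMn h2 -h mulrC !mulrA; congr (_ * _); rewrite mulrAC.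
  have E3 : lam ^+ k * (2 ^+ k) ^+ n = 1.
    by rewrite /lam -exprVn -!exprM mulnC -exprMn mulVf ?expr1n.
  rewrite E2.
  have -> : (4 * D / rho) ^+ n * (lam ^+ k * (lam ^+ k.+1) ^+ n.-1 * 2 ^+ n ^+ n.-1 * (2 ^+ k) ^+ n) * M rho =
    (lam ^+ k * (2 ^+ k) ^+ n) * ((lam ^+ k.+1) ^+ n.-1 * ((4 * D / rho) ^+ n * 2 ^+ n ^+ n.-1 * M rho)) by ring.
  rewrite E3 mul1r -[leRHS]mulr1; apply: ler_wpM2l; first by rewrite exprn_ge0// exprn_ge0// ltW.
  have p0 : 0 < (4 * D / rho) ^+ n * 2 ^+ n ^+ n.-1.
    by rewrite mulr_gt0 ?exprn_gt0 ?divr_gt0 ?mulr_gt0.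
  rewrite mulrC -ler_pdivlMr// mul1r; apply: (le_trans small).
  rewrite [leRHS]invfM [leRHS]mulrC le_eqVlt; apply/orP; left; apply/eqP; congr (_ * _).
  by rewrite -exprVn; congr (_ ^+ _); field; rewrite !gt_eqF.
apply/eqP; rewrite eq_le M0 andbT; apply/ler_addgt0Pr => e e0; rewrite add0r.
have /cvgrPdist_lt/(_ e e0)[k _ /(_ k (leqnn k))] :
    (fun k => M rho * lam ^+ k) @ \oo --> (0 : R).
  rewrite -(mulr0 (M rho)); apply: cvgMr; apply: cvg_expr; rewrite ger0_norm//; exact: ltW.
have p0 : 0 <= M rho * lam ^+ k by apply: mulr_ge0 => //; rewrite exprn_ge0// ltW.
rewrite /= sub0r normrN ger0_norm// => lt.
by apply: le_trans (ltW lt); apply: le_trans (claim k); exact: mono.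
Qed.

End de_giorgi.

Section lower_density.
Context {R : realType} {n N : nat}.
Local Notation rV := 'rV[R]_n.
Local Notation leb := (@lebesgue_rV R n).
Implicit Types (A B E K L U V Omega Theta : set rV) (a : rV -> R)
  (W : 'I_N -> set rV) (Ca al delta D q t r : R) (c x : rV).

Lemma locally_equal_variation U Z X nu E : open U -> measurable Z -> measurable X ->
  is_gradient U Z nu -> is_gradient U X (fun=> 0) -> open E -> E `<=` U ->
  {ae leb, forall x, E x -> \1_Z x = \1_X x :> R} -> Defs.total_variation U nu E = 0%E.
Proof.
move=> oU mZ mX gZ gX oE EU ae1; apply: total_variation_zero => A iA AE.
apply: (vm_inner_zero oU gZ.1 iA) => C cC CA.
apply: (fgradient_local oU oE EU (bounded_measurable_indic mZ) (bounded_measurable_indic mX) ae1 gZ gX).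
apply: (interior_borel_sub cC) => //; first exact: subset_trans AE.
exact: compact_measurable_rV.
Qed.

(** In [V] each phase agrees almost everywhere with [Omega] or with the empty set, and both have
    gradient 0 in [Omega]. *)
Lemma constant_phase Omega W k0 V k : open Omega -> weak_partition Omega W -> open V ->
  V `<=` Omega -> leb (V `\` W k0) = 0 ->
  perimeter_measure Omega (W k) V = 0%E.
Proof.
move=> oO wP oV VO null; have mO := open_measurable_rV oO; have mV := open_measurable_rV oV.
have [wW _] := wP; have mW l : measurable (W l) by case: (wW l).
have gW : is_gradient Omega (W k) (gradient Omega (W k)).
  by apply: gradient_is_gradient; case: (wW k).
pose X := if k == k0 then Omega else set0.
have mX : measurable X by rewrite /X; case: eqP.
have gX : is_gradient Omega X (fun=> 0).
  by rewrite /X; case: eqP => _; [exact: is_gradient_self|exact: is_gradient_set0].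
have ae1 : {ae leb, forall x, V x -> \1_(W k) x = \1_X x :> R}.
  have mD : measurable (V `\` W k0) by exact: measurableD.
  have [kk|kk] := eqVneq k k0.
    exists (V `\` W k0); split => // x /= H; apply: contrapT => nD; apply: H => Vx.
    rewrite /X kk eqxx !indicE (mem_set (VO _ Vx)) mem_set//.
    by apply: contrapT => nW; apply: nD.
  have mI : measurable (W k `&` W k0) by exact: measurableI.
  exists ((V `\` W k0) `|` (W k `&` W k0)); split; first exact: measurableU.
    apply/eqP; rewrite eq_le measure_ge0 andbT; 
    apply: (@le_trans _ _ (leb (V `\` W k0) + leb (W k `&` W k0))%E); first exact: measureU2.
    by rewrite (weak_partition_disjoint wP kk) null adde0.
  move=> x /= H; apply: contrapT => nD; apply: H => Vx.
  rewrite /X (negbTE kk) indic0 indicE memNset// => Wk; apply: nD.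
  by have [Wk0|] := pselect (W k0 x); [right|left].
exact: (locally_equal_variation oO (mW k) mX gW gX oV VO ae1).
Qed.

Lemma ex_large_term (F : 'I_N -> R) (S : R) : (0 < N)%N -> \sum_k F k = S ->
  exists k, S <= N%:R * F k.
Proof.
move=> N0 FS; apply: contrapT => H.
have lt k : 0 < S - N%:R * F k.
  by rewrite subr_gt0 ltNge; apply/negP => le; apply: H; exists k.
suff : 0 < \sum_k (S - N%:R * F k).
  by rewrite sumrB -mulr_sumr FS sumr_const card_ord mulr_natl subrr ltxx.
rewrite (bigD1 (Ordinal N0))//= ltr_pwDl// sumr_ge0// => k _; exact: ltW.
Qed.

(* By the Poincare inequality the complement of the dominant phase k0 has small
   volume, which the De Giorgi iteration then makes zero in the half cube. *)
Lemma lower_density Ca al delta : (1 < n)%N -> (0 < N)%N -> 0 <= Ca -> 0 < delta ->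
  (n%:R - 1) / n%:R < al -> exists rho0 c0 : R, [/\ 0 < rho0, 0 < c0 &
  forall Omega Theta a W, quasi_minimizer Ca al delta Omega Theta a W ->
  forall x rho, 0 < rho -> rho <= rho0 -> cube x (6 * rho) `<=` Theta ->
  (forall k, (perimeter_measure Omega (W k) (cube x (6 * rho)) <= (c0 * rho ^+ n.-1)%:E)%E) ->
  exists k0, leb (cube x (rho / 2) `\` W k0) = 0].
Proof.
move=> n1 N0 Ca0 d0 hal.
have n0 : (0 < n)%N by exact: ltnW.
have nR : 0 < n%:R :> R by rewrite ltr0n.
have NR : 0 < N%:R :> R by rewrite ltr0n.
have al0 : 0 <= al.
  by apply/ltW; apply: le_lt_trans hal; rewrite divr_ge0 ?subr_ge0 ?ler1n// ltW.
have [C C0 comp] := @cut_competitor R n N n1.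
pose A := (N%:R / delta + 1) * C.
have A0 : 0 < A by rewrite mulr_gt0// addr_gt0// divr_gt0.
pose A' := Ca * N%:R `^ al / delta.
have A'0 : 0 <= A' by rewrite divr_ge0 ?(ltW d0)// mulr_ge0// powR_ge0.
have [v0 v00 abs] := absorb n1 A'0 hal.
(* [absorb] yields the factor [8 n A] in front of the slope [q], and [q] will be
   [2 M r / (r - s)]. *)
pose D := 2 * (8 * n%:R * A).
have D0 : 0 < D by rewrite /D; do ![apply: mulr_gt0 => //].
pose e := (2 ^+ n ^+ n.-1)^-1 * (1 / (4 * D)) ^+ n : R.
have e0 : 0 < e by rewrite /e; apply: mulr_gt0; rewrite ?invr_gt0 exprn_gt0// ?exprn_gt0// divr_gt0// mulr_gt0.
(* The constants of [poincare] together with the factor [N] lost in choosing the dominant phase: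
   perimeter at most [e / c1 * rho ^+ n.-1] leaves outside that phase a volume of at most
   [e * rho ^+ n], the smallness at which the iteration starts. *)
pose c1 : R := N%:R * 2 ^+ n * n%:R * 2.
have c10 : 0 < c1 by rewrite /c1; do ![apply: mulr_gt0 => //]; rewrite exprn_gt0.
(* Then [2 rho <= 1] and [2 rho <= v0], so the volume [(2 rho)^n] of the cube is at most [v0] and
   [absorb] applies at all smaller radii. *)
exists (Num.min 1 v0 / 2), (e / c1); split.
- by rewrite divr_gt0// lt_min ltr01.
- exact: divr_gt0.
move=> Omega Theta a W qm x rho rho0 rhole QT pm.
have small_rho : (2 * rho) ^+ n <= v0.
  have : 2 * rho <= Num.min 1 v0 by move: rhole; rewrite ler_pdivlMr// mulrC.
  rewrite le_min => /andP[h1 h2]; apply: le_trans h2; apply: ler_iXnr => //.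
  by rewrite mulr_ge0// ltW.
have oO := qm_open qm; have QO := subset_trans QT (qm_sub qm).
have wP := qm_partition qm; have [wW _] := wP.
have mW k : measurable (W k) by case: (wW k).
have rho6 : rho <= 6 * rho by rewrite ler_peMl// ?ltW// ltr1n.
have QrO : cube x rho `<=` Omega by apply: subset_trans QO; exact: sub_cube.
have cQ r : compact (cube x r) by exact: cube_compact.
have volQ r : 0 <= r -> leb (cube x r) = ((2 * r) ^+ n)%:E by move=> r0; exact: lebesgue_rV_cube.
have [k0 k0P] := ex_large_term N0 (weak_partition_measure wP (cQ rho) QrO).
exists k0.
pose M r := fine (leb (cube x r `\` W k0)).
have mD r : measurable (cube x r `\` W k0) by apply: measurableD => //; exact: measurable_cube.
have Moo r : (leb (cube x r `\` W k0) < +oo)%E.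
  by apply: (@lebesgue_rV_bounded _ _ _ x r) => //; exact: subDsetl.
have ME r : leb (cube x r `\` W k0) = (M r)%:E by rewrite /M fineK// ge0_fin_numE.
have M0 r : 0 <= M r by exact: fine_ge0.
have mono s r : s <= r -> M s <= M r.
  move=> sr; rewrite -lee_fin -!ME; apply: le_measure; rewrite ?inE//.
  by move=> y [Qy nW]; split => //; exact: sub_cube Qy.
suff M00 : M (rho / 2) = 0 by rewrite ME M00.
apply: (de_giorgi_iteration n1 rho0 D0 M0 mono).
  move=> s r rs sr rr; have r0 : 0 < r - s by rewrite subr_gt0.
  have [Mr0|Mr0] := eqVneq (M r) 0.
    have -> : M s = 0 by apply/eqP; rewrite eq_le M0 andbT -Mr0; apply: mono; exact: ltW.
    by rewrite Mr0 mulr0 mul0r !expr0n -subn1 subn_eq0 leqNgt n1 (gtn_eqF n0).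
  have Mr : 0 < M r by rewrite lt_neqAle eq_sym Mr0 M0.
  (* The factor 2 makes the inequality required by [slow_growth] strict. *)
  pose q := 2 * M r / (r - s).
  have q0 : 0 <= q by rewrite divr_ge0 ?mulr_ge0// ltW.
  have grow : M r - M s < q * (r - s).
    rewrite /q divfK ?gt_eqF//; move: Mr (M0 s); set u := M r; set w := M s; lra.
  have [t [st tr slope]] := slow_growth sr (fun t u _ tu _ => mono t u tu) grow.
  have t0 : 0 < t by apply: lt_le_trans st; apply: lt_le_trans rs; rewrite divr_gt0.
  have trho : t <= rho by apply: le_trans rr; exact: ltW.
  have QtT : cube x t `<=` Theta.
    by apply: subset_trans QT; apply: sub_cube; exact: le_trans rho6.
  have slopeB h0 : 0 < h0 -> exists2 h, 0 < h < h0 &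
      (leb ((Omega `\` W k0) `&` shell x t h) <= (q * h)%:E)%E.
    move=> /slope[h h0h le]; exists h => //.
    have ms : measurable (shell x t h `\` W k0) by apply: measurableD => //; exact: measurable_shell.
    apply: (@le_trans _ _ (leb (shell x t h `\` W k0))).
      apply: le_measure; rewrite ?inE//; last by move=> y [[_ nW] sy]; split.
      apply: measurableI; last exact: measurable_shell.
      by apply: measurableD => //; exact: open_measurable_rV.
    have E : ((M t)%:E + leb (shell x t h `\` W k0) = (M (t + h))%:E)%E.
      rewrite -!ME -measureU//.
        congr (leb _); apply/seteqP; split => y /=.
          case=> [[Qy nW]|[[Qy _] nW]]; split => //.
          by apply: sub_cube Qy; rewrite lerDl ltW//; case/andP: h0h.
        move=> [Qy nW]; have [Qty|nQ] := pselect (cube x t y); [left|right] => //.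
      by apply/seteqP; split => y //= [[Qy _] [[_ nQ] _]].
    have fin : leb (shell x t h `\` W k0) \is a fin_num.
      rewrite ge0_fin_numE//; apply: (@lebesgue_rV_bounded _ _ _ x (t + h)) => //.
      by move=> y [[]].
    move: E; rewrite -(fineK fin) -EFinD => -[E]; rewrite lee_fin.
    by apply: le_trans le; rewrite -E addrAC subrr add0r.
  have st1 := comp _ _ _ _ _ _ _ k0 x t q d0 qm t0 QtT q0 al0 slopeB (M t) erefl.
  have Mv0 : 0 <= M t <= v0.
    rewrite M0/=; apply: le_trans small_rho; rewrite -lee_fin -ME -(volQ _ (ltW rho0)).
    apply: le_measure; rewrite ?inE//; first exact: measurable_cube.
    by move=> y [Qy _]; exact: sub_cube Qy.
  have st2 := abs _ _ _ Mv0 q0 (ltW A0) st1.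
  apply: (@le_trans _ _ (M t ^+ n.-1)); first by apply: lerXn2r; rewrite ?nnegrE//; exact: mono.
  apply: (le_trans st2); rewrite (_ : D * M r / (r - s) = 8 * n%:R * A * q)//.
  by rewrite /D /q; ring.
have gW : is_gradient Omega (W k0) (gradient Omega (W k0)).
  by apply: gradient_is_gradient; case: (wW k0).
have := poincare (mW k0) gW rho0 QO (pm k0); rewrite -/(M rho).
set y := fine (leb (cube x rho `&` W k0)) in k0P * => P.
have S0 : 0 < (2 * rho) ^+ n by rewrite exprn_gt0// mulr_gt0.
have volF : fine (leb (cube x rho)) = (2 * rho) ^+ n by rewrite volQ// ltW.
rewrite volF in k0P.
rewrite -(ler_pM2r S0); apply: (@le_trans _ _ (N%:R * (M rho * y))).
  by rewrite mulrCA ler_wpM2l.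
apply: (@le_trans _ _ (N%:R * ((4 * rho) ^+ n * (n%:R * (2 * rho) * (e / c1 * rho ^+ n.-1))))).
  by rewrite ler_wpM2l// ltW.
have -> : (4 * rho) ^+ n = 2 ^+ n * (2 * rho) ^+ n by rewrite -exprMn; congr (_ ^+ _); ring.
have rn : rho * rho ^+ n.-1 = rho ^+ n by rewrite -exprS prednK.
have -> : (2 ^+ n ^+ n.-1)^-1 * (rho / (4 * D)) ^+ n = e * rho ^+ n.
  by rewrite /e -mulrA -exprMn; congr (_ * _ ^+ _); ring.
rewrite -rn le_eqVlt; apply/orP; left; apply/eqP.
rewrite (_ : e / c1 * rho ^+ n.-1 = e * rho ^+ n.-1 / c1); last by ring.
have -> : e * (rho * rho ^+ n.-1) * (2 * rho) ^+ n = c1 * (e * (rho * rho ^+ n.-1) * (2 * rho) ^+ n / c1).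
  by rewrite [RHS]mulrC divfK// gt_eqF.
by move: (c1^-1) => ic; rewrite /c1; ring.
Qed.

End lower_density.

(** * Points charged by the perimeters of the phases *)

Section support.
Context {R : realType} {n N : nat}.
Local Notation rV := 'rV[R]_n.
Local Notation leb := (@lebesgue_rV R n).
Implicit Types (A B E K L U V Omega Theta Z : set rV) (a : rV -> R)
  (W : 'I_N -> set rV) (Ca al delta D q t r : R) (c x : rV).

Lemma ex_measure_sum (I : Type) (F : I -> {finite_measure set rV -> \bar R}) (s : seq I) :
  exists P : {finite_measure set rV -> \bar R}, forall A, (P A = \sum_(i <- s) F i A)%E.
Proof.
elim: s => [|i s [P PE]].
  have [|P PE] := @ex_finite_measure _ _ R (@mzero _ rV R); first by rewrite /mzero ltry.
  by exists P => A; rewrite big_nil PE.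
have [Q QE] := ex_measure_add (F i) P.
by exists Q => A; rewrite QE big_cons PE.
Qed.

(** A Vitali selection: a centre is kept only if it is farther than [2 t] in the sup norm from those
    kept before, which makes the cubes of radius [t] around the kept centres disjoint. *)
Lemma separated_centers (s : seq rV) t : 0 <= t -> exists X : seq rV,
  [/\ {subset X <= s}, forall c, c \in s -> exists2 c1, c1 \in X & cube c1 (2 * t) c &
    forall P : {measure set rV -> \bar R},
      (\sum_(c <- X) P (cube c t) <= P (\big[setU/set0]_(c <- X) cube c t))%E].
Proof.
move=> t0; elim: s => [|c s [X [Xs cov PX]]].
  by exists [::]; split => // P; rewrite !big_nil.
have [[c1 c1X cc]|H] := pselect (exists2 c1, c1 \in X & cube c1 (2 * t) c).
  exists X; split => //.
    by move=> y /Xs; rewrite inE orbC => ->.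
  by move=> y; rewrite inE => /predU1P[->|/cov//]; exists c1.
exists (c :: X); split.
- by move=> y; rewrite !inE => /predU1P[->|/Xs ->]; rewrite ?eqxx ?orbT.
- move=> y; rewrite inE => /predU1P[->|/cov[c1 c1X h]].
    by exists c; rewrite ?inE ?eqxx//; apply: cube_center; rewrite mulr_ge0.
  by exists c1; rewrite // inE c1X orbT.
- move=> P; rewrite !big_cons.
  have mU : measurable (\big[setU/set0]_(c <- X) cube c t).
    by apply: bigsetU_measurable => i _; exact: measurable_cube.
  have mc := measurable_cube c t.
  rewrite measureU//; first by apply: leeD.
  apply/seteqP; split => // y [cy]; rewrite -bigcup_seq => -[c1 /= c1X c1y]; apply: H.
  exists c1 => //; have -> : 2 * t = t + t by ring.
  by apply: (cube_trans c1y); apply: cube_sym.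
Qed.

(** The support of the perimeter measures. It stands in for [interface]: the argument uses that a
    point outside this support lies outside [interface]. *)
Definition active Omega W x := forall r, 0 < r ->
  exists k : 'I_N, perimeter_measure Omega (W k) (ocube x r) <> 0%E.

Lemma inactive_open Omega W : open [set x | ~ active Omega W x].
Proof.
rewrite openE => x /= nx.
have [r r0 H] : exists2 r, 0 < r & forall k, perimeter_measure Omega (W k) (ocube x r) = 0%E.
  apply: contrapT => nH; apply: nx => r r0; apply: contrapT => nk; apply: nH.
  by exists r => // k; apply: contrapT => h; apply: nk; exists k.
rewrite /interior/= nbhsE; exists (ocube x r); first by split; [exact: ocube_open|exact: ocube_center].
move=> y xy act.
have [r1 r10 yr] := open_cube (@ocube_open _ _ x r) xy.
have [k] := act r1 r10; apply; apply/eqP; rewrite eq_le; apply/andP; split.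
  rewrite -(H k); apply: total_variationS; exact: subset_trans (@ocube_sub _ _ _ _) yr.
apply: ereal_sup_ubound; exists 0%N, (fun=> set0); split => //; [|by apply/trivIsetP => *; rewrite set0I|by move=> _ z|by rewrite big_ord0].
by move=> _; exact: interior_borel0.
Qed.

(* K is covered by cubes with disjoint cores whose number is controlled by the
   lower density bound: a cutoff of K has then a gradient of small mass. *)
Lemma active_null_compact Ca al delta Omega Theta a W Z nuZ L V K : (1 < n)%N -> (0 < N)%N ->
  0 <= Ca -> 0 < delta -> (n%:R - 1) / n%:R < al ->
  quasi_minimizer Ca al delta Omega Theta a W -> measurable Z -> is_gradient Omega Z nuZ ->
  compact L -> L `<=` Theta -> open V -> V `<=` L -> compact K -> K `<=` V ->
  (forall x, K x -> active Omega W x) ->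
  (forall k, perimeter_measure Omega (W k) K = 0%E) ->
  nuZ K = 0.
Proof.
move=> n1 N0 Ca0 d0 hal qm mZ gZ cL LT oV VL cK KV act null.
have n0 : (0 < n)%N by exact: ltnW.
have [rho0 [c0 [rho00 c00 dens]]] := lower_density n1 N0 Ca0 d0 hal.
have oO := qm_open qm; have TO := qm_sub qm; have LO := subset_trans LT TO.
have mL := compact_measurable_rV cL; have mK := compact_measurable_rV cK.
have KL := subset_trans KV VL.
have [wW _] := qm_partition qm; have mW k : measurable (W k) by case: (wW k).
have gW k : is_gradient Omega (W k) (gradient Omega (W k)).
  by apply: gradient_is_gradient; case: (wW k).
pose nu (j : option 'I_N) := if j is Some k then gradient Omega (W k) else nuZ.
have nuU j : vector_measure Omega (nu j) by case: j => [k|]; [case: (gW k)|case: gZ].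
have [la [g dg]] := vm_density nuU cL LO.
have ig j i : la.-integrable setT (EFin \o g j i) by case: (dg j i).
have ivn j : la.-integrable setT (EFin \o vnorm (g j)) by apply: integrable_vnorm.
have exP j : exists P : {finite_measure set rV -> \bar R},
    forall A, measurable A -> A `<=` L -> Defs.total_variation Omega (nu j) A = P A.
  have [P [PE _]] := ex_density_measure (ivn j) (fun x => enorm_ge0 _).
  exists P => A mA AL; rewrite (total_variation_density (nuU j) cL LO (dg j) mA AL).
  exact: (esym (PE A mA)).
have [PZ PZE] := exP None.
have [PW PWE] : exists P : {finite_measure set rV -> \bar R},
    (forall k A, measurable A -> A `<=` L -> (perimeter_measure Omega (W k) A <= P A)%E) /\
    (forall A, measurable A -> A `<=` L -> (forall k, perimeter_measure Omega (W k) A = 0%E) -> P A = 0%E).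
  have /choice[F FE] k : exists P : {finite_measure set rV -> \bar R},
    forall A, measurable A -> A `<=` L -> perimeter_measure Omega (W k) A = P A := exP (Some k).
  have [P PE] := ex_measure_sum F (index_enum 'I_N).
  exists P; split => [k A mA AL|A mA AL H]; rewrite PE.
    by rewrite (FE k A mA AL) (bigD1 k)//= leeDl// sume_ge0.
  by rewrite big1// => k _; rewrite -FE.
have [PS PSE] := ex_measure_add PZ PW.
have [C0 C00 cut] := @cubes_cutoff R n.
(* The constant comes from the cutoff of the selected cubes: each contributes at most
   [C0 / t * (8 t)^n], their number is at most [e / (c0 (t / 6)^(n-1))], and the powers of [t]
   cancel. The last 1 is for the part of the gradient near [K] but off [K]. *)
suff small e : 0 < e -> forall i, `|nuZ K 0 i| <= (C0 * 8 ^+ n * 6 ^+ n.-1 / c0 + 1) * e.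
  apply/rowP => i; rewrite [RHS]mxE; apply/eqP; rewrite -normr_eq0 eq_le normr_ge0 andbT.
  apply/ler_addgt0Pr => e e0; rewrite add0r.
  have C10 : 0 < C0 * 8 ^+ n * 6 ^+ n.-1 / c0 + 1.
    by rewrite addr_gt0// divr_gt0// !mulr_gt0 ?exprn_gt0.
  have := small (e / (C0 * 8 ^+ n * 6 ^+ n.-1 / c0 + 1)) _ i.
  by rewrite [_ * (e / _)]mulrC divfK ?gt_eqF//; apply; exact: divr_gt0.
move=> e0 i.
have [C [B [cC oB CK [KB BV] PB]]] := finite_measure_squeeze PS mK (@subset_refl _ K) cK oV KV e0.
have mB := open_measurable_rV oB.
have BL := subset_trans BV VL.
have PBK : (PZ (B `\` K) < e%:E)%E /\ (PW (B `\` K) < e%:E)%E.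
  have mBK : measurable (B `\` K) by exact: measurableD.
  have le : (PS (B `\` K) <= PS (B `\` C))%E.
    apply: le_measure; rewrite ?inE//.
      by apply: measurableD => //; exact: compact_measurable_rV.
    by move=> x [Bx nK]; split => // /CK.
  by split; apply: le_lt_trans PB; apply: le_trans le; rewrite PSE ?leeDl ?leeDr.
have PWB : (PW B < e%:E)%E.
  have -> : PW B = (PW K + PW (B `\` K))%E.
    rewrite -measureU//; first by rewrite setDUK.
      exact: measurableD.
    by rewrite setDIK.
  rewrite (PWE.2 K mK KL null) add0e; exact: PBK.2.
have [r r0 rB] := lebesgue_number cK oB KB.
(* [4 t <= r] keeps the enlarged cubes inside [B], and [t / 6 <= rho0] allows [lower_density] with
   [rho = t / 6], whose reference cube has radius [t]. *)
pose t := Num.min (r / 4) (6 * rho0).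
have t0 : 0 < t by rewrite lt_min divr_gt0//= mulr_gt0.
have tr : 4 * t <= r.
  have : t <= r / 4 by rewrite ge_min lexx.
  by rewrite ler_pdivlMr// mulrC.
have trho : t / 6 <= rho0.
  have : t <= 6 * rho0 by rewrite ge_min lexx orbT.
  by rewrite ler_pdivrMr// mulrC.
have [s sK cov] := finite_cube_cover cK t0.
have [X [Xs covX PX]] := separated_centers s (ltW t0).
have XK c : c \in X -> K c by move=> /Xs /sK.
have cB c : c \in X -> cube c (4 * t) `<=` B.
  by move=> /XK /rB h; apply: subset_trans h; exact: sub_cube.
have cB1 c : c \in X -> cube c t `<=` B.
  by move=> /cB h; apply: subset_trans h; apply: sub_cube; rewrite ler_peMl// ?ler1n// ltW.
pose d := c0 * (t / 6) ^+ n.-1.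
have count : (size X)%:R * d <= e.
  have h1 : (\sum_(c <- X) d%:E <= PW B)%E.
    apply: (@le_trans _ _ (\sum_(c <- X) PW (cube c t))%E).
      rewrite big_seq [leRHS]big_seq; apply: lee_sum => c cX.
      have cT : cube c (6 * (t / 6)) `<=` Theta.
        rewrite mulrC divfK//; apply: subset_trans LT; apply: subset_trans BL; exact: cB1.
      (* Were the perimeter in a selected cube smaller, [lower_density] would give a whole cube
         around its centre to one phase, and by [constant_phase] the centre would not be
         [active]. *)
      apply: contrapT => /negP; rewrite -ltNge => lt.
      have [k0 k0P] : exists k0, leb (cube c (t / 6 / 2) `\` W k0) = 0.
        apply: (dens _ _ _ _ qm c (t / 6)) => //; first by rewrite divr_gt0.
        move=> k; rewrite mulrC divfK//; apply: le_trans (ltW lt).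
        apply: PWE.1; first exact: measurable_cube.
        apply: subset_trans BL; exact: cB1.
      have r2 : 0 < t / 6 / 2 by rewrite !divr_gt0.
      have [k] := act c (XK c cX) _ r2; apply; apply: (constant_phase (k0 := k0)) => //.
      - exact: qm_partition qm.
      - exact: ocube_open.
      - apply: subset_trans (@ocube_sub _ _ _ _) _; apply: subset_trans TO; apply: subset_trans cT.
        by apply: sub_cube; rewrite [leRHS]mulrC divfK//; rewrite -mulrA ler_piMr ?ltW//; lra.
      - apply/eqP; rewrite eq_le measure_ge0 andbT -k0P; apply: le_measure; rewrite ?inE.
        + by apply: measurableD => //; exact: measurable_ocube.
        + by apply: measurableD => //; exact: measurable_cube.
        + by move=> y [/ocube_sub Qy nW]; split.
    apply: (le_trans (PX PW)); apply: le_measure; rewrite ?inE//.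
      by apply: bigsetU_measurable => c _; exact: measurable_cube.
    by rewrite -bigcup_seq => y [c /= /cB1]; exact.
  move: (le_lt_trans h1 PWB); rewrite sumEFin lte_fin => /ltW.
  by rewrite big_const_seq count_predT iter_addr addr0 mulr_natl.
(* A point of [K] is within [t] of a centre in [s], which is within [2 t] of a selected one; the
   cutoff equals 1 up to [3 t] and has width [t]. *)
have t34 : 3 * t < 4 * t by rewrite ltr_pM2r// ltr_nat.
have [phi [sphi phi01 phi1 phi0 dphi]] := cut X (3 * t) (4 * t) t34.
have phiB x : ~ B x -> phi x = 0.
  by move=> nB; apply: phi0 => c cX /ocube_sub /(cB c cX).
have phiL x : ~ L x -> phi x = 0 by move=> nL; apply: phiB => /BL.
have phiK x : K x -> phi x = 1.
  move=> /cov[c cs cx]; have [c1 c1X cc] := covX c cs; apply: (phi1 x c1 c1X).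
  have -> : 3 * t = 2 * t + t by ring.
  by apply: (cube_trans cc); exact: ocube_sub.
have pair := fgradient_pairing (bounded_measurable_indic mZ) gZ cL LO (dg None i) sphi phiL.
have iL : la.-integrable L (EFin \o (fun x => phi x * g None i x)).
  apply: (@bounded_mul_integrable _ _ _ _ _ phi (g None i) 1) => //.
  - by apply: measurable_funTS; exact: smooth_measurable.
  - by move=> x _; have /andP[? ?] := phi01 x; rewrite ger0_norm.
  - exact: integrable_sub.
have mBK : measurable (B `\` K) by exact: measurableD.
have BKL : B `\` K `<=` L by move=> x [/BL].
have nuK : nuZ K 0 i = \int[la]_(x in K) (phi x * g None i x).
  rewrite [LHS]((dg None i).2 K mK KL); apply: eq_Rintegral => x; rewrite inE => Kx.
  by rewrite phiK// mul1r.
have split_int : \int[la]_(x in L) (phi x * g None i x) = nuZ K 0 i +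
    \int[la]_(x in B `\` K) (phi x * g None i x).
  rewrite (@Rintegral_support _ _ la B L B _ BL (@subset_refl _ B)); last first.
    by move=> x nB; rewrite phiB// mul0r.
  rewrite nuK -Rintegral_setU//; first by rewrite setDUK.
  - by rewrite setDUK//; exact: integrableS iL.
  - by rewrite disj_set2E setDIK.
have far : `|\int[la]_(x in B `\` K) (phi x * g None i x)| <= e.
  have iBK : la.-integrable (B `\` K) (EFin \o (fun x => phi x * g None i x)).
    exact: integrableS iL.
  apply: (le_trans (le_normr_Rintegral mBK iBK)).
  apply: (@le_trans _ _ (\int[la]_(x in B `\` K) vnorm (g None) x)).
    apply: le_Rintegral => //.
    - exact: integrable_norm iBK.
    - exact: integrable_sub.
    - move=> x _; have /andP[? ?] := phi01 x; rewrite normrM ger0_norm//.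
      apply: (@le_trans _ _ `|g None i x|); first by rewrite ler_piMl.
      by have := coord_le_enorm (\row_j g None j x) i; rewrite mxE.
  rewrite -lee_fin EFin_Rintegral//; last exact: integrable_sub.
  rewrite -(total_variation_density (nuU None) cL LO (dg None) mBK BKL).
  by rewrite PZE//; apply/ltW; exact: PBK.1.
have Loo := lebesgue_rV_compact cL.
have bdphi : bounded_measurable (partial i phi).
  apply: (smooth_bounded_measurable (smooth_partial i sphi) cL) => x nL.
  by apply: (partial_out _ _ phiL) => //; exact: compact_closed_rV.
have main : `|\int[leb]_(x in L) (\1_Z x * partial i phi x)| <=
    C0 * 8 ^+ n * 6 ^+ n.-1 / c0 * e.
  have ibm u : bounded_measurable u -> leb.-integrable L (EFin \o u).
    exact: bounded_measurable_integrable.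
  have iZ := ibm _ (bounded_measurableM (bounded_measurable_indic mZ) bdphi).
  have bc c : bounded_measurable (fun x => C0 / (4 * t - 3 * t) * \1_(cube c (4 * t)) x).
    by apply: bounded_measurableZ; apply: bounded_measurable_indic; exact: measurable_cube.
  apply: (le_trans (le_normr_Rintegral mL iZ)).
  apply: (@le_trans _ _ (\int[leb]_(x in L)
      (\sum_(c <- X) C0 / (4 * t - 3 * t) * \1_(cube c (4 * t)) x))).
    apply: le_Rintegral => //.
    - exact: integrable_norm iZ.
    - apply: ibm; elim: (X) => [|c X1 IH].
        rewrite (_ : (fun x => _) = cst 0); last by apply/funext => x; rewrite big_nil.
        by split; [exact: measurable_cst|exists 0 => x; rewrite normr0].
      rewrite (_ : (fun x => _) = fun x => C0 / (4 * t - 3 * t) * \1_(cube c (4 * t)) x +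
         \sum_(c <- X1) C0 / (4 * t - 3 * t) * \1_(cube c (4 * t)) x); last first.
        by apply/funext => x; rewrite big_cons.
      exact: bounded_measurableD.
    - move=> x _; rewrite normrM; apply: le_trans (dphi i x).
      rewrite ler_piMl// indicE; case: (_ \in _); rewrite ?normr1// normr0//.
  rewrite Rintegral_sum//; last by move=> c; exact: ibm.
  have -> : C0 * 8 ^+ n * 6 ^+ n.-1 / c0 * e = C0 / t * (8 * t) ^+ n * (e / d).
    rewrite /d !exprMn -[in t ^+ n](prednK n0) exprS exprVn; field.
    by rewrite !gt_eqF ?exprn_gt0.
  apply: (@le_trans _ _ (\sum_(c <- X) C0 / t * (8 * t) ^+ n)); last first.
    rewrite big_const_seq count_predT iter_addr addr0 -[leLHS]mulr_natr; apply: ler_wpM2l.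
      by rewrite mulr_ge0 ?divr_ge0 ?exprn_ge0 ?mulr_ge0 ?ltW.
    by rewrite ler_pdivlMr// /d mulr_gt0// exprn_gt0// divr_gt0.
  apply: ler_sum => c _; rewrite RintegralZl//; last first.
    by apply: ibm; apply: bounded_measurable_indic; exact: measurable_cube.
  rewrite (_ : 4 * t - 3 * t = t); last by ring.
  apply: ler_wpM2l; first by rewrite divr_ge0// ltW.
  rewrite Rintegral_indic//; last exact: measurable_cube.
  have cE : leb (cube c (4 * t)) = ((8 * t) ^+ n)%:E.
    rewrite [LHS]lebesgue_rV_cube; last by rewrite mulr_ge0// ltW.
    by congr (_ ^+ _)%:E; ring.
  have le : (leb (cube c (4 * t) `&` L) <= leb (cube c (4 * t)))%E.
    apply: le_measure; rewrite ?inE; [|exact: measurable_cube|exact: subIsetl].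
    by apply: measurableI => //; exact: measurable_cube.
  rewrite -lee_fin fineK; first by rewrite -cE.
  rewrite ge0_fin_numE//; apply: le_lt_trans le _; rewrite cE; exact: ltry.
have -> : nuZ K 0 i = (- (\int[leb]_(x in L) (\1_Z x * partial i phi x))) -
    \int[la]_(x in B `\` K) (phi x * g None i x).
  by rewrite pair opprK split_int addrK.
rewrite mulrDl mul1r; apply: (le_trans (ler_normB _ _)); rewrite normrN.
exact: lerD.
Qed.

End support.

(** * Inequalities for vectors *)

Section vectors.
Context {R : realType} {n N : nat}.
Local Notation rV := 'rV[R]_n.

(* The directions (1, q, q^2, ..) are in general position: a nonzero vector is
   orthogonal to fewer than n of them. *)
Lemma moment_directions (ga gb gc : 'I_n -> rV -> R) x (h : nat -> rV) :
  (forall q, h q = \row_(i < n) q%:R ^+ i) ->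
  (forall q, ~ 0 < dirc (h q) ga x * dirc (h q) gb x) ->
  (forall q, ~ 0 < dirc (h q) ga x * dirc (h q) gc x) ->
  (forall q, ~ 0 < dirc (h q) gb x * dirc (h q) gc x) ->
  vnorm ga x != 0 -> vnorm gb x != 0 -> vnorm gc x = 0.
Proof.
move=> hE ab ac bc a0 b0; apply/eqP; apply: contrapT => /negP c0.
pose P (g : 'I_n -> rV -> R) := \sum_(i < n) (g i x) *: 'X^i : {poly R}.
have PE g q : (P g).[q%:R] = dirc (h q) g x.
  rewrite /P horner_sum /dirc; apply: eq_bigr => i _.
  by rewrite hornerZ hornerXn hE mxE mulrC.
have P0 g : vnorm g x != 0 -> P g != 0.
  move=> g0; apply/eqP => Pg; move/eqP: g0; apply; rewrite /vnorm.
  rewrite (_ : \row_i _ = 0) ?enorm0//; apply/rowP => i; rewrite !mxE.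
  have := congr1 (fun p : {poly R} => p`_i) Pg; rewrite coef0 /P coef_sum (bigD1 i)//=.
  rewrite coefZ coefXn eqxx mulr1 big1 ?addr0// => j ji.
  by rewrite coefZ coefXn eq_sym (_ : (j == i :> nat) = false) ?mulr0//; apply/negbTE.
pose p := P ga * P gb * P gc.
have p0 : p != 0 by rewrite !mulf_neq0// P0.
have [q pq] : exists q : nat, p.[q%:R] != 0.
  apply: contrapT => H.
  suff : (size [seq q%:R : R | q <- iota 0 (size p)] < size p)%N.
    by rewrite size_map size_iota ltnn.
  apply: max_poly_roots => //.
    apply/allP => _ /mapP[q _ ->]; rewrite /root; apply: contrapT => /negP h1.
    by apply: H; exists q.
  rewrite map_inj_uniq ?iota_uniq// => a b /eqP; rewrite eqr_nat => /eqP //.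
move: pq (ab q) (ac q) (bc q); rewrite /p !hornerM !PE !mulf_eq0 !negb_or.
set u := dirc _ ga x; set v := dirc _ gb x; set w := dirc _ gc x.
move=> /andP[/andP[u0 v0] w0] /negP; rewrite -leNgt => uv /negP; rewrite -leNgt => uw /negP.
rewrite -leNgt => vw.
have {}uv : u * v < 0 by rewrite lt_neqAle uv mulf_neq0.
have {}uw : u * w < 0 by rewrite lt_neqAle uw mulf_neq0.
have {}vw : v * w < 0 by rewrite lt_neqAle vw mulf_neq0.
have h1 : 0 < (u * v) * (u * w) by rewrite nmulr_rgt0.
have h2 : (u * v) * (u * w) * (v * w) < 0 by rewrite pmulr_rlt0.
have : 0 <= (u * v * w) ^+ 2 by exact: sqr_ge0.
rewrite (_ : _ ^+ 2 = (u * v) * (u * w) * (v * w)); last by ring.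
by rewrite leNgt h2.
Qed.

(** The products [- z . q k] add up to [|z|^2], so one of them is at least [|z|^2 / N]. For that
    [k], multiply the claim by [|z| + |q k| + |z + q k|], which is at most [2 (|z| + |q k|)]: the
    difference of squares becomes [2 |z| |q k| - 2 z . q k]. *)
Lemma phase_inequality (z : rV) (q : 'I_N -> rV) : (0 < N)%N -> \sum_k q k = - z ->
  enorm z <= N%:R * \sum_k (enorm z + enorm (q k) - enorm (z + q k)).
Proof.
move=> N0 sq.
have T0 k : 0 <= enorm z + enorm (q k) - enorm (z + q k) by rewrite subr_ge0 ler_enormD.
pose F k := - \sum_i z 0 i * q k 0 i.
have sF : \sum_k F k = enorm z ^+ 2.
  rewrite sqr_enorm /F sumrN exchange_big/= -sumrN; apply: eq_bigr => i _.
  rewrite -mulr_sumr -[X in _ * X]summxE sq mxE; ring.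
have [k kP] := ex_large_term N0 sF.
apply: (@le_trans _ _ (N%:R * (enorm z + enorm (q k) - enorm (z + q k)))); last first.
  by apply: ler_wpM2l => //; rewrite (bigD1 k)//= lerDl sumr_ge0.
have sE : enorm (z + q k) ^+ 2 = enorm z ^+ 2 + enorm (q k) ^+ 2 - 2 * F k.
  rewrite !sqr_enorm /F mulrN opprK mulr_sumr -!big_split/=; apply: eq_bigr => i _.
  by rewrite mxE; ring.
move: (T0 k) kP sE (enorm_ge0 z) (enorm_ge0 (q k)) (enorm_ge0 (z + q k)); rewrite subr_ge0.
have N1 : 1 <= N%:R :> R by rewrite ler1n.
move: (enorm z) (enorm (q k)) (enorm (z + q k)) (F k) (N%:R) N1 => S Q s f m m1 sle le E S0 Q0 s0.
have [S00|Sn0] := eqVneq S 0; first rewrite {1}S00.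
  by apply: mulr_ge0; [exact: le_trans m1|rewrite subr_ge0].
have Sp : 0 < S by rewrite lt_neqAle eq_sym Sn0.
have p : 0 < S + Q + s by lra.
rewrite -(ler_pM2r p).
have -> : m * (S + Q - s) * (S + Q + s) = 2 * m * S * Q + 2 * (m * f).
  rewrite -mulrA (_ : (S + Q - s) * (S + Q + s) = S ^+ 2 + 2 * S * Q + Q ^+ 2 - s ^+ 2); last by ring.
  by rewrite E; ring.
have h : S * Q <= m * (S * Q) by rewrite ler_peMl// mulr_ge0.
have h2 : S * s <= S * (S + Q) by rewrite ler_wpM2l.
rewrite (_ : 2 * m * S * Q = 2 * (m * (S * Q))); last by ring.
rewrite expr2 in le.
rewrite !mulrDr in h2 *; move: h h2 le; move: (S * Q) (S * S) (S * s) (m * f); clear.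
move=> A B C D.
move: (m * A) => mA; lra.
Qed.

End vectors.

Section local_null.
Context {R : realType} {n : nat}.
Local Notation rV := 'rV[R]_n.
Local Notation leb := (@lebesgue_rV R n).
Implicit Types (A B E K L U V Z : set rV) (la : {finite_measure set rV -> \bar R}).

Lemma negligible_bigcup_countable (mu : {measure set rV -> \bar R}) (I : countType)
  (F : I -> set rV) : (forall q, mu.-negligible (F q)) -> mu.-negligible (\bigcup_q F q).
Proof.
move=> H; pose G k := if @unpickle I k is Some q then F q else set0.
apply: (@negligibleS _ _ _ mu (\bigcup_k G k)).
  by move=> x [q _ Fx]; exists (pickle q) => //; rewrite /G pickleK.
by apply: negligible_bigcup => k; rewrite /G; case: unpickle => [q|]; [exact: H|exact: negligible_set0].
Qed.

(** Countably many cubes with rational data suffice to cover [A] by neighbourhoods in which it is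
    null. *)
Lemma lindelof_null (mu : {measure set rV -> \bar R}) A : measurable A ->
  (forall x, A x -> exists2 r, 0 < r & mu (A `&` ocube x r) = 0%E) -> mu A = 0%E.
Proof.
move=> mA H; apply: (negligibleP _ mA).1.
pose B (q : 'rV[rat]_n * rat) : set rV := ocube (map_mx ratr q.1) (ratr q.2).
pose G q := if `[< mu (A `&` B q) = 0%E >] then A `&` B q else set0.
have GN : mu.-negligible (\bigcup_q G q).
  apply: negligible_bigcup_countable => q.
  by rewrite /G; case: asboolP => h; [apply/negligibleP => //; apply: measurableI => //; exact: measurable_ocube|exact: negligible_set0].
apply: negligibleS GN.
move=> x Ax; have [r r0 h] := H x Ax.
have : ocube x r x by exact: ocube_center.
rewrite {1}(open_rat_cubes (@ocube_open _ _ x r)) => -[q /= qr xq].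
exists q => //; rewrite /G; case: asboolP => [_|]; first by split.
case; apply/eqP; rewrite eq_le measure_ge0 andbT -h; apply: le_measure; rewrite ?inE.
- by apply: measurableI => //; exact: measurable_ocube.
- by apply: measurableI => //; exact: measurable_ocube.
- by move=> y [Ay yq]; split => //; exact: qr.
Qed.

Lemma density_null la A (f : rV -> R) : measurable A -> la.-integrable setT (EFin \o f) ->
  (forall x, 0 <= f x) -> (\int[la]_(x in A) (f x)%:E = 0)%E ->
  la (A `&` [set x | f x != 0]) = 0%E.
Proof.
move=> mA iF f0 int0.
have mf : measurable_fun setT f by apply/measurable_EFinP; exact: measurable_int iF.
have : ae_eq la A (EFin \o f) (cst 0%E).
  apply/(ae_eq_integral_abs la mA).
    by apply/measurable_EFinP; exact: measurable_funTS.
  by rewrite -[RHS]int0; apply: eq_integral => x _ /=; rewrite ger0_norm.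
have mS : measurable (A `&` [set x | f x != 0]).
  rewrite (_ : [set x | f x != 0] = f @^-1` (~` [set 0])); last first.
    by apply/seteqP; split => x /= /eqP.
  have mfA : measurable_fun A f by exact: measurable_funTS.
  by apply: mfA => //; exact: measurableC.
move=> h; apply: (negligibleP _ mS).1; apply: negligibleS h => x /= [Ax fx0] H.
by move: (H Ax) => -[] /eqP; rewrite (negbTE fx0).
Qed.

End local_null.

(** * The sharp sets and points away from the perimeters *)

Section sharp.
Context {R : realType} {n N : nat}.
Local Notation rV := 'rV[R]_n.
Local Notation leb := (@lebesgue_rV R n).
Implicit Types (A B E K L U V Omega Theta Z : set rV) (a : rV -> R)
  (W : 'I_N -> set rV) (Ca al delta D q t r : R) (c x : rV).

Lemma eball_sub_ocube x r : eball x r `<=` ocube x r.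
Proof.
move=> y /= h i; apply: le_lt_trans h; have := coord_le_enorm (y - x) i.
by rewrite !mxE.
Qed.

Lemma cube_sub_eball x r : 0 < r -> exists2 s, 0 < s & cube x s `<=` eball x r.
Proof.
move=> r0; exists (r / (n%:R + 1)); first by rewrite divr_gt0// ltr_wpDl.
move=> y h; rewrite /eball/=.
have : cube 0 (r / (n%:R + 1)) (y - x) by move=> i; rewrite !mxE subr0.
move=> /cube_enorm_le/le_lt_trans; apply.
by rewrite mulrCA gtr_pMr// ltr_pdivrMr ?ltr_wpDl// mul1r ltrDl.
Qed.

Lemma eball_open x r : open (eball x r).
Proof.
rewrite openE => y /= yr.
have r0 : 0 < r - enorm (y - x) by rewrite subr_gt0.
have [s s0 sub] := cube_sub_eball y r0.
rewrite /interior/= nbhsE; exists (ocube y s); first by split; [exact: ocube_open|exact: ocube_center].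
move=> w /ocube_sub/sub; rewrite /eball/= => h.
rewrite (_ : w - x = (w - y) + (y - x)); last by rewrite addrA subrK.
by apply: (le_lt_trans (ler_enormD _ _)); rewrite -ltrBrDr.
Qed.

Lemma sharp_open Omega W i : open Omega -> measurable (W i) -> open (sharp Omega W i).
Proof.
move=> oO mW; rewrite openE => x [[Ox nI] [r r0 null]].
pose C := closure (\bigcup_(i in [set: 'I_N]) reduced_boundary Omega (W i)).
have oC : open (Omega `&` ~` C `&` eball x r).
  apply: openI; last exact: eball_open.
  by apply: openI => //; apply: closed_openC; exact: closed_closure.
rewrite /interior/= nbhsE; exists (Omega `&` ~` C `&` eball x r).
  split => //; split; first by split => // Cx; apply: nI.
  by rewrite /eball/= subrr enorm0.
move=> y [[Oy nC] yr]; split; first by split => // -[_].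
have r1 : 0 < r - enorm (y - x) by rewrite subr_gt0.
exists (r - enorm (y - x)) => //; apply/eqP; rewrite eq_le measure_ge0 andbT -null.
apply: le_measure; rewrite ?inE.
- by apply: measurableD => //; apply: open_measurable_rV; exact: eball_open.
- by apply: measurableD => //; apply: open_measurable_rV; exact: eball_open.
- move=> w [wy nW]; split => //; rewrite /eball/= (_ : w - x = (w - y) + (y - x)); last by rewrite addrA subrK.
  by apply: (le_lt_trans (ler_enormD _ _)); rewrite -ltrBrDr.
Qed.

(** Where no perimeter is charged, [lower_density] gives a small cube to a single phase. If it is
    the phase [i], the point belongs to the sharp set; otherwise [W i] is null near the point. *)
Lemma inactive_cases Ca al delta Omega Theta a W i x : (1 < n)%N -> (0 < N)%N ->
  0 <= Ca -> 0 < delta -> (n%:R - 1) / n%:R < al ->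
  quasi_minimizer Ca al delta Omega Theta a W -> Theta x -> ~ active Omega W x ->
  sharp Omega W i x \/ exists2 r, 0 < r & leb (W i `&` ocube x r) = 0.
Proof.
move=> n1 N0 Ca0 d0 hal qm Tx nact.
have [rho0 [c0 [rho00 c00 dens]]] := lower_density n1 N0 Ca0 d0 hal.
have [wW _] := qm_partition qm; have mW k : measurable (W k) by case: (wW k).
have [r r0 H] : exists2 r, 0 < r & forall k, perimeter_measure Omega (W k) (ocube x r) = 0%E.
  apply: contrapT => nH; apply: nact => r r0; apply: contrapT => nk; apply: nH.
  by exists r => // k; apply: contrapT => h; apply: nk; exists k.
have [r1 r10 rT] := open_cube (qm_open' qm) Tx.
(* The cube of radius [6 rho] fits strictly inside the cube without perimeter and inside [Theta]. *)
pose rho := Num.min rho0 (Num.min r r1 / 12).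
have m0 : 0 < Num.min r r1 by rewrite lt_min r0.
have p0 : 0 < rho by rewrite lt_min rho00 divr_gt0.
have h6 : 6 * rho <= Num.min r r1 / 2.
  have : rho <= Num.min r r1 / 12 by rewrite ge_min lexx orbT.
  by move: (Num.min r r1) => m; lra.
have hr : 6 * rho < r.
  have : Num.min r r1 <= r by rewrite ge_min lexx.
  by move: (Num.min r r1) h6 m0 => m; lra.
have hr1 : 6 * rho <= r1.
  have : Num.min r r1 <= r1 by rewrite ge_min lexx orbT.
  by move: (Num.min r r1) h6 m0 => m; lra.
have [k0 null] : exists k0, leb (cube x (rho / 2) `\` W k0) = 0.
  apply: (dens _ _ _ _ qm x rho p0); first by rewrite ge_min lexx.
    by apply: subset_trans rT; exact: sub_cube.
  move=> k; apply: (@le_trans _ _ 0%E).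
    by rewrite -(H k); apply: total_variationS; exact: cube_sub_ocube.
  by rewrite lee_fin mulr_ge0 ?exprn_ge0// ltW.
have mQ : measurable (cube x (rho / 2) `\` W k0).
  by apply: measurableD => //; exact: measurable_cube.
have r2 : 0 < rho / 2 by rewrite divr_gt0.
have [ki|ki] := eqVneq k0 i; [left|right].
  split; last first.
    exists (rho / 2) => //; apply/eqP; rewrite eq_le measure_ge0 andbT -null ki.
    apply: le_measure; rewrite ?inE.
    - by apply: measurableD => //; apply: open_measurable_rV; exact: eball_open.
    - by rewrite -ki.
    - by move=> y [/eball_sub_ocube/ocube_sub Qy nW].
  split; first by apply: (qm_sub qm).
  move=> [_ cl].
  have nb : nbhs x (ocube x r).
    by rewrite nbhsE; exists (ocube x r) => //; split; [exact: ocube_open|exact: ocube_center].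
  have [y [[k _ [Oy pos _]] yr]] := cl _ nb.
  have [s s0 ys] := open_cube (@ocube_open _ _ x r) yr.
  have := pos s s0; rewrite ltNge; move/negP; apply.
  rewrite -(H k); apply: total_variationS.
  by apply: subset_trans ys; apply: subset_trans (@ocube_sub _ _ _ _); exact: eball_sub_ocube.
exists (rho / 2) => //.
have mI : measurable (W i `&` W k0) by exact: measurableI.
apply/eqP; rewrite eq_le measure_ge0 andbT.
apply: (@le_trans _ _ (leb (cube x (rho / 2) `\` W k0) + leb (W i `&` W k0))%E); last first.
  by rewrite null (weak_partition_disjoint (qm_partition qm)) ?adde0// eq_sym.
apply: (le_trans _ (measureU2 _ mQ mI)); apply: le_measure; rewrite ?inE.
- by apply: measurableI => //; exact: measurable_ocube.
- exact: measurableU.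
- by move=> y [Wy /ocube_sub Qy]; have [Wk|nW] := pselect (W k0 y); [right|left].
Qed.

Lemma active_null Ca al delta Omega Theta a W Z nuZ L V A : (1 < n)%N -> (0 < N)%N ->
  0 <= Ca -> 0 < delta -> (n%:R - 1) / n%:R < al ->
  quasi_minimizer Ca al delta Omega Theta a W -> measurable Z -> is_gradient Omega Z nuZ ->
  compact L -> L `<=` Theta -> open V -> V `<=` L -> A `<=` V ->
  (forall x, A x -> active Omega W x) ->
  (forall k, perimeter_measure Omega (W k) A = 0%E) ->
  Defs.total_variation Omega nuZ A = 0%E.
Proof.
move=> n1 N0 Ca0 d0 hal qm mZ gZ cL LT oV VL AV act null.
apply: total_variation_zero => B iB BA; apply: (vm_inner_zero (qm_open qm) gZ.1 iB) => C cC CB.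
have CA := subset_trans CB BA.
apply: (active_null_compact n1 N0 Ca0 d0 hal qm mZ gZ cL LT oV VL cC).
- exact: subset_trans AV.
- by move=> x /CA; exact: act.
- move=> k; apply/eqP; rewrite eq_le; apply/andP; split.
    by rewrite -(null k); exact: total_variationS.
  apply: ereal_sup_ubound; exists 0%N, (fun=> set0); split => //.
  + by move=> _; exact: interior_borel0.
  + by apply/trivIsetP => *; rewrite set0I.
  + by move=> _ z.
  + by rewrite big_ord0.
Qed.

End sharp.

(** * Exchanging a small set between two phases *)

Section exchange.
Context {R : realType} {n N : nat}.
Local Notation rV := 'rV[R]_n.
Local Notation leb := (@lebesgue_rV R n).
Implicit Types (A B E K L U V Omega Theta Z : set rV) (a : rV -> R)
  (la : {finite_measure set rV -> \bar R})
  (W : 'I_N -> set rV) (Ca al delta D t r : R) (c x : rV).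

Lemma fgradient_sum U (I : Type) (s : seq I) (F : I -> set rV) (nu : I -> set rV -> rV) :
  (forall k, measurable (F k)) -> (forall k, is_gradient U (F k) (nu k)) ->
  bounded_measurable (fun x => \sum_(k <- s) (\1_(F k) x : R)) /\
  fgradient U (fun x => \sum_(k <- s) \1_(F k) x) (fun A => \sum_(k <- s) nu k A).
Proof.
move=> mF gF; elim: s => [|k s [bs gs]].
  have -> : (fun x => \sum_(k <- [::]) \1_(F k) x) = cst (0 : R).
    by apply/funext => x; rewrite big_nil.
  have -> : (fun A => \sum_(k <- [::]) nu k A) = fun=> 0 by apply/funext => x; rewrite big_nil.
  split; last exact: fgradient_cst.
  by split; [exact: measurable_cst|exists 0 => x; rewrite normr0].
have -> : (fun x => \sum_(k <- k :: s) \1_(F k) x) = fun x => 1 * \1_(F k) x + 1 * \sum_(k <- s) \1_(F k) x :> R.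
  by apply/funext => x; rewrite big_cons !mul1r.
have -> : (fun A => \sum_(k <- k :: s) nu k A) = fun A => 1 *: nu k A + 1 *: \sum_(k <- s) nu k A.
  by apply/funext => x; rewrite big_cons !scale1r.
have bk := bounded_measurable_indic (mF k).
split; last exact: (fgradient_lin 1 1 bk bs (gF k) gs).
by apply: bounded_measurableD; exact: bounded_measurableZ.
Qed.

Lemma has_density_sum la K (I : Type) (s : seq I) (g : I -> rV -> R) (kappa : I -> set rV -> R) :
  (forall k, has_density la K (g k) (kappa k)) ->
  has_density la K (fun x => \sum_(k <- s) g k x) (fun A => \sum_(k <- s) kappa k A).
Proof.
move=> dg; elim: s => [|k s IH].
  have -> : (fun x => \sum_(k <- [::]) g k x) = cst (0 : R).
    by apply/funext => x; rewrite big_nil.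
  split; first exact: integrable0.
  by move=> A mA AK; rewrite big_nil Rintegral_cst// mul0r.
have -> : (fun x => \sum_(k <- k :: s) g k x) = fun x => 1 * g k x + 1 * \sum_(k <- s) g k x :> R.
  by apply/funext => x; rewrite big_cons !mul1r.
have -> : (fun A => \sum_(k <- k :: s) kappa k A) = fun A => 1 * kappa k A + 1 * \sum_(k <- s) kappa k A.
  by apply/funext => x; rewrite big_cons !mul1r.
exact: has_density_lin.
Qed.

(** The index [None] stands for [Z], so that a single use of [vm_density] provides densities of [Z]
    and of all phases for the same measure. *)
Definition phase_gradient Omega W (nuZ : set rV -> rV) (j : option 'I_N) : set rV -> rV :=
  if j is Some k then gradient Omega (W k) else nuZ.

(** The indicators of the phases add up to that of [Omega], whose gradient in [Omega] is 0. *)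
Lemma gradient_sum0 Omega W A : open Omega -> weak_partition Omega W ->
  interior_borel Omega A -> \sum_k gradient Omega (W k) A = 0.
Proof.
move=> oO [wW ae1] iA; have mO := open_measurable_rV oO.
have mW k : measurable (W k) by case: (wW k).
have gW k : is_gradient Omega (W k) (gradient Omega (W k)).
  by apply: gradient_is_gradient; case: (wW k).
have [bs gs] := fgradient_sum (index_enum 'I_N) mW gW.
apply: (fgradient_local oO oO (@subset_refl _ Omega) bs (bounded_measurable_indic mO) _ gs (is_gradient_self mO) iA).
by apply: filterS ae1 => x H Ox.
Qed.

Lemma sum_density_null Omega W nuZ L la (g : option 'I_N -> 'I_n -> rV -> R) :
  open Omega -> weak_partition Omega W -> compact L -> L `<=` Omega ->
  (forall j i, has_density la L (g j i) (fun A => phase_gradient Omega W nuZ j A 0 i)) ->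
  la (L `&` [set x | vnorm (fun i x => \sum_k g (Some k) i x) x != 0]) = 0%E.
Proof.
move=> oO wP cL LO dg; have mL := compact_measurable_rV cL.
have ds i : has_density la L (fun x => \sum_k g (Some k) i x) (fun A => (0 : rV) 0 i).
  have [ig gE] := has_density_sum (index_enum 'I_N) (fun k => dg (Some k) i).
  split => // A mA AL; rewrite -gE// mxE -summxE/= gradient_sum0 ?mxE//.
  exact: (interior_borel_sub cL).
have vm00 : vector_measure Omega (fun=> (0 : rV)) by case: (is_gradient_set0 (open_measurable_rV oO)).
apply: density_null => //.
- by apply: integrable_vnorm => i; case: (ds i).
- by move=> x; exact: enorm_ge0.
- rewrite -(total_variation_density vm00 cL LO ds mL)//.
  exact: total_variation_zero.
Qed.

(* Z, W i \ Z and W k are disjoint for k <> i, and at most two of three disjoint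
   sets have nonzero densities at a point; since the densities of the phases add
   up to 0, they all vanish where both Z and W i \ Z have nonzero densities. *)
Lemma mixed_null Ca al delta Omega Theta a W i Z nuZ L V la
    (g : option 'I_N -> 'I_n -> rV -> R) : (1 < n)%N -> (0 < N)%N ->
  0 <= Ca -> 0 < delta -> (n%:R - 1) / n%:R < al ->
  quasi_minimizer Ca al delta Omega Theta a W -> measurable Z -> is_gradient Omega Z nuZ ->
  leb (Z `\` W i) = 0 ->
  compact L -> L `<=` Theta -> open V -> V `<=` L ->
  (forall j l, has_density la L (g j l) (fun A => phase_gradient Omega W nuZ j A 0 l)) ->
  la (V `&` [set x | [/\ ~ sharp Omega W i x, vnorm (g None) x != 0 &
    vnorm (fun l x => g (Some i) l x - g None l x) x != 0]]) = 0%E.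
Proof.
move=> n1 N0 Ca0 d0 hal qm mZ gZ null cL LT oV VL dg.
have oO := qm_open qm; have mO := open_measurable_rV oO.
have TO := qm_sub qm; have LO := subset_trans LT TO; have VO := subset_trans VL LO.
have mL := compact_measurable_rV cL; have mV := open_measurable_rV oV.
have wP := qm_partition qm; have [wW ae1] := wP; have mW k : measurable (W k) by case: (wW k).
have gW k : is_gradient Omega (W k) (gradient Omega (W k)).
  by apply: gradient_is_gradient; case: (wW k).
pose z := g None; pose w k := g (Some k); pose f l x := w i l x - z l x.
have dz l : has_density la L (z l) (fun A => nuZ A 0 l) by exact: dg None l.
have dw k l : has_density la L (w k l) (fun A => gradient Omega (W k) A 0 l) by exact: dg (Some k) l.
have iz l : la.-integrable setT (EFin \o z l) by case: (dz l).
have iw k l : la.-integrable setT (EFin \o w k l) by case: (dw k l).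
have ivz : la.-integrable setT (EFin \o vnorm z) by exact: integrable_vnorm.
have ivw k : la.-integrable setT (EFin \o vnorm (w k)) by exact: integrable_vnorm.
have mvz : measurable_fun setT (vnorm z) by apply/measurable_EFinP; exact: measurable_int ivz.
have mvw k : measurable_fun setT (vnorm (w k)) by apply/measurable_EFinP; exact: measurable_int (ivw k).
have ifl l : la.-integrable setT (EFin \o f l).
  rewrite (_ : EFin \o f l = (EFin \o w i l) \- (EFin \o z l))%E; last exact/funext.
  exact: integrableB.
have ivf : la.-integrable setT (EFin \o vnorm f) by exact: integrable_vnorm.
have mvf : measurable_fun setT (vnorm f) by apply/measurable_EFinP; exact: measurable_int ivf.
have mne (h : rV -> R) : measurable_fun setT h -> measurable [set x | h x != 0].
  move=> mh; rewrite (_ : [set x | h x != 0] = setT `&` h @^-1` (~` [set 0])); last first.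
    by rewrite setTI; apply/seteqP; split => x /= /eqP.
  by apply: mh => //; exact: measurableC.
have oS : open (sharp Omega W i) by exact: sharp_open.
have mS : measurable (~` sharp Omega W i) by apply: measurableC; exact: open_measurable_rV.
have mI : measurable [set x | ~ active Omega W x] by apply: open_measurable_rV; exact: inactive_open.
have mA : measurable [set x | active Omega W x].
  rewrite (_ : [set x | _] = ~` [set x | ~ active Omega W x]); first exact: measurableC.
  by apply/seteqP; split => x /= h; [move=> /(_ h)|exact: contrapT].
have Znull k : k != i -> leb (Z `&` W k) = 0.
  move=> ki; have mZW : measurable (Z `\` W i) by exact: measurableD.
  have mWW : measurable (W k `&` W i) by exact: measurableI.
  apply/eqP; rewrite eq_le measure_ge0 andbT.
  apply: (@le_trans _ _ (leb (Z `\` W i) + leb (W k `&` W i))%E); last first.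
    by rewrite null (weak_partition_disjoint wP ki) adde0.
  apply: (le_trans _ (measureU2 _ mZW mWW)); apply: le_measure; rewrite ?inE.
  - exact: measurableI.
  - exact: measurableU.
  - by move=> x [Zx Wx]; have [Wi|nW] := pselect (W i x); [right|left].
pose F := W i `\` Z.
have mF : measurable F by exact: measurableD.
have gF : is_gradient Omega F (fun A => 1 *: gradient Omega (W i) A + (-1) *: nuZ A).
  have h := fgradient_lin 1 (-1) (bounded_measurable_indic (mW i)) (bounded_measurable_indic mZ) (gW i) gZ.
  apply: (fgradient_ae mO _ (bounded_measurable_indic mF) _ h).
    by apply: bounded_measurableD; apply: bounded_measurableZ; exact: bounded_measurable_indic.
  exists (Z `\` W i); split => //; first exact: measurableD.
  move=> x /= H; apply: contrapT => nD; apply: H => Ox.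
  rewrite /F !indicE in_setD; have [Zx|nZ] := pselect (Z x).
    by rewrite (mem_set Zx) mem_set ?andbF/=; [lra|apply: contrapT => nW; exact: nD].
  by rewrite (memNset nZ)/= andbT; lra.
have df l : has_density la L (f l) (fun A => (1 *: gradient Omega (W i) A + (-1) *: nuZ A) 0 l).
  have [h1 h2] := has_density_lin 1 (-1) (dw i l) (dz l).
  split => // A mA1 AL; rewrite !mxE h2//; apply: eq_Rintegral => x _.
  by rewrite /f mul1r mulN1r.
(* [disjoint_gradients] asks for sets that are disjoint, not merely almost disjoint; removing a null
   set from [W k] leaves its gradient unchanged. *)
pose X k := W k `\` (W i `|` Z).
have mX k : measurable (X k) by apply: measurableD => //; exact: measurableU.
have gX k : k != i -> is_gradient Omega (X k) (gradient Omega (W k)).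
  move=> ki; apply: (fgradient_ae mO (bounded_measurable_indic (mW k)) (bounded_measurable_indic (mX k)) _ (gW k)).
  have mWW : measurable (W k `&` W i) by exact: measurableI.
  have mZW : measurable (Z `&` W k) by exact: measurableI.
  exists ((W k `&` W i) `|` (Z `&` W k)); split; first exact: measurableU.
    apply/eqP; rewrite eq_le measure_ge0 andbT.
    apply: (@le_trans _ _ (leb (W k `&` W i) + leb (Z `&` W k))%E); first exact: measureU2.
    by rewrite (Znull k ki) (weak_partition_disjoint wP ki) adde0.
  move=> x /= H; apply: contrapT => nD; apply: H => Ox; rewrite !indicE; congr (_%:R).
  congr nat_of_bool; apply/idP/idP; rewrite !inE; last by case.
  by move=> Wx; split => // -[Wi|Zx]; apply: nD; [left|right].
(* The countably many directions of [moment_directions]: for each of them the components of two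
   disjoint sets have opposite signs off a null set. *)
pose h (q : nat) : rV := \row_(l < n) q%:R ^+ l.
pose pos (g1 g2 : 'I_n -> rV -> R) q := V `&` [set x | 0 < dirc (h q) g1 x * dirc (h q) g2 x].
have zf q : la (pos z f q) = 0%E.
  by apply: (disjoint_gradients (h q) mZ mF _ gZ gF cL LO dz df oV VL); rewrite /F setDIK.
have zw k q : k != i -> la (pos z (w k) q) = 0%E.
  move=> ki; apply: (disjoint_gradients (h q) mZ (mX k) _ gZ (gX k ki) cL LO dz (dw k) oV VL).
  by apply/seteqP; split => // x [Zx [_ nU]]; apply: nU; right.
have fw k q : k != i -> la (pos f (w k) q) = 0%E.
  move=> ki; apply: (disjoint_gradients (h q) mF (mX k) _ gF (gX k ki) cL LO df (dw k) oV VL).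
  by apply/seteqP; split => // x [[Wx _] [_ nU]]; apply: nU; left.
have mpos g1 g2 q : (forall l, measurable_fun setT (g1 l)) -> (forall l, measurable_fun setT (g2 l)) ->
    measurable (pos g1 g2 q).
  move=> m1 m2; apply: measurableI => //.
  have md : measurable_fun setT (fun x => dirc (h q) g1 x * dirc (h q) g2 x).
    by apply: measurable_funM; exact: measurable_dirc.
  rewrite (_ : [set x | _] = setT `&` (fun x => dirc (h q) g1 x * dirc (h q) g2 x) @^-1` `]0, +oo[%classic); last first.
    by rewrite setTI; apply/seteqP; split => x /=; rewrite in_itv/= andbT.
  by apply: md => //; exact: measurable_itv.
have mz l : measurable_fun setT (z l) by apply/measurable_EFinP; exact: measurable_int (iz l).
have mw k l : measurable_fun setT (w k l) by apply/measurable_EFinP; exact: measurable_int (iw k l).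
have mf l : measurable_fun setT (f l) by apply/measurable_EFinP; exact: measurable_int (ifl l).
(* The exceptional points of the direction [q.1]: the index [q.2 = i] stands for the pair of [Z] and
   [F], any other [q.2] for the two pairs with [W q.2]. *)
pose P1 (q : nat * 'I_N) := if q.2 == i then pos z f q.1 else pos z (w q.2) q.1 `|` pos f (w q.2) q.1.
have P1null : la.-negligible (\bigcup_q P1 q).
  apply: negligible_bigcup_countable => -[q k]; rewrite /P1/=; case: eqP => [_|/eqP ki].
    by apply/negligibleP; [exact: mpos|exact: zf].
  apply: negligibleU; apply/negligibleP; try exact: mpos; [exact: zw|exact: fw].
pose P2 := L `&` [set x | vnorm (fun l x => \sum_k w k l x) x != 0].
have mP2 : measurable P2.
  apply: measurableI => //; apply: mne; apply: measurable_vnorm => l.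
  by apply: measurable_sum => k.
have P2null : la.-negligible P2.
  by apply/negligibleP => //; exact: sum_density_null oO wP cL LO dg.
(* [active] points at which all phase densities vanish: [active_null] shows that they carry no
   gradient of [Z]. *)
pose P3 := V `&` [set x | [/\ active Omega W x, vnorm z x != 0 & forall k, vnorm (w k) x = 0]].
have mP3 : measurable P3.
  rewrite (_ : P3 = V `&` ([set x | active Omega W x] `&` ([set x | vnorm z x != 0] `&`
     ~` [set x | \sum_k vnorm (w k) x != 0]))).
    apply: measurableI => //; apply: measurableI => //; apply: measurableI; first exact: mne.
    by apply: measurableC; apply: mne; apply: measurable_sum.
  apply/seteqP; split => x.
    by move=> [Vx [ax zx wx]]; do 3 split => //; rewrite /= big1 ?eqxx.
  move=> [Vx [ax [zx /= /negP]]]; rewrite negbK => /eqP s0; split => //; split => // k.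
  by apply: (psumr_eq0P _ s0) => // l _; exact: enorm_ge0.
have P3V : P3 `<=` V by move=> x [].
have P3L := subset_trans P3V VL.
have P3null : la.-negligible P3.
  have tv0 : Defs.total_variation Omega nuZ P3 = 0%E.
    apply: (active_null n1 N0 Ca0 d0 hal qm mZ gZ cL LT oV VL P3V); first by move=> x [_ []].
    move=> k; rewrite [LHS](total_variation_density (gW k).1 cL LO (dw k) mP3 P3L).
    apply: integral0_eq => x [_ [_ _ ->]]//.
  apply/negligibleP => //; rewrite (_ : P3 = P3 `&` [set x | vnorm z x != 0]); last first.
    by apply/seteqP; split => x; [move=> Px; split => //; case: Px => _ []|case].
  apply: density_null => //; first by move=> x; exact: enorm_ge0.
  by rewrite -(total_variation_density gZ.1 cL LO dz mP3 P3L).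
(* At such a point [inactive_cases] leaves only that [W i], hence also [Z], is null nearby; locally
   [Z] then has no gradient, and [lindelof_null] sums this up. *)
pose P4 := V `&` [set x | [/\ ~ active Omega W x, ~ sharp Omega W i x & vnorm z x != 0]].
have mP4 : measurable P4.
  rewrite (_ : P4 = V `&` ([set x | ~ active Omega W x] `&` (~` sharp Omega W i `&` [set x | vnorm z x != 0]))).
    by apply: measurableI => //; apply: measurableI => //; apply: measurableI => //; exact: mne.
  by apply/seteqP; split => x; [move=> [? []]|move=> [? [? []]]].
have P4null : la.-negligible P4.
  apply/negligibleP => //; apply: lindelof_null => // x [Vx [nact nsh zx]].
  have Tx : Theta x by apply: LT; exact: VL.
  have [//|[r r0 locnull]] := inactive_cases i n1 N0 Ca0 d0 hal qm Tx nact.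
  have [s s0 sV] := open_cube oV Vx.
  pose t := Num.min r s; have t0 : 0 < t by rewrite lt_min r0.
  exists t => //.
  pose Q := ocube x t; have oQ : open Q by exact: ocube_open.
  have QV : Q `<=` V.
    apply: subset_trans (@ocube_sub _ _ _ _) _; apply: subset_trans sV; apply: sub_cube.
    by rewrite ge_min lexx orbT.
  have mQ := open_measurable_rV oQ.
  have tvQ : Defs.total_variation Omega nuZ Q = 0%E.
    apply: (locally_equal_variation oO mZ measurable0 gZ (is_gradient_set0 mO) oQ (subset_trans QV VO)).
    have mZW : measurable (Z `\` W i) by exact: measurableD.
    have mWQ : measurable (W i `&` ocube x r) by apply: measurableI => //; exact: measurable_ocube.
    exists ((Z `\` W i) `|` (W i `&` ocube x r)); split; first exact: measurableU.
      apply/eqP; rewrite eq_le measure_ge0 andbT.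
      apply: (@le_trans _ _ (leb (Z `\` W i) + leb (W i `&` ocube x r))%E); first exact: measureU2.
      by rewrite null locnull adde0.
    move=> y /= H; apply: contrapT => nD; apply: H => Qy; rewrite indic0 indicE memNset// => Zy.
    apply: nD; have [Wy|] := pselect (W i y); [right|left] => //; split => // l.
    by apply: lt_le_trans (Qy l) _; rewrite ge_min lexx.
  have QL := subset_trans QV VL.
  have QN : la (Q `&` [set x | vnorm z x != 0]) = 0%E.
    apply: density_null => //; first by move=> y; exact: enorm_ge0.
    by rewrite -(total_variation_density gZ.1 cL LO dz mQ QL).
  apply/eqP; rewrite eq_le measure_ge0 andbT -QN; apply: le_measure; rewrite ?inE.
  - exact: measurableI.
  - by apply: measurableI => //; exact: mne.
  - by move=> y [[_ [_ _ zy]] Qy].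
have mG : measurable (V `&` [set x | [/\ ~ sharp Omega W i x, vnorm z x != 0 & vnorm f x != 0]]).
  rewrite (_ : [set x | _] = ~` sharp Omega W i `&` ([set x | vnorm z x != 0] `&` [set x | vnorm f x != 0])).
    by apply: measurableI => //; apply: measurableI => //; apply: measurableI; exact: mne.
  by apply/seteqP; split => x; [move=> []|move=> [? []]].
apply: (negligibleP _ mG).1.
have PN : la.-negligible ((\bigcup_q P1 q `|` P2) `|` (P3 `|` P4)).
  by apply: negligibleU; exact: negligibleU.
apply: negligibleS PN.
move=> x [Vx [nsh zx fx]]; apply: contrapT => H.
have nP1 q k : ~ P1 (q, k) x by move=> p; apply: H; left; left; exists (q, k).
have npos g1 g2 q : ~ pos g1 g2 q x -> ~ 0 < dirc (h q) g1 x * dirc (h q) g2 x by move=> np p; apply: np.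
have w0 k : k != i -> vnorm (w k) x = 0.
  move=> ki; apply: (moment_directions (h := h) _ _ _ _ zx fx) => // q; apply: npos => p.
  - by apply: (nP1 q i); rewrite /P1/= eqxx.
  - by apply: (nP1 q k); rewrite /P1/= (negbTE ki); left.
  - by apply: (nP1 q k); rewrite /P1/= (negbTE ki); right.
have wz k : k != i -> forall l, w k l x = 0.
  move=> ki l; have := congr1 (fun v : rV => v 0 l) (enorm_eq0 (w0 k ki)).
  by rewrite !mxE.
have wi : vnorm (w i) x = 0.
  have : vnorm (fun l x => \sum_k w k l x) x = 0.
    apply/eqP; apply: contrapT => /negP ne; apply: H; left; right; split => //; exact: VL.
  rewrite /vnorm => <-; congr enorm; apply/rowP => l; rewrite !mxE (bigD1 i)//= big1 ?addr0// => k ki.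
  exact: wz.
have wall k : vnorm (w k) x = 0 by have [->|] := eqVneq k i; [exact: wi|exact: w0].
by have [act|nact] := pselect (active Omega W x); apply: H; right; [left|right]; split.
Qed.

End exchange.

Section exchange_inequality.
Context {R : realType} {n N : nat}.
Local Notation rV := 'rV[R]_n.
Local Notation leb := (@lebesgue_rV R n).
Implicit Types (A B E K L U V Omega Theta Z : set rV) (a : rV -> R)
  (la : {finite_measure set rV -> \bar R})
  (W : 'I_N -> set rV) (Ca al delta D t r : R) (x : rV).

(* The competitor moves Z from the phase i to the phase j. *)
Lemma exchange_inequality Ca al delta Omega Theta a W i j Z nuZ K L la
    (g : option 'I_N -> 'I_n -> rV -> R) : 0 < delta ->
  quasi_minimizer Ca al delta Omega Theta a W -> measurable Z -> is_gradient Omega Z nuZ ->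
  leb (Z `\` W i) = 0 -> compact K -> Z `<=` K -> K `<=` L -> compact L -> L `<=` Theta ->
  (forall j l, has_density la L (g j l) (fun A => phase_gradient Omega W nuZ j A 0 l)) ->
  j != i ->
  \int[la]_(x in K) (a x * vnorm (g (Some i)) x) + \int[la]_(x in K) (a x * vnorm (g (Some j)) x) <=
  \int[la]_(x in K) (a x * vnorm (fun l x => g (Some i) l x - g None l x) x) +
  \int[la]_(x in K) (a x * vnorm (fun l x => g (Some j) l x + g None l x) x) +
  Ca * (2 * fine (leb Z)) `^ al.
Proof.
move=> d0 qm mZ gZ null cK ZK KL cL LT dg ji.
have oO := qm_open qm; have mO := open_measurable_rV oO.
have TO := qm_sub qm; have LO := subset_trans LT TO; have KT := subset_trans KL LT.
have KO := subset_trans KL LO; have mK := compact_measurable_rV cK.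
have wP := qm_partition qm; have [wW ae1] := wP; have mW k : measurable (W k) by case: (wW k).
have gW k : is_gradient Omega (W k) (gradient Omega (W k)).
  by apply: gradient_is_gradient; case: (wW k).
have Zoo : (leb Z < +oo)%E.
  apply: le_lt_trans (lebesgue_rV_compact cK).
  by apply: le_measure; rewrite ?inE.
have vE : leb Z = (fine (leb Z))%:E by rewrite fineK// ge0_fin_numE.
pose v := fine (leb Z); have v0 : 0 <= v by exact: fine_ge0.
(* Off a null set the indicator of the new phase [k] is that of [W k] plus [c k] times that of [Z];
   the coefficients add up to 0. *)
pose c k : R := if k == i then -1 else if k == j then 1 else 0.
pose VV k := if k == i then W i `\` Z else if k == j then W j `|` Z else W k.
have mV k : measurable (VV k).
  rewrite /VV; case: eqP => _; first exact: measurableD.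
  by case: eqP => _ //; exact: measurableU.
pose N0 := (Z `\` W i) `|` (W j `&` W i).
have mZW : measurable (Z `\` W i) by exact: measurableD.
have mWW : measurable (W j `&` W i) by exact: measurableI.
have mN0 : measurable N0 by exact: measurableU.
have N00 : leb N0 = 0%E.
  apply/eqP; rewrite eq_le measure_ge0 andbT.
  apply: (@le_trans _ _ (leb (Z `\` W i) + leb (W j `&` W i))%E); first exact: measureU2.
  by rewrite null (weak_partition_disjoint wP ji) adde0.
have indE k x : ~ N0 x -> \1_(VV k) x = 1 * \1_(W k) x + c k * \1_Z x :> R.
  move=> nN; rewrite /VV /c; case: eqP => [->|_].
    rewrite !indicE in_setD; have [Zx|nZ] := pselect (Z x).
      rewrite (mem_set Zx) (_ : x \in W i) /=; first by rewrite mulr1 mulN1r subrr.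
      by rewrite inE; apply: contrapT => nW; apply: nN; left.
    by rewrite (memNset nZ)/= andbT mulr0 addr0 mul1r.
  case: eqP => [->|_]; last by rewrite mul1r mul0r addr0.
  rewrite !indicE in_setU; have [Zx|nZ] := pselect (Z x).
    rewrite (mem_set Zx) orbT memNset ?mulr0 ?add0r ?mulr1// => Wj; apply: nN.
    by have [Wi|nW] := pselect (W i x); [right|left].
  by rewrite (memNset nZ)/= orbF mulr0 addr0 mul1r.
pose nV k A := 1 *: gradient Omega (W k) A + c k *: nuZ A.
have gV k : is_gradient Omega (VV k) (nV k).
  have h := fgradient_lin 1 (c k) (bounded_measurable_indic (mW k)) (bounded_measurable_indic mZ) (gW k) gZ.
  apply: (fgradient_ae mO _ (bounded_measurable_indic (mV k)) _ h).
    by apply: bounded_measurableD; apply: bounded_measurableZ; exact: bounded_measurable_indic.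
  exists N0; split => // x /= H; apply: contrapT => nN; apply: H => _.
  by rewrite indE.
have sumc : \sum_k c k = 0.
  rewrite (bigD1 i)//= (bigD1 j)//= big1; first by rewrite /c eqxx (negbTE ji) eqxx; lra.
  by move=> k /andP[ki kj]; rewrite /c (negbTE ki) (negbTE kj).
have wV : weak_partition Omega VV.
  split.
    move=> k; split => //; last by exists (nV k).
    have WO l : W l `<=` Omega by case: (wW l).
    rewrite /VV; case: eqP => _; first by move=> x [/WO].
    by case: eqP => _ //; move=> x [/WO|/ZK/KO].
  have aeN : {ae leb, forall x, ~ N0 x}.
    by exists N0; split => // x /=; apply: contrapT.
  apply: filterS2 ae1 aeN => x H nN.
  rewrite (eq_bigr (fun k => \1_(W k) x + c k * \1_Z x)); last by move=> k _; rewrite indE// mul1r.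
  by rewrite big_split/= -mulr_suml sumc mul0r addr0.
have nVE k A : interior_borel Omega A -> gradient Omega (VV k) A = nV k A.
  exact: (perimeter_measureE oO (mV k) (gV k)).2.
have agree k A : interior_borel Omega A -> A `&` K = set0 ->
    gradient Omega (W k) A = gradient Omega (VV k) A.
  move=> iA AK; rewrite nVE// /nV.
  rewrite (gradient_supported oO (bounded_measurable_indic mZ) gZ cK _ iA); last first.
    by move=> x nK; rewrite indicE memNset// => /ZK.
  by rewrite AK (vm0 gZ.1) scaler0 addr0 scale1r.
(* Two phases change, each by a subset of [Z]. *)
have dist : (partition_dist VV W <= (2 * v)%:E)%E.
  apply: (@le_trans _ _ (\sum_k (`|c k| * v)%:E)%E).
    apply: lee_sum => k _; rewrite /VV /c; case: eqP => [->|_].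
      rewrite normrN normr1 mul1r -vE; apply: le_measure; rewrite ?inE//.
        by apply: measurableU; apply: measurableD => //; exact: measurableD.
      by move=> x /=; have := EM (Z x); have := EM (W i x); tauto.
    case: eqP => [->|_].
      rewrite normr1 mul1r -vE; apply: le_measure; rewrite ?inE//.
        by apply: measurableU; apply: measurableD => //; exact: measurableU.
      by move=> x /=; have := EM (Z x); have := EM (W j x); tauto.
    by rewrite normr0 mul0r setDv setU0 measure0.
  rewrite sumEFin lee_fin -mulr_suml (bigD1 i)//= (bigD1 j)//= big1.
    by rewrite /c eqxx (negbTE ji) eqxx normrN normr1 addr0.
  by move=> k /andP[ki kj]; rewrite /c (negbTE ki) (negbTE kj) normr0.
have ma : measurable_fun K a by apply: measurable_funS (qm_measurable qm).
have a01 x : K x -> 0 <= a x <= 1.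
  move=> /KT /(qm_weight qm) /andP[h ->]; rewrite andbT; apply: le_trans h; exact: ltW.
have dW k l : has_density la L (g (Some k) l) (fun A => gradient Omega (W k) A 0 l).
  exact: dg (Some k) l.
have dV k l : has_density la L (fun x => 1 * g (Some k) l x + c k * g None l x) (fun A => nV k A 0 l).
  have [h1 h2] := has_density_lin 1 (c k) (dW k l) (dg None l).
  by split => // A mA1 AL; rewrite !mxE h2.
have [IW IWE] : exists I : 'I_N -> R, forall k,
    I k = \int[la]_(x in K) (a x * vnorm (g (Some k)) x) by exists (fun k => \int[la]_(x in K) (a x * vnorm (g (Some k)) x)).
have [IV IVE] : exists I : 'I_N -> R, forall k, I k = \int[la]_(x in K)
    (a x * vnorm (fun l x => 1 * g (Some k) l x + c k * g None l x) x).
  by exists (fun k => \int[la]_(x in K) (a x * vnorm (fun l x => 1 * g (Some k) l x + c k * g None l x) x)).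
have SW : (\sum_k \int[perimeter_measure Omega (W k)]_(x in K) (a x)%:E = (\sum_k IW k)%:E)%E.
  rewrite -sumEFin; apply: eq_bigr => k _; rewrite IWE.
  exact: (weighted_density (gW k).1 cL LO (dW k) mK KL ma a01).
have SV : (\sum_k \int[perimeter_measure Omega (VV k)]_(x in K) (a x)%:E = (\sum_k IV k)%:E)%E.
  rewrite -sumEFin; apply: eq_bigr => k _; rewrite IVE (perimeter_measureE oO (mV k) (gV k)).1.
  exact: (weighted_density (gV k).1 cL LO (dV k) mK KL ma a01).
have cmp : ((\sum_k IW k)%:E <= (\sum_k IV k)%:E + (Ca * (2 * v) `^ al)%:E)%E.
  by rewrite -SW -SV; exact: (qm_compare qm wV cK KT agree dist).
move: cmp; rewrite -EFinD lee_fin => cmp.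
have vnE k (h : 'I_n -> rV -> R) : (forall l x, 1 * g (Some k) l x + c k * g None l x = h l x) ->
    IV k = \int[la]_(x in K) (a x * vnorm h x).
  move=> E; rewrite IVE; apply: eq_Rintegral => x _; congr (_ * enorm _); apply/rowP => l.
  by rewrite !mxE E.
rewrite -!IWE -(vnE i); last by move=> l x; rewrite /c eqxx mul1r mulN1r.
rewrite -(vnE j); last by move=> l x; rewrite /c (negbTE ji) eqxx !mul1r.
have IVk k : (k != i) && (k != j) -> IV k = IW k.
  move=> /andP[ki kj]; rewrite IWE; apply: vnE => l x.
  by rewrite /c (negbTE ki) (negbTE kj) mul1r mul0r addr0.
have split_sum (I : 'I_N -> R) : \sum_k I k = I i + (I j + \sum_(k | (k != i) && (k != j)) I k).
  by rewrite (bigD1 i)//= (bigD1 j).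
move: cmp; rewrite !split_sum (eq_bigr IW IVk) -/v.
move: (\sum_(_ | _) _) (IW i) (IW j) (IV i) (IV j) (Ca * _); clear; move=> *; lra.
Qed.

End exchange_inequality.

(** * The perimeter bound and the conclusion *)

Section small_sets.
Context {R : realType} {n N : nat}.
Local Notation rV := 'rV[R]_n.
Local Notation leb := (@lebesgue_rV R n).
Implicit Types (A B E K L U V Omega Theta Z : set rV) (a : rV -> R)
  (la : {finite_measure set rV -> \bar R})
  (W : 'I_N -> set rV) (Ca al delta D t r : R) (x : rV).

Lemma ae_le_Rintegral la K (h1 h2 : rV -> R) : measurable K ->
  la.-integrable K (EFin \o h1) -> la.-integrable K (EFin \o h2) ->
  (forall x, K x -> 0 <= h1 x) -> (forall x, K x -> 0 <= h2 x) ->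
  {ae la, forall x, K x -> h1 x <= h2 x} ->
  \int[la]_(x in K) h1 x <= \int[la]_(x in K) h2 x.
Proof.
move=> mK i1 i2 h10 h20 ae12; rewrite -lee_fin !EFin_Rintegral//.
apply: ae_ge0_le_integral => //.
- exact: measurable_int i1.
- exact: measurable_int i2.
Qed.

(** In the constant, one factor [N] comes from [phase_inequality], the other from bounding the [N]
    summands alike; [1 / delta] comes from the weight, and [2 p] from the bound [2 |z|] inside the
    sharp set. Here [p] is the part of the perimeter in the sharp set within [K], which is
    finite. *)
Lemma total_perimeter_le Ca al delta Omega Theta a W i Z nuZ K : (1 < n)%N -> (0 < N)%N ->
  0 <= Ca -> 0 < delta -> (n%:R - 1) / n%:R < al ->
  quasi_minimizer Ca al delta Omega Theta a W -> measurable Z -> is_gradient Omega Z nuZ ->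
  leb (Z `\` W i) = 0 -> compact K -> Z `<=` K -> K `<=` Theta ->
  exists p : R, [/\ 0 <= p,
    Defs.total_variation Omega nuZ (K `&` sharp Omega W i) = p%:E &
    (Defs.total_variation Omega nuZ K <=
     (N%:R ^+ 2 / delta * (2 * p + Ca * (2 * fine (leb Z)) `^ al))%:E)%E].
Proof.
move=> n1 N0 Ca0 d0 hal qm mZ gZ null cK ZK KT.
have oO := qm_open qm; have TO := qm_sub qm; have mK := compact_measurable_rV cK.
have [V [L [oV cL KV VL LT]]] := compact_nbhd cK (qm_open' qm) KT.
have LO := subset_trans LT TO; have KL := subset_trans KV VL; have KO := subset_trans KL LO.
have wP := qm_partition qm; have [wW ae1] := wP; have mW k : measurable (W k) by case: (wW k).
have gW k : is_gradient Omega (W k) (gradient Omega (W k)).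
  by apply: gradient_is_gradient; case: (wW k).
have nuU j : vector_measure Omega (phase_gradient Omega W nuZ j).
  by case: j => [k|]; [case: (gW k)|case: gZ].
have [la [g dg]] := vm_density nuU cL LO.
have mixed := mixed_null n1 N0 Ca0 d0 hal qm mZ gZ null cL LT oV VL dg.
have sumnull := sum_density_null oO wP cL LO dg.
have oS : open (sharp Omega W i) by exact: sharp_open.
have mS := open_measurable_rV oS.
have ig j l : la.-integrable setT (EFin \o g j l) by case: (dg j l).
pose z := g None.
(* The density of [W k] for [k != i] and that of [W i] minus [Z] for [k = i]; these add up to [- z],
   as [phase_inequality] wants. *)
pose q k l x := g (Some k) l x - (k == i)%:R * z l x.
pose qz k l x := z l x + q k l x.
have iq k l : la.-integrable setT (EFin \o q k l).
  have [h _] := has_density_lin 1 (- (k == i)%:R) (dg (Some k) l) (dg None l).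
  by move: h; congr (_.-integrable _ _); apply/funext => x /=; rewrite mul1r mulNr.
have iqz k l : la.-integrable setT (EFin \o qz k l).
  have [h _] := has_density_lin 1 (1 - (k == i)%:R) (dg (Some k) l) (dg None l).
  move: h; congr (_.-integrable _ _); apply/funext => x /=; congr (_%:E).
  by rewrite /qz /q /z mul1r mulrBl mul1r addrCA.
have ivz : la.-integrable setT (EFin \o vnorm z) by apply: integrable_vnorm => l; exact: ig.
have ivq k : la.-integrable setT (EFin \o vnorm (q k)) by exact: integrable_vnorm.
have ivqz k : la.-integrable setT (EFin \o vnorm (qz k)) by exact: integrable_vnorm.
have ma : measurable_fun K a by apply: measurable_funS (qm_measurable qm) => //; exact: open_measurable_rV.
have ad x : K x -> delta <= a x <= 1 by move=> /KT; exact: qm_weight qm x.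
have a0 x : K x -> 0 <= a x by move=> /ad/andP[h _]; apply: le_trans h; exact: ltW.
have a1 x : K x -> a x <= 1 by move=> /ad/andP[].
have iaK (h : rV -> R) : la.-integrable setT (EFin \o h) -> la.-integrable K (EFin \o (fun x => a x * h x)).
  move=> ih; apply: (@bounded_mul_integrable _ _ _ _ _ a h 1) => //.
  - by move=> x Kx; rewrite ger0_norm; [exact: a1|exact: a0].
  - exact: integrable_sub.
(* The defect in the triangle inequality for [z] and [q k]. For [k = i] the sum [z + q i] is the
   density of [W i]. *)
pose T k x := vnorm z x + vnorm (q k) x - vnorm (qz k) x.
have T0 k x : 0 <= T k x.
  rewrite subr_ge0; apply: le_trans (ler_enormD _ _); rewrite /vnorm.
  by rewrite le_eqVlt; apply/orP; left; apply/eqP; congr enorm; apply/rowP => l; rewrite !mxE.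
have iT k : la.-integrable setT (EFin \o T k).
  rewrite (_ : EFin \o T k = ((EFin \o vnorm z) \+ (EFin \o vnorm (q k))) \- (EFin \o vnorm (qz k)))%E; last exact/funext.
  by apply: integrableB => //; exact: integrableD.
have IT k : \int[la]_(x in K) (a x * T k x) = \int[la]_(x in K) (a x * vnorm z x) +
    \int[la]_(x in K) (a x * vnorm (q k) x) - \int[la]_(x in K) (a x * vnorm (qz k) x).
  rewrite -RintegralD//; try exact: iaK.
  rewrite -RintegralB//; try exact: iaK.
    by apply: eq_Rintegral => x _; rewrite /T mulrBr mulrDr.
  have iD : la.-integrable setT (EFin \o (fun x => vnorm z x + vnorm (q k) x)).
    rewrite (_ : EFin \o _ = (EFin \o vnorm z) \+ (EFin \o vnorm (q k)))%E; last exact/funext.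
    exact: integrableD.
  move: (iaK _ iD); congr (_.-integrable _ _); apply/funext => x /=; congr (_%:E).
  exact: mulrDr.
pose v := fine (leb Z).
pose err := Ca * (2 * v) `^ al.
have err0 : 0 <= err by rewrite mulr_ge0// powR_ge0.
have vnE (h1 h2 : 'I_n -> rV -> R) : (forall l x, h1 l x = h2 l x) ->
    \int[la]_(x in K) (a x * vnorm h1 x) = \int[la]_(x in K) (a x * vnorm h2 x).
  move=> E; apply: eq_Rintegral => x _; congr (_ * enorm _); apply/rowP => l.
  by rewrite !mxE E.
(* For [k != i] this is [exchange_inequality] with the terms regrouped; for [k = i] it only says
   that the error is nonnegative. *)
have stepA k : \int[la]_(x in K) (a x * T k x) <= \int[la]_(x in K) (a x * T i x) + err.
  have [->|ki] := eqVneq k i; first by rewrite lerDl.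
  have := exchange_inequality d0 qm mZ gZ null cK ZK KL cL LT dg ki.
  rewrite !IT (vnE (q k) (g (Some k))); last by move=> l x; rewrite /q (negbTE ki) mul0r subr0.
  rewrite (vnE (qz k) (fun l x => g (Some k) l x + g None l x)); last first.
    by move=> l x; rewrite /qz /q (negbTE ki) mul0r subr0 addrC.
  rewrite (vnE (q i) (fun l x => g (Some i) l x - g None l x)); last first.
    by move=> l x; rewrite /q eqxx mul1r.
  rewrite (vnE (qz i) (g (Some i))); last by move=> l x; rewrite /qz /q eqxx mul1r addrC subrK.
  rewrite -/v -/err.
  set x1 := Rintegral _ _ _; set x2 := Rintegral _ _ _; set x3 := Rintegral _ _ _.
  set x4 := Rintegral _ _ _; set x5 := Rintegral _ _ _.
  by move: x1 x2 x3 x4 x5 (err); clear; move=> *; lra.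
pose N1 := L `&` [set x | vnorm (fun l x => \sum_k g (Some k) l x) x != 0].
have mne (h : rV -> R) : measurable_fun setT h -> measurable [set x | h x != 0].
  move=> mh; rewrite (_ : [set x | h x != 0] = setT `&` h @^-1` (~` [set 0])); last first.
    by rewrite setTI; apply/seteqP; split => x /= /eqP.
  by apply: mh => //; exact: measurableC.
have mg j l : measurable_fun setT (g j l) by apply/measurable_EFinP; exact: measurable_int (ig j l).
have mN1 : measurable N1.
  apply: measurableI; first exact: compact_measurable_rV.
  by apply: mne; apply: measurable_vnorm => l; apply: measurable_sum.
(* [phase_inequality] at almost every point, namely off the null set [N1] where the phase densities
   fail to add up to 0. *)
have stepB : \int[la]_(x in K) (a x * vnorm z x) <=
    N%:R * \sum_k \int[la]_(x in K) (a x * T k x).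
  rewrite -Rintegral_sum//; last by move=> k; exact: iaK.
  pose S x := \sum_k a x * T k x.
  have isum : la.-integrable K (EFin \o S).
    have [iS _] := has_density_sum (index_enum 'I_N)
      (fun k => conj (iT k) (fun A (_ : measurable A) (_ : A `<=` K) => erefl (\int[la]_(x in A) T k x))).
    move: (iaK _ iS); congr (_.-integrable _ _); apply/funext => x /=; congr (_%:E).
    by rewrite mulr_sumr.
  rewrite -RintegralZl//; apply: ae_le_Rintegral => //.
  - exact: iaK.
  - rewrite (_ : EFin \o _ = fun x => ((N%:R)%:E * (EFin \o S) x)%E); last exact/funext.
    exact: integrableZl.
  - by move=> x Kx; rewrite mulr_ge0//; [exact: a0|exact: enorm_ge0].
  - by move=> x Kx; rewrite mulr_ge0// sumr_ge0// => k _; rewrite mulr_ge0//; exact: a0.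
  - exists N1; split => // x /= H; apply: contrapT => nN; apply: H => Kx.
    rewrite -mulr_sumr mulrCA; apply: ler_wpM2l; first exact: a0.
    have s0 l : \sum_k g (Some k) l x = 0.
      have : vnorm (fun l x => \sum_k g (Some k) l x) x = 0.
        by apply/eqP; apply: contrapT => /negP ne; apply: nN; split => //; exact: KL.
      by move=> /enorm_eq0/(congr1 (fun u : rV => u 0 l)); rewrite !mxE.
    have sq : \sum_k (\row_l q k l x : rV) = - \row_l z l x.
      apply/rowP => l; rewrite summxE !mxE.
      rewrite (eq_bigr (fun k => g (Some k) l x - (k == i)%:R * z l x)); last by move=> k _; rewrite mxE.
      rewrite sumrB s0 -mulr_suml (bigD1 i)//= eqxx big1 ?addr0 ?mul1r ?sub0r//.
      by move=> k /negbTE ->.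
    have := phase_inequality N0 sq; rewrite -/(vnorm z x); congr (_ <= _ * _).
    apply: eq_bigr => k _; rewrite /T; congr (_ + _ - enorm _).
    by apply/rowP => l; rewrite !mxE.
pose f l x := g (Some i) l x - g None l x.
pose N2 := V `&` [set x | [/\ ~ sharp Omega W i x, vnorm z x != 0 & vnorm f x != 0]].
have mf l : measurable_fun setT (f l) by exact: measurable_funB.
have mN2 : measurable N2.
  rewrite (_ : N2 = V `&` (~` sharp Omega W i `&` ([set x | vnorm z x != 0] `&` [set x | vnorm f x != 0]))).
    apply: measurableI; first exact: open_measurable_rV.
    apply: measurableI; first exact: measurableC.
    by apply: measurableI; apply: mne; apply: measurable_vnorm => // l; exact: mg.
  by apply/seteqP; split => x; [move=> [? []]|move=> [? [? []]]].
(* In the sharp set [T i] is at most [2 |z|] by the triangle inequality. Outside it, off the null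
   set [N2] of [mixed_null], one of [z] and [f] vanishes, and then so does [T i]. *)
have stepC : \int[la]_(x in K) (a x * T i x) <=
    2 * \int[la]_(x in K `&` sharp Omega W i) vnorm z x.
  have mKS : measurable (K `&` sharp Omega W i) by exact: measurableI.
  have -> : \int[la]_(x in K `&` sharp Omega W i) vnorm z x =
      \int[la]_(x in K) (\1_(sharp Omega W i) x * vnorm z x).
    rewrite Rintegral_mkcondr; apply: eq_Rintegral => x _ /=.
    by rewrite patchE indicE; case: (x \in _); rewrite ?mul1r ?mul0r.
  pose S x := \1_(sharp Omega W i) x * vnorm z x.
  have iS : la.-integrable K (EFin \o S).
    apply: (@bounded_mul_integrable _ _ _ _ _ (\1_(sharp Omega W i)) (vnorm z) 1) => //.
    - by move=> x _; rewrite indicE; case: (_ \in _); rewrite ?normr1// normr0.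
    - exact: integrable_sub.
  rewrite -RintegralZl//; apply: ae_le_Rintegral => //.
  - exact: iaK.
  - rewrite (_ : EFin \o _ = fun x => (2%:E * (EFin \o S) x)%E); last exact/funext.
    exact: integrableZl.
  - by move=> x Kx; rewrite mulr_ge0//; exact: a0.
  - by move=> x Kx; do ![apply: mulr_ge0 => //]; exact: enorm_ge0.
  - exists N2; split => // x /= H; apply: contrapT => nN; apply: H => Kx.
    have qf : vnorm (q i) x = vnorm f x.
      by congr enorm; apply/rowP => l; rewrite !mxE /q eqxx mul1r.
    have zq : vnorm (q i) x <= vnorm z x + vnorm (qz i) x.
      have -> : vnorm (q i) x = enorm (\row_l qz i l x - \row_l z l x).
        by congr enorm; apply/rowP => l; rewrite !mxE /qz addrAC subrr add0r.
      by apply: (le_trans (ler_enormB _ _)); rewrite addrC.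
    apply: (@le_trans _ _ (T i x)); first by rewrite ler_piMl//; exact: a1.
    rewrite indicE; have [Sx|nS] := pselect (sharp Omega W i x).
      rewrite mem_set// mul1r /T; move: zq; move: (vnorm z x) (vnorm (q i) x) (vnorm (qz i) x).
      by clear; move=> *; lra.
    rewrite memNset// mul0r mulr0.
    have [z0|z0] := eqVneq (vnorm z x) 0.
      rewrite /T z0 add0r (_ : vnorm (qz i) x = vnorm (q i) x) ?subrr//.
      have zl l : z l x = 0.
        by have := congr1 (fun u : rV => u 0 l) (enorm_eq0 z0); rewrite !mxE.
      by congr enorm; apply/rowP => l; rewrite !mxE /qz zl add0r.
    have [f0|f0] := eqVneq (vnorm f x) 0.
      rewrite /T qf f0 addr0 (_ : vnorm (qz i) x = vnorm z x) ?subrr//.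
      have fl l : f l x = 0.
        by have := congr1 (fun u : rV => u 0 l) (enorm_eq0 f0); rewrite !mxE.
      by congr enorm; apply/rowP => l; rewrite !mxE /qz /q eqxx mul1r -/(f l x) fl addr0.
    by exfalso; apply: nN; split => //; exact: KV.
have stepD : delta * \int[la]_(x in K) vnorm z x <= \int[la]_(x in K) (a x * vnorm z x).
  have izK : la.-integrable K (EFin \o vnorm z) by exact: integrable_sub.
  rewrite -RintegralZl//; apply: le_Rintegral => //.
  - rewrite (_ : EFin \o _ = fun x => (delta%:E * (EFin \o vnorm z) x)%E); last exact/funext.
    exact: integrableZl.
  - exact: iaK.
  - by move=> x /ad/andP[h _]; apply: ler_wpM2r => //; exact: enorm_ge0.
have mKS : measurable (K `&` sharp Omega W i) by exact: measurableI.
have KSL : K `&` sharp Omega W i `<=` L by move=> x [/KL].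
exists (\int[la]_(x in K `&` sharp Omega W i) vnorm z x); split.
- by apply: Rintegral_ge0 => x _; exact: enorm_ge0.
- rewrite (total_variation_density gZ.1 cL LO (dg None) mKS KSL) EFin_Rintegral//.
  exact: integrable_sub.
rewrite (total_variation_density gZ.1 cL LO (dg None) mK KL) -EFin_Rintegral//; last exact: integrable_sub.
rewrite lee_fin -/v -/err mulrAC ler_pdivlMr//.
set p := Rintegral _ (K `&` _) _ in stepC *; rewrite mulrC.
apply: (le_trans stepD); apply: (le_trans stepB).
rewrite expr2 -mulrA; apply: ler_wpM2l => //.
apply: (@le_trans _ _ (\sum_(k < N) (2 * p + err))).
  by apply: ler_sum => k _; apply: (le_trans (stepA k)); rewrite lerD2r.
by rewrite sumr_const card_ord [leRHS]mulr_natl.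
Qed.

End small_sets.

Lemma quasi_minimizer_of_minimizer (R : realType) (n N : nat) (Omega Theta : set 'rV[R]_n)
    (a : 'rV[R]_n -> R) (G : ('I_N -> set 'rV[R]_n) -> R) (Ca al delta : R) W :
  (0 < N)%N -> open Omega -> measurable_fun Omega a -> (forall x, Omega x -> 0 < a x) ->
  (forall V V', weak_partition Omega V -> weak_partition Omega V' ->
      (`|G V - G V'|%:E <= Ca%:E * partition_dist V V' `^ al)%E) ->
  open Theta -> Theta `<=` Omega -> (forall x, Theta x -> delta <= a x <= 1) ->
  0 <= al -> 0 <= Ca -> minimizer Omega a G W -> quasi_minimizer Ca al delta Omega Theta a W.
Proof.
move=> N0 oO ma a0 hG oT TO ad al0 Ca0 minW; split => //; first by case: minW.
move=> V K D wV cK KT agree dist.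
apply: (minimizer_compare N0 oO ma a0 hG al0 Ca0 minW wV cK _ agree dist).
exact: subset_trans TO.
Qed.

Theorem theorem6p2 (R : realType) (n : nat) (alpha C_alpha delta : R) (N : nat)
    (hn : (2 <= n)%N) (halpha : (n%:R - 1) / n%:R < alpha <= 1)
    (hC : 0 <= C_alpha) (hdelta : 0 < delta) (hN : (1 <= N)%N) :
  exists v0 C3 : R, [/\ 0 < v0, 1 <= C3 &
    forall (Omega : set 'rV[R]_n) (a : 'rV[R]_n -> R)
      (G : ('I_N -> set 'rV[R]_n) -> R) (Omega' : set 'rV[R]_n)
      (W : 'I_N -> set 'rV[R]_n),
    open Omega -> connected Omega -> Omega !=set0 -> bounded_set Omega ->
    measurable_fun Omega a -> (forall x, Omega x -> 0 < a x) ->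
    (forall V V', weak_partition Omega V -> weak_partition Omega V' ->
      (`|G V - G V'|%:E <= C_alpha%:E * partition_dist V V' `^ alpha)%E) ->
    open Omega' -> Omega' `<=` Omega ->
    (forall x, Omega' x -> delta <= a x <= 1) ->
    minimizer Omega a G W ->
    forall (i : 'I_N) (Z : set 'rV[R]_n),
    measurable Z -> Z `<=` sharp Omega W i ->
    finite_perimeter Omega Z -> compactly_contained Z Omega' ->
    (lebesgue_rV Z <= v0%:E)%E ->
    (lebesgue_rV Z <= C3%:E *
      perimeter_measure Omega Z (sharp Omega W i)
        `^ (n%:R / (n%:R - 1)))%E].
Proof.
have /andP[hal _] := halpha.
have n0 : (0 < n)%N by exact: ltnW.
have nR : 0 < n%:R :> R by rewrite ltr0n.
have n1R : 0 < n%:R - 1 :> R by rewrite subr_gt0 ltr1n.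
have al0 : 0 <= alpha.
  by apply/ltW; apply: le_lt_trans hal; rewrite divr_ge0// ltW.
(* [A] and [A'] are the coefficients of [p] and of [v^alpha] in [total_perimeter_le], with [2^alpha]
   taken out of [(2 v)^alpha]. *)
pose A := N%:R ^+ 2 / delta * 2.
have A0 : 0 <= A by rewrite mulr_ge0// divr_ge0 ?exprn_ge0// ltW.
pose A' := N%:R ^+ 2 / delta * (C_alpha * 2 `^ alpha).
have A'0 : 0 <= A'.
  by apply: mulr_ge0; [rewrite divr_ge0 ?exprn_ge0// ltW|rewrite mulr_ge0 ?powR_ge0].
have [v0 v00 abs] := absorb hn A'0 hal.
pose e : R := n%:R / (n%:R - 1).
have e0 : 0 <= e by rewrite divr_ge0// ltW.
pose D := 8 * n%:R * A.
have D0 : 0 <= D by rewrite /D; do ![apply: mulr_ge0 => //].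
(* [absorb] gives [v^(n-1) <= (D p)^n]; the root of order [n - 1] turns this into [v <= D^e p^e],
   with [e = n / (n - 1)]. *)
exists v0, (Num.max 1 (D `^ e)); split => //; first by rewrite le_max lexx.
move=> Omega a G Omega' W oO _ _ _ ma a0 hG oO' OO' ad minW i Z mZ ZS [fpZ _] [cK KO'] Zv0.
have qm := quasi_minimizer_of_minimizer hN oO ma a0 hG oO' OO' ad al0 hC minW.
have [wW _] := qm_partition qm; have mW k : measurable (W k) by case: (wW k).
have gZ := gradient_is_gradient fpZ.
have KO := subset_trans KO' OO'.
have ZK : Z `<=` closure Z by exact: subset_closure.
have mZW : measurable (Z `\` W i) by exact: measurableD.
(* Membership in the sharp set says only that [W i] has full measure near each point;
   [lindelof_null] makes this global. *)
have null : lebesgue_rV (Z `\` W i) = 0.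
  apply: lindelof_null => // x [/ZS[_ [r r0 h]] _].
  have [s s0 sr] := cube_sub_eball x r0; exists s => //.
  apply/eqP; rewrite eq_le measure_ge0 andbT -h; apply: le_measure; rewrite ?inE.
  - by apply: measurableI => //; exact: measurable_ocube.
  - by apply: measurableD => //; apply: open_measurable_rV; exact: eball_open.
  - by move=> y [[Zy nW] /ocube_sub/sr ye].
have [p [p0 pE tvle]] := total_perimeter_le hn hN hC hdelta hal qm mZ gZ null cK ZK KO'.
have ps : (p%:E <= perimeter_measure Omega Z (sharp Omega W i))%E.
  by rewrite -pE; apply: total_variationS => x [].
have iso := isoperimetric_compact hn oO mZ gZ cK KO ZK tvle.
pose v := fine (lebesgue_rV Z).
have Zoo : (lebesgue_rV Z < +oo)%E by apply: le_lt_trans Zv0 _; exact: ltry.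
have vE : lebesgue_rV Z = v%:E by rewrite /v fineK// ge0_fin_numE.
have v_ge0 : 0 <= v by exact: fine_ge0.
have vv0 : 0 <= v <= v0 by rewrite v_ge0/= -lee_fin -vE.
have st : v ^+ n.-1 <= (D * p) ^+ n.
  apply: (abs v p A vv0 p0 A0); move: iso; rewrite -/v; congr (_ <= 2 * (_ * _) ^+ _).
  by rewrite powRM// /A /A'; ring.
have Dp0 : 0 <= D * p by exact: mulr_ge0.
have vle : v <= (D * p) `^ e.
  have n1E : (n.-1)%:R = n%:R - 1 :> R by rewrite -subn1 natrB.
  have -> : v = (v ^+ n.-1) `^ (n%:R - 1)^-1.
    by rewrite -powR_mulrn// -powRrM n1E mulfV ?gt_eqF// powRr1.
  apply: (@le_trans _ _ (((D * p) ^+ n) `^ (n%:R - 1)^-1)).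
    apply: ge0_ler_powR; rewrite ?nnegrE//.
    - by rewrite invr_ge0 ltW.
    - exact: exprn_ge0.
    - exact: exprn_ge0.
  by rewrite -powR_mulrn// -powRrM.
rewrite vE; apply: (@le_trans _ _ ((Num.max 1 (D `^ e))%:E * p%:E `^ e)%E).
  rewrite poweR_EFin -EFinM lee_fin; apply: (le_trans vle); rewrite powRM//.
  by apply: ler_wpM2r; [exact: powR_ge0|rewrite le_max lexx orbT].
apply: lee_wpmul2l; first by rewrite lee_fin le_max ler01.
apply: gt0_ler_poweR => //; rewrite in_itv/= leey andbT ?lee_fin//.
by apply: le_trans ps; rewrite lee_fin.
Qed.
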